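(* Let $\lambda(N)\in\mathbb{GT}_N$ be a regular sequence of signatures with $m[\lambda(N)]\to\mathbf m$ weakly, and fix $0<a<1$; put $M=\lfloor aN\rfloor$. Let $\rho_N$ be the probability measure on $\mathbb{GT}_M$ with Schur generating function $\frac{s_{\lambda(N)}(x_1,\dots,x_M,1^{N-M})}{s_{\lambda(N)}(1^N)}$ (the decomposition measure of the restriction of $\pi^{\lambda(N)}$ to $U(M)$), and $p_k^{(N)}=\sum_{i=1}^M(\mu_i+M-i)^k$ with $\mu\sim\rho_N$. Then $\{N^{-k}(p_k^{(N)}-\mathbf Ep_k^{(N)})\}_{k\ge1}$ converges in the sense of moments to a centered Gaussian vector with covariance $$\lim_{N\to\infty}\frac{\mathrm{cov}(p_{k_1}^{(N)},p_{k_2}^{(N)})}{N^{k_1+k_2}}=\frac{a^{k_1+k_2}}{(2\pi\mathbf i)^2}\oint_{|z|=\epsilon}\oint_{|w|=2\epsilon}\Big(\frac1z+1+\frac{(1+z)H'_{\mathbf m}(1+z)}{a}\Big)^{k_1}\Big(\frac1w+1+\frac{(1+w)H'_{\mathbf m}(1+w)}{a}\Big)^{k_2}$$ $$\times\Big(\partial_z\partial_w\log\Big(1-zw\frac{(1+z)H'_{\mathbf m}(1+z)-(1+w)H'_{\mathbf m}(1+w)}{z-w}\Big)+\frac1{(z-w)^2}\Big)dz\,dw,$$ counter-clockwise contours, $\epsilon>0$ small.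
   Context: Signatures $\lambda=(\lambda_1\ge\dots\ge\lambda_N)\in\mathbb Z^N$ form $\mathbb{GT}_N$; $s_\lambda$ is the Schur function; Schur generating function of $\rho$ on $\mathbb{GT}_M$: $\sum_\mu\rho(\mu)s_\mu/s_\mu(1^M)$. $m[\lambda]=\frac1N\sum_{i=1}^N\delta(\frac{\lambda_i+N-i}N)$. A sequence $\lambda(N)\in\mathbb{GT}_N$ is regular if there are a piecewise-continuous $f$ on $[0,1]$ and $C$ with $\lim_N\frac1N\sum_j|\lambda_j(N)/N-f(j/N)|=0$ and $|\lambda_j(N)/N-f(j/N)|<C$ for all $j,N$. For a compactly supported probability measure $\mathbf m$, $C_{\mathbf m}(z)=\int\frac{d\mathbf m(x)}{z-x}$, $C^{(-1)}_{\mathbf m}$ its functional inverse, and $H'_{\mathbf m}(z)=\frac{C^{(-1)}_{\mathbf m}(\log z)}{z}-\frac1{z-1}$ (holomorphic near $z=1$). *)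

(* Defs.v *)
From mathcomp Require Import all_boot all_algebra.
From mathcomp Require Import all_classical all_reals all_analysis.
From mathcomp Require Import Rstruct Rstruct_topology.
From Stdlib Require Import Reals ZArith List.
From Coquelicot Require Import Coquelicot.

Open Scope R_scope.

Definition PMeasR : Type := probability (measurableTypeR R) R.

Definition mint (m : PMeasR) (g : R -> R) : R := Rintegral m setT g.

Definition compactly_supported (m : PMeasR) : Prop :=
  exists K : R, m (fun x => K < Rabs x) = EFin 0.

(* Signatures: lambda = (lambda_1 >= ... >= lambda_n) in Z^n, stored as a
   list whose 0-based entry i is lambda_{i+1}.                           *)
Definition is_sig (n : nat) (l : list Z) : Prop :=
  List.length l = n /\
  forall i : nat, Nat.lt (S i) n -> (List.nth (S i) l 0%Z <= List.nth i l 0%Z)%Z.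

Definition Rsum_nat (n : nat) (f : nat -> R) : R :=
  List.fold_right Rplus 0 (List.map f (List.seq 0 n)).

Definition emp_integral (l : list Z) (g : R -> R) : R :=
  let N := List.length l in
  / INR N * Rsum_nat N (fun i =>
     g ((IZR (List.nth i l 0%Z) + INR N - INR (S i)) / INR N)).

Definition weak_conv_emp (lam : nat -> list Z) (m : PMeasR) : Prop :=
  forall g : R -> R,
    (forall x, continuity_pt g x) -> (exists B, forall x, Rabs (g x) <= B) ->
    is_lim_seq (fun N => emp_integral (lam N) g) (mint m g).

Definition piecewise_continuous (f : R -> R) : Prop :=
  exists ts : list R,
    (forall x, 0 <= x <= 1 -> ~ In x ts ->
       forall eps, 0 < eps -> exists d, 0 < d /\
         forall y, 0 <= y <= 1 -> Rabs (y - x) < d -> Rabs (f y - f x) < eps) /\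
    (forall t, In t ts ->
       (exists l, forall eps, 0 < eps -> exists d, 0 < d /\
          forall y, 0 <= y <= 1 -> t - d < y < t -> Rabs (f y - l) < eps) /\
       (exists l, forall eps, 0 < eps -> exists d, 0 < d /\
          forall y, 0 <= y <= 1 -> t < y < t + d -> Rabs (f y - l) < eps)).

(* lambda_j(N), 1-based index j *)
Definition lamj (lam : nat -> list Z) (N j : nat) : R :=
  IZR (List.nth (Nat.pred j) (lam N) 0%Z).

Definition regular (lam : nat -> list Z) : Prop :=
  exists (f : R -> R) (C0 : R),
    piecewise_continuous f /\
    is_lim_seq (fun N => / INR N *
        Rsum_nat N (fun i => Rabs (lamj lam N (S i) / INR N - f (INR (S i) / INR N))))
      0 /\
    (forall N j, Nat.le 1 j -> Nat.le j N ->
        Rabs (lamj lam N j / INR N - f (INR j / INR N)) < C0).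

(* Schur functions of signatures (Laurent polynomials), via the
   Gelfand-Tsetlin branching rule:
     s_lambda(x_1..x_n) = sum_{nu interlacing lambda} x_n^{|lambda|-|nu|} s_nu(x_1..x_{n-1}). *)
Definition Zrange (lo hi : Z) : list Z :=
  List.map (fun k => (lo + Z.of_nat k)%Z) (List.seq 0 (Z.to_nat (hi - lo + 1))).

Fixpoint interlace (l : list Z) : list (list Z) :=
  match l with
  | nil => nil
  | a :: t =>
      match t with
      | nil => nil :: nil
      | b :: _ => List.flat_map (fun v => List.map (cons v) (interlace t)) (Zrange b a)
      end
  end.

Definition zsum (l : list Z) : Z := List.fold_right Z.add 0%Z l.

(* variables given in reverse order *)
Fixpoint schur_rev (xs : list R) (lam : list Z) : R :=
  match xs with
  | nil => match lam with nil => 1 | _ => 0 end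
  | x :: xs' =>
      List.fold_right Rplus 0
        (List.map (fun nu => powerRZ x (zsum lam - zsum nu) * schur_rev xs' nu)
                  (interlace lam))
  end.

Definition schur (lam : list Z) (x : list R) : R := schur_rev (List.rev x) lam.

Definition Ex (S : list (list Z)) (rho : list Z -> R) (g : list Z -> R) : R :=
  List.fold_right Rplus 0 (List.map (fun mu => rho mu * g mu) S).

Definition SGF_restriction (N M : nat) (lam : list Z)
    (S : list (list Z)) (rho : list Z -> R) : Prop :=
  NoDup S /\
  (forall mu, In mu S -> is_sig M mu) /\
  (forall mu, In mu S -> 0 <= rho mu) /\
  Ex S rho (fun _ => 1) = 1 /\
  (forall x : list R, List.length x = M -> (forall xi, In xi x -> 0 < xi) ->
     schur lam (x ++ List.repeat 1 (N - M)) / schur lam (List.repeat 1 N)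
     = Ex S rho (fun mu => schur mu x / schur mu (List.repeat 1 M))).

Definition Mof (a : R) (N : nat) : nat := Z.to_nat (Int_part (a * INR N)).

Definition pk (k : nat) (mu : list Z) : R :=
  let M := List.length mu in
  Rsum_nat M (fun i => (IZR (List.nth i mu 0%Z) + INR M - INR (S i)) ^ k).

Definition cov_p (S : list (list Z)) (rho : list Z -> R) (k1 k2 : nat) : R :=
  Ex S rho (fun mu => pk k1 mu * pk k2 mu) - Ex S rho (pk k1) * Ex S rho (pk k2).

Definition Xnk (S : list (list Z)) (rho : list Z -> R) (N k : nat) (mu : list Z) : R :=
  (pk k mu - Ex S rho (pk k)) / INR N ^ k.

Definition mixed_moment (S : list (list Z)) (rho : list Z -> R) (N : nat)
    (ks : list nat) : R :=
  Ex S rho (fun mu => List.fold_right Rmult 1 (List.map (fun k => Xnk S rho N k mu) ks)).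

(* Moments of a centered Gaussian vector with covariance Cv (Wick/Isserlis):
   E[prod_i xi_{k_i}] = sum over perfect matchings of prod Cv. *)
Fixpoint picks {A : Type} (l : list A) : list (A * list A) :=
  match l with
  | nil => nil
  | x :: t => (x, t) :: List.map (fun p => (fst p, x :: snd p)) (picks t)
  end.

Fixpoint wick_aux (Cv : nat -> nat -> R) (fuel : nat) (l : list nat) : R :=
  match l with
  | nil => 1
  | k :: t =>
      match fuel with
      | O => 0
      | S f => List.fold_right Rplus 0
                 (List.map (fun p => Cv k (fst p) * wick_aux Cv f (snd p)) (picks t))
      end
  end.

Definition gaussian_moment (Cv : nat -> nat -> R) (ks : list nat) : R :=
  wick_aux Cv (List.length ks) ks.

Definition Ci : C := (0, 1).
Definition Cexpi (t : R) : C := (cos t, sin t).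

Definition Carg (z : C) : R :=
  let x := fst z in let y := snd z in
  if Rlt_dec 0 x then atan (y / x)
  else if Rlt_dec x 0 then
    (if Rle_dec 0 y then atan (y / x) + PI else atan (y / x) - PI)
  else if Rlt_dec 0 y then PI / 2
  else if Rlt_dec y 0 then - (PI / 2) else 0.

Definition Clog (z : C) : C := (ln (Cmod z), Carg z).

(* Stieltjes transform C_m(z) = int dm(x) / (z - x) *)
Definition stieltjes (m : PMeasR) (z : C) : C :=
  (mint m (fun t => (fst z - t) / ((fst z - t) ^ 2 + (snd z) ^ 2)),
   mint m (fun t => - snd z / ((fst z - t) ^ 2 + (snd z) ^ 2))).

(* Ginv is the functional inverse C_m^{(-1)} near 0: the local inverse of
   C_m on a punctured neighbourhood of 0, branch with Ginv(u) -> infinity. *)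
Definition functional_inverse_at0 (Cm Ginv : C -> C) : Prop :=
  (exists delta, 0 < delta /\
     forall u : C, 0 < Cmod u < delta -> Cm (Ginv u) = u) /\
  (forall B, exists eta, 0 < eta /\
     forall u : C, 0 < Cmod u < eta -> B < Cmod (Ginv u)).

Definition Hprime (Ginv : C -> C) (z : C) : C :=
  (Ginv (Clog z) / z - / (z - 1))%C.

Definition circle_integral (f : C -> C) (r : R) : C :=
  @RInt C_R_CompleteNormedModule
    (fun t : R => (f (RtoC r * Cexpi t) * (Ci * RtoC r * Cexpi t))%C) 0 (2 * PI).

Definition PhiH (Ginv : C -> C) (z : C) : C := ((1 + z) * Hprime Ginv (1 + z))%C.

Definition Afac (Ginv : C -> C) (a : R) (z : C) : C :=
  (/ z + 1 + PhiH Ginv z / RtoC a)%C.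

Definition Ffac (Ginv : C -> C) (z w : C) : C :=
  (1 - z * w * ((PhiH Ginv z - PhiH Ginv w) / (z - w)))%C.

Definition Kern (Ginv : C -> C) (z w : C) : C :=
  (C_derive (fun z' => C_derive (fun w' => Clog (Ffac Ginv z' w')) w) z
   + / ((z - w) ^ 2))%C.

Definition cov_formula (Ginv : C -> C) (a eps : R) (k1 k2 : nat) : C :=
  (RtoC (a ^ (k1 + k2)) / ((2 * RtoC PI * Ci) ^ 2) *
   circle_integral (fun z =>
     circle_integral (fun w =>
        Afac Ginv a z ^ k1 * Afac Ginv a w ^ k2 * Kern Ginv z w) (2 * eps)) eps)%C.

(* Main.v *)
(* Put l_i = lambda_i + N - i, P(u) = prod_i (u - l_i), and Q(u) = prod_j (u - (mu_j + M - j)) for the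
   random mu. Summing over interlacing signatures turns a determinant of linear functionals into one
   of differences, so that E det[phi_a(u^j Q)] = c_r det[phi_a(Delta^(N-M)(u^j P))] for arbitrary
   linear functionals phi_1, ..., phi_r on polynomials. Evaluating at large points N zeta_a gives the
   joint moments of Y(tau) = Q(N zeta)/(N zeta)^M, suitably normalized, in the coordinates
   zeta(tau) = 1/tau - s - s/Psi(tau), where s = 1 - a and Psi(tau) = exp(C_m(1/tau)) - 1. The iterated
   differences solve a discrete transport equation, whose solution converges coefficientwise; hence
   prod_(a<b) ker(tau_a, tau_b) * E prod_a Y(tau_a) -> 1 for an explicit kernel ker. Its logarithmic
   derivative is a Stein equation for the coefficients of log Y, i.e. for the power sums, which are
   therefore jointly Gaussian in the limit; the Faber polynomials of zeta give the covariance
   sum_(i>0) i [zeta^k']_i [zeta^k]_(-i), with [.]_i the coefficient of tau^(-i).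

   With tau(z) = 1/C_m^(-1)(log(1 + z)), the first two factors of the contour integral are
   zeta(tau)/a, and the last one is tau'(z) tau'(w) / (tau(z) - tau(w))^2; expanding it in
   tau(z)/tau(w) and taking residues gives the same sum. *)
From Stdlib Require ZArith Reals Lra Lia Psatz List.
From Coquelicot Require Coquelicot.
Require Defs.
From HB Require structures.
From mathcomp Require all_boot all_order all_algebra boolp functions ring lra zify reals Rstruct ssrZ sequences exp classical_sets topology normedtype all_fingroup Rstruct_topology all_classical all_reals all_analysis measurable_realfun.

(** * Determinantal formula for the restriction measure *)

Module PowerSeries.
Import structures.
Import all_boot all_order all_algebra.
Import boolp functions.
Import ring lra zify.
Set Implicit Arguments.
Unset Strict Implicit.
Unset Printing Implicit Defensive.
Import GRing.Theory.
Local Open Scope ring_scope.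

(** The functionals may take values in any commutative algebra over the reals, so the large points
    can be formal: each zeta carries its own power series variable, and the r-point formula lives in
    an r-fold iterated power series ring. Every probabilistic limit is then a limit of finitely many
    real coefficients, and complex analysis enters only in the contour integral. The obstacle is
    division: the Vandermonde factors are not units of the ring, and convergence passes through them
    by recursion on coefficients. The coordinate zeta is a characteristic of the limiting transport
    equation df/ds + r theta(f) = 0, theta = x d/dx: on it x v keeps its initial value Psi(tau), so
    1/x = 1/tau - s (1 + 1/Psi(tau)) is a straight line in s. There the normalized differences of
    u^j P become pure j-th powers, so the limiting determinant is again a Vandermonde and the kernel
    is a ratio of two of them. Being a product over pairs, it has a logarithmic derivative that is a
    sum over the other points; hence the Stein operator is a derivation. *)

Definition fps (A : Type) : Type := nat -> A.

HB.instance Definition _ (A : zmodType) := GRing.Zmodule.copy (fps A) (nat -> A).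

Lemma fpsP (A : Type) (f g : fps A) : (forall n, f n = g n) <-> f = g.
Proof. by split=> [fg|->//]; apply/funext. Qed.

Lemma fpsDE (A : zmodType) (f g : fps A) n : (f + g) n = f n + g n.
Proof. by []. Qed.
Lemma fpsNE (A : zmodType) (f : fps A) n : (- f) n = - f n.
Proof. by []. Qed.
Lemma fpsBE (A : zmodType) (f g : fps A) n : (f - g) n = f n - g n.
Proof. by []. Qed.
Lemma fps0E (A : zmodType) n : (0 : fps A) n = 0.
Proof. by []. Qed.
Lemma fps_sumE (A : zmodType) I (r : seq I) (P : pred I) (F : I -> fps A) n :
  (\sum_(i <- r | P i) F i) n = \sum_(i <- r | P i) F i n.
Proof. by elim/big_rec2: _ => // i x y _ <-. Qed.

Section FpsRing.
Variable A : comNzRingType.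
Implicit Types f g h : fps A.

Definition fps_trunc m f : {poly A} := \poly_(i < m.+1) f i.
Definition fps_one : fps A := fun n => (n == 0)%:R.
Definition fps_mul f g : fps A := fun n => \sum_(i < n.+1) f i * g (n - i)%N.

Lemma coef_fps_trunc m f n : (n <= m)%N -> (fps_trunc m f)`_n = f n.
Proof. by move=> nm; rewrite coef_poly ltnS nm. Qed.

(** A coefficient of index at most m sees only the truncations at degree m; through this the ring
    axioms are inherited from [{poly A}]. *)
Lemma fps_mulE m f g n : (n <= m)%N ->
  fps_mul f g n = (fps_trunc m f * fps_trunc m g)`_n.
Proof.
move=> nm; rewrite coefM; apply: eq_bigr => -[i /= ilt] _.
by rewrite !coef_fps_trunc //; lia.
Qed.

Lemma coef_fps_trunc_mul m f g n : (n <= m)%N ->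
  (fps_trunc m (fps_mul f g))`_n = (fps_trunc m f * fps_trunc m g)`_n.
Proof. by move=> nm; rewrite coef_fps_trunc // (fps_mulE _ _ nm). Qed.

Lemma fps_mulA : associative fps_mul.
Proof.
move=> f g h; apply/fpsP => n; rewrite !(fps_mulE (m := n)) //.
transitivity ((fps_trunc n f * (fps_trunc n g * fps_trunc n h))`_n).
  rewrite !coefM; apply: eq_bigr => -[i /= ilt] _.
  by rewrite coef_fps_trunc_mul //; lia.
rewrite mulrA !coefM; apply: eq_bigr => -[i /= ilt] _.
by rewrite coef_fps_trunc_mul //; lia.
Qed.

Lemma fps_mulC : commutative fps_mul.
Proof. by move=> f g; apply/fpsP => n; rewrite !(fps_mulE (m := n)) // mulrC. Qed.

Lemma fps_mul1 : left_id fps_one fps_mul.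
Proof.
move=> f; apply/fpsP => n; rewrite /fps_mul big_ord_recl /= mul1r subn0 big1 ?addr0 //.
by move=> i _; rewrite /fps_one mul0r.
Qed.

Lemma fps_mulDl : left_distributive fps_mul +%R.
Proof.
move=> f g h; apply/fpsP => n; rewrite fpsDE /fps_mul -big_split /=.
by apply: eq_bigr => i _; rewrite mulrDl.
Qed.

Lemma fps_one_neq0 : fps_one != 0.
Proof.
apply/eqP => /(congr1 (fun f => f 0%N)); rewrite /fps_one /= => /eqP.
by rewrite oner_eq0.
Qed.

End FpsRing.

HB.instance Definition _ (A : comNzRingType) :=
  GRing.Zmodule_isComNzRing.Build (fps A) (@fps_mulA A) (@fps_mulC A)
    (@fps_mul1 A) (@fps_mulDl A) (@fps_one_neq0 A).

Section FpsTheory.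
Variable A : comNzRingType.
Implicit Types f g h : fps A.

Lemma fpsME f g n : (f * g) n = \sum_(i < n.+1) f i * g (n - i)%N.
Proof. by []. Qed.

Lemma fps1E n : (1 : fps A) n = (n == 0)%:R.
Proof. by []. Qed.

Lemma fpsM0 f g : (f * g) 0%N = f 0%N * g 0%N.
Proof. by rewrite fpsME big_ord_recl big_ord0 addr0. Qed.

Lemma fpsME_rev f g n : (f * g) n = \sum_(i < n.+1) f (n - i)%N * g i.
Proof. by rewrite mulrC fpsME; apply: eq_bigr => i _; rewrite mulrC. Qed.

Definition fpsC (c : A) : fps A := fun n => if n is 0%N then c else 0.

Lemma fpsCM c f n : (fpsC c * f) n = c * f n.
Proof.
rewrite fpsME big_ord_recl /= subn0 big1 ?addr0 // => i _.
by rewrite mul0r.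
Qed.

Lemma fpsC_is_additive : zmod_morphism fpsC.
Proof. by move=> c d; apply/fpsP => -[|n] //=; rewrite fpsBE /= subr0. Qed.

Lemma fpsC_is_multiplicative : monoid_morphism fpsC.
Proof.
split; first by apply/fpsP => -[|n].
by move=> c d; apply/fpsP => n; rewrite fpsCM; case: n => //= n; rewrite mulr0.
Qed.

HB.instance Definition _ := GRing.isZmodMorphism.Build A (fps A) fpsC fpsC_is_additive.
HB.instance Definition _ := GRing.isMonoidMorphism.Build A (fps A) fpsC fpsC_is_multiplicative.

Definition fpsX : fps A := fun n => (n == 1)%:R.

Lemma fpsXM f n : (fpsX * f) n = if n is k.+1 then f k else 0.
Proof.
rewrite fpsME; case: n => [|n]; first by rewrite big_ord_recl big_ord0 mul0r addr0.
rewrite big_ord_recl mul0r add0r big_ord_recl /= mul1r subSS subn0 big1 ?addr0 //.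
by move=> i _; rewrite mul0r.
Qed.

Lemma fpsXnM k f n : (fpsX ^+ k * f) n = if (k <= n)%N then f (n - k)%N else 0.
Proof.
elim: k n => [|k IH] n; first by rewrite expr0 mul1r subn0.
rewrite exprS -mulrA fpsXM; case: n => [|n] //.

Qed.

Lemma fpsXn k n : (fpsX ^+ k) n = (n == k)%:R.
Proof.
rewrite -[_ ^+ _]mulr1 fpsXnM fps1E; case: leqP => kn.
  by congr (_%:R); apply/eqP/eqP; lia.
by rewrite (_ : _ == _ = false) //; apply/eqP; lia.
Qed.

Lemma fpsX_inj f g : fpsX * f = fpsX * g -> f = g.
Proof. by move=> fg; apply/fpsP => n; have := congr1 (fun h => h n.+1) fg; rewrite !fpsXM. Qed.

(** The Euler operator x d/dx. Unlike d/dx it preserves the degree, so coefficient estimates need no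
    shift of index. *)
Definition fps_theta f : fps A := fun n => n%:R * f n.

Lemma fps_thetaD f g : fps_theta (f + g) = fps_theta f + fps_theta g.
Proof. by apply/fpsP => n; rewrite fpsDE /fps_theta mulrDr. Qed.
Lemma fps_thetaB f g : fps_theta (f - g) = fps_theta f - fps_theta g.
Proof. by apply/fpsP => n; rewrite fpsBE /fps_theta mulrBr. Qed.
Lemma fps_theta0 : fps_theta 0 = 0.
Proof. by apply/fpsP => n; rewrite /fps_theta mulr0. Qed.
Lemma fps_thetaC c : fps_theta (fpsC c) = 0.
Proof. by apply/fpsP => -[|n]; rewrite /fps_theta ?mul0r //= mulr0. Qed.
Lemma fps_theta1 : fps_theta 1 = 0.
Proof. by rewrite -(rmorph1 fpsC) fps_thetaC. Qed.
Lemma fps_thetaX : fps_theta fpsX = fpsX.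
Proof. by apply/fpsP => -[|[|n]]; rewrite /fps_theta /= ?mulr0 ?mul1r //. Qed.

Lemma fps_thetaM f g : fps_theta (f * g) = fps_theta f * g + f * fps_theta g.
Proof.
apply/fpsP => n; rewrite fpsDE /fps_theta !fpsME mulr_sumr -big_split /=.
apply: eq_bigr => -[i /= ilt] _.
have -> : n%:R = i%:R + (n - i)%:R :> A by rewrite -natrD; congr (_%:R); lia.
by ring.
Qed.

Lemma fps_thetaXn f k : fps_theta (f ^+ k.+1) = k.+1%:R * f ^+ k * fps_theta f.
Proof.
elim: k => [|k IH]; first by rewrite expr1 expr0 !mul1r.
rewrite exprS fps_thetaM IH -[k.+2%:R]natr1 mulrDl mul1r mulrDl addrC.
by congr (_ + _); rewrite ?exprS; [rewrite !mulrA [f * _]mulrC | rewrite mulrC].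
Qed.

Lemma fps_theta_prod I (r : seq I) (F D : I -> fps A) :
  (forall i, fps_theta (F i) = D i * F i) ->
  fps_theta (\prod_(i <- r) F i) = (\sum_(i <- r) D i) * \prod_(i <- r) F i.
Proof.
move=> FD; elim: r => [|i r IH]; first by rewrite !big_nil mul0r fps_theta1.
by rewrite !big_cons fps_thetaM IH FD; ring.
Qed.

Definition fps_val m f := forall n, (n < m)%N -> f n = 0.

Lemma fps_valM m k f g : fps_val m f -> fps_val k g -> fps_val (m + k) (f * g).
Proof.
move=> fm gk n nmk; rewrite fpsME big1 // => -[i /= ilt] _.
have [im|mi] := ltnP i m; first by rewrite fm // mul0r.
by rewrite gk ?mulr0 //; lia.
Qed.

Lemma fps_valX m k f : fps_val m f -> fps_val (m * k) (f ^+ k).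
Proof.
move=> fm; elim: k => [|k IH]; first by rewrite muln0 => n.
by rewrite exprS mulnS; apply: fps_valM.
Qed.

Lemma fps_valX1 k f : f 0%N = 0 -> fps_val k (f ^+ k).
Proof. by move=> f0; rewrite -[k in fps_val k]mul1n; apply: fps_valX => -[]. Qed.

(* The coefficient recursion for 1/f; meaningful only when the constant term of f is 1. *)
Fixpoint fps_inv_seq f (n : nat) : seq A :=
  if n is k.+1 then
    let s := fps_inv_seq f k in
    rcons s (- \sum_(i < k.+1) f (k.+1 - i)%N * s`_i)
  else [:: 1].

Definition fps_inv f : fps A := fun n => (fps_inv_seq f n)`_n.

Lemma size_fps_inv_seq f n : size (fps_inv_seq f n) = n.+1.
Proof. by elim: n => //= n IH; rewrite size_rcons IH. Qed.

Lemma nth_fps_inv_seq f n i : (i <= n)%N -> (fps_inv_seq f n)`_i = fps_inv f i.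
Proof.
elim: n i => [|n IH] i; first by rewrite leqn0 => /eqP ->.
rewrite leq_eqVlt => /orP[/eqP -> //|]; rewrite ltnS => le_in.
by rewrite /= nth_rcons size_fps_inv_seq ltnS le_in IH.
Qed.

Lemma fps_inv0 f : fps_inv f 0%N = 1.
Proof. by []. Qed.

Lemma fps_invS f n :
  fps_inv f n.+1 = - \sum_(i < n.+1) f (n.+1 - i)%N * fps_inv f i.
Proof.
rewrite {1}/fps_inv /= nth_rcons size_fps_inv_seq ltnn eqxx; congr (- _).
by apply: eq_bigr => -[i /= ilt] _; rewrite nth_fps_inv_seq.
Qed.

Lemma fps_mulV f : f 0%N = 1 -> f * fps_inv f = 1.
Proof.
move=> f0; apply/fpsP => -[|n]; first by rewrite fpsM0 f0 mul1r.
rewrite fpsME_rev big_ord_recr /= subnn f0 mul1r fps_invS fps1E /=.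
by rewrite addrN.
Qed.

End FpsTheory.

Section FpsComp.
Variable A : comNzRingType.
Implicit Types f g b : fps A.

(** The substitution f(b(x)), with the inner series as first argument. The sum stops at k = n, which
    is exact when [b] has constant term 0 and a junk value otherwise. *)
Definition fps_comp b f : fps A := fun n => \sum_(k < n.+1) f k * (b ^+ k) n.

Lemma fps_compE b f n m : b 0%N = 0 -> (n <= m)%N ->
  fps_comp b f n = \sum_(k < m.+1) f k * (b ^+ k) n.
Proof.
move=> b0 nm; rewrite /fps_comp (big_ord_widen m.+1 (fun k => f k * (b ^+ k) n)) ?ltnS //.
rewrite big_mkcond /=; apply: eq_bigr => -[k /= klt] _; case: ltnP => // nk.
by rewrite (fps_valX1 b0) ?mulr0.
Qed.

Lemma fps_comp_poly b f n m : b 0%N = 0 -> (n <= m)%N ->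
  fps_comp b f n = (\sum_(k < m.+1) fpsC (f k) * b ^+ k) n.
Proof.
move=> b0 nm; rewrite (fps_compE f b0 nm) fps_sumE.
by apply: eq_bigr => k _; rewrite fpsCM.
Qed.

Lemma fps_compD b f g : fps_comp b (f + g) = fps_comp b f + fps_comp b g.
Proof.
apply/fpsP => n; rewrite fpsDE /fps_comp -big_split /=.
by apply: eq_bigr => k _; rewrite mulrDl.
Qed.

Lemma fps_compB b f g : fps_comp b (f - g) = fps_comp b f - fps_comp b g.
Proof.
apply/fpsP => n; rewrite fpsBE /fps_comp -sumrB.
by apply: eq_bigr => k _; rewrite mulrBl.
Qed.

Lemma fps_compC b c : fps_comp b (fpsC c) = fpsC c.
Proof.
apply/fpsP => n; rewrite /fps_comp big_ord_recl /= big1 ?addr0; last first.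
  by move=> i _; rewrite mul0r.
by case: n => [|n]; rewrite expr0 fps1E /= ?mulr1 ?mulr0.
Qed.

Lemma fps_comp1 b : fps_comp b 1 = 1.
Proof. by rewrite -(rmorph1 (@fpsC A)) fps_compC. Qed.

Lemma fps_compX b : b 0%N = 0 -> fps_comp b (fpsX A) = b.
Proof.
move=> b0; apply/fpsP => n; rewrite (fps_compE _ b0 (leqnSn n)).
rewrite big_ord_recl mul0r add0r big_ord_recl /= mul1r expr1 big1 ?addr0 //.
by move=> i _; rewrite mul0r.
Qed.

Lemma fps_comp_const b f : fps_comp b f 0%N = f 0%N.
Proof. by rewrite /fps_comp big_ord_recl big_ord0 addr0 expr0 fps1E mulr1. Qed.

(* Both sides have the coefficients of polynomials in [b]: compare them in [{poly A}]. *)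
Lemma fps_compM b f g : b 0%N = 0 -> fps_comp b (f * g) = fps_comp b f * fps_comp b g.
Proof.
move=> b0; apply/fpsP => n.
rewrite (fps_comp_poly _ b0 (leqnn n)).
have -> : (fps_comp b f * fps_comp b g) n =
  ((\sum_(k < n.+1) fpsC (f k) * b ^+ k) * (\sum_(k < n.+1) fpsC (g k) * b ^+ k)) n.
  rewrite !fpsME; apply: eq_bigr => -[i /= ilt] _.
  by congr (_ * _); apply: fps_comp_poly => //; lia.
pose ev (p : {poly A}) := (map_poly (@fpsC A) p).[b].
have evE (h : fps A) : \sum_(k < n.+1) fpsC (h k) * b ^+ k = ev (fps_trunc n h).
  rewrite /ev (horner_coef_wide (n := n.+1)).
    by apply: eq_bigr => i _; rewrite coef_map /= coef_fps_trunc // -ltnS.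
  by apply: leq_trans (size_poly _ _) _; apply: size_poly.
have ev_val (p : {poly A}) : (forall k, (k <= n)%N -> p`_k = 0) -> (ev p) n = 0.
  move=> p0; rewrite /ev horner_coef fps_sumE big1 // => i _; rewrite coef_map /= fpsCM.
  have [le_in|lt_ni] := leqP i n; first by rewrite p0 // mul0r.
  by rewrite (fps_valX1 b0) ?mulr0.
rewrite !evE; apply/eqP; rewrite -subr_eq0 -fpsBE; apply/eqP.
have -> : ev (fps_trunc n (f * g)) - ev (fps_trunc n f) * ev (fps_trunc n g)
  = ev (fps_trunc n (f * g) - fps_trunc n f * fps_trunc n g).
  by rewrite /ev rmorphB rmorphM /= !hornerE.
by apply: ev_val => k kn; rewrite coefB coef_fps_trunc_mul // subrr.
Qed.

Lemma fps_compXn b f k : b 0%N = 0 -> fps_comp b (f ^+ k) = fps_comp b f ^+ k.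
Proof.
move=> b0; elim: k => [|k IH]; first by rewrite !expr0 fps_comp1.
by rewrite !exprS fps_compM // IH.
Qed.

End FpsComp.

End PowerSeries.

(** * Finite differences and determinants of linear functionals *)

Module FiniteDifferences.
Import ZArith.
Import Defs.
Import structures.
Import all_boot all_order all_algebra.
Import boolp functions.
Import ring lra zify.
Import PowerSeries.
Set Implicit Arguments.
Unset Strict Implicit.
Unset Printing Implicit Defensive.
Import GRing.Theory Num.Theory.
Local Open Scope ring_scope.
Local Notation seq := list.

Section FDiff.
Variable K : numFieldType.

Definition fdiff (f : {poly K}) : {poly K} := f \Po ('X + 1) - f.

(** Falling factorials, the monic basis on which the difference operator acts as d/du acts on
    monomials. *)
Definition ffpoly (i : nat) : {poly K} := \prod_(k < i) ('X - (k%:R)%:P).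

Lemma ffpoly0 : ffpoly 0 = 1.
Proof. by rewrite /ffpoly big_ord0. Qed.

Lemma ffpolyS i : ffpoly i.+1 = ffpoly i * ('X - (i%:R)%:P).
Proof. by rewrite /ffpoly big_ord_recr. Qed.

Lemma ffpoly_shift i : ffpoly i.+1 \Po ('X + 1) = ('X + 1) * ffpoly i.
Proof.
elim: i => [|i IH].
  by rewrite ffpolyS ffpoly0 mul1r mulr1 subr0 comp_polyX.
rewrite ffpolyS rmorphM /= IH ffpolyS -!mulrA; congr (_ * (_ * _)).
rewrite rmorphB /= comp_polyX comp_polyC -[i.+1%:R]natr1 polyCD; ring.
Qed.

Lemma fdiff_ffpoly i : fdiff (ffpoly i.+1) = i.+1%:R *: ffpoly i.
Proof.
rewrite /fdiff ffpoly_shift ffpolyS -mul_polyC -[i.+1%:R]natr1 polyCD; ring.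
Qed.

Lemma fdiff1 : fdiff 1 = 0.
Proof. by rewrite /fdiff rmorph1 subrr. Qed.

Lemma fdiffZD c f g : fdiff (c *: f + g) = c *: fdiff f + fdiff g.
Proof.
rewrite /fdiff comp_polyD comp_polyZ scalerBr opprD !addrA.
by congr (_ - _); rewrite -!addrA; congr (_ + _); rewrite addrC.
Qed.

Lemma size_ffpoly i : size (ffpoly i) = i.+1.
Proof. by rewrite size_prod_XsubC /index_enum -enumT size_enum_ord. Qed.

Lemma monic_ffpoly i : ffpoly i \is monic.
Proof. exact: monic_prod_XsubC. Qed.

End FDiff.

Section Det.
Variables (K : numFieldType) (A : comNzRingType) (iota : {rmorphism K -> A}).
Notation func := ({poly K} -> A).
Implicit Types (phi : func) (cs pre post : seq func).

(** Values lie in an algebra [A] over [K], so that evaluations at formal points are allowed as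
    functionals. *)
Definition linf phi := forall c f g, phi (c *: f + g) = iota c * phi f + phi g.

Lemma linfD phi f g : linf phi -> phi (f + g) = phi f + phi g.
Proof. by move=> lf; rewrite -[f in LHS]scale1r lf rmorph1 mul1r. Qed.

Lemma linf0 phi : linf phi -> phi 0 = 0.
Proof. by move=> lf; apply: (addrI (phi 0)); rewrite -linfD // !addr0. Qed.

Lemma linfZ phi c f : linf phi -> phi (c *: f) = iota c * phi f.
Proof. by move=> lf; rewrite -[c *: f]addr0 lf linf0 // addr0. Qed.

Lemma linf_sum phi I (r : seq I) (P : pred I) F : linf phi ->
  phi (\sum_(i <- r | P i) F i) = \sum_(i <- r | P i) phi (F i).
Proof.
move=> lf; apply: (big_morph phi) => [f g|]; first exact: linfD.
exact: linf0.
Qed.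

Definition evf (c : K) : func := fun f => iota f.[c].

Lemma linf_ev c : linf (evf c).
Proof. by move=> d f g; rewrite /evf !hornerE rmorphD rmorphM. Qed.

Lemma iter_fdiffZD n (c : K) (f g : {poly K}) :
  iter n (@fdiff K) (c *: f + g) = c *: iter n (@fdiff K) f + iter n (@fdiff K) g.
Proof. by elim: n => //= n ->; rewrite fdiffZD. Qed.

Lemma linf_fdiff phi n : linf phi -> linf (phi \o iter n (@fdiff K)).
Proof. by move=> lf c f g /=; rewrite iter_fdiffZD lf. Qed.

Notation z0 := (fun _ : {poly K} => 0 : A).

(** A generalized Vandermonde determinant: functionals as rows, polynomials as columns. The rows
    form a list, so that row operations become list surgery; missing rows default to the zero
    functional. *)
Definition Dt (n : nat) (e : nat -> {poly K}) cs : A :=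
  \det (\matrix_(i < n, j < n) nth z0 cs i (e j)).

Lemma nth_cat_cons pre phi post i :
  nth z0 (pre ++ phi :: post) i =
  if i == size pre then phi else nth z0 (pre ++ z0 :: post) i.
Proof.
rewrite !nth_cat; case: ltngtP => // [ip|->]; last by rewrite subnn.
by rewrite -[(i - _)%N]prednK ?subn_gt0.
Qed.

Lemma Dt_D n e pre phi psi post : (size pre < n)%N ->
  Dt n e (pre ++ (fun f => phi f + psi f) :: post) =
  Dt n e (pre ++ phi :: post) + Dt n e (pre ++ psi :: post).
Proof.
move=> pn; rewrite /Dt.
rewrite -[X in X + _]mul1r -[X in _ + X]mul1r.
have nE X (k : 'I_n.-1) : nth z0 (pre ++ X :: post) (lift (Ordinal pn) k)
    = nth z0 (pre ++ z0 :: post) (lift (Ordinal pn) k).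
  rewrite nth_cat_cons; case: eqP => // kp; have := neq_lift (Ordinal pn) k.
  by move: kp; rewrite -val_eqE /= => ->; rewrite eqxx.
apply: (determinant_multilinear (i0 := Ordinal pn)).
- by apply/rowP => j; rewrite !mxE /= !nth_cat ltnn subnn /= !mul1r.
- by apply/matrixP => i j; rewrite !mxE !nE.
- by apply/matrixP => i j; rewrite !mxE !nE.
Qed.

Lemma Dt_0 n e pre post : (size pre < n)%N -> Dt n e (pre ++ z0 :: post) = 0.
Proof.
move=> pn; apply: (addrI (Dt n e (pre ++ z0 :: post))).
rewrite -[LHS]Dt_D // [RHS]addr0; congr Dt; congr (_ ++ _ :: _).
by apply/funext => f; rewrite addr0.
Qed.

Lemma Dt_sum n e pre post I (r : seq I) (F : I -> func) : (size pre < n)%N ->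
  Dt n e (pre ++ (fun f => \sum_(i <- r) F i f) :: post) =
  \sum_(i <- r) Dt n e (pre ++ F i :: post).
Proof.
move=> pn; elim: r => [|i r IH].
  rewrite big_nil -[RHS](Dt_0 e post pn); congr Dt; congr (_ ++ _ :: _).
  by apply/funext => f; rewrite big_nil.
rewrite big_cons -IH -Dt_D //; congr Dt; congr (_ ++ _ :: _).
by apply/funext => f; rewrite big_cons.
Qed.

Lemma Dt_N n e pre phi post : (size pre < n)%N ->
  Dt n e (pre ++ (fun f => - phi f) :: post) = - Dt n e (pre ++ phi :: post).
Proof.
move=> pn; apply/eqP; rewrite -addr_eq0 -Dt_D // -(Dt_0 e post pn); apply/eqP.
by congr Dt; congr (_ ++ _ :: _); apply/funext => f; rewrite addNr.
Qed.

Lemma Dt_alt n e pre phi post : ((size pre).+1 < n)%N ->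
  Dt n e (pre ++ phi :: phi :: post) = 0.
Proof.
move=> pn; apply: (determinant_alternate (i1 := Ordinal (ltnW pn)) (i2 := Ordinal pn)).
  by rewrite -val_eqE /= neq_ltn leqnn.
by move=> j; rewrite !mxE /= !nth_cat ltnn subnn ltnNge leqnSn /= subSn // subnn.
Qed.

Lemma Dt_sub n e pre phi psi post : ((size pre).+1 < n)%N ->
  Dt n e (pre ++ (fun f => phi f - psi f) :: psi :: post) =
  Dt n e (pre ++ phi :: psi :: post).
Proof.
by move=> pn; rewrite Dt_D ?Dt_N ?Dt_alt ?oppr0 ?addr0 // ltnW.
Qed.

Fixpoint evdiffs (c : K) (ds : seq K) : seq func :=
  if ds is d :: ds' then (fun f => evf c f - evf d f) :: evdiffs d ds' else [::].

Lemma size_evdiffs c ds : size (evdiffs c ds) = size ds.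
Proof. by elim: ds c => //= d ds IH c; rewrite IH. Qed.

(** Subtracting from each evaluation row the next one leaves differences, which vanish on constants,
    and a single evaluation at the end. *)
Lemma Dt_evdiffs n e pre c ds post : (size pre + size ds < n)%N ->
  Dt n e (pre ++ map evf (c :: ds) ++ post) =
  Dt n e (pre ++ evdiffs c ds ++ evf (last c ds) :: post).
Proof.
elim: ds c pre => [|d ds IH] c pre //= pn.
rewrite -Dt_sub; last by apply: leq_ltn_trans pn; lia.
have := IH d (rcons pre (fun f => evf c f - evf d f)).
rewrite size_rcons !cat_rcons => -> //.
by apply: leq_ltn_trans pn; lia.
Qed.

(* The row of the last evaluation is the only one that does not vanish on the constant [1]. *)
Lemma Dt_expand n (F : seq func) phi post c (e : nat -> {poly K}) :
  (size F + size post)%N = n ->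
  (forall i, (i < n)%N -> nth z0 (F ++ post) i (e 0%N) = 0) -> phi (e 0%N) = c ->
  Dt n.+1 e (F ++ phi :: post) =
  (-1) ^+ size F * c * Dt n (fun i => e i.+1) (F ++ post).
Proof.
move=> Fn H0 phic; have Fn' : (size F < n.+1)%N by lia.
have nE (i : 'I_n) : nth z0 (F ++ phi :: post) (lift (Ordinal Fn') i) = nth z0 (F ++ post) i.
  rewrite !nth_cat /= /bump; case: (ltnP i (size F)) => iF.
    by rewrite add0n iF.
  by rewrite add1n ltnNge (leq_trans iF (leqnSn i)) /= subSn.
rewrite {1}/Dt (expand_det_col _ ord0) (bigD1 (Ordinal Fn')) //= big1 ?addr0; last first.
  move=> i; rewrite eq_sym => /unlift_some[k -> _].
  by rewrite mxE nE H0 ?mul0r.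
rewrite mxE /= nth_cat ltnn subnn /= phic /cofactor addn0 mulrCA mulrA; congr (_ * _).
congr (\det _); apply/matrixP => i j; rewrite !mxE nE.
by congr (nth _ _ _ (e _)); rewrite lift0.
Qed.

Lemma Dt_scale n (e e' : nat -> {poly K}) (k : nat -> A) cs cs' :
  (forall i j, (i < n)%N -> nth z0 cs i (e j) = k j * nth z0 cs' i (e' j)) ->
  Dt n e cs = (\prod_(j < n) k j) * Dt n e' cs'.
Proof.
move=> H; have -> : \prod_(j < n) k j = \det (diag_mx (\row_(j < n) k j)).
  by rewrite det_diag; apply: eq_bigr => j _; rewrite mxE.
rewrite /Dt mulrC -det_mulmx; congr (\det _).
apply/matrixP => i j; rewrite !mxE (bigD1 j) //= big1 ?addr0; last first.
  by move=> l lj; rewrite !mxE (negbTE lj) mulr0n mulr0.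
by rewrite !mxE eqxx mulr1n H // mulrC.
Qed.

Lemma evf_sum_telescope (F G : {poly K}) (m : nat) (c : K) :
  fdiff F = G -> iota F.[c + m%:R] - iota F.[c] = \sum_(i < m) evf (c + i%:R) G.
Proof.
move=> <-; elim: m => [|m IH]; first by rewrite big_ord0 addr0 subrr.
rewrite big_ord_recr /= -IH /evf /fdiff hornerD hornerN horner_comp !hornerE.
rewrite rmorphB -natr1 addrA; ring.
Qed.

(** The change of basis from monomials to monic polynomials of degrees 0, 1, 2, ... is
    unitriangular, hence has determinant 1. *)
Lemma Dt_monic_basis n (e : nat -> {poly K}) cs :
  (forall phi, List.In phi cs -> linf phi) -> (forall i, size (e i) = i.+1 /\ e i \is monic) ->
  Dt n e cs = Dt n (fun i => 'X^i) cs.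
Proof.
move=> lcs He; pose U := \matrix_(i < n, j < n) iota (e i)`_j.
have Udet : \det U = 1.
  rewrite det_trig; last first.
    apply/is_trig_mxP => i j ij; rewrite mxE nth_default ?rmorph0 //.
    by rewrite (He i).1.
  rewrite big1 // => i _; rewrite mxE.
  have := monicP (He i).2; rewrite lead_coefE (He i).1 /= => ->.
  by rewrite rmorph1.
rewrite -[RHS]mulr1 -Udet -(det_tr U) -det_mulmx; congr (\det _).
apply/matrixP => i j; rewrite !mxE.
have li : linf (nth z0 cs i).
  have [ilt|ige] := ltnP i (size cs); last first.
    by rewrite nth_default // => c f g; rewrite mulr0 addr0.
  apply: lcs; elim: (cs) (val i) ilt => //= phi cs' IH [|k] klt; first by left.
  by right; apply: IH.
have -> : e j = \sum_(k < n) (e j)`_k *: 'X^k.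
  rewrite -poly_def; apply/polyP => k; rewrite coef_poly; case: ltnP => // nk.
  by rewrite nth_default // (He j).1; apply: leq_trans nk.
rewrite (linf_sum _ _ _ li); apply: eq_bigr => k _.
by rewrite !mxE linfZ // mulrC.
Qed.

Lemma Dt_monic n (e e' : nat -> {poly K}) cs :
  (forall phi, List.In phi cs -> linf phi) -> (forall i, size (e i) = i.+1 /\ e i \is monic) ->
  (forall i, size (e' i) = i.+1 /\ e' i \is monic) -> Dt n e cs = Dt n e' cs.
Proof. by move=> lcs He He'; rewrite (Dt_monic_basis _ lcs He) (Dt_monic_basis _ lcs He'). Qed.

End Det.

End FiniteDifferences.

(** * One step of the branching rule as a determinant identity *)

Module InterlacingSums.
Import ZArith.
Import Defs.
Import structures.
Import all_boot all_order all_algebra.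
Import boolp functions.
Import ring lra zify.
Import PowerSeries FiniteDifferences.
Set Implicit Arguments.
Unset Strict Implicit.
Unset Printing Implicit Defensive.
Import GRing.Theory Num.Theory.
Local Open Scope ring_scope.

Lemma big_List_map (V : zmodType) I J (h : I -> J) (r : seq I) (F : J -> V) :
  \sum_(j <- List.map h r) F j = \sum_(i <- r) F (h i).
Proof. by elim: r => [|i r IH] /=; rewrite ?big_nil // !big_cons IH. Qed.

Lemma big_flat_map (V : zmodType) I J (h : I -> seq J) (r : seq I) (F : J -> V) :
  \sum_(j <- List.flat_map h r) F j = \sum_(i <- r) \sum_(j <- h i) F j.
Proof. by elim: r => [|i r IH] /=; rewrite ?big_nil // big_cons big_cat IH. Qed.

Lemma eq_big_In (V : zmodType) I (r : seq I) (F G : I -> V) :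
  (forall i, List.In i r -> F i = G i) -> \sum_(i <- r) F i = \sum_(i <- r) G i.
Proof.
elim: r => [|i r IH] FG; first by rewrite !big_nil.
by rewrite !big_cons FG ?IH //; [move=> j jr; apply: FG; right | left].
Qed.

Fixpoint Zdecr (l : seq Z) : Prop :=
  if l is a :: t then (if t is b :: _ then Z.le b a else True) /\ Zdecr t else True.

(** The strictly decreasing points l_i = lambda_i + n - i, where n is the length of the list and i
    starts at 1. *)
Fixpoint shsig (l : seq Z) : seq Z :=
  if l is a :: t then (Z.add a (Z.of_nat (size t))) :: shsig t else [::].

Lemma size_shsig l : size (shsig l) = size l.
Proof. by elim: l => //= a t ->. Qed.

Lemma size_interlace l nu : List.In nu (interlace l) -> size nu = (size l).-1.
Proof.
elim: l nu => [|a [|b t] IH] nu //; first by case=> // <-.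
case/List.in_flat_map => v [_ /List.in_map_iff[nu' [<- /IH /= ->]]].
by [].
Qed.

Lemma Zdecr_interlace l nu : Zdecr l -> List.In nu (interlace l) ->
  Zdecr nu /\ (if nu is v :: _ then if l is a :: _ then Z.le v a else True else True).
Proof.
elim: l nu => [|a [|b t] IH] nu //; first by move=> _; case=> // <-.
case=> ba lt /List.in_flat_map[v [/List.in_map_iff[k [<- kr]]]].
case/List.in_map_iff => nu' [<- /(IH _ lt)[nu's hnu']].
move/List.in_seq: kr => kr; split; last by clear -ba kr; rewrite /=; lia.
by split=> //; case: nu' nu's hnu' => // w nu' _ /= ?; lia.
Qed.

Lemma interlace_cons a b t : interlace (a :: b :: t) =
  List.flat_map (fun v => List.map (cons v) (interlace (b :: t))) (Zrange b a).
Proof. by []. Qed.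
Arguments interlace : simpl never.

Section Branching.
Variables (K : numFieldType) (A : comNzRingType) (io : {rmorphism K -> A}).
Variable pt : Z -> K.
Hypothesis ptS : forall z, pt (Z.add z (Zpos xH)) = pt z + 1.
Notation func := ({poly K} -> A).
Notation z0 := (fun _ : {poly K} => 0 : A).
Notation ff := (@ffpoly K).

Lemma pt_addn z (k : nat) : pt (Z.add z (Z.of_nat k)) = pt z + k%:R.
Proof.
elim: k => [|k IH]; first by rewrite Z.add_0_r addr0.
by rewrite -natr1 addrA -IH -ptS; congr pt; lia.
Qed.

Definition pts (l : seq Z) : seq K := map pt (shsig l).

Lemma size_pts l : size (pts l) = size l.
Proof. by rewrite size_map size_shsig. Qed.

Fixpoint evsums (a : Z) (t : seq Z) : seq func :=
  if t is b :: t' then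
    (fun f => \sum_(v <- Zrange b a) evf io (pt (Z.add v (Z.of_nat (size t')))) f) :: evsums b t'
  else [::].

(** Interlacing confines each coordinate of nu separately, between two neighbouring entries of
    [a :: t]; the sum over nu runs over a product set, and multilinearity moves it into the rows. *)
Lemma Dt_interlace n e a t (pre post : seq func) : (size pre + size t <= n)%N ->
  \sum_(nu <- interlace (a :: t)) Dt n e (pre ++ map (evf io) (pts nu) ++ post) =
  Dt n e (pre ++ evsums a t ++ post).
Proof.
elim: t a pre => [|b t IH] a pre pn; first by rewrite big_seq1.
rewrite interlace_cons big_flat_map Dt_sum; last by apply: leq_trans pn; rewrite /=; lia.
apply: eq_bigr => v _; rewrite big_List_map -cat_rcons -IH; last first.
  by rewrite size_rcons; apply: leq_trans pn; rewrite /=; lia.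
apply: eq_big_In => nu nuI; have /= nut := size_interlace nuI.
by rewrite /= nut cat_rcons.
Qed.

(** Both kinds of row are exact differences of [ff j.+1]: an interval sum of [ff j] telescopes, and
    a functional composed with the difference operator picks up the same factor j + 1. *)
Lemma evsums_telescope a t (post : seq func) i j : Zdecr (a :: t) ->
  (forall phi, List.In phi post -> linf io phi) ->
  nth z0 (evdiffs io (pt (Z.add a (Z.of_nat (size t)))) (pts t)
          ++ map (fun phi => phi \o @fdiff K) post) i (ff j.+1) =
  j.+1%:R * nth z0 (evsums a t ++ post) i (ff j).
Proof.
elim: t a i => [|b t IH] a i /=.
  move=> _; elim: post i => [|phi post IH] [|i] lp; rewrite /= ?mulr0 //.
    have lphi : linf io phi by apply: lp; left.
    by rewrite fdiff_ffpoly (linfZ _ _ lphi) rmorph_nat.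
  by apply: IH => phi' ?; apply: lp; right.
case=> ba bt lp; case: i => [|i]; last exact: IH.
rewrite /= big_List_map.
(* The shift for nu is one smaller than for the longer signature. The interval from b to a has a - b
   + 1 integers, so one step past its upper end is exactly the point of a. *)
have -> : pt (Z.add a (Z.of_nat (size t).+1)) =
    pt (Z.add b (Z.of_nat (size t))) + (Z.to_nat (Z.add (Z.sub a b) 1))%:R.
  by rewrite -pt_addn; congr pt; lia.
rewrite [LHS](evf_sum_telescope io _ _ (@fdiff_ffpoly K j)) mulr_sumr.
rewrite -(big_mkord xpredT (fun i => evf io (pt (Z.add b (Z.of_nat (size t))) + i%:R) (j.+1%:R *: ff j))).
rewrite /index_iota subn0.
have -> : iota 0 (Z.to_nat (Z.add (Z.sub a b) 1)) = List.seq 0 (Z.to_nat (Z.add (Z.sub a b) 1)).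
  by elim: (Z.to_nat _) 0%N => //= m ->.
apply: eq_bigr => k _; rewrite /evf -pt_addn hornerZ rmorphM rmorph_nat.
by congr (_ * _); congr (io _.[pt _]); lia.
Qed.

(** The sign comes from expanding along the column of the constant polynomial, the product from the
    telescoping factors j + 1. *)
Definition step_const (n r : nat) : A := (-1) ^+ n * \prod_(j < n + r) j.+1%:R.

(** The determinant of interval sums is a minor of one with one more row: adjoining the column
    [ff 0 = 1] and one evaluation row turns the differences back into evaluations at the points of
    [a :: t]. *)
Lemma Dt_branching a t (post : seq func) : Zdecr (a :: t) ->
  (forall phi, List.In phi post -> linf io phi) ->
  step_const (size t) (size post) *
    \sum_(nu <- interlace (a :: t)) Dt (size t + size post) ff (map (evf io) (pts nu) ++ post)
  = Dt (size t + size post).+1 ff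
      (map (evf io) (pts (a :: t)) ++ map (fun phi => phi \o @fdiff K) post).
Proof.
move=> lt lp; have := @Dt_interlace (size t + size post) ff a t [::] post.
rewrite !cat0s => ->; last by rewrite leq_addr.
have := @Dt_evdiffs _ _ io (size t + size post).+1 ff [::]
  (pt (Z.add a (Z.of_nat (size t)))) (pts t) (map (fun phi => phi \o @fdiff K) post).
rewrite !cat0s size_pts add0n => ->; last by rewrite ltnS leq_addr.
have sz : (size (evdiffs io (pt (Z.add a (Z.of_nat (size t)))) (pts t)) +
   size [seq phi \o fdiff (K:=K) | phi <- post])%N = (size t + size post)%N.
  by rewrite size_evdiffs size_pts size_map.
rewrite (@Dt_expand _ _ _ _ _ _ 1 ff sz); last first.
- by rewrite /evf ffpoly0 hornerC rmorph1.
- move=> i _; rewrite ffpoly0.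
  elim: (pts t) (pt _) i {sz} => [|d ds IH] c i; last first.
    by case: i => [|i] /=; [rewrite /evf !hornerC subrr | exact: IH].
  rewrite /=; elim: post lp i => [|phi post IH] lp [|i] //=.
    have lphi : linf io phi by apply: lp; left.
    by rewrite fdiff1 (linf0 lphi).
  by apply: IH => phi' ?; apply: lp; right.
rewrite size_evdiffs size_pts mulr1 /step_const -mulrA; congr (_ * _).
rewrite [RHS](@Dt_scale _ _ _ _ ff (fun j => j.+1%:R) _ (evsums a t ++ post)) //.
by move=> i j _; exact: evsums_telescope.
Qed.

End Branching.

End InterlacingSums.

(** * Iterated branching, the dimension formula and block factorization *)

Module Branching.
Import ZArith.
Import Defs.
Import structures.
Import all_boot all_order all_algebra.
Import boolp functions.
Import ring lra zify.
Import PowerSeries FiniteDifferences InterlacingSums.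
Set Implicit Arguments.
Unset Strict Implicit.
Unset Printing Implicit Defensive.
Import GRing.Theory Num.Theory.
Local Open Scope ring_scope.

(** End points of all interlacing chains of n steps below [l], listed with multiplicity; the
    multiplicity of mu counts the Gelfand-Tsetlin patterns between [l] and mu. *)
Fixpoint chains (n : nat) (l : seq Z) : seq (seq Z) :=
  if n is n'.+1 then List.flat_map (chains n') (interlace l) else [:: l].

Lemma In_chains n l mu : (n <= size l)%N -> Zdecr l -> List.In mu (chains n l) ->
  Zdecr mu /\ size mu = (size l - n)%N.
Proof.
elim: n l => [|n IH] l nl ld /=; first by case=> // <-; rewrite subn0.
case/List.in_flat_map => nu [nul muc]; have nus := size_interlace nul.
have [|mud ->] := IH nu _ (Zdecr_interlace ld nul).1 muc; first by rewrite nus; lia.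
by split=> //; rewrite nus; lia.
Qed.

(** This is the largest interlacing signature. It shows that chains exist, and later serves to
    recover a signature from its branching. *)
Lemma belast_interlace a t : Zdecr (a :: t) -> List.In (belast a t) (interlace (a :: t)).
Proof.
elim: t a => [|b t IH] a; first by left.
case=> ba bt; rewrite interlace_cons; apply/List.in_flat_map; exists a; split; last first.
  by apply/List.in_map_iff; exists (belast b t); split=> //; apply: IH.
apply/List.in_map_iff; exists (Z.to_nat (Z.sub a b)); split; first lia.
by apply/List.in_seq; lia.
Qed.

Lemma chains_neq0 n l : (n <= size l)%N -> Zdecr l -> (0 < size (chains n l))%N.
Proof.
elim: n l => [|n IH] // [|a t] // nl ld.
have := belast_interlace ld => bin; have := IH _ _ (Zdecr_interlace ld bin).1.
rewrite size_belast => /(_ nl) /=; elim: (interlace _) bin => //= nu r IHr [-> | nur] gt0.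
  by rewrite size_cat; lia.
by rewrite size_cat; have := IHr nur gt0; lia.
Qed.

Lemma sum_ones (V : pzSemiRingType) I (r : seq I) : \sum_(i <- r) 1 = (size r)%:R :> V.
Proof. by elim: r => [|i r IH]; rewrite ?big_nil ?big_cons //= IH -nat1r. Qed.

Lemma sum_if_eq (V : pzSemiRingType) (I : eqType) (r : seq I) (j : I) (g : I -> V) :
  \sum_(i <- r) (if i == j then g i else 0) = (count_mem j r)%:R * g j.
Proof.
elim: r => [|i r IH]; first by rewrite big_nil mul0r.
rewrite big_cons IH /=; case: eqP => [->|_]; last by rewrite add0r add0n.
by rewrite natrD mulrDl mul1r.
Qed.

Lemma InP (T : eqType) (x : T) s : reflect (List.In x s) (x \in s).
Proof.
elim: s => [|y s IH] /=; first exact: ReflectF.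
rewrite in_cons; apply: (iffP orP) => [[/eqP ->|/IH]|[->|/IH]]; by [left | right].
Qed.

Section ChainDt.
Variables (K : numFieldType) (A : comNzRingType) (io : {rmorphism K -> A}).
Variable pt : Z -> K.
Hypothesis ptS : forall z, pt (Z.add z (Zpos xH)) = pt z + 1.
Notation func := ({poly K} -> A).
Notation z0 := (fun _ : {poly K} => 0 : A).
Notation ff := (@ffpoly K).
Notation evs l := (map (evf io) (pts pt l)).

Definition chain_const M n r : A := \prod_(k < n) step_const A (M + k) r.

Lemma linf_map_fdiff n (post : seq func) : (forall phi, List.In phi post -> linf io phi) ->
  forall phi, List.In phi [seq phi \o iter n (@fdiff K) | phi <- post] -> linf io phi.
Proof.
elim: post => //= psi post IHp lp phi [<-|]; first by apply: linf_fdiff; apply: lp; left.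
by apply: IHp => *; apply: lp; right.
Qed.

Lemma Dt_chains M n l (post : seq func) : Zdecr l -> size l = (M + n)%N ->
  (forall phi, List.In phi post -> linf io phi) ->
  chain_const M n (size post) *
    \sum_(mu <- chains n l) Dt (M + size post) ff (evs mu ++ post)
  = Dt (size l + size post) ff (evs l ++ map (fun phi => phi \o iter n (@fdiff K)) post).
Proof.
move=> ld sl lp; elim: n l ld sl => [|n IH] l ld sl.
  rewrite /chain_const big_ord0 mul1r big_seq1 sl addn0; congr Dt; congr (_ ++ _).
  by rewrite -[LHS]map_id.
case: l ld sl => [|a t] ld sl; first by move: sl; rewrite addnS.
pose post' := [seq phi \o iter n (@fdiff K) | phi <- post].
have lp' := @linf_map_fdiff n post lp.
have sp : size post' = size post by rewrite size_map.
have st : size t = (M + n)%N by move: sl => /=; lia.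
have := @Dt_branching K A io pt ptS a t post' ld lp'; rewrite st sp => E.
transitivity (Dt (M + n + size post).+1 ff
    (evs (a :: t) ++ [seq phi \o @fdiff K | phi <- post'])); last first.
  rewrite [size (a :: t)]/= st; congr (Dt _ _ (_ ++ _)); rewrite -map_comp; apply: eq_map => phi.
  by apply/funext => f; rewrite /= -iterSr.
rewrite -E /chain_const big_ord_recr big_flat_map -mulrA.
rewrite mulrCA; congr (_ * _); rewrite mulr_sumr; apply: eq_big_In => nu nuI.
have snu : size nu = (M + n)%N by rewrite (size_interlace nuI).
by rewrite IH ?snu //; apply: (Zdecr_interlace ld nuI).1.
Qed.

Definition rootpoly (cs : seq K) : {poly K} := \prod_(c <- cs) ('X - c%:P).

Lemma Dt_evs_rmorph n (cs : seq K) : n = size cs ->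
  Dt n ff (map (evf io) cs) = io (Dt n ff (map (evf idfun) cs)).
Proof.
move=> ->; rewrite -det_map_mx; congr (\det _); apply/matrixP => i j; rewrite !mxE.
by rewrite !(nth_map 0) // !size_map.
Qed.

Lemma monic_e (cs : seq K) i : size ('X^i * rootpoly cs) = (i + size cs).+1 /\
  'X^i * rootpoly cs \is monic.
Proof.
have mQ : rootpoly cs \is monic by rewrite monic_prod_XsubC.
split; last by rewrite monicMl ?monicXn.
rewrite size_monicM ?monicXn ?monic_neq0 // size_polyXn size_prod_XsubC.
by rewrite addSn /= addnS.
Qed.

(** In the monic basis [ff 0], ..., [ff n.-1], Q, u Q, u^2 Q, ... with Q the polynomial of the roots
    [cs], the evaluations at the roots vanish on all multiples of Q, so the matrix is block
    triangular. *)
Lemma Dt_factor n r (cs : seq K) (post : seq func) : size cs = n -> size post = r ->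
  (forall phi, List.In phi post -> linf io phi) ->
  Dt (n + r) ff (map (evf io) cs ++ post) =
  io (Dt n ff (map (evf idfun) cs)) *
  \det (\matrix_(i < r, j < r) nth z0 post i ('X^j * rootpoly cs)).
Proof.
move=> scs sp lp.
pose e i := if (i < n)%N then ff i else 'X^(i - n) * rootpoly cs.
have He i : size (e i) = i.+1 /\ e i \is monic.
  rewrite /e; case: ltnP => ni; first by rewrite size_ffpoly monic_ffpoly.
  by have [-> ->] := monic_e cs (i - n); rewrite scs subnK.
have Hff i : size (ff i) = i.+1 /\ ff i \is monic by rewrite size_ffpoly monic_ffpoly.
rewrite (@Dt_monic K A io _ ff e) //; last first.
  move=> phi /List.in_app_iff[|]; last exact: lp.
  by elim: cs {scs e He} => //= c cs' IH [<-|/IH //]; apply: linf_ev.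
rewrite -Dt_evs_rmorph // -[Dt n _ _]/(\det _) -(det_lblock _ (\matrix_(i < r, j < n) nth z0 post i (e j))).
congr (\det _); apply/matrixP => i j.
case: (split_ordP i) => i' ->; case: (split_ordP j) => j' ->;
  rewrite ?(block_mxEul, block_mxEur, block_mxEdl, block_mxEdr) !mxE nth_cat size_map scs /=.
- by rewrite ltn_ord /e ltn_ord.
- rewrite ltn_ord (nth_map 0) ?scs // /e ltnNge leq_addr /= /evf hornerM.
  suff /rootP -> : root (rootpoly cs) (nth 0 cs i') by rewrite mulr0 rmorph0.
  by rewrite root_prod_XsubC mem_nth ?scs.
- by rewrite ltnNge leq_addr /= addKn.
- by rewrite ltnNge leq_addr /= !addKn /e ltnNge leq_addr /= addKn.
Qed.

(** By the monic change of basis this is the Vandermonde determinant of the points of [l]. *)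
Definition wdet (l : seq Z) : K := Dt (size l) ff (map (evf idfun) (pts pt l)).

(** The branching identity iterated n times, with [Dt_factor] applied on both sides to split off the
    Vandermonde determinants of mu and of [l]. *)
Lemma det_chains M n l (post : seq func) : Zdecr l -> size l = (M + n)%N ->
  (forall phi, List.In phi post -> linf io phi) ->
  chain_const M n (size post) *
    \sum_(mu <- chains n l) io (wdet mu) *
       \det (\matrix_(i < size post, j < size post) nth z0 post i ('X^j * rootpoly (pts pt mu)))
  = io (wdet l) *
    \det (\matrix_(i < size post, j < size post)
       nth z0 post i (iter n (@fdiff K) ('X^j * rootpoly (pts pt l)))).
Proof.
move=> ld sl lp.
pose post' := [seq phi \o iter n (@fdiff K) | phi <- post].
have lp' := @linf_map_fdiff n post lp.
have -> : \det (\matrix_(i < size post, j < size post)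
       nth z0 post i (iter n (@fdiff K) ('X^j * rootpoly (pts pt l)))) =
   \det (\matrix_(i < size post, j < size post) nth z0 post' i ('X^j * rootpoly (pts pt l))).
  by congr (\det _); apply/matrixP => i j; rewrite !mxE (nth_map z0).
rewrite /wdet -(Dt_factor (r := size post)) ?size_map ?size_shsig //.
rewrite -(Dt_chains ld sl lp); congr (_ * _); apply: eq_big_In => mu muc.
have [|mud smu] := In_chains _ ld muc; first by rewrite sl leq_addl.
by rewrite -Dt_factor ?size_pts // smu sl addnK.
Qed.

End ChainDt.

Section WdetCount.
Variables (K : numFieldType) (pt : Z -> K).
Hypothesis ptS : forall z, pt (Z.add z (Zpos xH)) = pt z + 1.

Lemma step_const_neq0 n r : step_const K n r != 0.
Proof.
rewrite /step_const mulf_neq0 ?signr_eq0 //; apply/prodf_neq0 => i _.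
by rewrite pnatr_eq0.
Qed.

Lemma chain_const_neq0 M n r : chain_const K M n r != 0.
Proof. by apply/prodf_neq0 => i _; apply: step_const_neq0. Qed.

(** Weyl's dimension formula: the case M = 0 of [det_chains] without functionals, where the sum
    merely counts complete patterns. *)
Lemma wdet_count l : Zdecr l ->
  chain_const K 0 (size l) 0 * (size (chains (size l) l))%:R = wdet pt l.
Proof.
move=> ld; have := @det_chains K K idfun pt ptS 0 (size l) l [::] ld erefl.
rewrite det_mx00 /= mulr1 => <- //; congr (_ * _).
rewrite -sum1_size natr_sum; apply: eq_big_In => mu muc.
have [//|mud smu] := In_chains _ ld muc.
by rewrite det_mx00 mulr1 /wdet smu subnn /Dt det_mx00.
Qed.

Lemma wdet_neq0 l : Zdecr l -> wdet pt l != 0.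
Proof.
move=> ld; rewrite -wdet_count // mulf_neq0 ?chain_const_neq0 //.
by rewrite pnatr_eq0 -lt0n chains_neq0.
Qed.

Lemma chain_const_split M n :
  chain_const K 0 (M + n) 0 = chain_const K 0 M 0 * chain_const K M n 0.
Proof. by rewrite /chain_const big_split_ord. Qed.

Lemma chain_const_rmorph (A : comNzRingType) (io : {rmorphism K -> A}) M n r :
  chain_const A M n r = io (chain_const K M n r).
Proof.
rewrite /chain_const rmorph_prod; apply: eq_bigr => k _.
rewrite /step_const rmorphM rmorphXn rmorphN1 rmorph_prod; congr (_ * _).
by apply: eq_bigr => i _; rewrite rmorph_nat.
Qed.

(** In an expectation only the ratio of the constants with r functionals and with none survives. *)
Lemma chain_const_ratio M n r :
  chain_const K M n r = chain_const K M n 0 * \prod_(k < n) \prod_(i < r) (M + k + i.+1)%:R.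
Proof.
rewrite /chain_const -big_split; apply: eq_bigr => k _ /=.
rewrite /step_const addn0 -mulrA; congr (_ * _).
by rewrite big_split_ord; congr (_ * _); apply: eq_bigr => i _; rewrite addnS.
Qed.
End WdetCount.

End Branching.

(** * Independence of Schur functions and the exact expectation formula *)

Module SchurIdentification.
Import Reals ZArith.
Import Defs.
Import structures.
Import all_boot all_order all_algebra.
Import boolp functions reals Rstruct.
Import ring lra zify ssrZ.
Import PowerSeries FiniteDifferences InterlacingSums Branching.
Set Implicit Arguments.
Unset Strict Implicit.
Unset Printing Implicit Defensive.
Import Order.TTheory GRing.Theory Num.Theory.
Local Open Scope ring_scope.
Local Notation R := Rdefinitions.R.

Lemma fold_right_Rplus I (r : seq I) (F : I -> R) :
  List.fold_right Rplus 0 (List.map F r) = \sum_(i <- r) F i.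
Proof. by elim: r => [|i r IH] /=; rewrite ?big_nil // big_cons -IH. Qed.

Lemma schur_rev_cons x xs l : schur_rev (x :: xs) l =
  \sum_(nu <- interlace l) powerRZ x (Z.sub (zsum l) (zsum nu)) * schur_rev xs nu.
Proof. by rewrite /= fold_right_Rplus. Qed.

Lemma powerRZ_1l z : powerRZ 1 z = 1.
Proof. by case: z => //= p; rewrite ?pow1 ?Rinv_1. Qed.

Lemma schur_rev_ones n xs l : schur_rev (List.repeat 1 n ++ xs) l =
  \sum_(mu <- chains n l) schur_rev xs mu.
Proof.
elim: n l => [|n IH] l; first by rewrite big_seq1.
rewrite [List.repeat _ _]/= cat_cons schur_rev_cons big_flat_map.
by apply: eq_bigr => nu _; rewrite powerRZ_1l mul1r IH.
Qed.

Lemma schur_ones l : Zdecr l ->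
  schur l (List.repeat 1 (size l)) = (size (chains (size l) l))%:R.
Proof.
move=> ld; rewrite /schur List.rev_repeat -[List.repeat _ _]cats0 schur_rev_ones.
rewrite -sum_ones; apply: eq_big_In => mu muc.
by have [//|_] := In_chains _ ld muc; rewrite subnn => /size0nil ->.
Qed.

Lemma is_sig_Zdecr n l : is_sig n l -> Zdecr l /\ size l = n.
Proof.
case=> ln H; split; last by rewrite -ln; elim: l {ln H} => //= a t ->.
elim: l n ln H => [|a [|b t] IH] n ln H //; split; first by apply: (H 0%N); rewrite -ln /=; lia.
apply: (IH n.-1); first by rewrite -ln.
by move=> i ilt; apply: (H i.+1); rewrite -ln /= in ilt *; lia.
Qed.

Lemma powerRZ_shift (x : R) (z : Z) (B : nat) : x != 0 -> Z.le 0 (Z.add z (Z.of_nat B)) ->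
  powerRZ x z * x ^+ B = x ^+ Z.to_nat (Z.add z (Z.of_nat B)).
Proof.
move=> /eqP x0 zB; rewrite -!RpowE !pow_powerRZ -[_ * _]/(Rmult _ _) -powerRZ_add //.
by congr (powerRZ _ _); lia.
Qed.

(** Multiplied by a high power of x the sum becomes a polynomial; it vanishes at 1, 2, 3, ..., more
    points than its degree permits. *)
Lemma powerRZ_indep (I : eqType) (L : seq I) (c : I -> R) (d : I -> Z) :
  (forall x : R, 0 < x -> \sum_(i <- L) c i * powerRZ x (d i) = 0) ->
  forall d0, \sum_(i <- L | d i == d0) c i = 0.
Proof.
move=> H d0.
have [B HB] : exists B : nat, Z.le 0 (Z.add d0 (Z.of_nat B)) /\
    forall i, i \in L -> Z.le 0 (Z.add (d i) (Z.of_nat B)).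
  elim: L {H} => [|i L [B [B0 BL]]]; first by exists (Z.to_nat (Z.opp d0)); split=> //; lia.
  exists (B + Z.to_nat (Z.opp (d i)))%N; split; first lia.
  by move=> j; rewrite in_cons => /orP[/eqP ->|/BL]; lia.
pose p : {poly R} := \sum_(i <- L) c i *: 'X^(Z.to_nat (Z.add (d i) (Z.of_nat B))).
have p0 : p = 0.
  apply/eqP; apply/negP => /negP pn0.
  pose s := [seq k.+1%:R : R | k <- iota 0 (size p)].
  have us : uniq s by rewrite map_inj_uniq ?iota_uniq // => a b /eqP; rewrite eqr_nat => /eqP [].
  suff rp : all (root p) s by have := max_poly_roots pn0 rp us; rewrite size_map size_iota ltnn.
  apply/allP => _ /mapP[k _ ->]; rewrite /root /p horner_sum; apply/eqP.
  have kp : 0 < k.+1%:R :> R by rewrite ltr0n.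
  transitivity ((\sum_(i <- L) c i * powerRZ k.+1%:R (d i)) * k.+1%:R ^+ B); last first.
    by rewrite H // mul0r.
  rewrite mulr_suml; apply: eq_big_seq => i iL; rewrite hornerZ hornerXn -mulrA.
  by rewrite powerRZ_shift ?gt_eqF //; apply: HB.2.
have := congr1 (fun q : {poly R} => q`_(Z.to_nat (Z.add d0 (Z.of_nat B)))) p0.
rewrite /p coef_sum coef0 => E; rewrite -[RHS]E big_mkcond; apply: eq_big_seq => i iL.
rewrite coefZ coefXn; case: eqP => [->|dd]; first by rewrite eqxx mulr1.
case: eqP => [|_]; last by rewrite mulr0.
by have := HB.2 _ iL; have := HB.1; lia.
Qed.

(** Each entry of lambda but the last dominates the corresponding entry of nu, so equality of the
    sums forces equality of the entries. *)
Lemma interlace_last a t nu : List.In nu (interlace (a :: t)) ->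
  Z.le (Z.add (zsum nu) (last a t)) (zsum (a :: t)) /\
  (Z.add (zsum nu) (last a t) = zsum (a :: t) -> a :: t = rcons nu (last a t)).
Proof.
elim: t a nu => [|b t IH] a nu; first by case=> // <- /=; split=> //; lia.
rewrite interlace_cons => /List.in_flat_map[v [/List.in_map_iff[k [<- /List.in_seq kr]]]].
case/List.in_map_iff => nu' [<- /IH[le eq]] /=; rewrite /= in le eq.
split; first lia.
move=> E; have Ek : a = Z.add b (Z.of_nat k) by lia.
by rewrite -Ek; congr (_ :: _); apply: eq; lia.
Qed.

Lemma zsum_belast a t : Z.add (zsum (belast a t)) (last a t) = zsum (a :: t).
Proof. by elim: t a => [|b t IH] a /=; [lia | rewrite -Z.add_assoc IH]. Qed.

Definition mult (L : seq (R * seq Z)) (mu : seq Z) : R := \sum_(p <- L | p.2 == mu) p.1.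

Lemma mult_notin L mu : mu \notin [seq p.2 | p <- L] -> mult L mu = 0.
Proof.
move=> muL; rewrite /mult big_seq_cond big1 // => p /andP[pL /eqP pmu].
by move: muL; rewrite -pmu map_f.
Qed.

Lemma mult_expand (A : comNzRingType) (io : {rmorphism R -> A}) L (F : seq Z -> A) :
  \sum_(p <- L) io p.1 * F p.2 =
  \sum_(mu <- undup [seq p.2 | p <- L]) io (mult L mu) * F mu.
Proof.
transitivity (\sum_(mu <- undup [seq p.2 | p <- L])
    \sum_(p <- L) (if p.2 == mu then io p.1 * F p.2 else 0)).
  rewrite exchange_big /=; apply: eq_big_seq => p pL.
  rewrite (eq_bigr (fun mu => if mu == p.2 then io p.1 * F p.2 else 0)); last first.
    by move=> mu _; rewrite eq_sym.
  rewrite (sum_if_eq _ _ (fun=> io p.1 * F p.2)) count_uniq_mem ?undup_uniq //.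
  by rewrite mem_undup map_f // mul1r.
apply: eq_bigr => mu _; rewrite /mult rmorph_sum mulr_suml [RHS]big_mkcond.
by apply: eq_bigr => p _; case: eqP => [->|].
Qed.

Local Lemma Zadd_eq_of_sub_eq (n l l' s s' : Z) : Z.add n l = s -> Z.sub s' n = Z.sub s n ->
  l' = l -> Z.add n l' = s'.
Proof. lia. Qed.

Local Lemma Zlt_of_partial_sums (n l l' s s' b : Z) (k : nat) : Z.le (Z.add n l') s' -> Z.add n l = s ->
  Z.sub s' n = Z.sub s n -> l' <> l -> Z.lt (Z.add l b) (Z.of_nat k.+1) ->
  Z.lt (Z.add l' b) (Z.of_nat k).
Proof. lia. Qed.

(** Linear independence, by induction on the number of variables. The powers of the split-off
    variable separate the terms by |lambda| - |nu|, the induction hypothesis separates them by nu.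
    The resulting linear system is triangular in the last entry of lambda. *)
Lemma schur_indep M (L : seq (R * seq Z)) :
  (forall p, p \in L -> Zdecr p.2 /\ size p.2 = M) ->
  (forall xs, size xs = M -> (forall x, List.In x xs -> 0 < x) ->
     \sum_(p <- L) p.1 * schur_rev xs p.2 = 0) ->
  forall mu, mult L mu = 0.
Proof.
elim: M L => [|M IH] L LM H mu.
  case: (eqVneq mu [::]) => [->|mu0]; last first.
    apply: mult_notin; apply/negP => /mapP[p /LM[_ /size0nil pm] pmu].
    by rewrite pmu pm eqxx in mu0.
  rewrite -(H [::]) // /mult big_mkcond; apply: eq_big_seq => p /LM[_ /size0nil ->].
  by rewrite eqxx /= mulr1.
have H2 nu d0 : \sum_(p <- L | Z.sub (zsum p.2) (zsum nu) == d0)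
    p.1 * (count_mem nu (interlace p.2))%:R = 0.
  apply: (powerRZ_indep (c := fun p => p.1 * (count_mem nu (interlace p.2))%:R)
    (d := fun p : R * seq Z => Z.sub (zsum p.2) (zsum nu))) => x x0.
  pose L' := [seq (p.1 * powerRZ x (Z.sub (zsum p.2) (zsum v)), v) | p <- L, v <- interlace p.2].
  rewrite -[RHS](IH L' _ _ nu).
  - rewrite [RHS]/mult [RHS]big_mkcond /L' [RHS]big_allpairs_dep; apply: eq_bigr => p _ /=.
    rewrite (sum_if_eq _ _ (fun v => p.1 * powerRZ x (Z.sub (zsum p.2) (zsum v)))).
    by rewrite -mulrA mulrCA.
  - move=> q /allpairsPdep[p [v [/LM[pd ps] /InP vI ->]]] /=.
    by split; [apply: (Zdecr_interlace pd vI).1 | rewrite (size_interlace vI) ps].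
  - move=> xs xsM xs0; rewrite -[RHS](H (x :: xs)); last 2 first.
    + by rewrite /= xsM.
    + by move=> y [<-|/xs0].
    rewrite /L' big_allpairs_dep; apply: eq_bigr => p _.
    by rewrite schur_rev_cons mulr_sumr; apply: eq_bigr => v _; rewrite mulrA.
(* A lower bound for the last entries, from which the triangular induction starts. *)
have [B HB] : exists B : Z, forall p, p \in L -> Z.le 0 (Z.add (last Z0 p.2) B).
  elim: L {LM H H2} => [|p L [B BL]]; first by exists Z0.
  exists (Z.add (Z.abs B) (Z.abs (last Z0 p.2))) => q; rewrite in_cons => /orP[/eqP ->|/BL].
    by move: (last Z0 p.2) => z; lia.
  by move: (last Z0 q.2) (last Z0 p.2) => z w; lia.
(* Take nu to be mu without its last entry. Any other signature of the same size above nu has a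
   strictly smaller last entry, so its coefficient already vanishes and the equation for nu isolates
   that of mu. *)
have main n : forall mu, Z.lt (Z.add (last Z0 mu) B) (Z.of_nat n) -> mult L mu = 0.
  elim: n => [|n IHn] {}mu mun.
    by apply: mult_notin; apply/negP => /mapP[p /HB pB pmu]; move: pB mun; rewrite pmu; move: (last Z0 p.2) => z; lia.
  have [muL|/mult_notin //] := boolP (mu \in [seq p.2 | p <- L]).
  have [mud mus] : Zdecr mu /\ size mu = M.+1 by case/mapP: muL => p /LM ? ->.
  case: mu mud mus muL mun => // a t mud mus muL mun.
  have /InP bin := belast_interlace mud; set nu := belast a t in bin.
  pose F mu' : R := if Z.sub (zsum mu') (zsum nu) == Z.sub (zsum (a :: t)) (zsum nu)
     then (count_mem nu (interlace mu'))%:R else 0.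
  have := mult_expand idfun L F.
  rewrite (bigD1_seq (a :: t)) ?undup_uniq ?mem_undup //= [X in _ = _ + X]big1_seq ?addr0; last first.
    move=> mu' /andP[mu'n]; rewrite mem_undup => mu'L; rewrite /F.
    case: eqP => [Es|_]; last by rewrite mulr0.
    have [/InP nuI|nuI] := boolP (nu \in interlace mu'); last first.
      by rewrite (count_memPn nuI) mulr0.
    rewrite IHn ?mul0r //.
    case: mu' mu'n {mu'L} Es nuI => [|a' t'] mu'n Es; first by move=> nuI; case: (nuI : False).
    move=> /interlace_last[le eq]; have zb := zsum_belast a t; rewrite -/nu in zb.
    have lneq : last a' t' <> last a t.
      move=> ll; move/eqP: mu'n; apply; rewrite eq; last exact: (Zadd_eq_of_sub_eq zb Es ll).
      by rewrite ll /nu -lastI.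
    exact: (Zlt_of_partial_sums le zb Es lneq mun).
  rewrite /F eqxx /= => E.
  have : mult L (a :: t) * (count_mem nu (interlace (a :: t)))%:R = 0.
    rewrite -E -[RHS](H2 nu (Z.sub (zsum (a :: t)) (zsum nu))) [RHS]big_mkcond /=.
    by apply: eq_bigr => p _; case: ifP => _ //; rewrite mulr0.
  move/eqP; rewrite mulf_eq0 => /orP[/eqP //|]; rewrite pnatr_eq0.
  by rewrite -leqn0 leqNgt -has_count has_pred1 bin.
apply: (main (Z.to_nat (Z.add (Z.add (last Z0 mu) B) 1))).
by move: (last Z0 mu) => z; lia.
Qed.

(** Branching expands the restricted Schur function over the chains below [lam], the generating
    function over the measure. Independence makes rho(mu) / s_mu(1^M) the number of chains from lam
    to mu divided by s_lam(1^N); in [det_chains] the dimension factors then cancel. *)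
Lemma exact_formula (A : comNzRingType) (io : {rmorphism R -> A}) N n M lam S rho
    (post : seq ({poly R} -> A)) :
  is_sig N lam -> N = (M + n)%N -> SGF_restriction N M lam S rho ->
  (forall phi, List.In phi post -> linf io phi) ->
  \sum_(mu <- S) io (rho mu) *
    \det (\matrix_(i < size post, j < size post)
       nth (fun=> 0) post i ('X^j * rootpoly (pts IZR mu))) =
  io (\prod_(k < n) \prod_(i < size post) (M + k + i.+1)%:R)^-1 *
    \det (\matrix_(i < size post, j < size post)
       nth (fun=> 0) post i (iter n (@fdiff R) ('X^j * rootpoly (pts IZR lam)))).
Proof.
move=> lamN NMn [_ [Ssig [_ [_ HS]]]] lp.
have [lamd lams] := is_sig_Zdecr lamN.
have ptS z : IZR (Z.add z (Zpos xH)) = IZR z + 1 by rewrite plus_IZR.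
have Sd mu : mu \in S -> Zdecr mu /\ size mu = M by move=> /InP/Ssig/is_sig_Zdecr.
have wE l : Zdecr l -> wdet IZR l = chain_const R 0 (size l) 0 * schur l (List.repeat 1 (size l)).
  by move=> ld; rewrite schur_ones // (wdet_count ptS ld).
set sl := schur lam (List.repeat 1 N).
have sl0 : sl != 0.
  by have := wdet_neq0 ptS lamd; rewrite wE // mulf_eq0 lams => /norP[].
(* The formal difference of the two expansions; all its multiplicities vanish. *)
pose L := [seq (sl^-1, mu) | mu <- chains n lam] ++
  [seq (- (rho mu / schur mu (List.repeat 1 M)), mu) | mu <- S].
have Lmult : forall mu, mult L mu = 0.
  apply: (@schur_indep M).
    move=> p; rewrite mem_cat => /orP[/mapP[mu /InP/In_chains muc ->]|/mapP[mu /Sd ? ->]] //=.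
    by have [||mud ->] := muc; rewrite ?lams ?NMn ?addnK ?leq_addl.
  move=> xs xsM xs0; rewrite big_cat !big_map /=; apply/eqP; rewrite addr_eq0; apply/eqP.
  have := HS (List.rev xs); rewrite List.length_rev => /(_ xsM).
  have rp (x : R) : List.In x (List.rev xs) -> Rlt (IZR 0) x.
    by move=> /(proj2 (List.in_rev xs x)) xx; apply/RltP; apply: xs0.
  move=> /(_ rp).
  rewrite /Ex fold_right_Rplus /schur List.rev_app_distr List.rev_involutive List.rev_repeat.
  rewrite NMn addKn schur_rev_ones -NMn -/(schur lam _) -/sl.
  rewrite -mulr_sumr mulrC -[_ / _]/(Rdiv _ _) => ->.
  rewrite -sumrN; apply: eq_bigr => mu _; rewrite mulNr opprK.
  by rewrite RdivE RmultE mulrA mulrAC.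
pose D mu := \det (\matrix_(i < size post, j < size post)
  nth (fun=> 0) post i ('X^j * rootpoly (pts IZR mu))).
have := mult_expand io L (fun mu => io (wdet IZR mu) * D mu).
rewrite [RHS]big1; last by move=> mu _; rewrite Lmult rmorph0 mul0r.
rewrite big_cat !big_map /= => /eqP; rewrite addr_eq0 -mulr_sumr.
have := @det_chains R A io IZR ptS M n lam post lamd; rewrite lams => /(_ NMn lp).
rewrite -/(D _) (chain_const_rmorph io) => E /eqP E2.
have cc0 := chain_const_neq0 R.
have S1 : \sum_(mu <- S) io (rho mu) * D mu =
   io (chain_const R 0 M 0)^-1 * \sum_(mu <- S)
     io (rho mu / schur mu (List.repeat 1 M)) * (io (wdet IZR mu) * D mu).
  rewrite mulr_sumr; apply: eq_big_seq => mu /Sd[mud mus].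
  rewrite !mulrA -!rmorphM; congr (io _ * _).
  have := wdet_neq0 ptS mud; rewrite wE // mulf_eq0 mus => /norP[_ s0].
  by have c0 := cc0 0%N M 0%N; field; rewrite s0 c0.
rewrite [LHS]S1 -[X in _ * X]opprK -sumrN.
rewrite (eq_bigr (fun mu => io (- (rho mu / schur mu (List.repeat 1 M))) *
   (io (wdet IZR mu) * D mu))); last by move=> mu _; rewrite rmorphN mulNr.
rewrite -E2; clear E2 S1.
have -> : \sum_(mu <- chains n lam) io (wdet IZR mu) * D mu =
    io (chain_const R M n (size post))^-1 *
    (io (wdet IZR lam) * \det (\matrix_(i < size post, j < size post)
       nth (fun=> 0) post i (iter n (@fdiff R) ('X^j * rootpoly (pts IZR lam))))).
  by rewrite -E mulrA -rmorphM mulVf // rmorph1 mul1r.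
rewrite !mulrA -!rmorphM; congr (io _ * _).
rewrite wE // lams -/sl NMn chain_const_split (chain_const_ratio _ M n (size post)).
have p0 : \prod_(k < n) \prod_(i < size post) ((M + k + i.+1)%:R : R) != 0.
  by apply/prodf_neq0 => k _; apply/prodf_neq0 => i _; rewrite pnatr_eq0 addnS.
by field; rewrite !cc0 p0 sl0.
Qed.

End SchurIdentification.

(** * One-variable asymptotics *)

Module GrowthFamilies.
Import structures.
Import all_boot all_order all_algebra.
Import boolp functions reals sequences exp.
Import ring lra zify.
Import PowerSeries.
Set Implicit Arguments.
Unset Strict Implicit.
Unset Printing Implicit Defensive.
Import Order.TTheory GRing.Theory Num.Theory.
Local Open Scope ring_scope.

(** The m steps of size e cover a total time of at most 1, whence the factor exp c. *)
Lemma gronwall (K : realType) (a : nat -> K) (e c b : K) (m : nat) :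
  0 <= e -> 0 <= c -> 0 <= b -> m%:R * e <= 1 -> 0 <= a 0%N ->
  (forall n, (n < m)%N -> a n.+1 <= (1 + e * c) * a n + e * b) ->
  forall n, (n <= m)%N -> a n <= expR c * (a 0%N + b).
Proof.
move=> e0 c0 b0 me a0 H n nm.
have ec0 : 0 <= e * c by rewrite mulr_ge0.
have step k : (k <= m)%N -> a k <= (1 + e * c) ^+ k * (a 0%N + k%:R * e * b).
  elim: k => [|k IH] km; first by rewrite expr0 !mul0r addr0 mul1r.
  apply: le_trans (H k km) _.
  have ge1 : 1 <= (1 + e * c) ^+ k.+1 by rewrite exprn_ege1 // lerDl.
  apply: (@le_trans _ _ ((1 + e * c) * ((1 + e * c) ^+ k * (a 0%N + k%:R * e * b)) + e * b)).
    by rewrite lerD2r ler_wpM2l ?IH ?(ltnW km) // addr_ge0.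
  rewrite mulrA -exprS -[k.+1%:R]natr1 -subr_ge0.
  have -> : (1 + e * c) ^+ k.+1 * (a 0%N + (k%:R + 1) * e * b) -
     ((1 + e * c) ^+ k.+1 * (a 0%N + k%:R * e * b) + e * b) =
     ((1 + e * c) ^+ k.+1 - 1) * (e * b) by ring.
  by rewrite mulr_ge0 ?subr_ge0 // mulr_ge0.
apply: le_trans (step n nm) _.
have ne : n%:R * e <= 1 by apply: le_trans me; rewrite ler_wpM2r // ler_nat.
have p1 : (1 + e * c) ^+ n <= expR c.
  apply: (@le_trans _ _ (expR (e * c) ^+ n)).
    by rewrite lerXn2r ?nnegrE ?expR_ge0 ?addr_ge0 // expR_ge1Dx.
  by rewrite -expRM_natl ler_expR mulrA -[leRHS]mul1r ler_wpM2r.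
have ne0 : 0 <= n%:R * e by rewrite mulr_ge0.
apply: ler_pM => //; first by rewrite exprn_ge0 // addr_ge0.
  by rewrite addr_ge0 // mulr_ge0.
by rewrite lerD2l -[leRHS]mul1r ler_wpM2r.
Qed.

Section Families.
Variables (K : realType) (e : nat -> K).
Hypothesis e_ge0 : forall N, 0 <= e N.
Hypothesis e_le1 : forall N, e N <= 1.
Notation fam := (nat -> nat -> fps K).
Implicit Types (u w : fam) (d : nat -> nat -> Prop) (p q k : nat).

(* Coefficientwise [u = O(e ^ p)], uniformly over the pairs (N, n) in [d]. *)
Definition bigO d p u := forall k, exists C : K, forall N n, d N n -> `|u N n k| <= C * e N ^+ p.

Lemma bigO_bound d p u : bigO d p u ->
  exists2 C : nat -> K, (forall k, 0 <= C k) &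
    forall k N n, d N n -> `|u N n k| <= C k * e N ^+ p.
Proof.
move=> /choice[C HC]; exists (fun k => `|C k|) => // k N n dN.
by apply: le_trans (HC k N n dN) _; rewrite ler_wpM2r ?exprn_ge0 // ler_norm.
Qed.

Lemma bigO_ext d p u w : (forall N n, d N n -> u N n = w N n) -> bigO d p u -> bigO d p w.
Proof. by move=> uw uO k; have [C HC] := uO k; exists C => N n dN; rewrite -uw ?HC. Qed.

Lemma bigO_sub d d' p u : (forall N n, d' N n -> d N n) -> bigO d p u -> bigO d' p u.
Proof. by move=> dd uO k; have [C HC] := uO k; exists C => N n /dd; apply: HC. Qed.

Lemma bigO_shift d d' p u : (forall N n, d' N n -> d N n.+1) -> bigO d p u ->
  bigO d' p (fun N n => u N n.+1).
Proof. by move=> dd uO k; have [C HC] := uO k; exists C => N n /dd; apply: HC. Qed.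

Lemma bigO_le d p q u : (q <= p)%N -> bigO d p u -> bigO d q u.
Proof.
move=> qp /bigO_bound[C C0 HC] k; exists (C k) => N n dN.
by apply: le_trans (HC _ _ _ dN) _; rewrite ler_wpM2l // ler_wiXn2l.
Qed.

Lemma bigOD d p u w : bigO d p u -> bigO d p w -> bigO d p (fun N n => u N n + w N n).
Proof.
move=> uO wO k; have [C HC] := uO k; have [D HD] := wO k; exists (C + D) => N n dN.
by rewrite fpsDE mulrDl (le_trans (ler_normD _ _)) // lerD ?HC ?HD.
Qed.

Lemma bigON d p u : bigO d p u -> bigO d p (fun N n => - u N n).
Proof. by move=> uO k; have [C HC] := uO k; exists C => N n dN; rewrite fpsNE normrN HC. Qed.

Lemma bigOB d p u w : bigO d p u -> bigO d p w -> bigO d p (fun N n => u N n - w N n).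
Proof. by move=> uO /bigON; apply: bigOD. Qed.

Lemma bigOM d p q u w : bigO d p u -> bigO d q w ->
  bigO d (p + q) (fun N n => u N n * w N n).
Proof.
move=> /bigO_bound[C C0 HC] /bigO_bound[D D0 HD] k.
exists (\sum_(i < k.+1) C i * D (k - i)%N) => N n dN.
rewrite fpsME (le_trans (ler_norm_sum _ _ _)) // mulr_suml; apply: ler_sum => i _.
by rewrite normrM exprD mulrACA ler_pM ?HC ?HD.
Qed.

Lemma bigOM0 d p u w : bigO d 0 u -> bigO d p w -> bigO d p (fun N n => u N n * w N n).
Proof. by move=> uO wO; apply: (bigOM uO wO). Qed.

Lemma bigOM0r d p u w : bigO d p u -> bigO d 0 w -> bigO d p (fun N n => u N n * w N n).
Proof. by move=> uO wO; have := bigOM uO wO; rewrite addn0. Qed.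

Lemma bigO_cst d (f : fps K) : bigO d 0 (fun _ _ => f).
Proof. by move=> k; exists `|f k| => N n _; rewrite expr0 mulr1. Qed.

Lemma bigO_C d p (c : nat -> nat -> K) (C : K) :
  (forall N n, d N n -> `|c N n| <= C * e N ^+ p) -> bigO d p (fun N n => fpsC (c N n)).
Proof.
move=> HC [|k]; first by exists C.
by exists 0 => N n _; rewrite normr0 mul0r.
Qed.

Lemma bigO_e d p : bigO d p (fun N _ => fpsC (e N ^+ p)).
Proof. by apply: (bigO_C (C := 1)) => N n _; rewrite mul1r ger0_norm // exprn_ge0. Qed.

Lemma bigO_eM d p q u : bigO d q u -> bigO d (p + q) (fun N n => fpsC (e N ^+ p) * u N n).
Proof. by move=> uO; apply: bigOM uO; apply: bigO_e. Qed.

Lemma bigO_X d p u k : bigO d p u -> bigO d (p * k) (fun N n => u N n ^+ k).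
Proof.
move=> uO; elim: k => [|k IH]; first by rewrite muln0; apply: bigO_cst.
rewrite mulnS; apply: bigO_ext (bigOM uO IH) => N n _.
by rewrite exprS.
Qed.

Lemma bigO_X0 d u k : bigO d 0 u -> bigO d 0 (fun N n => u N n ^+ k).
Proof. by move=> uO; have := bigO_X k uO; rewrite mul0n. Qed.

Lemma bigO_theta d p u : bigO d p u -> bigO d p (fun N n => fps_theta (u N n)).
Proof.
move=> uO k; have [C HC] := uO k; exists (k%:R * C) => N n dN.
by rewrite /fps_theta normrM normr_nat -mulrA ler_wpM2l ?HC.
Qed.

Lemma bigO_sum d p (m : nat) (F : nat -> fam) : (forall i, (i < m)%N -> bigO d p (F i)) ->
  bigO d p (fun N n => \sum_(i < m) F i N n).
Proof.
elim: m => [|m IH] HF.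
  by move=> k; exists 0 => N n _; rewrite big_ord0 normr0 mul0r.
apply: bigO_ext (bigOD (IH _) (HF m (ltnSn m))) => [N n _|i im]; first by rewrite big_ord_recr.
by apply: HF; apply: leqW.
Qed.

(** Each coefficient of the inverse is a finite convolution with earlier ones, so the bounds follow
    by strong induction on the index. *)
Lemma bigO_inv d u : bigO d 0 u -> bigO d 0 (fun N n => fps_inv (u N n)).
Proof.
move=> /bigO_bound[C C0 HC].
elim/ltn_ind => -[|k] IH; first by exists 1 => N n _; rewrite fps_inv0 normr1 expr0 mulr1.
have [D HD] : exists D : nat -> K, forall i, (i < k.+1)%N -> forall N n, d N n ->
    `|fps_inv (u N n) i| <= D i.
  have : forall i, exists D, (i < k.+1)%N -> forall N n, d N n -> `|fps_inv (u N n) i| <= D.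
    move=> i; have [ik|ik] := ltnP i k.+1; last by exists 0.
    by have [D HD] := IH i ik; exists D => _ N n dN; have := HD N n dN; rewrite expr0 mulr1.
  by move=> /choice[D HD]; exists D.
exists (\sum_(i < k.+1) C (k.+1 - i)%N * D i) => N n dN.
rewrite fps_invS normrN expr0 mulr1 (le_trans (ler_norm_sum _ _ _)) //; apply: ler_sum => i _.
by rewrite normrM ler_pM ?HD //; have := HC (k.+1 - i)%N N n dN; rewrite expr0 mulr1.
Qed.

(** Inverse for an arbitrary nonzero constant term, which is first normalized to 1 because [fps_inv]
    expects it. *)
Definition fps_vinv (f : fps K) : fps K := fpsC (f 0%N)^-1 * fps_inv (fpsC (f 0%N)^-1 * f).

Lemma fps_mul_vinv (f : fps K) : f 0%N != 0 -> f * fps_vinv f = 1.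
Proof.
move=> f0; have f1 : (fpsC (f 0%N)^-1 * f) 0%N = 1 by rewrite fpsCM mulVf.
by rewrite /fps_vinv mulrA [f * _]mulrC fps_mulV.
Qed.

Lemma fps_vinv0 (f : fps K) : fps_vinv f 0%N = (f 0%N)^-1.
Proof. by rewrite /fps_vinv fpsCM fps_inv0 mulr1. Qed.

Lemma bigO_vinv d u (c : K) : 0 < c -> (forall N n, d N n -> c <= u N n 0%N) -> bigO d 0 u ->
  bigO d 0 (fun N n => fps_vinv (u N n)).
Proof.
move=> c0 cu uO.
have cO : bigO d 0 (fun N n => fpsC (u N n 0%N)^-1).
  apply: (bigO_C (C := c^-1)) => N n dN; have cu' := cu N n dN.
  rewrite expr0 mulr1 normrV ?unitfE ?gt_eqF //; last exact: lt_le_trans cu'.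
  by rewrite lef_pV2 ?posrE ?(le_trans cu') ?ler_norm // (lt_le_trans c0) // (le_trans cu') // ler_norm.
by apply: bigOM0 => //; apply: bigO_inv; apply: bigOM0.
Qed.

(** Coefficientwise convergence to 0 without a rate: the initial data of the transport equation are
    only known to converge. *)
Definition littleo d u := forall k (c : K), 0 < c ->
  exists N0, forall N n, (N0 <= N)%N -> d N n -> `|u N n k| <= c.

Hypothesis e_to0 : forall c : K, 0 < c -> exists N0, forall N, (N0 <= N)%N -> e N <= c.

Lemma bigO1_littleo d u : bigO d 1 u -> littleo d u.
Proof.
move=> /bigO_bound[C C0 HC] k c c0.
have [|N0 HN] := e_to0 (c := c / (C k + 1)); first by rewrite divr_gt0 // ltr_wpDl.
exists N0 => N n /HN eN dN; apply: le_trans (HC k N n dN) _; rewrite expr1.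
apply: (@le_trans _ _ ((C k + 1) * e N)); first by rewrite ler_wpM2r // lerDl.
by rewrite mulrC -ler_pdivlMr // ltr_wpDl.
Qed.

Lemma littleo_ext d u w : (forall N n, d N n -> u N n = w N n) -> littleo d u -> littleo d w.
Proof.
move=> uw uo k c c0; have [N0 H] := uo k c c0; exists N0 => N n nN dN.
by rewrite -uw ?H.
Qed.

Lemma littleo_sub d d' u : (forall N n, d' N n -> d N n) -> littleo d u -> littleo d' u.
Proof.
by move=> dd uo k c c0; have [N0 H] := uo k c c0; exists N0 => N n nN /dd; apply: H.
Qed.

Lemma littleoD d u w : littleo d u -> littleo d w -> littleo d (fun N n => u N n + w N n).
Proof.
move=> uo wo k c c0; have c2 : 0 < c / 2 by rewrite divr_gt0.
have [N1 H1] := uo k _ c2; have [N2 H2] := wo k _ c2.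
exists (maxn N1 N2) => N n; rewrite geq_max => /andP[n1 n2] dN.
rewrite fpsDE (le_trans (ler_normD _ _)) // (le_trans (lerD (H1 _ _ n1 dN) (H2 _ _ n2 dN))) //.
lra.
Qed.

Lemma littleoN d u : littleo d u -> littleo d (fun N n => - u N n).
Proof.
move=> uo k c c0; have [N0 H] := uo k c c0; exists N0 => N n nN dN.
by rewrite fpsNE normrN H.
Qed.

Lemma littleoB d u w : littleo d u -> littleo d w -> littleo d (fun N n => u N n - w N n).
Proof. by move=> uo /littleoN; apply: littleoD. Qed.

Lemma littleo_sum_scalar d (m : nat) (F : nat -> nat -> nat -> K) (C : nat -> K) u :
  littleo d u -> (forall i N n, d N n -> `|F i N n| <= C i) ->
  forall c : K, 0 < c -> exists N0, forall N n, (N0 <= N)%N -> d N n ->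
    `|\sum_(i < m) F i N n * u N n i| <= c.
Proof.
move=> uo HF; elim: m => [|m IH] c c0.
  by exists 0%N => N n _ _; rewrite big_ord0 normr0 ltW.
have c2 : 0 < c / 2 by rewrite divr_gt0.
have [N1 H1] := IH _ c2.
have [|N2 H2] := uo m (c / 2 / (`|C m| + 1)); first by rewrite divr_gt0 // ltr_wpDl.
exists (maxn N1 N2) => N n; rewrite geq_max => /andP[n1 n2] dN; rewrite big_ord_recr /=.
apply: le_trans (ler_normD _ _) _; rewrite [c in _ <= c](_ : _ = c / 2 + c / 2); last by field.
apply: lerD; first exact: H1.
rewrite normrM; apply: (@le_trans _ _ ((`|C m| + 1) * (c / 2 / (`|C m| + 1)))).
  apply: ler_pM => //; last exact: H2.
  by apply: le_trans (HF _ _ _ dN) _; rewrite (le_trans (ler_norm _)) // lerDl.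
by rewrite mulrCA divff ?mulr1 // gt_eqF // ltr_wpDl.
Qed.

Lemma littleoM d u w : bigO d 0 w -> littleo d u -> littleo d (fun N n => w N n * u N n).
Proof.
move=> /bigO_bound[C C0 HC] uo k c c0.
have [|N0 H] := @littleo_sum_scalar d k.+1 (fun i N n => w N n (k - i)%N)
    (fun i => C (k - i)%N) u uo _ c c0.
  by move=> i N n dN; have := HC (k - i)%N N n dN; rewrite expr0 mulr1.
by exists N0 => N n nN dN; rewrite fpsME_rev; apply: H.
Qed.

Lemma littleo_comp d u (b : fps K) : littleo d u -> littleo d (fun N n => fps_comp b (u N n)).
Proof.
move=> uo k c c0.
have [|N0 H] := @littleo_sum_scalar d k.+1 (fun i N n => (b ^+ i) k)
    (fun i => `|(b ^+ i) k|) u uo _ c c0 => //.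
exists N0 => N n nN dN; rewrite /fps_comp.
by under eq_bigr do rewrite mulrC; apply: H.
Qed.

Lemma littleo_XK d u : littleo d (fun N n => fpsX K * u N n) -> littleo d u.
Proof.
move=> uo k c c0; have [N0 H] := uo k.+1 c c0; exists N0 => N n nN dN.
by have := H N n nN dN; rewrite fpsXM.
Qed.

Lemma bigO_comp d u (b : fps K) : bigO d 0 u -> bigO d 0 (fun N n => fps_comp b (u N n)).
Proof.
move=> /bigO_bound[C C0 HC] k; exists (\sum_(i < k.+1) C i * `|(b ^+ i) k|) => N n dN.
rewrite expr0 mulr1 /fps_comp (le_trans (ler_norm_sum _ _ _)) //; apply: ler_sum => i _.
by rewrite normrM ler_wpM2r //; have := HC i N n dN; rewrite expr0 mulr1.
Qed.

End Families.

End GrowthFamilies.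

(** * The discrete transport equation *)

Module Transport.
Import structures.
Import all_boot all_order all_algebra.
Import boolp functions reals sequences exp.
Import ring lra zify.
Import PowerSeries GrowthFamilies.
Set Implicit Arguments.
Unset Strict Implicit.
Unset Printing Implicit Defensive.
Import Order.TTheory GRing.Theory Num.Theory.
Local Open Scope ring_scope.

Section ShiftDerivative.
Variable K : realType.
Implicit Types (c : K) (f : fps K).

Definition fps_i1 c : fps K := fps_inv (1 + fpsC c * fpsX K).

Lemma fps_i1M c : (1 + fpsC c * fpsX K) * fps_i1 c = 1.
Proof. by apply: fps_mulV; rewrite fpsDE fpsCM mulr0 addr0. Qed.

(** The quotient of 1 - (1 + c x)^-(k+1) by c x, written as a geometric sum so that no division by c
    occurs. *)
Definition fps_dser c (k : nat) : fps K := \sum_(j < k.+1) fps_i1 c ^+ j.+1.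

(* With z = 1/x, the shift z -> z + c maps x^k to x^k (1+cx)^-k, and
   x c D f = f - (1 + c x)^-1 (shift of f). *)
Definition fps_D c f : fps K := fun m => \sum_(k < m.+1) f k * fps_dser c k (m - k)%N.

Lemma fps_i1_0 c : fps_i1 c 0%N = 1.
Proof. by []. Qed.

Lemma fps_i1E c : fpsC c * fpsX K * fps_i1 c = 1 - fps_i1 c.
Proof. by rewrite -[1 in RHS](fps_i1M c); ring. Qed.

Lemma fps_dser_telescope c k :
  fpsC c * fpsX K * fps_dser c k = 1 - fps_i1 c ^+ k.+1.
Proof.
rewrite /fps_dser; elim: k => [|k IH]; first by rewrite big_ord1 expr1 fps_i1E.
rewrite big_ord_recr /= mulrDr IH [fps_i1 c ^+ k.+2]exprS mulrA fps_i1E; ring.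
Qed.

(** With z = 1/x this is the shift of z by c, that is, x becomes x / (1 + c x). *)
Definition fps_sigma c f := fps_comp (fpsX K * fps_i1 c) f.

Lemma fps_sigmaE c f m :
  fps_sigma c f m = \sum_(k < m.+1) f k * (fps_i1 c ^+ k) (m - k)%N.
Proof.
rewrite /fps_sigma /fps_comp; apply: eq_bigr => k _.
by rewrite exprMn fpsXnM -ltnS ltn_ord.
Qed.

Lemma fps_DE c f : fpsC c * fpsX K * fps_D c f = f - fps_i1 c * fps_sigma c f.
Proof.
have E : fps_i1 c * fps_sigma c f = fun m => \sum_(k < m.+1) f k * (fps_i1 c ^+ k.+1) (m - k)%N.
  apply/fpsP => m.
  transitivity ((fps_i1 c * \sum_(k < m.+1) fpsC (f k) * (fpsX K * fps_i1 c) ^+ k) m).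
    rewrite !fpsME; apply: eq_bigr => i _; congr (_ * _).
    by apply: fps_comp_poly; rewrite ?leq_subr // fpsXM.
  rewrite mulr_sumr fps_sumE; apply: eq_bigr => k _.
  rewrite mulrCA fpsCM exprMn mulrCA -exprS fpsXnM.
  by rewrite -ltnS ltn_ord.
rewrite E; apply/fpsP => m; rewrite -mulrA fpsCM fpsXM fpsBE.
case: m => [|m]; first by rewrite big_ord1 subnn mulr0 expr1 fps_i1_0 mulr1 subrr.
rewrite [in RHS]big_ord_recr /= subnn.
have -> : (fps_i1 c ^+ m.+2) 0%N = 1.
  by elim: m.+2 => [//|q IH]; rewrite exprS fpsM0 IH fps_i1_0 mulr1.
rewrite mulr1 opprD addrCA subrr addr0 /fps_D mulr_sumr -sumrN.
apply: eq_bigr => -[k /= km] _.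
have := congr1 (fun g => g (m.+1 - k)%N) (fps_dser_telescope c k).
rewrite -mulrA fpsCM fpsXM fpsBE fps1E subSn //= => E'.
by rewrite mulrCA E' sub0r mulrN.
Qed.

End ShiftDerivative.

Section Transport.
Variables (K : realType) (e : nat -> K).
Hypothesis e_ge0 : forall N, 0 <= e N.
Hypothesis e_le1 : forall N, e N <= 1.
Hypothesis e_to0 : forall c : K, 0 < c -> exists N0, forall N, (N0 <= N)%N -> e N <= c.
Notation fam := (nat -> nat -> fps K).
Notation X := (fpsX K).
Notation C := (@fpsC K).
Notation bigO := (bigO e).

Lemma bigO_i1 d : bigO d 0 (fun N _ => fps_i1 (e N)).
Proof.
apply: (@bigO_inv _ e) => //; apply: bigOD; first exact: bigO_cst.
apply: bigOM0r => //; last exact: bigO_cst.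
by apply: (bigO_C (C := 1)) => N n _; rewrite expr0 mulr1 ger0_norm.
Qed.

Lemma bigO_i1X d j : bigO d 1 (fun N _ => fps_i1 (e N) ^+ j - 1).
Proof.
elim: j => [|j IH].
  by move=> k; exists 0 => N n _; rewrite expr0 subrr normr0 mul0r.
have -> : (fun N _ => fps_i1 (e N) ^+ j.+1 - 1) =
    (fun N (_ : nat) => fps_i1 (e N) * (fps_i1 (e N) ^+ j - 1)
      + (- (C (e N ^+ 1) * (X * fps_i1 (e N))))) :> fam.
  apply/funext => N; apply/funext => n; rewrite exprS expr1.
  by rewrite -[in RHS]mulrN mulrBr mulr1 -addrA; congr (_ + _); rewrite -{1}(fps_i1M (e N)); ring.
apply: bigOD; first by apply: bigOM0 => //; exact: bigO_i1.
apply: bigON; apply: (bigO_eM e_ge0 1 (q := 0)); apply: bigOM0 => //.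
  exact: bigO_cst.
exact: bigO_i1.
Qed.

(** Each of the k + 1 summands of [fps_dser] is 1 + O(e), so in the limit D multiplies the
    coefficient of degree k by k + 1. *)
Lemma bigO_D d u : bigO d 0 u -> bigO d 0 (fun N n => fps_D (e N) (u N n)) /\
  bigO d 1 (fun N n => fps_D (e N) (u N n) - (u N n + fps_theta (u N n))).
Proof.
move=> uO; have dO k : bigO d 1 (fun N _ => fps_dser (e N) k - k.+1%:R).
  have -> : (fun N _ => fps_dser (e N) k - k.+1%:R) =
     (fun N _ => \sum_(j < k.+1) (fps_i1 (e N) ^+ j.+1 - 1)) :> fam.
    apply/funext => N; apply/funext => n; rewrite sumrB; congr (_ - _).
    by rewrite sumr_const card_ord.
  by apply: (@bigO_sum _ _ _ _ _ (fun j N _ => fps_i1 (e N) ^+ j.+1 - 1)) => // i _; apply: bigO_i1X.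
have H2 : bigO d 1 (fun N n => fps_D (e N) (u N n) - (u N n + fps_theta (u N n))).
  move=> k; have [C1 C10 HC1] := bigO_bound e_ge0 uO.
  have /choice[F HF] : forall i, exists F : nat -> K, (forall j, 0 <= F j) /\
     forall j N n, d N n -> `|(fps_dser (e N) i - i.+1%:R) j| <= F j * e N ^+ 1.
    by move=> i; have [F F0 HF] := bigO_bound e_ge0 (dO i); exists F.
  exists (\sum_(i < k.+1) C1 i * F i (k - i)%N) => N n dN.
  have -> : (fps_D (e N) (u N n) - (u N n + fps_theta (u N n))) k =
    \sum_(i < k.+1) u N n i * (fps_dser (e N) i - i.+1%:R) (k - i)%N.
    rewrite fpsBE fpsDE /fps_theta /fps_D.
    under [RHS]eq_bigr do rewrite fpsBE mulrBr.
    rewrite sumrB; congr (_ - _); rewrite big_ord_recr /= big1 ?add0r; last first.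
      move=> [i /= ik] _; rewrite -[X in X%:R]/(i.+1) -(rmorph_nat C).
      by case E : (k - i)%N => [|m] /=; [lia | rewrite mulr0].
    by rewrite subnn -(rmorph_nat C) /= -natr1; ring.
  rewrite (le_trans (ler_norm_sum _ _ _)) // mulr_suml; apply: ler_sum => i _.
  have HFi := (HF i).2 (k - i)%N N n dN; rewrite normrM -mulrA; apply: ler_pM => //.
  by have := HC1 i N n dN; rewrite expr0 mulr1.
split=> //; have -> : (fun N n => fps_D (e N) (u N n)) =
   (fun N n => (fps_D (e N) (u N n) - (u N n + fps_theta (u N n))) + (u N n + fps_theta (u N n))) :> fam.
  by apply/funext => N; apply/funext => n; rewrite subrK.
apply: bigOD; first exact: bigO_le H2.
by apply: bigOD => //; apply: bigO_theta.
Qed.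

Variables (dom0 : nat -> nat -> Prop) (v : fam) (c0 : K).
Hypothesis c0_gt0 : 0 < c0.
Hypothesis dom0_down : forall N n, dom0 N n.+1 -> dom0 N n.
Hypothesis dom0_ne : forall N n, dom0 N n -> n%:R * e N <= 1.
Hypothesis v_const : forall N n, dom0 N n -> v N n 0%N = 1 - n%:R * e N.
Hypothesis v_lb : forall N n, dom0 N n -> c0 <= v N n 0%N.
(** In the application X v_n is W_n = Delta^(n+1) P / Delta^n P at u = N/x, and this is the identity
    W_n W_(n+1) = W_n^2 + (W_n(u+1) - W_n(u)) (1 + W_n) divided by X^2. *)
Hypothesis v_rec : forall N n, dom0 N n.+1 ->
  v N n * v N n.+1 = v N n ^+ 2 - C (e N) * fps_D (e N) (v N n) * (1 + X * v N n).
Hypothesis v_init : bigO (fun N n => n = 0%N /\ dom0 N 0%N) 0 v.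

Let dom1 N n := dom0 N n.+1.
Let iv : fam := fun N n => fps_vinv (v N n).
Let q : fam := fun N n => fps_D (e N) (v N n) * iv N n.
(** The speed of transport: the recursion reads v_(n+1) = v_n - e r D(v_n). *)
Let r : fam := fun N n => X + iv N n.

Lemma v_neq0 N n : dom0 N n -> v N n 0%N != 0.
Proof. by move=> /v_lb H; rewrite gt_eqF // (lt_le_trans c0_gt0). Qed.

Lemma vM_iv N n : dom0 N n -> v N n * iv N n = 1.
Proof. by move=> dN; apply: fps_mul_vinv; apply: v_neq0. Qed.

Lemma v_step N n : dom0 N n.+1 ->
  v N n.+1 = v N n - C (e N) * (X * fps_D (e N) (v N n) + q N n).
Proof.
move=> dN; have vi := vM_iv (dom0_down dN).
have -> : v N n.+1 = iv N n * (v N n * v N n.+1).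
  by rewrite mulrA [iv N n * _]mulrC vi mul1r.
rewrite v_rec // /q.
transitivity ((v N n * iv N n) * v N n -
   C (e N) * (iv N n * fps_D (e N) (v N n) + X * fps_D (e N) (v N n) * (v N n * iv N n))).
  by ring.
by rewrite vi; ring.
Qed.

(** Strong induction on the coefficient. Once the lower coefficients are bounded, those of index k+1
    of D(v) and of D(v)/v are bounded by an affine function of that of v, and the discrete Gronwall
    inequality closes the estimate. *)
Lemma v_bounded : bigO dom0 0 v.
Proof.
suff H k : exists B : K, forall N n, dom0 N n -> `|v N n k| <= B /\ `|q N n k| <= B.
  by move=> k; have [B HB] := H k; exists B => N n /HB[]; rewrite expr0 mulr1.
elim/ltn_ind: k => k IH.
have [B [B0 HB]] : exists B : nat -> K, (forall i, 0 <= B i) /\ forall i, (i < k)%N ->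
    forall N n, dom0 N n -> `|v N n i| <= B i /\ `|q N n i| <= B i.
  have : forall i, exists B, 0 <= B /\ ((i < k)%N -> forall N n, dom0 N n ->
      `|v N n i| <= B /\ `|q N n i| <= B).
    move=> i; have [ik|_] := ltnP i k; last by exists 0.
    have [B HB] := IH i ik; exists `|B|; split=> // _ N n /HB[h1 h2].
    by split; [apply: le_trans h1 _ | apply: le_trans h2 _]; apply: ler_norm.
  by move=> /choice[B HB]; exists B; split=> [i|i ik]; have [h1 h2] := HB i; [|apply: h2].
(* [D v] at order [m] involves only the coefficients of [v] of order at most [m] *)
have dsO i : bigO dom0 0 (fun N _ => fps_dser (e N) i).
  apply: (@bigO_sum _ _ _ _ _ (fun j N _ => fps_i1 (e N) ^+ j.+1)) => // j _.
  by apply: bigO_X0 => //; exact: bigO_i1.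
have /choice[F HF] : forall i, exists F : nat -> K, (forall j, 0 <= F j) /\
   forall j N n, dom0 N n -> `|fps_dser (e N) i j| <= F j.
  move=> i; have [F F0 HF] := bigO_bound e_ge0 (dsO i); exists F; split=> // j N n dN.
  by have := HF j N n dN; rewrite expr0 mulr1.
have Dlow m : (m < k)%N -> exists2 B1 : K, 0 <= B1 & forall N n, dom0 N n -> `|fps_D (e N) (v N n) m| <= B1.
  move=> mk; exists (\sum_(i < m.+1) B i * F i (m - i)%N).
    by apply: sumr_ge0 => i _; rewrite mulr_ge0 // (HF i).1.
  move=> N n dN; rewrite /fps_D (le_trans (ler_norm_sum _ _ _)) //; apply: ler_sum => i _.
  rewrite normrM ler_pM //; last exact: ((HF i).2 _ N n dN).
  by apply: (HB i _ N n dN).1; apply: leq_ltn_trans mk; rewrite -ltnS.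
have q0 N n : dom0 N n -> q N n 0%N = 1.
  move=> dN; rewrite /q fpsM0 /iv fps_vinv0 /fps_D big_ord1 subnn /fps_dser big_ord1 expr1.
  by rewrite fps_i1_0 mulr1 divff ?v_neq0.
case: k => [|k] in IH HB Dlow *.
  exists 1 => N n dN; split.
    have := v_lb dN; rewrite v_const // => vl.
    by rewrite ger0_norm ?(le_trans (ltW c0_gt0)) // gerBl mulr_ge0.
  by rewrite q0 // normr1.
have vq N n : dom0 N n -> v N n * q N n = fps_D (e N) (v N n).
  by move=> dN; rewrite /q mulrCA vM_iv // mulr1.
pose S := \sum_(i < k) B i.+1 * B (k - i)%N.
pose G := \sum_(i < k.+1) B i * F i (k.+1 - i)%N.
have S0 : 0 <= S by apply: sumr_ge0 => i _; rewrite mulr_ge0.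
have G0 : 0 <= G by apply: sumr_ge0 => i _; rewrite mulr_ge0 // (HF i).1.
have Dtop N n : dom0 N n -> `|fps_D (e N) (v N n) k.+1| <= G + `|v N n k.+1| * F k.+1 0%N.
  move=> dN; rewrite /fps_D big_ord_recr /= subnn (le_trans (ler_normD _ _)) //.
  apply: lerD; last by rewrite normrM ler_wpM2l //; exact: ((HF k.+1).2 0%N N n dN).
  rewrite (le_trans (ler_norm_sum _ _ _)) //; apply: ler_sum => i _.
  by rewrite normrM ler_pM //; [exact: (HB i _ N n dN).1 | exact: ((HF i).2 _ N n dN)].
(* Solve v q = D(v) for the top coefficient of q; the constant terms are v_0 >= c0 and q_0 = 1, and
   the middle terms are covered by the induction. *)
have qtop N n : dom0 N n ->
    `|q N n k.+1| <= c0^-1 * (G + S) + c0^-1 * (F k.+1 0%N + 1) * `|v N n k.+1|.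
  move=> dN; have := congr1 (fun g => g k.+1) (vq N n dN).
  rewrite /= fpsME big_ord_recl /= subn0 big_ord_recr /= subnn q0 // mulr1 => E.
  have vq0 : v N n 0%N * q N n k.+1 = fps_D (e N) (v N n) k.+1 - v N n k.+1
       - \sum_(i < k) v N n i.+1 * q N n (k - i)%N.
    rewrite -E; under eq_bigr => i _ do rewrite /bump /= add1n subSS.
    by rewrite /bump /= add1n; ring.
  have -> : c0^-1 * (G + S) + c0^-1 * (F k.+1 0%N + 1) * `|v N n k.+1| =
     (G + `|v N n k.+1| * F k.+1 0%N + `|v N n k.+1| + S) / c0 by ring.
  rewrite ler_pdivlMr // mulrC.
  apply: (@le_trans _ _ (`|v N n 0%N * q N n k.+1|)).
    by rewrite normrM ler_wpM2r // (le_trans (v_lb dN)) // ler_norm.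
  rewrite vq0 (le_trans (ler_normB _ _)) // lerD // ?(le_trans (ler_normB _ _)) // ?lerD // ?Dtop //.
  rewrite (le_trans (ler_norm_sum _ _ _)) //; apply: ler_sum => -[i /= ik] _.
  by rewrite normrM ler_pM //; [apply: (HB _ _ N n dN).1 | apply: (HB _ _ N n dN).2]; lia.
have [B1 B10 HB1] := Dlow k (ltnSn k).
have [I HI] := v_init k.+1.
pose c1 := c0^-1 * (F k.+1 0%N + 1); pose b1 := B1 + c0^-1 * (G + S).
have c10 : 0 <= c1 by rewrite mulr_ge0 ?invr_ge0 ?(ltW c0_gt0) // addr_ge0 // (HF k.+1).1.
have b10 : 0 <= b1 by rewrite addr_ge0 // mulr_ge0 ?invr_ge0 ?(ltW c0_gt0) // addr_ge0.
have vb N n : dom0 N n -> `|v N n k.+1| <= expR c1 * (`|I| + b1).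
  move=> dN.
  have dom m : (m <= n)%N -> dom0 N m.
    move=> mn; have : dom0 N (n - (n - m)) by elim: (n - m)%N => [|j IHj]; rewrite ?subn0 // subnS; case: (n - j)%N IHj => //= ? /dom0_down.
    by rewrite subKn.
  apply: (@le_trans _ _ (expR c1 * (`|v N 0%N k.+1| + b1))); last first.
    rewrite ler_wpM2l ?expR_ge0 // lerD2r; have := HI N 0%N (conj erefl (dom 0%N isT)).
    by rewrite expr0 mulr1 => h; apply: le_trans h (ler_norm _).
  apply: (@gronwall K (fun m => `|v N m k.+1|) (e N) c1 b1 n) => //; first exact: dom0_ne.
  move=> m mn; have dm := dom m.+1 mn; have dm' := dom m (ltnW mn).
  rewrite v_step // fpsBE fpsCM fpsDE fpsXM (le_trans (ler_normB _ _)) // mulrDl mul1r -addrA lerD //.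
  rewrite normrM (ger0_norm (e_ge0 N)) -mulrA -mulrDr ler_wpM2l // (le_trans (ler_normD _ _)) //.
  apply: le_trans (lerD (HB1 N m dm') (qtop N m dm')) _.
  by rewrite /b1 /c1; lra.
exists (Num.max (expR c1 * (`|I| + b1))
   (c0^-1 * (G + S) + c1 * (expR c1 * (`|I| + b1)))) => N n dN.
split; rewrite le_max; first by rewrite vb.
apply/orP; right; apply: le_trans (qtop N n dN) _.
by rewrite lerD2l ler_wpM2l // vb.
Qed.


Lemma dom0_le N n m : (m <= n)%N -> dom0 N n -> dom0 N m.
Proof.
move=> mn dN; have : dom0 N (n - (n - m)).
  elim: (n - m)%N => [|j IHj]; rewrite ?subn0 // subnS.
  by case: (n - j)%N IHj => //= ? /dom0_down.
by rewrite subKn.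
Qed.

Let d10 N n : dom1 N n -> dom0 N n. Proof. exact: dom0_down. Qed.

Lemma iv_bounded : bigO dom0 0 iv.
Proof. by apply: (bigO_vinv e_ge0 c0_gt0 v_lb); apply: v_bounded. Qed.

Let v1 : bigO dom1 0 v. Proof. exact: bigO_sub d10 v_bounded. Qed.
Let iv1 : bigO dom1 0 iv. Proof. exact: bigO_sub d10 iv_bounded. Qed.
Let iv1' : bigO dom1 0 (fun N n => iv N n.+1).
Proof. by apply: bigO_shift iv_bounded. Qed.

Lemma r_bounded : bigO dom0 0 r.
Proof. by apply: bigOD => //; [exact: bigO_cst | exact: iv_bounded]. Qed.
Let r1 : bigO dom1 0 r. Proof. exact: bigO_sub d10 r_bounded. Qed.

Let Dv1 := (bigO_D v1).1.
Let Dvt1 := (bigO_D v1).2.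
Let vt1 : bigO dom1 0 (fun N n => v N n + fps_theta (v N n)).
Proof. by apply: bigOD => //; apply: bigO_theta. Qed.

Lemma v_step' N n : dom0 N n.+1 -> v N n.+1 = v N n - C (e N) * (r N n * fps_D (e N) (v N n)).
Proof. by move=> dN; rewrite v_step // /q /r; ring. Qed.

Lemma bigO_e1M p u : bigO dom1 p u -> bigO dom1 p.+1 (fun N n => C (e N) * u N n).
Proof.
by move=> uO; apply: bigO_ext (bigO_eM e_ge0 1 uO) => N n _; rewrite expr1.
Qed.

(** One step of df/ds + r theta(f) = 0 with a local error O(e^2); over at most 1/e steps the errors
    add up to O(e). *)
Definition transported (f : fam) :=
  bigO dom1 2 (fun N n => f N n.+1 - f N n + C (e N) * (r N n * fps_theta (f N n))).

Lemma fps_thetaXM (f : fps K) : fps_theta (X * f) = X * (f + fps_theta f).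
Proof. by rewrite fps_thetaM fps_thetaX; ring. Qed.

(** Here theta(X v) = X (v + theta v), and v + theta v replaces D(v) up to O(e). *)
Lemma transported_Xv : transported (fun N n => X * v N n).
Proof.
apply: (@bigO_ext _ _ _ _ (fun N n => C (e N) * (- (X * r N n) *
    (fps_D (e N) (v N n) - (v N n + fps_theta (v N n)))))).
  by move=> N n dN; rewrite v_step' // fps_thetaXM; ring.
apply: bigO_e1M; apply: bigOM0 => //; apply: bigON; apply: bigOM0 => //.
exact: bigO_cst.
Qed.

Lemma iv_step N n : dom0 N n.+1 -> iv N n.+1 - iv N n =
  C (e N) * (r N n * fps_D (e N) (v N n)) * (iv N n * iv N n.+1).
Proof.
move=> dN; have E := v_step' dN; have i1 := vM_iv (d10 dN); have i2 := vM_iv dN.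
have -> : C (e N) * (r N n * fps_D (e N) (v N n)) = v N n - v N n.+1 by rewrite E; ring.
transitivity ((v N n * iv N n) * iv N n.+1 - (v N n.+1 * iv N n.+1) * iv N n); last by ring.
by rewrite i1 i2 !mul1r.
Qed.

Lemma iv_step1 : bigO dom1 1 (fun N n => iv N n.+1 - iv N n).
Proof.
apply: (@bigO_ext _ _ _ _ (fun N n =>
  C (e N) * (r N n * fps_D (e N) (v N n) * (iv N n * iv N n.+1)))).
  by move=> N n dN; rewrite iv_step //; ring.
by apply: bigO_e1M; apply: bigOM0 => //; apply: bigOM0.
Qed.

Lemma iv_step2 : bigO dom1 2 (fun N n => iv N n.+1 - iv N n -
  C (e N) * (r N n * iv N n ^+ 2 * (v N n + fps_theta (v N n)))).
Proof.
apply: (@bigO_ext _ _ _ _ (fun N n => C (e N) * (r N n * iv N n *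
  ((iv N n.+1 - iv N n) * fps_D (e N) (v N n) +
   iv N n * (fps_D (e N) (v N n) - (v N n + fps_theta (v N n))))))).
  move=> N n dN; rewrite [in RHS]iv_step //.
  have := iv_step dN; move: (iv N n) (iv N n.+1) (r N n) (C (e N)) (fps_D _ _) (v N n + _).
  by move=> a b rr c D w E; ring.
apply: bigO_e1M; apply: bigOM0 => //; first exact: bigOM0.
apply: bigOD; first by apply: bigOM0r => //; exact: iv_step1.
exact: bigOM0.
Qed.

(** On a characteristic X v is constant and d(1/x)/ds = -(1 + 1/(X v)). With s = n e the starting
    value of 1/x is therefore [th] / x. *)
Definition th : fam := fun N n => 1 + C (n%:R * e N) * r N n.

Lemma ne_bounded : bigO dom0 0 (fun N n => C (n%:R * e N)).
Proof.
apply: (bigO_C (C := 1)) => N n dN; rewrite expr0 mulr1 ger0_norm ?mulr_ge0 //.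
exact: dom0_ne.
Qed.
Let ne1' : bigO dom1 0 (fun N n => C (n.+1%:R * e N)).
Proof. exact: (bigO_shift (u := fun N n => C (n%:R * e N)) _ ne_bounded). Qed.

Lemma th_bounded : bigO dom0 0 th.
Proof.
apply: bigOD; first exact: bigO_cst.
by apply: bigOM0; [exact: e_ge0 | exact: ne_bounded | exact: r_bounded].
Qed.

Lemma th_const N n : dom0 N n -> th N n 0%N = (v N n 0%N)^-1.
Proof.
move=> dN; have := v_neq0 dN; rewrite /th /r fpsDE fpsCM fpsDE /iv fps_vinv0 v_const // fps1E /= => v0.
have -> : fpsX K 0%N = 0 by [].
by rewrite add0r; field.
Qed.

Lemma th_ge1 N n : dom0 N n -> 1 <= th N n 0%N.
Proof.
move=> dN; rewrite th_const // invf_ge1 ?(lt_le_trans c0_gt0 (v_lb dN)) // v_const // gerBl.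
by rewrite mulr_ge0.
Qed.

Definition ith : fam := fun N n => fps_vinv (th N n).

Lemma thM_ith N n : dom0 N n -> th N n * ith N n = 1.
Proof. by move=> dN; apply: fps_mul_vinv; rewrite gt_eqF // (lt_le_trans ltr01 (th_ge1 dN)). Qed.

Lemma ith_bounded : bigO dom0 0 ith.
Proof. by apply: (bigO_vinv e_ge0 ltr01 th_ge1); apply: th_bounded. Qed.

Lemma theta_inv (f g : fps K) : f * g = 1 -> fps_theta g = - (g ^+ 2 * fps_theta f).
Proof.
move=> fg; have := congr1 (@fps_theta K) fg; rewrite fps_thetaM fps_theta1 => E.
have -> : fps_theta g = g * (fps_theta f * g + f * fps_theta g) - g ^+ 2 * fps_theta f
    + (1 - f * g) * fps_theta g by ring.
by rewrite E fg subrr mul0r addr0 mulr0 sub0r.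
Qed.

(** The additional term -th on the right is what makes the quotient X / th transported. *)
Lemma th_step2 : bigO dom1 2 (fun N n =>
  th N n.+1 - th N n + C (e N) * (r N n * (fps_theta (th N n) - th N n))).
Proof.
apply: (@bigO_ext _ _ _ _ (fun N n => C (n.+1%:R * e N) * (iv N n.+1 - iv N n -
  C (e N) * (r N n * iv N n ^+ 2 * (v N n + fps_theta (v N n)))) +
  C (e N) * (C (e N) * (r N n * iv N n ^+ 2 * (v N n + fps_theta (v N n)))))); last first.
  apply: bigOD; first by apply: bigOM0 => //; exact: iv_step2.
  apply: bigO_e1M; apply: bigO_e1M; apply: bigOM0 => //; apply: bigOM0 => //.
  exact: bigO_X0.
move=> N n dN; have i1 := vM_iv (d10 dN).
have tt : fps_theta (th N n) = C (n%:R * e N) * (X - iv N n ^+ 2 * fps_theta (v N n)).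
  rewrite /th fps_thetaD fps_theta1 add0r fps_thetaM fps_thetaC mul0r add0r.
  by rewrite /r fps_thetaD fps_thetaX (theta_inv i1).
by rewrite tt /th /r -[n.+1%:R]natr1; ring: i1.
Qed.

Lemma th_step1 : bigO dom1 1 (fun N n => th N n.+1 - th N n).
Proof.
apply: (@bigO_ext _ _ _ _ (fun N n => (th N n.+1 - th N n +
   C (e N) * (r N n * (fps_theta (th N n) - th N n))) -
   C (e N) * (r N n * (fps_theta (th N n) - th N n)))).
  by move=> N n _; rewrite addrK.
have t1 : bigO dom1 0 th by exact: bigO_sub d10 th_bounded.
apply: bigOB; first exact: bigO_le th_step2.
by apply: bigO_e1M; apply: bigOM0 => //; apply: bigOB => //; apply: bigO_theta.
Qed.

Lemma ith_step N n : dom0 N n.+1 ->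
  ith N n.+1 - ith N n = ith N n * ith N n.+1 * (th N n - th N n.+1).
Proof.
move=> dN; have i1 := thM_ith (d10 dN); have i2 := thM_ith dN.
transitivity ((th N n * ith N n) * ith N n.+1 - (th N n.+1 * ith N n.+1) * ith N n); last by ring.
by rewrite i1 i2 !mul1r.
Qed.

(** The foot at n = 0 of the characteristic through x. *)
Definition bb : fam := fun N n => X * ith N n.

Lemma transported_bb : transported bb.
Proof.
have it1 : bigO dom1 0 ith by exact: bigO_sub d10 ith_bounded.
have it1' : bigO dom1 0 (fun N n => ith N n.+1) by apply: bigO_shift ith_bounded.
have ts : bigO dom1 1 (fun N n => th N n - th N n.+1).
  by apply: bigO_ext (bigON th_step1) => N n _; rewrite opprB.
apply: (@bigO_ext _ _ _ _ (fun N n => - (X * ith N n ^+ 2) * (th N n.+1 - th N n +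
   C (e N) * (r N n * (fps_theta (th N n) - th N n))) +
   X * ith N n * ((ith N n * ith N n.+1 * (th N n - th N n.+1)) * (th N n - th N n.+1)))).
  move=> N n dN; rewrite /bb -ith_step // fps_thetaXM (theta_inv (thM_ith (d10 dN))).
  have E : X * ith N n.+1 - X * ith N n = X * ith N n * ith N n.+1 * (th N n - th N n.+1).
    by rewrite -mulrBr ith_step //; ring.
  by rewrite E; have i1 := thM_ith (d10 dN); ring: i1.
have Xi : bigO dom1 0 (fun N n => X * ith N n) by apply: bigOM0 => //; exact: bigO_cst.
apply: bigOD.
  apply: bigOM0 => //; last exact: th_step2.
  by apply: bigON; apply: bigOM0 => //; [exact: bigO_cst | exact: bigO_X0].
apply: bigOM0 => //; apply: (bigOM e_ge0 (p := 1) (q := 1)) => //.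
by apply: bigOM0 => //; apply: bigOM0.
Qed.

Lemma transported_step f : bigO dom0 0 f -> transported f ->
  bigO dom1 1 (fun N n => f N n.+1 - f N n).
Proof.
move=> f0 ft; have f1 : bigO dom1 0 f by exact: bigO_sub d10 f0.
apply: (@bigO_ext _ _ _ _ (fun N n => (f N n.+1 - f N n +
   C (e N) * (r N n * fps_theta (f N n))) - C (e N) * (r N n * fps_theta (f N n)))).
  by move=> N n _; rewrite addrK.
apply: bigOB; first exact: bigO_le ft.
by apply: bigO_e1M; apply: bigOM0 => //; apply: bigO_theta.
Qed.

Lemma transportedM f g : bigO dom0 0 f -> bigO dom0 0 g -> transported f -> transported g ->
  transported (fun N n => f N n * g N n).
Proof.
move=> f0 g0 ft gt; have f1 : bigO dom1 0 f by exact: bigO_sub d10 f0.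
have g1' : bigO dom1 0 (fun N n => g N n.+1) by apply: bigO_shift g0.
apply: (@bigO_ext _ _ _ _ (fun N n =>
  (f N n.+1 - f N n + C (e N) * (r N n * fps_theta (f N n))) * g N n.+1 +
  (C (e N) * (- (r N n * fps_theta (f N n)) * (g N n.+1 - g N n)) +
  f N n * (g N n.+1 - g N n + C (e N) * (r N n * fps_theta (g N n)))))).
  by move=> N n _; rewrite fps_thetaM; ring.
apply: bigOD; first exact: bigOM0r.
apply: bigOD; last exact: bigOM0.
apply: bigO_e1M; apply: bigOM0 => //; last exact: transported_step.
by apply: bigON; apply: bigOM0 => //; apply: bigO_theta.
Qed.

Lemma transported_cst (f : K) : transported (fun _ _ => C f).
Proof.
apply: (@bigO_ext _ _ _ _ (fun _ _ => 0)).
  by move=> N n _; rewrite subrr fps_thetaC !mulr0 addr0.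
by move=> k; exists 0 => N n _; rewrite normr0 mul0r.
Qed.

Lemma transportedX f k : bigO dom0 0 f -> transported f -> transported (fun N n => f N n ^+ k).
Proof.
move=> f0 ft; elim: k => [|k IH].
  apply: bigO_ext (transported_cst 1) => N n _.
  by rewrite !expr0 rmorph1.
apply: bigO_ext (transportedM f0 (bigO_X0 e_ge0 k f0) ft IH) => N n _.
by rewrite !exprS.
Qed.

Lemma transportedB f g : transported f -> transported g -> transported (fun N n => f N n - g N n).
Proof.
move=> ft gt; apply: bigO_ext (bigOB ft gt) => N n _.
by rewrite fps_thetaB; ring.
Qed.

Lemma transported_sum (F : nat -> fam) m : (forall i, transported (F i)) ->
  transported (fun N n => \sum_(i < m) F i N n).
Proof.
move=> Ft; have := @bigO_sum _ _ dom1 2 m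
  (fun i N n => F i N n.+1 - F i N n + C (e N) * (r N n * fps_theta (F i N n))) (fun i _ => Ft i).
apply: bigO_ext => N n _; elim: m => [|m IH]; first by rewrite !big_ord0 fps_theta0; ring.
by rewrite !big_ord_recr /= IH fps_thetaD; ring.
Qed.

Variable Psi : fps K.
Hypothesis Psi0 : Psi 0%N = 0.
Hypothesis v_lim : forall k (c : K), 0 < c ->
  exists N0, forall N, (N0 <= N)%N -> dom0 N 0%N -> `|Psi k.+1 - v N 0%N k| <= c.

Lemma bb_bounded : bigO dom0 0 bb.
Proof. by apply: bigOM0; [exact: e_ge0 | exact: bigO_cst | exact: ith_bounded]. Qed.

Lemma bb0 N : dom0 N 0%N -> bb N 0%N = X.
Proof.
move=> dN; have := thM_ith dN; rewrite /bb {1}/th mul0r rmorph0 mul0r addr0 mul1r => ->.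
by rewrite mulr1.
Qed.

(* Both [Psi(bb)] and [X v] solve the same transport equation up to O(e^2) and have
   asymptotically the same initial value. *)
Lemma Psi_bb : littleo dom0 (fun N n => fps_comp (bb N n) Psi - X * v N n).
Proof.
move=> k cc cc0.
(* Coefficients up to k see only a truncation of Psi, a finite combination of powers of [bb] to
   which the algebra of transported families applies. *)
pose W : fam := fun N n => \sum_(i < k.+1) C (Psi i) * bb N n ^+ i - X * v N n.
have WE N n : (fps_comp (bb N n) Psi - X * v N n) k = W N n k.
  rewrite /W fpsBE [RHS]fpsBE (fps_comp_poly _ _ (leqnn k)) //.
  by rewrite /bb fpsXM.
have Wt : transported W.
  apply: transportedB; last exact: transported_Xv.
  apply: (transported_sum (F := fun i N n => C (Psi i) * bb N n ^+ i)) => i.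
  apply: (transportedM (f := fun _ _ => C (Psi i))); [exact: bigO_cst | | exact: transported_cst |].
    by apply: bigO_X0; [exact: e_ge0 | exact: bb_bounded].
  by apply: transportedX; [exact: bb_bounded | exact: transported_bb].
have [R R0 HR] := bigO_bound e_ge0 r_bounded.
have [E E0 HE] := bigO_bound e_ge0 Wt.
pose c1 := \sum_(j < k.+1) \sum_(i < j.+1) R (j - i)%N * i%:R.
pose b1 := \sum_(j < k.+1) E j.
have c10 : 0 <= c1 by do 2 (apply: sumr_ge0 => ? _); rewrite mulr_ge0.
have b10 : 0 <= b1 by apply: sumr_ge0.
(* The transport term couples a coefficient only to those of no larger index, so the sum of the
   first k + 1 absolute values satisfies a Gronwall inequality of its own. *)
pose s N n := \sum_(j < k.+1) `|W N n j|.
have s0 N n : 0 <= s N n by apply: sumr_ge0.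
have Ws N n j : (j < k.+1)%N -> `|W N n j| <= s N n.
  move=> jk; rewrite /s (bigD1 (Ordinal jk)) //= lerDl; exact: sumr_ge0.
have sb N n : dom0 N n -> s N n <= expR c1 * (s N 0%N + e N * b1).
  move=> dN; apply: (@gronwall K (s N) (e N) c1 (e N * b1) n) => //.
  - by rewrite mulr_ge0.
  - exact: dom0_ne.
  move=> m mn; have dm := dom0_le mn dN; have dm' := dom0_down dm.
  rewrite mulrDl mul1r -addrA -mulrA -mulrDr.
  have step (j : 'I_k.+1) : `|W N m.+1 j| <= `|W N m j| +
      e N * ((\sum_(i < j.+1) R (j - i)%N * i%:R) * s N m + e N * E j).
    have -> : W N m.+1 j = W N m j - e N * (r N m * fps_theta (W N m)) j +
        (W N m.+1 - W N m + C (e N) * (r N m * fps_theta (W N m))) j.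
      by rewrite [in RHS]fpsDE fpsBE fpsCM; ring.
    apply: le_trans (ler_normD _ _) _; rewrite mulrDr addrA; apply: lerD; last first.
      by apply: le_trans (HE j N m dm) _; rewrite expr2 mulrC mulrA.
    apply: le_trans (ler_normB _ _) _; rewrite lerD2l normrM (ger0_norm (e_ge0 N)) ler_wpM2l //.
    rewrite fpsME_rev (le_trans (ler_norm_sum _ _ _)) // mulr_suml; apply: ler_sum => i _.
    rewrite normrM -mulrA ler_pM //.
      by have := HR (j - i)%N N m dm'; rewrite expr0 mulr1.
    rewrite /fps_theta normrM normr_nat ler_wpM2l // Ws //.
    by apply: leq_trans (ltn_ord i) (ltn_ord j).
  rewrite {1}/s; apply: le_trans (ler_sum _ (fun j _ => step j)) _.
  rewrite big_split /= -/(s N m) lerD2l -mulr_sumr ler_wpM2l // big_split /= -mulr_suml -mulr_sumr.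
  by rewrite -/c1 -/b1.
have init c : 0 < c -> exists N0, forall N, (N0 <= N)%N -> dom0 N 0%N -> s N 0%N <= c.
  have W0 N j : dom0 N 0%N -> (j < k.+1)%N -> W N 0%N j = if j is i.+1 then Psi i.+1 - v N 0%N i else 0.
    move=> dN jk; rewrite /W fpsBE bb0 // fpsXM fps_sumE (bigD1 (Ordinal jk)) //= big1; last first.
      move=> i; rewrite fpsCM fpsXn -val_eqE /= eq_sym => /negbTE ->; by rewrite mulr0.
    by rewrite addr0 fpsCM fpsXn eqxx mulr1; case: (j) => [|i]; rewrite ?Psi0 ?subrr.
  move=> c0'; pose c' := c / k.+1%:R.
  have c'0 : 0 < c' by rewrite divr_gt0 // ltr0n.
  have /choice[M HM] : forall j, exists N0, forall N, (N0 <= N)%N -> dom0 N 0%N -> `|Psi j.+1 - v N 0%N j| <= c'.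
    by move=> j; apply: v_lim.
  exists (\max_(j < k) M j)%N => N NM dN.
  rewrite /s; apply: (@le_trans _ _ (\sum_(j < k.+1) c')); last first.
    by rewrite sumr_const card_ord -[_ *+ _]mulr_natl /c' mulrCA divff ?mulr1 // pnatr_eq0.
  apply: ler_sum => -[j jk] _ /=; rewrite W0 //; case: j jk => [|j] jk.
    by rewrite normr0 ltW.
  by apply: HM => //; apply: leq_trans NM; apply: (leq_bigmax (Ordinal (jk : (j < k)%N))).
pose c2 := cc / (2 * expR c1).
have ex0 := expR_gt0 c1.
have c20 : 0 < c2 by rewrite divr_gt0 // mulr_gt0.
have [N1 H1] := init _ c20.
have [|N2 H2] := e_to0 (c := c2 / (b1 + 1)); first by rewrite divr_gt0 // ltr_wpDl.
exists (maxn N1 N2) => N n; rewrite geq_max => /andP[n1 n2] dN.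
rewrite WE; apply: le_trans (Ws N n k (ltnSn k)) _; apply: le_trans (sb N n dN) _.
apply: (@le_trans _ _ (expR c1 * (c2 + c2))); last first.
  by rewrite /c2 le_eqVlt; apply/orP; left; apply/eqP; field; rewrite gt_eqF.
rewrite ler_wpM2l ?expR_ge0 // lerD //; first by apply: H1 => //; exact: dom0_le dN.
apply: (@le_trans _ _ (c2 / (b1 + 1) * (b1 + 1))); last by rewrite divfK // gt_eqF // ltr_wpDl.
by apply: ler_pM => //; [exact: H2 | rewrite lerDl].
Qed.

Lemma bigO_dom1 p u : (forall N, u N 0%N = 0) -> bigO dom1 p (fun N n => u N n.+1) -> bigO dom0 p u.
Proof.
move=> u0 uO k; have [B HB] := uO k; exists `|B| => N [|n] dN.
  by rewrite u0 normr0 mulr_ge0 // exprn_ge0.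
by apply: le_trans (HB N n dN) _; rewrite ler_wpM2r ?exprn_ge0 // ler_norm.
Qed.

Variable T : nat -> fam.
Hypothesis T0 : forall N n, dom0 N n -> T 0 N n = 1.
Hypothesis Tinit : forall j N, dom0 N 0%N -> T j N 0%N = 1.
Hypothesis Tstep : forall j N n, dom0 N n.+1 -> T j.+1 N n.+1 =
  (1 + C (n.+1%:R * e N) * X) * T j N n.+1 + C (n.+1%:R * e N) * (iv N n * T j N n).

(** Since T and 1/v change by O(e) in one step, the recursion becomes T_(j+1) = (1 + s (X + 1/v))
    T_j = th T_j up to O(e). *)
Lemma T_th j : bigO dom0 1 (fun N n => T j N n - th N n ^+ j).
Proof.
have thX k : bigO dom1 1 (fun N n => th N n ^+ k - th N n.+1 ^+ k).
  elim: k => [|k IH].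
    by move=> i; exists 0 => N n _; rewrite !expr0 subrr normr0 mul0r.
  apply: (@bigO_ext _ _ _ _ (fun N n => - (th N n ^+ k * (th N n.+1 - th N n)) +
      th N n.+1 * (th N n ^+ k - th N n.+1 ^+ k))).
    by move=> N n _; rewrite !exprS; ring.
  apply: bigOD.
    apply: bigON; apply: bigOM0 => //; last exact: th_step1.
    by apply: bigO_X0 => //; exact: bigO_sub d10 th_bounded.
  by apply: bigOM0 => //; apply: bigO_shift th_bounded.
elim: j => [|j IH].
  apply: (@bigO_ext _ _ _ _ (fun _ _ => 0)); first by move=> N n dN; rewrite T0 // expr0 subrr.
  by move=> k; exists 0 => N n _; rewrite normr0 mul0r.
have IH1 : bigO dom1 1 (fun N n => T j N n - th N n ^+ j) by exact: bigO_sub d10 IH.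
have IH1' : bigO dom1 1 (fun N n => T j N n.+1 - th N n.+1 ^+ j).
  exact: (bigO_shift (u := fun N n => T j N n - th N n ^+ j) _ IH).
pose u : fam := fun N n => if n is 0%N then 0 else T j.+1 N n - th N n ^+ j.+1.
apply: (@bigO_ext _ _ _ _ u).
  move=> N [|n] dN //; rewrite /u Tinit // /th mul0r rmorph0 mul0r addr0 expr1n subrr //.
apply: bigO_dom1 => //.
apply: (@bigO_ext _ _ _ _ (fun N n =>
   (1 + C (n.+1%:R * e N) * X) * (T j N n.+1 - th N n.+1 ^+ j) +
   (C (n.+1%:R * e N) * (iv N n * (T j N n - th N n ^+ j)) +
   C (n.+1%:R * e N) * (- ((iv N n.+1 - iv N n) * th N n ^+ j) +
        iv N n.+1 * (th N n ^+ j - th N n.+1 ^+ j))))).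
  move=> N n dN; rewrite /u Tstep //.
  have -> : th N n.+1 ^+ j.+1 = (1 + C (n.+1%:R * e N) * (X + iv N n.+1)) * th N n.+1 ^+ j.
    by rewrite exprS.
  by ring.
have C1' : bigO dom1 0 (fun N n => 1 + C (n.+1%:R * e N) * X).
  apply: bigOD; first exact: bigO_cst.
  by apply: bigOM0 => //; exact: bigO_cst.
apply: bigOD; first exact: bigOM0.
apply: bigOD; first by apply: bigOM0 => //; apply: bigOM0.
apply: bigOM0 => //; apply: bigOD; last exact: bigOM0.
apply: bigON; apply: bigOM0r => //; first exact: iv_step1.
by apply: bigO_X0 => //; exact: bigO_sub d10 th_bounded.
Qed.

End Transport.

End Transport.

(** * The coordinate in which the limit of the differences is explicit *)

Module TransportCoordinates.
Import structures.
Import all_boot all_order all_algebra.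
Import boolp functions reals sequences exp.
Import ring lra zify.
Import PowerSeries GrowthFamilies Transport.
Set Implicit Arguments.
Unset Strict Implicit.
Unset Printing Implicit Defensive.
Import Order.TTheory GRing.Theory Num.Theory.
Local Open Scope ring_scope.

Section CompQuotient.
Variable A : comNzRingType.
Implicit Types b c f : fps A.

Lemma fps_comp_id f : fps_comp (fpsX A) f = f.
Proof.
apply/fpsP => n; rewrite /fps_comp (bigD1 ord_max) //= fpsXn eqxx mulr1 big1 ?addr0 //.
move=> k; rewrite -val_eqE /= fpsXn eq_sym => /negbTE ->; by rewrite mulr0.
Qed.

Lemma fps_comp_sum I (r : seq I) (P : pred I) (F : I -> fps A) b :
  fps_comp b (\sum_(i <- r | P i) F i) = \sum_(i <- r | P i) fps_comp b (F i).
Proof.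
apply: (big_morph (fps_comp b)) => [f g|]; first exact: fps_compD.
by apply/fpsP => n; rewrite /fps_comp big1 // => i _; rewrite mul0r.
Qed.

Lemma fps_comp_comp b c f : b 0%N = 0 -> c 0%N = 0 ->
  fps_comp c (fps_comp b f) = fps_comp (fps_comp c b) f.
Proof.
move=> b0 c0; apply/fpsP => n.
have cb0 : (fps_comp c b) 0%N = 0 by rewrite fps_comp_const.
rewrite (fps_comp_poly _ cb0 (leqnn n)).
transitivity (fps_comp c (\sum_(k < n.+1) fpsC (f k) * b ^+ k) n).
  rewrite /fps_comp; apply: eq_bigr => -[k /= kn] _; congr (_ * _).
  by apply: fps_comp_poly.
rewrite fps_comp_sum !fps_sumE; apply: eq_bigr => k _.
by rewrite fps_compM // fps_compC fps_compXn.
Qed.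

(** The divided difference (f(b) - f(c)) / (b - c). The k-th summand has order at least k - 1 when b
    and c have constant term 0, so stopping at k = n + 1 is exact. *)
Definition fps_quot b c f : fps A :=
  fun n => \sum_(k < n.+2) f k * (\sum_(i < k) b ^+ (k.-1 - i) * c ^+ i) n.

Lemma fps_quotE b c f : b 0%N = 0 -> c 0%N = 0 ->
  fps_comp b f - fps_comp c f = (b - c) * fps_quot b c f.
Proof.
move=> b0 c0; apply/fpsP => n; pose S k := \sum_(i < k) b ^+ (k.-1 - i) * c ^+ i.
have Sval k : fps_val k.-1 (S k).
  move=> m mk; rewrite /S fps_sumE big1 // => i _.
  have vb : fps_val (k.-1 - i) (b ^+ (k.-1 - i)) by apply: fps_valX1.
  have vc : fps_val i (c ^+ i) by apply: fps_valX1.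
  by apply: (fps_valM vb vc); have := ltn_ord i; lia.
have -> : ((b - c) * fps_quot b c f) n = ((b - c) * \sum_(k < n.+1) fpsC (f k) * S k) n.
  rewrite !fpsME; apply: eq_bigr => -[j /= jn] _; case: j jn => [|j] jn.
    by rewrite !fpsBE b0 c0 subrr !mul0r.
  congr (_ * _); rewrite /fps_quot fps_sumE.
  rewrite (big_ord_widen n.+1 (fun k => f k * (S k) (n - j.+1)%N)); last lia.
  rewrite big_mkcond; apply: eq_bigr => k _; rewrite fpsCM; case: ifP => // /negbT.
  by rewrite -leqNgt => kn; rewrite Sval ?mulr0 //; lia.
rewrite mulr_sumr fps_sumE fpsBE !(fps_compE _ _ (leqnn n)) // -sumrB.
apply: eq_bigr => k _; rewrite -mulrBr mulrCA fpsCM -fpsBE; congr (_ * _).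
by rewrite /S; case: (val k) => [|m]; rewrite ?big_ord0 ?mulr0 ?subrr // subrXX.
Qed.

Lemma fps_quot0 b c f : fps_quot b c f 0%N = f 1%N.
Proof.
rewrite /fps_quot !big_ord_recl !big_ord0 /= mulr0 add0r addr0 expr0 mulr1.
by rewrite addr0 -[(0 + 0 - 0)%N]/0%N expr0 fps1E mulr1.
Qed.
End CompQuotient.

Section TauCoordinates.
Variables (K : realType) (e : nat -> K).
Hypothesis e_ge0 : forall N, 0 <= e N.
Hypothesis e_le1 : forall N, e N <= 1.
Hypothesis e_to0 : forall c : K, 0 < c -> exists N0, forall N, (N0 <= N)%N -> e N <= c.
Notation fam := (nat -> nat -> fps K).
Notation X := (fpsX K).
Notation C := (@fpsC K).
Notation bigO := (bigO e).

Variables (d : nat -> nat -> Prop) (s : K) (psi : fps K).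
Hypothesis s_neq1 : 1 - s != 0.
Hypothesis psi0 : psi 0%N = 1.
Let Psi := X * psi.

(* With tau = 1/t this is zeta(t)/t, where zeta(t) = t - s - s/Psi. *)
Definition zhat : fps K := 1 - C s * X - C s * fps_inv psi.
Definition izhat : fps K := fps_vinv zhat.
(** The point x = 1/zeta as a series in tau. *)
Definition xtau : fps K := X * izhat.

Lemma zhat0 : zhat 0%N = 1 - s.
Proof. by rewrite /zhat !fpsBE !fpsCM fps_inv0 fps1E /= mulr1 /fpsX /= mulr0 subr0. Qed.

Lemma zhatM : zhat * izhat = 1.
Proof. by apply: fps_mul_vinv; rewrite zhat0. Qed.

Lemma xtau0 : xtau 0%N = 0.
Proof. by rewrite /xtau fpsXM. Qed.

Lemma zhat_psi : psi * zhat = psi - C s * (Psi + 1).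
Proof.
rewrite /zhat /Psi; transitivity (psi - C s * X * psi - C s * (psi * fps_inv psi)); first by ring.
by rewrite fps_mulV //; ring.
Qed.

Variables (v iv th ith T : fam) (sN : nat -> nat -> K).
Notation bb := (fun N n => X * ith N n).
Hypothesis vM : forall N n, d N n -> v N n * iv N n = 1.
Hypothesis thE : forall N n, d N n -> th N n = 1 + C (sN N n) * (X + iv N n).
Hypothesis thM : forall N n, d N n -> th N n * ith N n = 1.
Hypothesis v_bd : bigO d 0 v.
Hypothesis th_bd : bigO d 0 th.
Hypothesis ith_bd : bigO d 0 ith.
Hypothesis sN_to : littleo d (fun N n => C (sN N n) - C s).
Hypothesis PsiB : littleo d (fun N n => fps_comp (bb N n) Psi - X * v N n).

Let h := fps_comp xtau.
Let V : fam := fun N n => h (v N n).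
Let Th : fam := fun N n => h (th N n).
Let B : fam := fun N n => xtau * h (ith N n).
Let V0 := psi * zhat.

(** At x = 1/zeta the foot of the characteristic should be tau itself. Instead of inverting a
    series, the relations B Th = x and Psi(B) = x V + o(1) are turned by a divided difference into a
    linear equation for B - X whose right side is small. *)
Lemma Th_to : littleo d (fun N n => Th N n - izhat).
Proof.
have x0 := xtau0.
have B0 N n : B N n 0%N = 0 by rewrite /B fpsM0 x0 mul0r.
have hX : h X = xtau by apply: fps_compX.
have hM f g : h (f * g) = h f * h g by apply: fps_compM.
have hC c : h (C c) = C c by apply: fps_compC.
have h1 : h 1 = 1 by apply: fps_comp1.
have hD f g : h (f + g) = h f + h g by apply: fps_compD.
have V_bd : bigO d 0 V by apply: bigO_comp.
have Th_bd : bigO d 0 Th by apply: bigO_comp.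
have B_bd : bigO d 0 B by apply: bigOM0 => //; [exact: bigO_cst | exact: bigO_comp].
pose U : fam := fun N n => fps_quot (B N n) X Psi.
have U_bd : bigO d 0 U.
  move=> k; pose F i : fam := fun N n => \sum_(j < i) B N n ^+ (i.-1 - j) * X ^+ j.
  have F_bd i : bigO d 0 (F i).
    apply: (@bigO_sum _ _ _ _ _ (fun j N n => B N n ^+ (i.-1 - j) * X ^+ j)) => j _.
    by apply: bigOM0r => //; [exact: bigO_X0 | exact: bigO_cst].
  have /choice[D HD] : forall i, exists D : K, forall N n, d N n -> `|F i N n k| <= D.
    by move=> i; have [D HD] := F_bd i k; exists D => N n dN; have := HD N n dN; rewrite expr0 mulr1.
  exists (\sum_(i < k.+2) `|Psi i| * D i) => N n dN; rewrite expr0 mulr1.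
  rewrite /U /fps_quot (le_trans (ler_norm_sum _ _ _)) //; apply: ler_sum => i _.
  by rewrite normrM ler_wpM2l // HD.
pose o1 : fam := fun N n => fps_comp (B N n) Psi - xtau * V N n.
have o1o : littleo d o1.
  apply: (littleo_ext _ (littleo_comp xtau PsiB)) => N n dN.
  rewrite /o1 fps_compB fps_comp_comp ?x0 //; last by rewrite fpsXM.
  by rewrite -/h !hM hX.
pose o2 : fam := fun N n => (C (sN N n) - C s) * (xtau * V N n + 1).
have o2o : littleo d o2.
  apply: (littleo_ext (u := fun N n => (xtau * V N n + 1) * (C (sN N n) - C s))).
    by move=> N n _; rewrite mulrC.
  apply: (littleoM e_ge0) => //.
  apply: bigOD; last exact: bigO_cst.
  by apply: bigOM0 => //; exact: bigO_cst.
pose del : fam := fun N n => B N n - X.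
pose br : fam := fun N n => Th N n * psi + U N n * (1 + C s * xtau - Th N n).
have main N n : d N n -> br N n * del N n = (1 + C s * xtau - Th N n) * o1 N n - xtau * o2 N n.
  move=> dN.
  have E1 : del N n * U N n = o1 N n + xtau * V N n - Psi.
    rewrite /o1 subrK -[X in _ - X](fps_comp_id Psi) /del.
    by rewrite (fps_quotE _ (B0 N n)).
  have E3 : Th N n * V N n = V N n + C (sN N n) * (xtau * V N n + 1).
    rewrite /Th /V -hM thE // (_ : _ * v N n = v N n + C (sN N n) * (X * v N n + v N n * iv N n)).
      by rewrite vM // !(hD, hM, hC, hX, h1).
    by ring.
  have E4 : B N n * Th N n = xtau by rewrite /B /Th -mulrA -hM mulrC [ith N n * _]mulrC thM // h1 mul1r.
  have E5 := zhat_psi; have Ez := zhatM.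
  have EX : xtau = X * izhat by [].
  have EP : Psi = X * psi by [].
  rewrite /br /o2 /del in E1 *.
  transitivity (psi * (B N n * Th N n - X * Th N n) +
     (B N n - X) * U N n * (1 + C s * xtau - Th N n)); first by ring.
  rewrite E1 E4.
  have E6 : (C (sN N n) - C s) * (xtau * V N n + 1) =
     Th N n * V N n - V N n - C s * (xtau * V N n + 1) by rewrite E3; ring.
  rewrite E6.
  rewrite EX EP in E5 *; apply/eqP; rewrite -subr_eq0; apply/eqP.
  transitivity (X * izhat * (psi - C s * (X * psi + 1)) - X * psi); first by ring.
  by rewrite -E5; ring: Ez.
have br0 N n : d N n -> br N n 0%N = 1.
  move=> dN; rewrite /br fpsDE !fpsM0 psi0 /U fps_quot0 /Psi fpsXM psi0.
  by rewrite fpsBE fpsDE fpsCM x0 fps1E /=; ring.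
have br_bd : bigO d 0 br.
  apply: bigOD; first by apply: bigOM0r => //; exact: bigO_cst.
  by apply: bigOM0 => //; apply: bigOB => //; exact: bigO_cst.
have delo : littleo d del.
  apply: (littleo_ext (u := fun N n => fps_inv (br N n) *
     ((1 + C s * xtau - Th N n) * o1 N n - xtau * o2 N n))).
    by move=> N n dN; rewrite -main // mulrA [fps_inv _ * _]mulrC fps_mulV ?mul1r ?br0.
  apply: (littleoM e_ge0); first exact: bigO_inv.
  apply: littleoB; apply: (littleoM e_ge0) => //; last exact: bigO_cst.
  by apply: bigOB => //; exact: bigO_cst.
apply: littleo_XK.
apply: (littleo_ext (u := fun N n => - (Th N n * del N n))).
  move=> N n dN; rewrite /del mulrBr [Th N n * B N n]mulrC.
  by rewrite /B /Th -mulrA -hM [ith N n * _]mulrC thM // h1 mulr1 /xtau; ring.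
by apply: littleoN; apply: (littleoM e_ge0).
Qed.

Lemma ThX_to j : littleo d (fun N n => Th N n ^+ j - izhat ^+ j).
Proof.
elim: j => [|j IH].
  apply: (littleo_ext (u := fun _ _ => 0)); first by move=> N n _; rewrite !expr0 subrr.
  by move=> k c c0; exists 0%N => N n _ _; rewrite normr0 ltW.
apply: (littleo_ext (u := fun N n => Th N n * (Th N n ^+ j - izhat ^+ j) +
    izhat ^+ j * (Th N n - izhat))).
  by move=> N n _; rewrite !exprS; ring.
apply: littleoD; first by apply: (littleoM e_ge0) => //; apply: bigO_comp.
by apply: (littleoM e_ge0); [exact: bigO_cst | exact: Th_to].
Qed.

Lemma T_to j : littleo d (fun N n => T N n - th N n ^+ j) ->
  littleo d (fun N n => fps_comp xtau (T N n) - izhat ^+ j).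
Proof.
move=> To'; have To := littleo_comp xtau To'.
apply: (littleo_ext _ (littleoD To (ThX_to j))) => N n dN.
by rewrite fps_compB fps_compXn ?xtau0 // -/h -/(Th N n); ring.
Qed.

End TauCoordinates.

End TransportCoordinates.

(** * Evaluation of polynomials near infinity *)

Module HomogeneousEvaluation.
Import structures.
Import all_boot all_order all_algebra.
Import boolp functions reals sequences exp.
Import ring lra zify.
Import PowerSeries FiniteDifferences Branching GrowthFamilies Transport.
Set Implicit Arguments.
Unset Strict Implicit.
Unset Printing Implicit Defensive.
Import Order.TTheory GRing.Theory Num.Theory.
Local Open Scope ring_scope.

Section HomogeneousEval.
Variables (K : numFieldType) (A : comNzRingType) (io : {rmorphism K -> A}).
Implicit Types (f g : {poly K}) (y w : A).

(** The homogenization w^m f(y/w). It makes sense for a non-invertible w, so the point y/w may lie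
    near infinity; m must be at least the degree, since higher coefficients are dropped. *)
Definition hev y w m f : A := \sum_(i < m.+1) io f`_i * (y ^+ i * w ^+ (m - i)).

Lemma linf_hev y w m : linf io (hev y w m).
Proof.
move=> c f g; rewrite /hev mulr_sumr -big_split; apply: eq_bigr => i _ /=.
by rewrite coefD coefZ rmorphD rmorphM; ring.
Qed.

Lemma hevXn y w m i : (i <= m)%N -> hev y w m 'X^i = y ^+ i * w ^+ (m - i).
Proof.
move=> im; rewrite /hev (bigD1 (Ordinal (im : (i < m.+1)%N))) //= coefXn eqxx rmorph1 mul1r.
rewrite big1 ?addr0 // => j; rewrite -val_eqE coefXn /= => /negbTE ->.
by rewrite rmorph0 mul0r.
Qed.

Lemma poly_sumXn m f : (size f <= m.+1)%N -> f = \sum_(i < m.+1) f`_i *: 'X^i.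
Proof.
move=> sf; rewrite -poly_def; apply/polyP => k; rewrite coef_poly; case: ltnP => // km.
by rewrite nth_default // (leq_trans sf).
Qed.

Lemma hev_expand (phi : {poly K} -> A) m f : linf io phi -> (size f <= m.+1)%N ->
  phi f = \sum_(i < m.+1) io f`_i * phi 'X^i.
Proof.
move=> lphi sf; rewrite {1}(poly_sumXn sf) (linf_sum _ _ _ lphi).
by apply: eq_bigr => i _; rewrite (linfZ _ _ lphi).
Qed.

Lemma hevM y w m k f g : (size f <= m.+1)%N -> (size g <= k.+1)%N ->
  hev y w (m + k) (f * g) = hev y w m f * hev y w k g.
Proof.
move=> sf sg; have lf : linf io (fun f => hev y w (m + k) (f * g)).
  by move=> c f1 f2; rewrite mulrDl -scalerAl linf_hev.
rewrite (hev_expand lf sf) [hev y w m f]/hev mulr_suml; apply: eq_bigr => -[i /= im] _.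
rewrite -!mulrA; congr (_ * _).
have lg : linf io (fun g => hev y w (m + k) ('X^i * g)).
  by move=> c g1 g2; rewrite mulrDr -scalerAr linf_hev.
rewrite (hev_expand lg sg) [hev y w k g]/hev !mulr_sumr; apply: eq_bigr => -[j /= jk] _.
rewrite -exprD hevXn; last lia.
have -> : (m + k - (i + j) = (m - i) + (k - j))%N by lia.
by rewrite !exprD; ring.
Qed.

Lemma hev1 y w m : hev y w m 1 = w ^+ m.
Proof. by rewrite -(expr0 'X) hevXn // expr0 mul1r subn0. Qed.

Lemma hev_wk y w m k f : (size f <= m.+1)%N -> hev y w (k + m) f = w ^+ k * hev y w m f.
Proof. by move=> sf; rewrite -[f in LHS]mul1r hevM ?hev1 // size_poly1. Qed.

Lemma hev_XD y w c : hev y w 1 ('X + c%:P) = y + io c * w.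
Proof.
rewrite -[c%:P]alg_polyC -[_ + _]addrC linf_hev hev1 -['X]expr1 hevXn // subnn.
by rewrite expr0 expr1 mulr1 addrC.
Qed.

Lemma hev_XB y w c : hev y w 1 ('X - c%:P) = y - io c * w.
Proof. by rewrite -polyCN hev_XD rmorphN mulNr. Qed.

Lemma hev_rootpoly y w (cs : seq K) :
  hev y w (size cs) (rootpoly cs) = \prod_(c <- cs) (y - io c * w).
Proof.
elim: cs => [|c cs IH]; first by rewrite /rootpoly !big_nil hev1.
rewrite /rootpoly !big_cons -/(rootpoly cs) -[size _]/(1 + size cs)%N hevM ?IH ?hev_XB //.
  by rewrite size_XsubC.
by rewrite size_prod_XsubC.
Qed.

Lemma size_X1n i : size (('X + 1 : {poly K}) ^+ i) = i.+1.
Proof. by rewrite -[1]/(1%:P) -[1%:P]opprK -polyCN size_exp_XsubC. Qed.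

Lemma hev_X1n y w i : hev y w i (('X + 1) ^+ i) = (y + w) ^+ i.
Proof.
elim: i => [|i IH]; first by rewrite !expr0 hev1.
rewrite !exprS -add1n hevM ?IH ?size_X1n //; last by rewrite -polyC1 size_XaddC.
by rewrite -polyC1 hev_XD rmorph1 mul1r.
Qed.

Lemma hev_shift y w m f : (size f <= m.+1)%N ->
  hev y w m (f \Po ('X + 1)) = hev (y + w) w m f.
Proof.
move=> sf; have l1 : linf io (fun f => hev y w m (f \Po ('X + 1))).
  by move=> c f1 f2; rewrite comp_polyD comp_polyZ linf_hev.
rewrite (hev_expand l1 sf) (hev_expand (linf_hev (y + w) w m) sf).
apply: eq_bigr => -[i /= im] _; congr (_ * _).
rewrite comp_Xn_poly hevXn // -[X in hev _ _ X](subnK (im : (i <= m)%N)).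
by rewrite hev_wk ?size_X1n // hev_X1n mulrC.
Qed.

Lemma size_fdiff m f : (size f <= m.+1)%N -> (size (fdiff f) <= m)%N.
Proof.
move=> sf; apply/leq_sizeP => j mj; rewrite {1}(poly_sumXn sf) /fdiff.
rewrite [_ \Po _]raddf_sum -sumrB coef_sum big1 // => -[i /= im] _.
rewrite comp_polyZ comp_Xn_poly -scalerBr coefZ coefB coefXn.
have [ij|ij|ij] := ltngtP i j.
- by rewrite [_`_j]nth_default ?size_X1n // subrr mulr0.
- by move: ij; rewrite ltnNge (leq_trans (im : (i <= m)%N) mj).
- rewrite ij; have : ('X + 1 : {poly K}) ^+ j \is monic.
    by apply: monic_exp; rewrite monicXaddC.
  by rewrite monicE lead_coefE size_X1n => /eqP ->; rewrite subrr mulr0.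
Qed.

Lemma hev_fdiff y w m f : (size f <= m.+1)%N ->
  hev y w m (fdiff f) = hev (y + w) w m f - hev y w m f.
Proof.
move=> sf; rewrite /fdiff -hev_shift //.
by rewrite addrC -scaleN1r (linf_hev y w m) rmorphN1 mulN1r addrC.
Qed.

Lemma size_iter_fdiff n m f : (size f <= m.+1)%N -> (n <= m)%N ->
  (size (iter n (@fdiff K) f) <= (m - n).+1)%N.
Proof.
move=> sf; elim: n => [|n IH] nm; first by rewrite subn0.
rewrite iterS; have -> : (m - n.+1).+1 = (m - n)%N by lia.
by apply: size_fdiff; apply: IH; lia.
Qed.

Lemma fdiff_XM (c : K) f : fdiff (('X + c%:P) * f) = ('X + (c + 1)%:P) * fdiff f + f.
Proof. rewrite /fdiff rmorphM rmorphD /= comp_polyX comp_polyC polyCD; ring. Qed.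

Lemma iter_fdiff_XM n f : iter n.+1 (@fdiff K) ('X * f) =
  ('X + (n.+1%:R)%:P) * iter n.+1 (@fdiff K) f + n.+1%:R *: iter n (@fdiff K) f.
Proof.
elim: n => [|n IH].
  by rewrite /= -[X in X * _]addr0 -polyC0 fdiff_XM add0r scale1r.
rewrite iterS IH addrC fdiffZD fdiff_XM natr1 -!iterS -[in RHS](natr1 n.+1) scalerDl scale1r.
by rewrite natr1 addrCA.
Qed.

Lemma hevM_scale y w a m f : hev (a * y) (a * w) m f = a ^+ m * hev y w m f.
Proof.
rewrite /hev mulr_sumr; apply: eq_bigr => -[i /= im] _; rewrite !exprMn.
by rewrite -{3}(subnKC (im : (i <= m)%N)) exprD; ring.
Qed.

End HomogeneousEval.

Lemma hev_comp (K : numFieldType) (b y w : fps K) m f : b 0%N = 0 ->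
  fps_comp b (hev (@fpsC K) y w m f) = hev (@fpsC K) (fps_comp b y) (fps_comp b w) m f.
Proof.
move=> b0; rewrite /hev.
elim/big_rec2: _ => [|i u v _ <-].
  by rewrite -(rmorph0 (@fpsC K)) fps_compC.
by rewrite fps_compD !fps_compM // fps_compC !fps_compXn.
Qed.

End HomogeneousEvaluation.

(** * Logarithmic derivatives and the series attached to a finite point set *)

Module ExponentialSeries.
Import structures.
Import all_boot all_order all_algebra.
Import boolp functions reals sequences exp.
Import ring lra zify.
Import PowerSeries FiniteDifferences Branching GrowthFamilies Transport TransportCoordinates HomogeneousEvaluation.
Set Implicit Arguments.
Unset Strict Implicit.
Unset Printing Implicit Defensive.
Import Order.TTheory GRing.Theory Num.Theory.
Local Open Scope ring_scope.

Section ExponentialSeries.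
Variable K : realType.

(* The solution of theta f = g f with constant term 1 (for g of constant term 0). *)
Fixpoint fps_ode_seq (g : fps K) (n : nat) : seq K :=
  if n is k.+1 then
    let s := fps_ode_seq g k in
    rcons s (k.+1%:R^-1 * \sum_(i < k.+1) g (k.+1 - i)%N * s`_i)
  else [:: 1].

Definition fps_ode (g : fps K) : fps K := fun n => (fps_ode_seq g n)`_n.

Lemma size_fps_ode_seq g n : size (fps_ode_seq g n) = n.+1.
Proof. by elim: n => //= n IH; rewrite size_rcons IH. Qed.

Lemma nth_fps_ode_seq g n i : (i <= n)%N -> (fps_ode_seq g n)`_i = fps_ode g i.
Proof.
elim: n i => [|n IH] i; first by rewrite leqn0 => /eqP ->.
rewrite leq_eqVlt => /orP[/eqP -> //|]; rewrite ltnS => le_in.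
by rewrite /= nth_rcons size_fps_ode_seq ltnS le_in IH.
Qed.

Lemma fps_odeS g n :
  fps_ode g n.+1 = n.+1%:R^-1 * \sum_(i < n.+1) g (n.+1 - i)%N * fps_ode g i.
Proof.
rewrite {1}/fps_ode /= nth_rcons size_fps_ode_seq ltnn eqxx; congr (_ * _).
by apply: eq_bigr => -[i /= ilt] _; rewrite nth_fps_ode_seq.
Qed.

Lemma fps_ode_unique (f g : fps K) : g 0%N = 0 -> f 0%N = 1 -> fps_theta f = g * f -> f = fps_ode g.
Proof.
move=> g0 f0 fg; apply/fpsP; elim/ltn_ind => -[|n] IH //.
have := congr1 (fun h => h n.+1) fg; rewrite /fps_theta /= fpsME_rev.
rewrite big_ord_recr /= subnn g0 mul0r addr0 => E.
have n0 : n.+1%:R != 0 :> K by rewrite pnatr_eq0.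
rewrite fps_odeS -[f n.+1](mulKf n0) E; congr (_ * _).
by apply: eq_bigr => i _; rewrite IH.
Qed.

(** Minus the logarithmic derivative theta log of the product of 1 - c x; the entry of index 0 is
    therefore 0 and not the number of points. *)
Definition powersums (cs : seq K) : fps K := fun k => if k is 0%N then 0 else \sum_(c <- cs) c ^+ k.

Lemma theta_prod_roots (cs : seq K) :
  fps_theta (\prod_(c <- cs) (1 - fpsC c * fpsX K)) =
  - powersums cs * \prod_(c <- cs) (1 - fpsC c * fpsX K).
Proof.
pose g c : fps K := fun k => if k is 0%N then 0 else c ^+ k.
have gE c : fps_theta (1 - fpsC c * fpsX K) = - g c * (1 - fpsC c * fpsX K).
  rewrite fps_thetaB fps_theta1 sub0r fps_thetaM fps_thetaC mul0r add0r fps_thetaX.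
  rewrite mulNr; congr (- _); apply/fpsP => n; rewrite mulrBr mulr1 fpsBE mulrCA !fpsCM [g c * _]mulrC fpsXM.
  case: n => [|[|n]].
  - by rewrite /g /fpsX /= !mulr0 subr0.
  - by rewrite /g /fpsX /= mulr1 expr1 mulr0 subr0.
  - have -> : fpsX K n.+2 = 0 by [].
    by rewrite mulr0 /g -exprS subrr.
rewrite (fps_theta_prod _ gE); congr (_ * _); apply/fpsP => n.
rewrite fps_sumE fpsNE /powersums; case: n => [|n].
  by rewrite big1 ?oppr0 // => c _; rewrite fpsNE oppr0.
by rewrite -sumrN; apply: eq_bigr.
Qed.

End ExponentialSeries.

Section FiniteN.
Variable K : realType.
Notation X := (fpsX K).
Notation C := (@fpsC K).
Notation hv := (hev (@fpsC K)).

Variables (N : nat) (l : seq K).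
Hypothesis N_gt0 : (0 < N)%N.
Hypothesis size_l : size l = N.
Let e : K := N%:R^-1.
Let P := rootpoly l.

(** With u = N/x this is (x/N)^(N-n) times Delta^n P at u. *)
Definition pser n : fps K := hv 1 (C e * X) (N - n) (iter n (@fdiff K) P).
(** X times this series is the ratio of Delta^(n+1) P to Delta^n P at u = N/x. *)
Definition vser n : fps K := C e * pser n.+1 * fps_vinv (pser n).
(** The ratio of Delta^n (u^j P) to u^j Delta^n P at u = N/x. *)
Definition Tser j n : fps K :=
  hv 1 (C e * X) (N + j - n) (iter n (@fdiff K) ('X^j * P)) * fps_vinv (pser n).

Lemma e_gt0 : 0 < e.
Proof. by rewrite invr_gt0 ltr0n. Qed.

Lemma Ne1 : N%:R * e = 1.
Proof. by rewrite divff // pnatr_eq0 -lt0n. Qed.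

Lemma size_P : size P = N.+1.
Proof. by rewrite size_prod_XsubC size_l. Qed.

Lemma size_DP n : (n <= N)%N -> (size (iter n (@fdiff K) P) <= (N - n).+1)%N.
Proof. by move=> nN; apply: size_iter_fdiff => //; rewrite size_P. Qed.

Lemma pser0E : pser 0 = \prod_(c <- l) (1 - C (c * e) * X).
Proof.
rewrite /pser subn0 -size_l hev_rootpoly; apply: eq_bigr => c _.
by rewrite rmorphM mulrA.
Qed.

Lemma hev_sigma m (f : {poly K}) : (size f <= m.+1)%N ->
  hv (1 + C e * X) (C e * X) m f = (1 + C e * X) ^+ m * fps_sigma e (hv 1 (C e * X) m f).
Proof.
move=> sf; rewrite /fps_sigma hev_comp; last by rewrite fpsXM.
rewrite fps_comp1 fps_compM ?fps_compC ?fps_compX ?fpsXM // -hevM_scale mulr1.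
have -> // : (1 + C e * X) * (C e * (X * fps_i1 e)) = C e * X.
transitivity (C e * X * ((1 + C e * X) * fps_i1 e)); first by ring.
by rewrite fps_i1M mulr1.
Qed.

Lemma pser_step n : (n < N)%N ->
  C e * X * pser n.+1 = (1 + C e * X) ^+ (N - n) * fps_sigma e (pser n) - pser n.
Proof.
move=> nN; have sD := size_DP (ltnW nN).
rewrite -hev_sigma // -hev_fdiff // -iterS /pser.
have -> : (N - n = 1 + (N - n.+1))%N by lia.
by rewrite hev_wk ?expr1 // size_DP.
Qed.

(** The constant term is the leading coefficient of Delta^n P, which the difference operator
    multiplies by the degree N - n. *)
Lemma pser_const n : (n < N)%N -> pser n.+1 0%N = (N - n)%:R * pser n 0%N.
Proof.
move=> nN; have := congr1 (fun f => f 1%N) (pser_step nN).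
have pw m : ((1 + C e * X) ^+ m) 0%N = 1 /\ ((1 + C e * X) ^+ m) 1%N = m%:R * e.
  elim: m => [|m [IH0 IH1]]; first by rewrite expr0 mul0r.
  rewrite exprS fpsM0 IH0 fpsDE fpsCM mulr0 addr0 mulr1; split=> //.
  rewrite fpsME !big_ord_recl big_ord0 /= IH0 IH1 !fpsDE !fpsCM /fpsX !fps1E /= -[m.+1%:R]natr1; ring.
rewrite -mulrA fpsCM fpsXM fpsBE fpsME !big_ord_recl big_ord0 /= (pw _).1 (pw _).2.
have -> : fps_sigma e (pser n) 0%N = pser n 0%N by rewrite /fps_sigma fps_comp_const.
have -> : fps_sigma e (pser n) 1%N = pser n 1%N.
  by rewrite fps_sigmaE !big_ord_recl big_ord0 /= expr0 fps1E expr1 fps_i1_0 /=; ring.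
have e0 : e != 0 by rewrite gt_eqF // e_gt0.
move=> E; apply: (mulfI e0).
by rewrite E; ring.
Qed.

Lemma prod_roots0 (cs : seq K) (f : K -> K) : (\prod_(c <- cs) (1 - C (f c) * X)) 0%N = 1.
Proof.
elim: cs => [|c cs IH]; first by rewrite big_nil.
by rewrite big_cons fpsM0 IH fpsBE fpsCM mulr0 subr0 mulr1.
Qed.

Lemma pser_neq0 n : (n <= N)%N -> pser n 0%N != 0.
Proof.
elim: n => [|n IH] nN.
  by rewrite pser0E prod_roots0 oner_eq0.
by rewrite pser_const // mulf_neq0 ?IH ?(ltnW nN) // pnatr_eq0 -lt0n subn_gt0.
Qed.

Lemma pserV n : (n <= N)%N -> pser n * fps_vinv (pser n) = 1.
Proof. by move=> nN; apply: fps_mul_vinv; apply: pser_neq0. Qed.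

Lemma vser_pser n : (n <= N)%N -> vser n * pser n = C e * pser n.+1.
Proof. by move=> nN; rewrite /vser -mulrA [fps_vinv _ * _]mulrC pserV // mulr1. Qed.

Lemma vser_const n : (n < N)%N -> vser n 0%N = 1 - n%:R * e.
Proof.
move=> nN; rewrite /vser !fpsM0 fps_vinv0 pser_const //= -mulrA mulfK ?pser_neq0 ?(ltnW nN) //.
by rewrite natrB ?(ltnW nN) // mulrC mulrBl Ne1.
Qed.

(** With W_n = X v_n one has 1 + W_(n+1) = (1 + W_n(u)) W_n(u+1) / W_n(u). Division is avoided by
    multiplying both sides by X, by [pser n] and by e, each of which can be cancelled. *)
Lemma vser_rec n : (n.+1 < N)%N ->
  vser n * vser n.+1 = vser n ^+ 2 - C e * fps_D e (vser n) * (1 + X * vser n).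
Proof.
move=> nN; have n1 : (n <= N)%N by lia.
have Ce : C e * C e^-1 = 1 by rewrite -rmorphM divff ?rmorph1 // gt_eqF // e_gt0.
have cancel_p f g : pser n * f = pser n * g -> f = g.
  move=> E; rewrite -[f]mul1r -[g]mul1r -(pserV n1) [pser n * _]mulrC -!mulrA.
  by rewrite E.
have cancel_e f g : C e * f = C e * g -> f = g.
  move=> E; rewrite -[f]mul1r -[g]mul1r -Ce [C e * _]mulrC -!mulrA.
  by rewrite E.
apply: fpsX_inj; apply: cancel_p; apply: cancel_e.
have E1 := vser_pser n1; have E2 := vser_pser (ltnW nN).
have S1 := pser_step (ltnW nN); have S2 := pser_step nN.
have DE := fps_DE e (vser n).
have sM f g : fps_sigma e (f * g) = fps_sigma e f * fps_sigma e g.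
  by apply: fps_compM; rewrite fpsXM.
have sC c : fps_sigma e (C c) = C c by apply: fps_compC.
have E3 : fps_sigma e (vser n) * fps_sigma e (pser n) = C e * fps_sigma e (pser n.+1).
  by rewrite -sM E1 sM sC.
have Nn : (N - n = (N - n.+1).+1)%N by lia.
have iM := fps_i1M e.
set q := 1 + C e * X in S1 S2 iM; set m := (N - n.+1)%N in S2 Nn; rewrite Nn exprS in S1.
transitivity (C e * (X * (vser n * pser n) * vser n.+1)); first by ring.
rewrite E1; transitivity (C e * (C e * X * (vser n.+1 * pser n.+1))); first by ring.
rewrite E2 mulrCA; transitivity (C e * C e * (C e * X * pser n.+2)); first by ring.
rewrite S2; transitivity (C e * (q ^+ m * (C e * fps_sigma e (pser n.+1)) - C e * pser n.+1)); first by ring.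
rewrite -E3 -E1.
have SP : q ^+ m * fps_sigma e (pser n) = fps_i1 e * (pser n * (1 + X * vser n)).
  have -> : pser n * (1 + X * vser n) = q * q ^+ m * fps_sigma e (pser n).
    rewrite -[RHS](subrK (pser n)) -S1 -mulrA [C e * _]mulrCA -E1; ring.
  by rewrite !mulrA [fps_i1 e * q]mulrC iM mul1r.
transitivity (C e * (fps_sigma e (vser n) * (q ^+ m * fps_sigma e (pser n)) - vser n * pser n)); first by ring.
rewrite SP; transitivity (C e * pser n * ((fps_i1 e * fps_sigma e (vser n)) * (1 + X * vser n) - vser n)); first by ring.
have -> : fps_i1 e * fps_sigma e (vser n) = vser n - C e * X * fps_D e (vser n) by rewrite DE; ring.
ring.
Qed.

Lemma Tser0 n : (n <= N)%N -> Tser 0 n = 1.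
Proof. by move=> nN; rewrite /Tser addn0 expr0 mul1r -/(pser n) pserV. Qed.

Lemma Tser_init j : Tser j 0 = 1.
Proof.
rewrite /Tser subn0 addnC hevM ?size_polyXn ?size_P // hevXn // subnn !expr0 expr1n !mul1r.
by have := pserV (leq0n N); rewrite /pser subn0.
Qed.

(** The Leibniz rule [iter_fdiff_XM] for u times u^j P, divided by u^(j+1) Delta^(n+1) P. *)
Lemma Tser_step j n : (n < N)%N -> Tser j.+1 n.+1 =
  (1 + C (n.+1%:R * e) * X) * Tser j n.+1 +
  C (n.+1%:R * e) * (fps_vinv (vser n) * Tser j n).
Proof.
move=> nN; have sXP : (size ('X^j * P : {poly K})%R <= (N + j).+1)%N.
  by rewrite (leq_trans (size_polyMleq _ _)) // size_polyXn size_P; lia.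
have s1 : (size (iter n.+1 (@fdiff K) ('X^j * P)%R) <= (N + j - n.+1).+1)%N.
  by apply: size_iter_fdiff => //; lia.
rewrite /Tser exprS -mulrA iter_fdiff_XM.
have -> : (N + j.+1 - n.+1 = 1 + (N + j - n.+1))%N by lia.
rewrite addrC (linf_hev _ _ _ _) addrC hevM ?size_XaddC // hev_XD mulrDl.
congr (_ + _); first by rewrite rmorphM; ring.
have -> : (1 + (N + j - n.+1) = N + j - n)%N by lia.
have n1 : (n <= N)%N by lia.
set g := hv _ _ _ _.
have vn0 : vser n 0%N != 0.
  rewrite /vser !fpsM0 fps_vinv0; apply: mulf_neq0; first apply: mulf_neq0.
  - by rewrite /fpsC /= gt_eqF // e_gt0.
  - exact: pser_neq0.
  - by rewrite invr_eq0 pser_neq0 // ltnW.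
have vi := fps_mul_vinv vn0; have pi1 := pserV n1; have pi2 := pserV nN.
have E1 := vser_pser n1.
have Ce : C e * C e^-1 = 1 by rewrite -rmorphM divff ?rmorph1 // gt_eqF // e_gt0.
(* 1 / p_(n+1) = e / (v_n p_n) *)
have -> : fps_vinv (pser n.+1) = C e * (fps_vinv (vser n) * fps_vinv (pser n)).
  transitivity ((vser n * pser n) * fps_vinv (pser n.+1) * (fps_vinv (vser n) * fps_vinv (pser n))).
    by ring: vi pi1.
  by rewrite E1; ring: pi2.
by rewrite rmorphM rmorph_nat; ring.
Qed.

End FiniteN.

End ExponentialSeries.

(** * Convergence of the initial data and of the iterated differences *)

Module SingleVariableLimit.
Import structures.
Import all_boot all_order all_algebra.
Import boolp classical_sets functions reals topology normedtype sequences exp.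
Import ring lra zify.
Import PowerSeries FiniteDifferences Branching GrowthFamilies Transport TransportCoordinates HomogeneousEvaluation ExponentialSeries.
Set Implicit Arguments.
Unset Strict Implicit.
Unset Printing Implicit Defensive.
Import Order.TTheory GRing.Theory Num.Theory numFieldNormedType.Exports.
Local Open Scope ring_scope.
Local Open Scope classical_set_scope.

Section Convergence.
Variable K : realType.

Lemma cvg_seqP (u : nat -> K) (x : K) :
  u @ \oo --> x <-> forall c : K, 0 < c -> exists N0, forall N, (N0 <= N)%N -> `|u N - x| <= c.
Proof.
split=> [/cvgrPdist_le H c c0|H].
  by have [N0 _ HN] := H _ c0; exists N0 => N NN; rewrite distrC; apply: HN.
apply/cvgrPdist_le => c c0; have [N0 HN] := H _ c0; exists N0 => // N /= NN.
by rewrite distrC; apply: HN.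
Qed.

Lemma cvg_big_sum (I : Type) (r : seq I) (F : I -> nat -> K) (G : I -> K) :
  (forall i, F i @ \oo --> G i) -> (fun N => \sum_(i <- r) F i N) @ \oo --> \sum_(i <- r) G i.
Proof.
move=> FG; elim: r => [|i r IH].
  under eq_fun do rewrite big_nil; rewrite big_nil; exact: cvg_cst.
under eq_fun do rewrite big_cons; rewrite big_cons; exact: cvgD.
Qed.

Lemma cvg_fps_ode (gN : nat -> fps K) (g : fps K) :
  (forall k, (fun N => gN N k) @ \oo --> g k) ->
  forall k, (fun N => fps_ode (gN N) k) @ \oo --> fps_ode g k.
Proof.
move=> gg; elim/ltn_ind => -[|k] IH; first exact: cvg_cst.
under eq_fun do rewrite fps_odeS; rewrite fps_odeS; apply: cvgMr.
apply: cvg_big_sum => i; apply: cvgM; [exact: gg | exact: IH].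
Qed.

Lemma pow_diff_bound (B : K) k : 0 <= B -> exists C : K, 0 <= C /\ forall y e : K, `|y| <= B -> 0 <= e <= 1 ->
  `|y ^+ k.+1 - (y - e) ^+ k.+1 - e * (k.+1%:R * y ^+ k)| <= e ^+ 2 * C.
Proof.
move=> B0; elim: k => [|k [C [C0 IH]]].
  exists 0; split=> // y e _ _; rewrite (_ : _ - _ = 0) ?normr0 ?mulr0 //; ring.
exists (B * C + C + k.+1%:R * B ^+ k); split.
  by rewrite !addr_ge0 // mulr_ge0 // exprn_ge0.
move=> y e yB e01; have /andP[e0 e1] := e01; have {}IH := IH y e yB e01.
set D := y ^+ k.+1 - _ - _ in IH.
have -> : y ^+ k.+2 - (y - e) ^+ k.+2 - e * (k.+2%:R * y ^+ k.+1) =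
    y * D - e * D - e ^+ 2 * (k.+1%:R * y ^+ k).
  rewrite /D -[k.+2%:R]natr1 ![_ ^+ k.+2]exprS ![_ ^+ k.+1]exprS; ring.
have h1 : `|y * D| <= B * (e ^+ 2 * C) by rewrite normrM ler_pM.
have h2 : `|e * D| <= e ^+ 2 * C.
  by rewrite normrM (ger0_norm e0) (le_trans (ler_piMl _ e1)).
have h3 : `|e ^+ 2 * (k.+1%:R * y ^+ k)| <= e ^+ 2 * (k.+1%:R * B ^+ k).
  rewrite normrM ger0_norm ?exprn_ge0 // ler_wpM2l ?exprn_ge0 // normrM normr_nat ler_wpM2l //.
  by rewrite normrX lerXn2r // nnegrE.
apply: le_trans (ler_normB _ _) _; apply: le_trans (lerD (ler_normB _ _) (lexx _)) _.
apply: le_trans (lerD (lerD h1 h2) h3) _; rewrite le_eqVlt; apply/orP; left; apply/eqP; ring.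
Qed.

End Convergence.

Section InitialCondition.
Variable K : realType.
Notation X := (fpsX K).
Notation C := (@fpsC K).

(** The left side is P(u+1)/P(u), a quotient of products over roots; its logarithmic derivative is a
    difference of power sums, and [fps_ode] plays the part of the exponential. *)
Lemma vser0_ode N (l : seq K) : (0 < N)%N -> size l = N ->
  1 + X * vser N l 0 =
  fps_ode (powersums [seq c / N%:R | c <- l] - powersums [seq c / N%:R - N%:R^-1 | c <- l]).
Proof.
move=> N0 sl; set e := N%:R^-1.
pose ys := [seq c / N%:R | c <- l]; pose zs := [seq c / N%:R - e | c <- l].
rewrite -/ys -/zs; set U := 1 + _.
have p0 : pser N l 0 = \prod_(c <- ys) (1 - C c * X) by rewrite (pser0E sl) big_map.
have pU : pser N l 0 * U = \prod_(c <- zs) (1 - C c * X).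
  have S : C e * X * pser N l 1 =
      hev (@fpsC K) (1 + C e * X) (C e * X) N (rootpoly l) - pser N l 0.
    by rewrite hev_sigma ?(size_P sl) // -[N in _ ^+ N](subn0 N) (pser_step N0 sl N0) /pser subn0.
  rewrite /U mulrDr mulr1 mulrCA [pser N l 0 * _]mulrC (vser_pser N0 sl) // mulrA [X * C _]mulrC.
  have R := hev_rootpoly (@fpsC K) (1 + C e * X) (C e * X) l; rewrite sl in R.
  rewrite S addrC subrK R big_map; apply: eq_bigr => c _.
  by rewrite rmorphB rmorphM /=; ring.
apply: fps_ode_unique.
- by rewrite fpsBE /powersums subrr.
- by rewrite /U fpsDE fpsXM fps1E addr0.
have pi := pserV N0 sl (leq0n N).
have T1 := theta_prod_roots ys; rewrite -p0 in T1.
have T2 := theta_prod_roots zs; rewrite -pU fps_thetaM T1 in T2.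
have E : pser N l 0 * (fps_theta U - (powersums ys - powersums zs) * U) = 0.
  by transitivity (- powersums ys * pser N l 0 * U + pser N l 0 * fps_theta U
     + powersums zs * (pser N l 0 * U)); [ring | rewrite T2; ring].
apply/eqP; rewrite -subr_eq0; apply/eqP.
by rewrite -[LHS]mul1r -pi mulrAC E mul0r.
Qed.

Variables (l : nat -> seq K) (B : K) (mom : nat -> K).
Hypothesis size_l : forall N, size (l N) = N.
Hypothesis B_ge0 : 0 <= B.
Hypothesis l_bd : forall N c, c \in l N -> `|c / N%:R| <= B.
Hypothesis mom_to : forall k, (fun N => N%:R^-1 * \sum_(c <- l N) (c / N%:R) ^+ k) @ \oo --> mom k.

(** theta applied to C_m(1/x), the sum of mom_k x^(k+1). Hence [fps_ode gmom] is exp(C_m(1/x)), and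
    [psim] is Psi(x)/x. *)
Definition gmom : fps K := fun k => if k is j.+1 then k%:R * mom j else 0.
Definition psim : fps K := fun k => fps_ode gmom k.+1.

Lemma inv_to0 : (fun N : nat => N%:R^-1 : K) @ \oo --> (0 : K).
Proof.
apply/cvg_seqP => c c0; pose m := (Num.trunc c^-1).+1.
have mc : c^-1 <= m%:R by rewrite ltW // truncnS_gt.
exists m => N mN; rewrite subr0 ger0_norm ?invr_ge0 //.
have Nm : (m%:R : K) <= N%:R by rewrite ler_nat.
by rewrite -[c]invrK lef_pV2 ?posrE ?invr_gt0 // ?(lt_le_trans _ Nm) ?ltr0n // (le_trans mc).
Qed.

(** By Taylor's formula y^(j+1) - (y - 1/N)^(j+1) = (j+1) y^j / N + O(1/N^2) uniformly on the
    bounded support, and there are N points. *)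
Lemma vser0_to k : (fun N => vser N (l N) 0 k) @ \oo --> psim k.
Proof.
pose gN N := powersums [seq c / N%:R | c <- l N] - powersums [seq c / N%:R - N%:R^-1 | c <- l N].
suff gg : forall k, (fun N => gN N k) @ \oo --> gmom k.
  move: (@cvg_fps_ode K gN gmom gg k.+1); rewrite -/(psim k); apply: cvg_trans; apply: near_eq_cvg.
  exists 1%N => // N /= N0; rewrite -/(gN N) -vser0_ode //.
  by rewrite fpsDE fpsXM fps1E add0r.
case=> [|j].
  by under eq_fun do rewrite /gN fpsBE /powersums subrr; exact: cvg_cst.
have [D [D0 HD]] := pow_diff_bound j B_ge0.
have H : (fun N => j.+1%:R * (N%:R^-1 * \sum_(c <- l N) (c / N%:R) ^+ j)) @ \oo --> j.+1%:R * mom j.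
  by apply: cvgMr; exact: mom_to.
rewrite -[gmom _]addr0.
have R : (fun N => gN N j.+1 - j.+1%:R * (N%:R^-1 * \sum_(c <- l N) (c / N%:R) ^+ j)) @ \oo --> (0 : K).
  have R0 : (fun N : nat => N%:R^-1 * D : K) @ \oo --> (0 : K).
    by rewrite -[X in _ --> X](mul0r D); apply: cvgMl; exact: inv_to0.
  have R0' : (fun N : nat => - (N%:R^-1 * D) : K) @ \oo --> (0 : K).
    by rewrite -[X in _ --> X]oppr0; apply: cvgN.
  apply: (squeeze_cvgr _ R0' R0); exists 1%N => // N /= N0; rewrite -ler_norml.
  have Np : (0 < N%:R :> K) by rewrite ltr0n.
  have e01 : 0 <= (N%:R^-1 : K) <= 1 by rewrite invr_ge0 ler0n invf_le1 // ler1n.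
  rewrite /gN fpsBE /powersums !big_map -sumrB mulrCA mulr_sumr mulr_sumr -sumrB big_seq.
  apply: le_trans (ler_norm_sum _ _ _) _.
  apply: (@le_trans _ _ (\sum_(c <- l N | c \in l N) (N%:R^-1 ^+ 2 * D))).
    by apply: ler_sum => c cl; apply: HD => //; apply: l_bd.
  rewrite -big_seq big_const_seq count_predT size_l iter_addr_0 -[leLHS]mulr_natl mulrA.
  by rewrite ler_wpM2r // expr2 mulrA divff ?mul1r // gt_eqF.
apply: cvg_trans (cvgD H R); apply: near_eq_cvg; exists 0%N => // N _.
by rewrite /= addrC subrK.
Qed.

Variables (s : K) (nN : nat -> nat).
Hypothesis s01 : 0 < s < 1.
Hypothesis nN_to : (fun N => (nN N)%:R / N%:R) @ \oo --> s.


Let e : nat -> K := fun N => N%:R^-1.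
(** Half of 1 - s, the limit of the constant term 1 - n/N at the last level; the other half leaves
    room for the convergence of n/N. *)
Let c0 : K := (1 - s) / 2.
Let good N := [/\ (0 < N)%N, ((nN N).+1 < N)%N & c0 <= 1 - (nN N).+1%:R * e N].
Let dom0 N n := good N /\ (n <= (nN N).+1)%N.
Let v : nat -> nat -> fps K := fun N n => vser N (l N) n.

Lemma mom0 : mom 0 = 1.
Proof.
rewrite -(cvg_lim _ (@mom_to 0%N)) //; apply: lim_near_cst => //; exists 1%N => // N /= N0.
under eq_bigr do rewrite expr0.
by rewrite big_const_seq count_predT size_l iter_addr_0 mulVf // pnatr_eq0 -lt0n.
Qed.

Lemma psim0 : psim 0 = 1.
Proof. by rewrite /psim fps_odeS big_ord1 subn0 invr1 mul1r mulr1 /= mul1r mom0. Qed.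

Lemma eventually_good : exists N0, forall N, (N0 <= N)%N -> good N.
Proof.
have /andP[s0 s1] := s01.
have c00 : 0 < c0 by rewrite /c0; lra.
have [N1 H1] := (cvg_seqP _ _).1 nN_to (c0 / 2) (divr_gt0 c00 (ltr0Sn _ _)).
have [N2 H2] := (cvg_seqP _ _).1 inv_to0 (c0 / 2) (divr_gt0 c00 (ltr0Sn _ _)).
exists (maxn 1 (maxn N1 N2)) => N; rewrite !geq_max => /and3P[N0 NN1 NN2].
have Np : (0 < N%:R :> K) by rewrite ltr0n.
have := H1 N NN1; have := H2 N NN2; rewrite subr0 -/(e N) !ler_norml => /andP[_ h2] /andP[_ h1].
have h3 : c0 <= 1 - (nN N).+1%:R * e N.
  rewrite -[(nN N).+1%:R]natr1 mulrDl mul1r; move: h1; rewrite -/(e N) /c0; move: h2; rewrite /c0; lra.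
split=> //; rewrite -(ltr_nat K) -(@ltr_pM2r _ (e N)) ?invr_gt0 // /e divff ?gt_eqF // -/(e N).
by move: h3; lra.
Qed.

Lemma vser_Tser_to j k :
  (fun N => fps_comp (xtau s psim) (Tser N (l N) j (nN N)) k) @ \oo --> (izhat s psim ^+ j) k.
Proof.
have /andP[s0 s1] := s01.
have c00 : 0 < c0 by rewrite /c0; lra.
have e_ge0 N : 0 <= e N by rewrite invr_ge0 ler0n.
have e_le1 N : e N <= 1.
  by case: N => [|N]; rewrite /e ?invr0 ?ler01 // invf_le1 ?ler1n // ltr0n.
have e_to0 c : 0 < c -> exists N0, forall N, (N0 <= N)%N -> e N <= c.
  move=> cp; have [N0 H] := (cvg_seqP _ _).1 inv_to0 c cp; exists N0 => N /H.
  by rewrite subr0 => h; rewrite -(ger0_norm (e_ge0 N)).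
have domN N n : dom0 N n -> (n < N)%N by case=> [[_ nl _] ?]; lia.
have dom0_down N n : dom0 N n.+1 -> dom0 N n by case=> gN nn; split=> //; lia.
have dom0_N N n : dom0 N n -> (0 < N)%N by case=> [[]].
have v_const N n : dom0 N n -> v N n 0%N = 1 - n%:R * e N.
  by move=> dN; rewrite /v vser_const ?(domN _ _ dN) ?(dom0_N _ _ dN).
have v_lb N n : dom0 N n -> c0 <= v N n 0%N.
  move=> dN; rewrite v_const //; case: dN => [[_ _ h] nn]; apply: le_trans h _.
  by rewrite lerD2l lerN2 ler_wpM2r // ler_nat.
have dom0_ne N n : dom0 N n -> n%:R * e N <= 1.
  by move=> dN; have := v_lb _ _ dN; rewrite v_const // => h; move: c00 h; lra.
have v_rec N n : dom0 N n.+1 ->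
    v N n * v N n.+1 = v N n ^+ 2 - C (e N) * fps_D (e N) (v N n) * (1 + X * v N n).
  by move=> dN; apply: vser_rec; [exact: dom0_N dN | | exact: domN dN].
have v_init : bigO e (fun N n => n = 0%N /\ dom0 N 0%N) 0 v.
  move=> i; have [N1 H1] := (cvg_seqP _ _).1 (@vser0_to i) 1 ltr01.
  (* The finitely many N before the threshold of convergence are absorbed into the constant. *)
  exists (`|psim i| + 1 + \sum_(N < N1) `|v N 0%N i|) => N _ [-> _]; rewrite expr0 mulr1.
  case: (ltnP N N1) => NN.
    rewrite (bigD1 (Ordinal NN)) //= addrCA lerDl; apply: addr_ge0; first exact: addr_ge0.
    exact: sumr_ge0.
  apply: (@le_trans _ _ (`|psim i| + 1)); last by rewrite lerDl sumr_ge0.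
  rewrite addrC -lerBlDr; apply: le_trans (H1 N NN).
  exact: lerB_dist.
have Psi0 : (X * psim) 0%N = 0 by rewrite fpsXM.
have v_lim i (c : K) : 0 < c ->
    exists N0, forall N, (N0 <= N)%N -> dom0 N 0%N -> `|(X * psim) i.+1 - v N 0%N i| <= c.
  move=> cp; have [N0 H] := (cvg_seqP _ _).1 (@vser0_to i) c cp.
  by exists N0 => N NN _; rewrite fpsXM distrC; apply: H.
have sN_to : littleo (fun N n => good N /\ n = nN N) (fun N n => C (n%:R * e N) - C s).
  move=> i c cp; have [N0 H] := (cvg_seqP _ _).1 nN_to c cp.
  exists N0 => N n NN [_ ->]; rewrite fpsBE; case: i => [|i]; first exact: H.
  by rewrite subrr normr0 ltW.
have dd N n : good N /\ n = nN N -> dom0 N n by case=> gN ->; split=> //; lia.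
have T_o : littleo (fun N n => good N /\ n = nN N)
    (fun N n => Tser N (l N) j n - th e v N n ^+ j).
  apply: littleo_sub dd _; apply: (bigO1_littleo e_ge0 e_to0).
  apply: (T_th e_ge0 e_le1 c00 dom0_down dom0_ne v_const v_lb v_rec v_init
     (T := fun j N n => Tser N (l N) j n)).
  - by move=> N n dN; apply: Tser0; [exact: dom0_N dN | | exact: ltnW (domN _ _ dN)].
  - by move=> i N dN; apply: Tser_init; [exact: dom0_N dN |].
  - by move=> i N n dN; apply: Tser_step; [exact: dom0_N dN | | exact: ltnW (domN _ _ dN)].
have s1' : 1 - s != 0 by rewrite gt_eqF //; lra.
have PsiB := Psi_bb e_ge0 e_le1 e_to0 c00 dom0_down dom0_ne v_const v_lb v_rec v_init Psi0 v_lim.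
have main := @T_to K e e_ge0 (fun N n => good N /\ n = nN N) s psim s1' psim0 v
  (fun N n => fps_vinv (v N n)) (th e v) (ith e v) (fun N n => Tser N (l N) j n) (fun N n => n%:R * e N).
apply/cvg_seqP => c cp; have [N1 H1] := eventually_good.
have lim : littleo (fun N n => good N /\ n = nN N)
    (fun N n => fps_comp (xtau s psim) (Tser N (l N) j n) - izhat s psim ^+ j).
  apply: main => //.
  - by move=> N n dN; apply: fps_mul_vinv; rewrite gt_eqF // (lt_le_trans c00 (v_lb _ _ (dd _ _ dN))).
  - by move=> N n dN; apply: (thM_ith e_ge0 c00 v_const v_lb (dd _ _ dN)).
  - exact: bigO_sub dd (v_bounded e_ge0 e_le1 c00 dom0_down dom0_ne v_const v_lb v_rec v_init).
  - exact: bigO_sub dd (th_bounded e_ge0 e_le1 c00 dom0_down dom0_ne v_const v_lb v_rec v_init).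
  - exact: bigO_sub dd (ith_bounded e_ge0 e_le1 c00 dom0_down dom0_ne v_const v_lb v_rec v_init).
  - exact: littleo_sub dd PsiB.
have [N2 H2] := lim k c cp; exists (maxn N1 N2) => N; rewrite geq_max => /andP[NN1 NN2].
by rewrite -fpsNE -fpsDE; apply: H2 => //; split=> //; apply: H1.
Qed.

End InitialCondition.

End SingleVariableLimit.

(** * Gaussian limits *)

Module SeriesTower.
Import structures.
Import all_boot all_order all_algebra.
Import boolp classical_sets functions reals topology normedtype sequences exp.
Import ring lra zify.
Import PowerSeries FiniteDifferences GrowthFamilies Transport TransportCoordinates SingleVariableLimit.
Set Implicit Arguments.
Unset Strict Implicit.
Unset Printing Implicit Defensive.
Import Order.TTheory GRing.Theory Num.Theory numFieldNormedType.Exports.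
Local Open Scope ring_scope.
Local Open Scope classical_set_scope.

Section FpsMap.
Variables (A B : comNzRingType) (h : {rmorphism A -> B}).

Definition fps_map (f : fps A) : fps B := fun n => h (f n).

Lemma fps_map_additive : {morph fps_map : f g / f - g}.
Proof. by move=> f g; apply/fpsP => n; rewrite /fps_map !fpsBE rmorphB. Qed.

Lemma fps_map_multiplicative : (fps_map 1 = 1) * {morph fps_map : f g / f * g}.
Proof.
split; first by apply/fpsP => n; rewrite /fps_map !fps1E rmorph_nat.
move=> f g; apply/fpsP => n; rewrite /fps_map !fpsME rmorph_sum.
by apply: eq_bigr => i _; rewrite rmorphM.
Qed.

HB.instance Definition _ := GRing.isZmodMorphism.Build (fps A) (fps B) fps_map fps_map_additive.
HB.instance Definition _ := GRing.isMonoidMorphism.Build (fps A) (fps B) fps_map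
  (fps_map_multiplicative.1, fps_map_multiplicative.2).

Lemma fps_map_C c : fps_map (fpsC c) = fpsC (h c).
Proof. by apply/fpsP => -[|n]; rewrite /fps_map //= rmorph0. Qed.

Lemma fps_map_X : fps_map (fpsX A) = fpsX B.
Proof. by apply/fpsP => n; rewrite /fps_map /fpsX rmorph_nat. Qed.

Lemma fps_map_theta f : fps_map (fps_theta f) = fps_theta (fps_map f).
Proof. by apply/fpsP => n; rewrite /fps_map /fps_theta rmorphM rmorph_nat. Qed.
End FpsMap.

Section FpsConst.
Variable A : comNzRingType.
Definition fps_c0 (f : fps A) : A := f 0%N.
Lemma fps_c0_additive : {morph fps_c0 : f g / f - g}.
Proof. by move=> f g; rewrite /fps_c0 fpsBE. Qed.
Lemma fps_c0_multiplicative : (fps_c0 1 = 1) * {morph fps_c0 : f g / f * g}.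
Proof. by split=> [|f g]; rewrite /fps_c0 ?fps1E ?fpsM0. Qed.
HB.instance Definition _ := GRing.isZmodMorphism.Build (fps A) A fps_c0 fps_c0_additive.
HB.instance Definition _ := GRing.isMonoidMorphism.Build (fps A) A fps_c0
  (fps_c0_multiplicative.1, fps_c0_multiplicative.2).
End FpsConst.

(** Just the closure properties that survive the passage to power series, so that the construction
    can be iterated. *)
Record limring := LimRing {
  lring :> comNzRingType;
  conv : (nat -> lring) -> lring -> Prop;
  convD : forall u v x y, conv u x -> conv v y -> conv (fun N => u N + v N) (x + y);
  convM : forall u v x y, conv u x -> conv v y -> conv (fun N => u N * v N) (x * y);
  conv_cst : forall x, conv (fun=> x) x }.

Section FpsLim.
Variable A : limring.

Definition fconv (u : nat -> fps A) (x : fps A) := forall k, conv (fun N => u N k) (x k).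

Lemma conv_sum (I : Type) (r : seq I) (F : I -> nat -> A) (G : I -> A) :
  (forall i, conv (F i) (G i)) -> conv (fun N => \sum_(i <- r) F i N) (\sum_(i <- r) G i).
Proof.
move=> FG; elim: r => [|i r IH].
  by rewrite big_nil; under eq_fun do rewrite big_nil; exact: conv_cst.
by rewrite big_cons; under eq_fun do rewrite big_cons; exact: convD.
Qed.

Lemma fconvD u v x y : fconv u x -> fconv v y -> fconv (fun N => u N + v N) (x + y).
Proof. by move=> ux vy k; rewrite fpsDE; exact: convD. Qed.

Lemma fconvM u v x y : fconv u x -> fconv v y -> fconv (fun N => u N * v N) (x * y).
Proof.
move=> ux vy k; rewrite fpsME; under eq_fun do rewrite fpsME.
by apply: conv_sum => i; exact: convM.
Qed.

Lemma fconv_cst x : fconv (fun=> x) x.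
Proof. by move=> k; exact: conv_cst. Qed.

Definition fps_lim : limring := LimRing fconvD fconvM fconv_cst.
End FpsLim.

(* Elements by which a convergent sequence may be divided. *)
Definition convreg (A : limring) (c : A) :=
  forall (u : nat -> A) x, conv (fun N => c * u N) (c * x) -> conv u x.

Section ConvReg.
Variable A : limring.
Implicit Types c d x : A.

Lemma convregM c d : convreg c -> convreg d -> convreg (c * d).
Proof.
move=> rc rd u x; rewrite -mulrA; under eq_fun do rewrite -mulrA.
by move=> /rc /rd.
Qed.

Lemma convreg_unit c d : c * d = 1 -> convreg c.
Proof.
move=> cd u x H; have := convM (conv_cst d) H.
by rewrite mulrA [d * c]mulrC cd mul1r; under eq_fun do rewrite mulrA [d * c]mulrC cd mul1r.
Qed.

Lemma convregX c n : convreg c -> convreg (c ^+ n).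
Proof.
move=> rc; elim: n => [|n IH]; last by rewrite exprS; apply: convregM.
by rewrite expr0; apply: (@convreg_unit _ 1); rewrite mulr1.
Qed.

Lemma convreg_prod (I : Type) (r : seq I) (F : I -> A) :
  (forall i, convreg (F i)) -> convreg (\prod_(i <- r) F i).
Proof.
move=> rF; elim: r => [|i r IH]; last by rewrite big_cons; apply: convregM.
by rewrite big_nil; apply: (@convreg_unit _ 1); rewrite mulr1.
Qed.

Lemma convreg_C c : convreg c -> convreg (fpsC c : fps_lim A).
Proof.
by move=> rc u x H k; apply: rc; have := H k; rewrite fpsCM; under eq_fun do rewrite fpsCM.
Qed.

Lemma convreg_X : convreg (fpsX A : fps_lim A).
Proof.
by move=> u x H k; have := H k.+1; rewrite fpsXM; under eq_fun do rewrite fpsXM.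
Qed.

(** Coefficient k + 1 of (c - X) u is c u_(k+1) - u_k, so convergence of u is recovered coefficient
    by coefficient, dividing only by c. *)
Lemma convreg_CBX c : convreg c -> convreg (fpsC c - fpsX A : fps_lim A).
Proof.
move=> rc u x H; elim => [|k IH]; apply: rc.
  have := H 0%N; rewrite mulrBl fpsBE fpsCM fpsXM subr0.
  by under eq_fun do rewrite mulrBl fpsBE fpsCM fpsXM subr0.
have := convD (H k.+1) IH; rewrite mulrBl fpsBE fpsCM fpsXM subrK.
by under eq_fun do rewrite mulrBl fpsBE fpsCM fpsXM subrK.
Qed.
End ConvReg.

Section Tower.
Variable K : realType.
Local Notation C := (@fpsC _).

Lemma K_cvgD (u v : nat -> K) (x y : K) : u @ \oo --> x -> v @ \oo --> y ->
  (fun N => u N + v N) @ \oo --> x + y.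
Proof. exact: cvgD. Qed.
Lemma K_cvgM (u v : nat -> K) (x y : K) : u @ \oo --> x -> v @ \oo --> y ->
  (fun N => u N * v N) @ \oo --> x * y.
Proof. exact: cvgM. Qed.
Lemma K_cvg_cst (x : K) : (fun _ : nat => x) @ \oo --> x.
Proof. exact: cvg_cst. Qed.

Definition base_lim : limring := @LimRing K (fun (u : nat -> K) (x : K) => u @ \oo --> x) K_cvgD K_cvgM K_cvg_cst.

Fixpoint tow (r : nat) : limring := if r is r'.+1 then fps_lim (tow r') else base_lim.

Fixpoint io (r : nat) : {rmorphism K -> tow r} :=
  if r is r'.+1 return {rmorphism K -> tow r}
  then (@fpsC (tow r') \o io r' : {rmorphism _ -> _})
  else (@idfun K : {rmorphism _ -> _}).

(** The series read in variable number a, counted from the outermost one. For a >= r there is no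
    such variable and the constant term results. *)
Fixpoint emb (r a : nat) : {rmorphism fps K -> tow r} :=
  match r return {rmorphism fps K -> tow r} with
  | 0 => (@fps_c0 K : {rmorphism _ -> _})
  | r'.+1 => match a with
    | 0 => (fps_map (io r') : {rmorphism _ -> _})
    | a'.+1 => (@fpsC (tow r') \o emb r' a' : {rmorphism _ -> _})
    end
  end.

Lemma emb_C r a c : emb r a (C c) = io r c.
Proof.
elim: r a => [|r IH] [|a] //=; first by rewrite fps_map_C.
by rewrite IH.
Qed.

(** Exponents are listed from the outermost variable inwards; missing ones count as 0. *)
Fixpoint coef r (ts : seq nat) : tow r -> K :=
  match r return tow r -> K with
  | 0 => fun f => f
  | r'.+1 => fun f => coef (behead ts) ((f : fps (tow r')) (head 0%N ts))
  end.

Lemma coefD r ts (f g : tow r) : coef ts (f + g) = coef ts f + coef ts g.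
Proof. by elim: r ts f g => [|r IH] ts f g //=; rewrite fpsDE IH. Qed.

Lemma coef_io r ts c (f : tow r) : coef ts (io r c * f) = c * coef ts f.
Proof. by elim: r ts f => [|r IH] ts f //=; rewrite fpsCM IH. Qed.

Lemma coef0 r ts : coef ts (0 : tow r) = 0.
Proof. by elim: r ts => [|r IH] ts //=. Qed.

Lemma coef_sum (I : Type) (s : seq I) r ts (F : I -> tow r) :
  coef ts (\sum_(i <- s) F i) = \sum_(i <- s) coef ts (F i).
Proof. by elim: s => [|i s IH]; rewrite ?big_nil ?coef0 // !big_cons coefD IH. Qed.

Lemma conv_coef r ts (u : nat -> tow r) x : conv u x -> (fun N => coef ts (u N)) @ \oo --> coef ts x.
Proof. by elim: r ts u x => [|r IH] ts u x //= H; apply: IH; exact: H. Qed.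

Lemma coef_emb0 r ts (f : fps K) (g : tow r) :
  coef ts (emb r.+1 0 f * (C g : tow r.+1)) = f (head 0%N ts) * coef (behead ts) g.
Proof. by rewrite /= mulrC fpsCM mulrC coef_io. Qed.

Lemma convreg_io r c : c != 0 -> convreg (io r c).
Proof. by move=> c0; apply: (@convreg_unit _ _ (io r c^-1)); rewrite -rmorphM divff // rmorph1. Qed.

Lemma convreg_embX r a : (a < r)%N -> convreg (emb r a (fpsX K)).
Proof.
elim: r a => [|r IH] [|a] //= ar; last by apply: convreg_C; apply: IH.
by rewrite fps_map_X; exact: convreg_X.
Qed.

(** The Vandermonde product of f in the r variables. The recursion on the outermost variable
    displays each new factor as a constant minus a series in that variable, the form needed to
    cancel it. *)
Fixpoint vd r (f : fps K) : tow r :=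
  match r return tow r with
  | 0 => 1
  | r'.+1 => (C (vd r' f) * \prod_(b < r') (C (emb r' b f) - fps_map (io r') f) : fps (tow r'))
  end.

Lemma vdE r f : vd r f = \prod_(i < r) \prod_(j < r | (i < j)%N) (emb r j f - emb r i f).
Proof.
elim: r => [|r IH]; first by rewrite big_ord0.
rewrite big_ord_recl /= mulrC; congr (_ * _).
  by rewrite [RHS]big_mkcond big_ord_recl /= mul1r; apply: eq_bigr.
rewrite IH rmorph_prod; apply: eq_bigr => i _.
rewrite rmorph_prod [RHS]big_mkcond big_ord_recl /= mul1r [LHS]big_mkcond; apply: eq_bigr => j _.
by rewrite /bump /= !add1n ltnS rmorphB.
Qed.

Lemma convreg_vdX r : convreg (vd r (fpsX K)).
Proof.
elim: r => [|r IH] /=; first by apply: (@convreg_unit _ _ 1); rewrite mulr1.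
apply: convregM; first exact: convreg_C.
apply: convreg_prod => b; rewrite fps_map_X; apply: convreg_CBX.
exact: convreg_embX.
Qed.

Fixpoint pe r (f : fps K) : tow r :=
  match r return tow r with
  | 0 => 1
  | r'.+1 => (fps_map (io r') f * C (pe r' f) : fps (tow r'))
  end.

Lemma peE r f : pe r f = \prod_(i < r) emb r i f.
Proof.
elim: r => [|r IH]; first by rewrite big_ord0.
rewrite big_ord_recl /= IH rmorph_prod; congr (_ * _).
Qed.

Lemma peM r f g : pe r (f * g) = pe r f * pe r g.
Proof. by rewrite !peE -big_split; apply: eq_bigr => i _; rewrite rmorphM. Qed.

Lemma pe1 r : pe r 1 = 1.
Proof. by rewrite peE big1 // => i _; rewrite rmorph1. Qed.

Lemma coef_pe r ts f : size ts = r -> coef ts (pe r f) = \prod_(t <- ts) f t.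
Proof.
elim: r ts => [|r IH] [|t ts] // sz; first by rewrite big_nil.
by rewrite big_cons -(IH ts) ?coef_emb0 //; case: sz.
Qed.

Section Kernel.
Variables (a : K) (zh izh : fps K).
Hypothesis a0 : a != 0.
Hypothesis zh0 : zh 0%N = a.
Hypothesis zhM : zh * izh = 1.

(* The outer variable is tau, the inner one tau'. *)
Definition ker : fps (fps K) := fun p q =>
  ((p == 0) && (q == 0))%:R - a^-1 * (if (p == 0) || (q == 0) then 0 else zh (p + q)%N).

(** In t = 1/tau this says that [ker] is (zeta(t) - zeta(t')) / (a (t - t')), the generating kernel
    of the Faber polynomials of zeta, cleared of denominators. *)
Lemma kerE : fps_map (@fpsC K) zh * C (fpsX K) - fpsX _ * C zh =
  C (C a) * (C (fpsX K) - fpsX _) * ker.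
Proof.
apply/fpsP => p; apply/fpsP => q.
rewrite -mulrA [_ * ker]mulrBl !(fpsBE, fpsXM, fpsCM) [fps_map _ _ * _]mulrC !fpsCM.
case: p => [|p].
  rewrite subr0 fps0E subr0 !fpsXM /fps_map /ker /fpsC; case: q => [|q] //=; first by rewrite mulr0.
  by case: q => [|q] /=; rewrite ?zh0; ring.
rewrite /fps_map; case: p => [|p]; case: q => [|[|q]];
  rewrite ?fpsXM /ker /fpsC /= ?fps0E ?addSn ?addnS ?addn0 ?add0n ?zh0 /=; field; exact: a0.
Qed.

Lemma ker0 : ker 0%N = 1.
Proof. by apply/fpsP => q; rewrite /ker /= mulr0 subr0 fps1E. Qed.

Let cu : {rmorphism fps K -> fps (fps K)} := fps_map (@fpsC K).

Lemma xtau_ker (x := fpsX K * izh) :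
  C x - cu x = C izh * cu izh * C (C a) * (C (fpsX K) - fpsX _) * ker.
Proof.
have zC : (C zh : fps (fps K)) * C izh = 1 by rewrite -rmorphM zhM rmorph1.
have zM : cu zh * cu izh = 1 by rewrite -rmorphM zhM rmorph1.
transitivity (C izh * cu izh * (cu zh * C (fpsX K) - fpsX _ * C zh)).
  rewrite !rmorphM /= /cu fps_map_X -/cu.
  transitivity ((cu zh * cu izh) * (C (fpsX K) * C izh) - (C zh * C izh) * (fpsX _ * cu izh)).
    by rewrite zC zM !mul1r.
  by ring.
by rewrite kerE; ring.
Qed.

(* -theta_tau log ker, and its inverse ingredients in the tower. *)
Definition Dk : fps (fps K) := - fps_theta ker * fps_inv ker.

Definition kb r b : fps (tow r) := fps_map (emb r b) ker.
Definition ikb r b : fps (tow r) := fps_map (emb r b) (fps_inv ker).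

Lemma kbV r b : kb r b * ikb r b = 1.
Proof. by rewrite -rmorphM fps_mulV ?ker0 // rmorph1. Qed.

Lemma theta_ikb r b : fps_theta (ikb r b) = fps_map (emb r b) Dk * ikb r b.
Proof.
rewrite -fps_map_theta -rmorphM; congr fps_map.
have kV := fps_mulV ker0.
have T := congr1 (@fps_theta _) kV; rewrite fps_thetaM fps_theta1 in T.
transitivity (ker * fps_inv ker * fps_theta (fps_inv ker)); first by rewrite kV mul1r.
transitivity (fps_inv ker * (fps_theta ker * fps_inv ker + ker * fps_theta (fps_inv ker) - fps_theta ker * fps_inv ker)); first by ring.
by rewrite T /Dk; ring.
Qed.

Fixpoint kk r : tow r :=
  match r return tow r with
  | 0 => 1
  | r'.+1 => (C (kk r') * \prod_(b < r') kb r' b : fps (tow r'))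
  end.

(** The inverse of the product of the kernels over all pairs of variables; it will be the limit of
    the joint moments of Y. *)
Fixpoint GG r : tow r :=
  match r return tow r with
  | 0 => 1
  | r'.+1 => (C (GG r') * \prod_(b < r') ikb r' b : fps (tow r'))
  end.

Lemma kkG r : kk r * GG r = 1.
Proof.
elim: r => [|r IH] /=; first by rewrite mulr1.
rewrite mulrACA -rmorphM IH rmorph1 mul1r -big_split big1 // => b _.
exact: kbV.
Qed.

(** [xtau_ker] splits every difference 1/zeta_i - 1/zeta_j; a variable occurs in r - 1 pairs and
    there are r (r - 1)/2 pairs in all. *)
Lemma vd_xtau r (x := fpsX K * izh) :
  vd r x = io r a ^+ 'C(r, 2) * pe r izh ^+ r.-1 * vd r (fpsX K) * kk r.
Proof.
elim: r => [|r IH]; first by rewrite /= expr0 !mulr1.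
have Eb (b : nat) : C (emb r b x) - fps_map (io r) x =
  C (emb r b izh) * fps_map (io r) izh * C (io r a) *
   (C (emb r b (fpsX K)) - fps_map (io r) (fpsX K)) * kb r b.
  have := congr1 (fps_map (emb r b)) xtau_ker.
  have h f : fps_map (emb r b) (cu f) = fps_map (io r) f.
    by apply/fpsP => n; rewrite /fps_map /= emb_C.
  rewrite rmorphB /= fps_map_C h => ->.
  by rewrite !rmorphM rmorphB /= h !fps_map_C !fps_map_X emb_C.
have pr : pe r izh ^+ r.-1 * pe r izh = pe r izh ^+ r.
  by case: r {IH Eb} => [|r]; rewrite ?expr0 ?mulr1 // -exprSr.
have -> : vd r.+1 x = (C (vd r x) * \prod_(b < r) (C (emb r b x) - fps_map (io r) x) : fps (tow r)) by [].
rewrite IH (eq_bigr _ (fun (b : 'I_r) _ => Eb b)) !big_split /= !prodr_const card_ord.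
rewrite -rmorph_prod -peE binS bin1 exprD [(_ * C (pe r izh)) ^+ r]exprMn.
rewrite -[in RHS](rmorphXn _ r (pe r izh)) -pr !rmorphM /=.
set V := \prod_(i < r) _; set W := \prod_(i < r) _; set U := (C (io r a)) ^+ r.
rewrite -[C (io r a ^+ _)]/(C (io r a ^+ _)) rmorphXn.
set S := C (io r a) ^+ _; set z := fps_map (io r) izh ^+ r.
set p1 := C (pe r izh ^+ r.-1); set p2 := C (pe r izh); set v := C (vd r _); set k := C (kk r).
clearbody V W U S z p1 p2 v k; clear; ring.
Qed.

Lemma theta_GG r : fps_theta (GG r.+1 : fps (tow r)) =
  (\sum_(b < r) fps_map (emb r b) Dk) * (GG r.+1 : fps (tow r)).
Proof.
rewrite /= fps_thetaM fps_thetaC mul0r add0r mulrCA; congr (_ * _).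
by rewrite (fps_theta_prod _ (fun b : 'I_r => theta_ikb r b)).
Qed.

(** The logarithmic derivative in the outermost variable is a sum over the others. Read
    coefficientwise, this is the source of the Stein equation. *)
Lemma GG_rec r k : k%:R * (GG r.+1 : fps (tow r)) k =
  \sum_(j < k.+1) (\sum_(b < r) emb r b (Dk j)) * (GG r.+1 : fps (tow r)) (k - j)%N.
Proof.
have := congr1 (fun f => f k) (theta_GG r); rewrite {1}/fps_theta => ->.
by rewrite fpsME; apply: eq_bigr => j _; rewrite fps_sumE.
Qed.

(** After [vd_xtau] both sides contain the same factor, which is not a unit but is [convreg];
    cancelling it leaves the convergence of U times the product of kernels to 1. *)
Lemma conv_G r (U : nat -> tow r) (c : K) : c != 0 ->
  conv (fun N => U N * vd r (fpsX K * izh)) (io r c * (pe r izh ^+ r.-1 * vd r (fpsX K))) ->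
  c = a ^+ 'C(r, 2) -> conv U (GG r).
Proof.
move=> c0 H cE; have G := kkG r.
apply: (@convreg_unit _ (kk r) (GG r) G); rewrite G.
have rg : convreg (io r c * (pe r izh ^+ r.-1 * vd r (fpsX K))).
  apply: convregM; first exact: convreg_io.
  apply: convregM; last exact: convreg_vdX.
  apply: convregX; apply: (@convreg_unit _ _ (pe r zh)).
  by rewrite -peM mulrC zhM pe1.
apply: rg; rewrite mulr1; move: H; congr (conv _ _); apply/funext => N.
by rewrite vd_xtau cE rmorphXn; ring.
Qed.
End Kernel.

End Tower.

End SeriesTower.

(** * From the Stein equation to Wick's formula *)

Module SteinEquation.
Import Reals ZArith.
Import Defs.
Import structures.
Import all_boot all_order all_algebra.
Import boolp classical_sets functions reals topology normedtype sequences exp.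
Import ring lra zify.
Import PowerSeries GrowthFamilies SingleVariableLimit SeriesTower.
Set Implicit Arguments.
Unset Strict Implicit.
Unset Printing Implicit Defensive.
Import Order.TTheory GRing.Theory Num.Theory numFieldNormedType.Exports.
Local Open Scope ring_scope.
Local Open Scope classical_set_scope.

Section Gaussian.
Variables (K : realType) (T : Type) (E : nat -> (T -> K) -> K) (Y : nat -> T -> fps K) (D : nat -> fps K).
Hypothesis ED : forall N f g, E N (fun t => f t + g t) = E N f + E N g.
Hypothesis EZ : forall N c f, E N (fun t => c * f t) = c * E N f.
Hypothesis Y0 : forall N t, Y N t 0%N = 1.
Hypothesis D0 : forall j, D j 0%N = 0.
Notation rv := (nat -> T -> K).
Implicit Types (V W : rv) (ts : seq nat).

Definition Ys ts : rv := fun N t => \prod_(k <- ts) Y N t k.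

(* D_j acts as the derivation with delta_j Y(tau) = D_j(tau) Y(tau). *)
Fixpoint dYs j ts : rv := fun N t =>
  if ts is k :: ts' then (D j * Y N t) k * Ys ts' N t + Y N t k * dYs j ts' N t else 0.

Definition nice V := forall ts, exists x : K, (fun N => E N (fun t => V N t * Ys ts N t)) @ \oo --> x.

Definition stein V (dV : nat -> rv) := forall k ts,
  (fun N => k%:R * E N (fun t => Y N t k * Ys ts N t * V N t) -
     \sum_(j < k.+1) E N (fun t => Y N t (k - j)%N * (Ys ts N t * dV j N t + dYs j ts N t * V N t)))
  @ \oo --> (0 : K).

Definition good V dV := [/\ nice V, forall j, nice (dV j) & stein V dV].

Hypothesis good1 : good (fun _ _ => 1) (fun _ _ _ => 0).

Lemma cvg_eq (u v : nat -> K) (x y : K) : (forall N, u N = v N) -> x = y -> u @ \oo --> x -> v @ \oo --> y.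
Proof. by move=> uv ->; have -> : u = v by apply/funext. Qed.

Lemma cvg_sum0 (I : Type) (r : seq I) (F : I -> nat -> K) :
  (forall i, F i @ \oo --> (0 : K)) -> (fun N => \sum_(i <- r) F i N) @ \oo --> (0 : K).
Proof.
move=> F0; have := @cvg_big_sum _ _ r F _ F0; by rewrite big1.
Qed.

Lemma cvg_scale (c : K) (u : nat -> K) x : u @ \oo --> x -> (fun N => c * u N) @ \oo --> c * x.
Proof. by move=> H; apply: K_cvgM => //; exact: K_cvg_cst. Qed.

Lemma E_ext N f g : (forall t, f t = g t) -> E N f = E N g.
Proof. by move=> fg; congr E; apply/funext. Qed.

Lemma E0 N : E N (fun=> 0) = 0.
Proof. by have := EZ N 0 (fun=> 0); under eq_fun do rewrite mul0r; rewrite mul0r. Qed.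

Lemma E_sum N (I : Type) (r : seq I) (F : I -> T -> K) :
  E N (fun t => \sum_(i <- r) F i t) = \sum_(i <- r) E N (F i).
Proof.
elim: r => [|i r IH]; first by rewrite big_nil -[RHS](E0 N); congr E; apply/funext => t; rewrite big_nil.
by rewrite big_cons -IH -ED; congr E; apply/funext => t; rewrite big_cons.
Qed.

Lemma nice_ext V W : (forall N t, V N t = W N t) -> nice V -> nice W.
Proof. by move=> VW; congr nice; apply/funext => N; apply/funext => t. Qed.

Lemma nice0 : nice (fun _ _ => 0).
Proof.
move=> ts; exists 0; under eq_fun do (under eq_fun do rewrite mul0r; rewrite E0).
exact: cvg_cst.
Qed.

Lemma niceD V W : nice V -> nice W -> nice (fun N t => V N t + W N t).
Proof.
move=> nV nW ts; have [x Hx] := nV ts; have [y Hy] := nW ts; exists (x + y).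
have -> : (fun N => E N (fun t => (V N t + W N t) * Ys ts N t)) =
    (fun N => E N (fun t => V N t * Ys ts N t) + E N (fun t => W N t * Ys ts N t)).
  by apply/funext => N; rewrite -ED; congr E; apply/funext => t; rewrite mulrDl.
exact: cvgD.
Qed.

Lemma niceZ c V : nice V -> nice (fun N t => c * V N t).
Proof.
move=> nV ts; have [x Hx] := nV ts; exists (c * x).
have -> : (fun N => E N (fun t => (c * V N t) * Ys ts N t)) =
    (fun N => c * E N (fun t => V N t * Ys ts N t)).
  by apply/funext => N; rewrite -EZ; congr E; apply/funext => t; rewrite mulrA.
exact: cvgMr.
Qed.

Lemma nice_sum (I : Type) (r : seq I) (F : I -> rv) : (forall i, nice (F i)) ->
  nice (fun N t => \sum_(i <- r) F i N t).
Proof.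
move=> nF; elim: r => [|i r IH].
  by apply: nice_ext nice0 => N t; rewrite big_nil.
by apply: nice_ext (niceD (nF i) IH) => N t; rewrite big_cons.
Qed.

Lemma nice_Y m V : nice V -> nice (fun N t => Y N t m * V N t).
Proof.
move=> nV ts; have [x Hx] := nV (m :: ts); exists x; apply: cvg_eq Hx => // N.
by apply: E_ext => t; rewrite /Ys big_cons; ring.
Qed.

(** The coefficients of theta log Y; the power sums are linear functions of them. *)
Definition La N t : fps K := fps_theta (Y N t) * fps_inv (Y N t).

Lemma LaY N t : La N t * Y N t = fps_theta (Y N t).
Proof. by rewrite /La -mulrA [fps_inv _ * _]mulrC fps_mulV // mulr1. Qed.

(** Newton's identities, solved for the highest power sum. *)
Lemma newton N t m : La N t m = m%:R * Y N t m - \sum_(j < m) La N t j * Y N t (m - j)%N.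
Proof.
have := congr1 (fun f => f m) (LaY N t); rewrite fpsME big_ord_recr /= subnn Y0 mulr1.
by rewrite /fps_theta => <-; rewrite addrC addrK.
Qed.

Lemma nice_DY j m V : nice V -> nice (fun N t => (D j * Y N t) m * V N t).
Proof.
move=> nV; apply: (@nice_ext (fun N t => \sum_(i < m.+1) D j i * (Y N t (m - i)%N * V N t))).
  by move=> N t; rewrite fpsME mulr_suml; apply: eq_bigr => i _; ring.
by apply: (@nice_sum _ _ (fun (i : 'I_m.+1) N t => D j i * (Y N t (m - i)%N * V N t))) => i; apply/niceZ/nice_Y.
Qed.

Lemma good_ext V W dV dW : (forall N t, V N t = W N t) ->
  (forall j N t, dV j N t = dW j N t) -> good V dV -> good W dW.
Proof.
move=> VW dVW; suff [-> ->] : V = W /\ dV = dW by [].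
split; first by apply/funext => N; apply/funext => t.
by apply/funext => j; apply/funext => N; apply/funext => t.
Qed.

Lemma good0 : good (fun _ _ => 0) (fun _ _ _ => 0).
Proof.
split; [exact: nice0 | by move=> j; exact: nice0 | move=> k ts].
apply: (@cvg_eq (fun=> 0) _ 0) => // [N|]; last exact: cvg_cst.
rewrite (@E_ext N _ (fun=> 0)) ?E0 ?mulr0 ?big1 ?subrr // => [j _|t]; last by rewrite mulr0.
by rewrite -[RHS](E0 N); apply: E_ext => t; rewrite !mulr0 addr0 mulr0.
Qed.

Lemma good_lin c V dV W dW : good V dV -> good W dW ->
  good (fun N t => c * V N t + W N t) (fun j N t => c * dV j N t + dW j N t).
Proof.
case=> nV ndV sV [nW ndW sW]; split.
- exact: niceD (niceZ c nV) nW.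
- by move=> j; apply: niceD (niceZ c (ndV j)) (ndW j).
move=> k ts; apply: cvg_eq (K_cvgD (@cvg_scale c _ _ (sV k ts)) (sW k ts)) => [N|]; last by rewrite mulr0 addr0.
rewrite /= mulrBr addrACA -opprD; congr (_ - _).
  by rewrite mulrCA -mulrDr; congr (_ * _); rewrite -EZ -ED; apply: E_ext => t; ring.
by rewrite mulr_sumr -big_split; apply: eq_bigr => j _ /=; rewrite -EZ -ED; apply: E_ext => t; ring.
Qed.

Lemma good_sum (I : Type) (r : seq I) (F : I -> rv) dF : (forall i, good (F i) (dF i)) ->
  good (fun N t => \sum_(i <- r) F i N t) (fun j N t => \sum_(i <- r) dF i j N t).
Proof.
move=> gF; elim: r => [|i r IH].
  by apply: good_ext good0 => [N t|j N t]; rewrite big_nil.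
by apply: good_ext (good_lin 1 (gF i) IH) => [N t|j N t]; rewrite big_cons mul1r.
Qed.

(** The Stein equation is imposed against all products of coefficients of Y, so one more factor can
    be moved from the product into V. *)
Lemma good_Y m V dV : good V dV ->
  good (fun N t => Y N t m * V N t) (fun j N t => Y N t m * dV j N t + (D j * Y N t) m * V N t).
Proof.
case=> nV ndV sV; split; first exact: nice_Y.
  by move=> j; apply: niceD; [exact: nice_Y | exact: nice_DY].
move=> k ts; apply: cvg_eq (sV k (m :: ts)) => // N; congr (_ * _ - _).
  by apply: E_ext => t; rewrite /Ys big_cons; ring.
by apply: eq_bigr => j _; apply: E_ext => t; rewrite /= /Ys big_cons; ring.
Qed.

Lemma newton_D N t j m : m%:R * (D j * Y N t) m =
  \sum_(i < m) (La N t i * (D j * Y N t) (m - i)%N + i%:R * D j i * Y N t (m - i)%N) + m%:R * D j m.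
Proof.
have Th : fps_theta (D j * Y N t) = La N t * (D j * Y N t) + fps_theta (D j) * Y N t.
  by rewrite fps_thetaM -LaY; ring.
have := congr1 (fun f => f m) Th; rewrite /fps_theta -/(fps_theta _) => ->.
rewrite fpsDE fpsME [X in _ + X]fpsME !big_ord_recr /= subnn Y0 mulr1 fpsM0 D0 !mul0r mulr0 addr0.
by rewrite addrA -big_split.
Qed.

(** By Newton's identities [La] m is a combination of Y_m and of products of earlier [La] with Y, so
    the property passes up by strong induction; [newton_D] identifies the derivative, delta_j La_m =
    m D_j(m). *)
Lemma good_La m V dV : good V dV ->
  good (fun N t => La N t m * V N t) (fun j N t => La N t m * dV j N t + m%:R * D j m * V N t).
Proof.
elim/ltn_ind: m V dV => m IH V dV gV.
have G1 := good_lin m%:R (good_Y m gV) good0.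
have G2 := good_sum (index_enum 'I_m) (fun i : 'I_m => IH i (ltn_ord i) _ _ (good_Y (m - i) gV)).
apply: good_ext (good_lin (-1) G2 G1) => [N t|j N t] /=.
  rewrite newton mulrBl mulr_suml mulN1r addr0 addrC mulrA; congr (_ - _).
  by apply: eq_bigr => i _; ring.
have := newton_D N t j m => ND.
rewrite addr0 mulrDr !mulrA ND newton mulN1r.
rewrite (_ : \sum_(i <- _) _ = \sum_(i < m) (La N t i * Y N t (m - i)%N) * dV j N t +
  \sum_(i < m) (La N t i * (D j * Y N t) (m - i)%N + i%:R * D j i * Y N t (m - i)%N) * V N t).
  by rewrite -!mulr_suml; ring.
by rewrite -big_split; apply: eq_bigr => i _ /=; ring.
Qed.

(** The asymptotic mean of the coefficients of theta log Y. It arises because delta_j also acts on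
    the factor Y that accompanies a coefficient in the induction. *)
Definition mu : fps K := fun m => - \sum_(j < m.+1) D j (m - j)%N.

Lemma mu_Y N t k : \sum_(j < k) (mu j * Y N t (k - j)%N + (D j * Y N t) (k - j)%N) = - mu k.
Proof.
suff H : \sum_(j < k.+1) (mu j * Y N t (k - j)%N + (D j * Y N t) (k - j)%N) = 0.
  by move: H; rewrite big_ord_recr /= subnn Y0 fpsM0 D0 mul0r addr0 mulr1 => /eqP; rewrite addr_eq0 => /eqP.
rewrite big_split /=.
have -> : \sum_(j < k.+1) (D j * Y N t) (k - j)%N = ((\sum_(j < k.+1) fpsX K ^+ j * D j) * Y N t) k.
  rewrite mulr_suml fps_sumE; apply: eq_bigr => j _; rewrite -mulrA fpsXnM.
  by rewrite -ltnS ltn_ord.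
rewrite fpsME -big_split big1 // => m _ /=; rewrite -mulrDl.
suff -> : (\sum_(j < k.+1) fpsX K ^+ j * D j) m = - mu m by rewrite subrr mul0r.
rewrite /mu opprK fps_sumE (big_ord_widen k.+1 (fun j => D j (m - j)%N)) // big_mkcond [RHS]big_mkcond.
by apply: eq_bigr => j _; rewrite fpsXnM ltnS; case: ltnP.
Qed.

(** From the equation for Y_k subtract those already known for [La] j, j < k, tested against Y_(k-j)
    V. What is left over apart from dV_k sums to mu_k by [mu_Y]. *)
Lemma stein_La k V dV : good V dV ->
  (fun N => E N (fun t => La N t k * V N t) - mu k * E N (V N) - E N (dV k N)) @ \oo --> (0 : K).
Proof.
elim/ltn_ind: k V dV => k IH V dV gV; have [_ _ sV] := gV.
have S1 := sV k [::].
have S2 : (fun N => \sum_(j < k) (E N (fun t => La N t j * (Y N t (k - j)%N * V N t))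
   - mu j * E N (fun t => Y N t (k - j)%N * V N t)
   - E N (fun t => Y N t (k - j)%N * dV j N t + (D j * Y N t) (k - j)%N * V N t))) @ \oo --> (0 : K).
  apply: (@cvg_sum0 _ _ (fun (j : 'I_k) N => _)) => j.
  by apply: (IH _ (ltn_ord j) _ _ (good_Y (k - j) gV)).
apply: cvg_eq (K_cvgD S1 (@cvg_scale (-1) _ _ S2)) => [N|]; last by rewrite mulr0 addr0.
rewrite mulN1r big_ord_recr /= subnn.
have -> : E N (fun t => La N t k * V N t) = k%:R * E N (fun t => Y N t k * V N t)
    - \sum_(j < k) E N (fun t => La N t j * (Y N t (k - j)%N * V N t)).
  rewrite -EZ -E_sum -mulN1r -EZ -ED; apply: E_ext => t.
  by rewrite newton mulrBl mulr_suml mulN1r mulrA; congr (_ - _); apply: eq_bigr => j _; ring.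
have -> : mu k * E N (V N) = - \sum_(j < k) (mu j * E N (fun t => Y N t (k - j)%N * V N t) +
    E N (fun t => (D j * Y N t) (k - j)%N * V N t)).
  transitivity (-1 * E N (fun t => - mu k * V N t)).
    by rewrite EZ mulrA mulN1r opprK.
  rewrite mulN1r; congr (- _); rewrite (@E_ext N _ (fun t => \sum_(j < k)
    (mu j * (Y N t (k - j)%N * V N t) + (D j * Y N t) (k - j)%N * V N t))).
    by rewrite E_sum; apply: eq_bigr => j _; rewrite -EZ -ED.
  by move=> t; rewrite -(mu_Y N t k) mulr_suml; apply: eq_bigr => j _; ring.
rewrite !sumrB; set S2' := \sum_(i < k) mu i * _.
rewrite [X in _ - (_ - _ - X)](eq_bigr (fun j : 'I_k => E N (fun t => Y N t (k - j)%N * dV j N t) +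
   E N (fun t => (D j * Y N t) (k - j)%N * V N t))); last by move=> j _; rewrite -ED.
rewrite !big_split /= -/S2'.
rewrite [E N (fun t => Y N t 0 * _)](@E_ext N _ (dV k N)); last by move=> t; rewrite Y0 /Ys big_nil; ring.
rewrite [E N (fun t => _ * Ys [::] N t * _)](@E_ext N _ (fun t => Y N t k * V N t)); last by move=> t; rewrite /Ys big_nil; ring.
rewrite [X in _ - (X + E N (dV k N))](eq_bigr (fun j : 'I_k => E N (fun t => Y N t (k - j)%N * dV j N t))).
  ring.
by move=> j _; apply: E_ext => t; rewrite /Ys big_nil; ring.
Qed.

Variable A : nat -> nat -> K.

Definition Pk k : rv := fun N t => \sum_(j < k.+1) A k j * (La N t j - mu j).
(** The derivative delta_j of [Pk] k. It is deterministic, which is why the recursion for moments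
    closes. *)
Definition cA k j : K := \sum_(i < k.+1) A k i * (i%:R * D j i).
Definition covA k k' : K := \sum_(j < k.+1) A k j * cA k' j.

Lemma good_Pk k V dV : good V dV ->
  good (fun N t => Pk k N t * V N t) (fun j N t => Pk k N t * dV j N t + cA k j * V N t).
Proof.
move=> gV.
have G (i : 'I_k.+1) := good_lin (A k i) (good_La i gV) (good_lin (- (A k i * mu i)) gV good0).
apply: good_ext (good_sum (index_enum 'I_k.+1) G) => [N t|j N t].
  by rewrite /Pk mulr_suml; apply: eq_bigr => i _; ring.
by rewrite /Pk /cA !mulr_suml -big_split; apply: eq_bigr => i _ /=; ring.
Qed.

Lemma stein_Pk k V dV : good V dV ->
  (fun N => E N (fun t => Pk k N t * V N t) - \sum_(j < k.+1) A k j * E N (dV j N)) @ \oo --> (0 : K).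
Proof.
move=> gV.
have S : (fun N => \sum_(j < k.+1) A k j * (E N (fun t => La N t j * V N t) - mu j * E N (V N) - E N (dV j N)))
    @ \oo --> (0 : K).
  apply: (@cvg_sum0 _ _ (fun (j : 'I_k.+1) N => _)) => j.
  by apply: cvg_eq (@cvg_scale (A k j) _ _ (stein_La j gV)) => //; rewrite mulr0.
apply: cvg_eq S => // N.
have -> : E N (fun t => Pk k N t * V N t) =
    E N (fun t => \sum_(j < k.+1) A k j * (La N t j * V N t + - mu j * V N t)).
  by apply: E_ext => t; rewrite /Pk mulr_suml; apply: eq_bigr => j _; ring.
by rewrite E_sum -sumrB; apply: eq_bigr => j _; rewrite !EZ !ED EZ; ring.
Qed.

Definition Ps ks : rv := fun N t => \prod_(k <- ks) Pk k N t.

Fixpoint dPs j ks : rv := fun N t =>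
  if ks is k :: ks' then Pk k N t * dPs j ks' N t + cA k j * Ps ks' N t else 0.

Lemma good_Ps ks : good (Ps ks) (dPs^~ ks).
Proof.
elim: ks => [|k ks IH]; first by apply: good_ext good1 => [N t|j N t] //; rewrite /Ps big_nil.
by apply: good_ext (good_Pk k IH) => [N t|j N t] //; rewrite /Ps big_cons.
Qed.

(** A derivation removes one factor of a product at a time, the same enumeration as [picks]. *)
Lemma dPs_picks k ks N t : \sum_(j < k.+1) A k j * dPs j ks N t =
  \sum_(p <- picks ks) covA k p.1 * Ps p.2 N t.
Proof.
elim: ks => [|k' ks IH]; first by rewrite big_nil big1 // => j _; rewrite mulr0.
rewrite big_cons big_map /= [X in X * Ps _ _ _]/covA mulr_suml.
transitivity (\sum_(j < k.+1) A k j * cA k' j * Ps ks N t + Pk k' N t * \sum_(j < k.+1) A k j * dPs j ks N t).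
  by rewrite mulr_sumr -big_split; apply: eq_bigr => j _ /=; ring.
rewrite IH mulr_sumr; congr (_ + _); apply: eq_bigr => p _.
by rewrite /Ps big_cons; ring.
Qed.

Fixpoint wick f ks : K :=
  match ks with
  | [::] => 1
  | k :: ks' => if f is f'.+1 then \sum_(p <- picks ks') covA k p.1 * wick f' p.2 else 0
  end.

Hypothesis E1 : forall N, E N (fun=> 1) = 1.

(** Integration by parts against the first factor gives the recursion defining [wick]; the fuel f
    only has to dominate the number of factors. *)
Lemma Ps_wick f ks : (size ks <= f)%N -> (fun N => E N (Ps ks N)) @ \oo --> wick f ks.
Proof.
elim: f ks => [|f IH] [|k ks] //= sz.
1,2: by apply: (@cvg_eq (fun=> 1) _ 1) => [N||]; [rewrite -[LHS](E1 N); apply: E_ext => t; rewrite /Ps big_nil | by [] | exact: cvg_cst].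
have S1 := stein_Pk k (good_Ps ks).
have szp p : List.In p (picks ks) -> (size p.2 < size ks)%N.
  elim: ks p {sz S1} => [|x ks IHk] p //= [<- //|/List.in_map_iff[q [<- /IHk]]] //.
have S2 : (fun N => \sum_(p <- picks ks) covA k p.1 * E N (Ps p.2 N)) @ \oo -->
    (\sum_(p <- picks ks) covA k p.1 * wick f p.2).
  elim: (picks ks) szp => [|p L IHL] szp.
    by apply: (@cvg_eq (fun=> 0) _ 0) => [N||]; rewrite ?big_nil //; exact: cvg_cst.
  rewrite big_cons; apply: (@cvg_eq (fun N => covA k p.1 * E N (Ps p.2 N) + \sum_(q <- L) covA k q.1 * E N (Ps q.2 N))) => [N|//|].
    by rewrite big_cons.
  apply: cvgD; last by apply: IHL => q qL; apply: szp; right.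
  apply: cvgMr; apply: IH; rewrite -ltnS; apply: leq_trans sz; rewrite ltnS.
  exact: ltnW (szp p (or_introl erefl)).
apply: cvg_eq (K_cvgD S1 S2) => [N|]; last by rewrite add0r.
rewrite /= (@E_ext N _ (Ps (k :: ks) N)); last by move=> t; rewrite /Ps big_cons.
rewrite -addrA -[RHS]addr0; congr (_ + _); apply/eqP; rewrite addrC subr_eq0; apply/eqP.
transitivity (E N (fun t => \sum_(p <- picks ks) covA k p.1 * Ps p.2 N t)).
  by rewrite E_sum; apply: eq_bigr => p _; rewrite EZ.
rewrite (@E_ext N _ _ (fun t => esym (dPs_picks k ks N t))) E_sum; apply: eq_bigr => j _; by rewrite EZ.
Qed.

Variables (X : nat -> rv) (c : nat -> nat -> K).
Hypothesis XP : \forall N \near \oo, forall k t, X k N t = Pk k N t + c k N.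
Hypothesis EX : forall k N, E N (X k N) = 0.

(** X k is centered, and the mean of [Pk] k tends to the Wick sum over a single index, which is
    0. *)
Lemma c_to0 k : c k @ \oo --> (0 : K).
Proof.
have := @cvg_scale (-1) _ _ (Ps_wick (leqnn (size [:: k]))); rewrite /= big_nil mulr0; apply: cvg_trans.
apply: near_eq_cvg; near=> N.
have H : forall k t, X k N t = Pk k N t + c k N by near: N.
rewrite /=; have := EX k N; rewrite (@E_ext N _ (fun t => Ps [:: k] N t + c k N * 1)); last first.
  by move=> t; rewrite H /Ps big_cons big_nil !mulr1.
by rewrite ED EZ E1 mulr1 => /eqP; rewrite addrC addr_eq0 => /eqP ->; rewrite mulN1r.
Unshelve. all: by end_near.
Qed.

(** The factors X are replaced by [Pk] one at a time, the factors already replaced being carried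
    along in [Ps ls]. *)
Lemma moments_wick ks : (fun N => E N (fun t => \prod_(k <- ks) X k N t)) @ \oo --> wick (size ks) ks.
Proof.
suff H ls (x : K) : (fun N => E N (Ps (ks ++ ls) N)) @ \oo --> x ->
    (fun N => E N (fun t => (\prod_(k <- ks) X k N t) * Ps ls N t)) @ \oo --> x.
  have := Ps_wick (leqnn (size ks)); rewrite -{1}[ks]cats0 => /H.
  by apply: cvg_eq => // N; apply: E_ext => t; rewrite /Ps big_nil mulr1.
elim: ks ls x => [|k ks IH] ls x Hx.
  by apply: cvg_eq Hx => // N; apply: E_ext => t; rewrite big_nil mul1r.
have L1 : (fun N => E N (fun t => (\prod_(k <- ks) X k N t) * Ps (k :: ls) N t)) @ \oo --> x.
  apply: IH; apply: cvg_eq Hx => // N; apply: E_ext => t; apply: perm_big.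
  by rewrite perm_sym -cat1s perm_catCA.
have L2 := IH ls _ (Ps_wick (leqnn (size (ks ++ ls)))).
have L3 := K_cvgD L1 (K_cvgM (c_to0 k) L2); rewrite mul0r addr0 in L3.
apply: cvg_trans L3; apply: near_eq_cvg; near=> N.
have H : forall k t, X k N t = Pk k N t + c k N by near: N.
rewrite -EZ -ED; apply: E_ext => t; rewrite big_cons /Ps big_cons H; ring.
Unshelve. all: by end_near.
Qed.

End Gaussian.

End SteinEquation.

(** * Faber polynomials and the principal part of powers of zeta *)

Module FaberCoefficients.
Import structures.
Import all_boot all_order all_algebra.
Import boolp classical_sets functions reals topology normedtype sequences exp.
Import ring lra zify.
Import PowerSeries GrowthFamilies SeriesTower.
Set Implicit Arguments.
Unset Strict Implicit.
Unset Printing Implicit Defensive.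
Import Order.TTheory GRing.Theory Num.Theory.
Local Open Scope ring_scope.

Section Faber.
Variables (K : realType) (a : K) (zh : fps K).
Hypothesis a0 : a != 0.
Hypothesis zh0 : zh 0%N = a.
Local Notation C := (@fpsC _).
Local Notation Xo := (fpsX (fps K)).
Local Notation c := (C (fpsX K) : fps (fps K)).
Local Notation e := (C zh : fps (fps K)).
Local Notation z := (fps_map (@fpsC K) zh).
Local Notation kr := (ker a zh).
Local Notation dk := (Dk a zh).

Lemma fps_mapXn k : (z ^+ k : fps (fps K)) = fps_map (@fpsC K) (zh ^+ k).
Proof. by rewrite rmorphXn. Qed.

Lemma fpsMXn (B : comNzRingType) (g : fps B) i m : (g * fpsX B ^+ i) m = if (m < i)%N then 0 else g (m - i)%N.
Proof. by rewrite mulrC fpsXnM; case: ltnP. Qed.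

Lemma fps_natM (B : comNzRingType) n (g : fps B) m : (n%:R * g) m = n%:R * g m.
Proof. by rewrite -(rmorph_nat (@fpsC B)) fpsCM. Qed.

Lemma fps_nat_inj n (f g : fps K) : n.+1%:R * f = n.+1%:R * g -> f = g.
Proof.
move=> E; apply/fpsP => m; have n0 : n.+1%:R != 0 :> K by rewrite pnatr_eq0.
by have := congr1 (fun h => h m) E; rewrite /= !fps_natM => /(mulfI n0).
Qed.

(** Minus the logarithmic derivative of [kerE] in the outer variable, multiplied by c z - X e; the
    last term comes from theta(c - X) = -X. *)
Lemma ker_Dk : (c * z - Xo * e) * dk = - fps_theta (c * z - Xo * e) - Xo * (C (C a) * kr).
Proof.
have E := kerE a0 zh0; rewrite [c * z]mulrC E.
have kV := fps_mulV (ker0 a zh).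
rewrite !fps_thetaM fps_thetaB !fps_thetaC fps_thetaX /Dk.
transitivity (- (C (C a) * (c - Xo) * fps_theta kr) * (kr * fps_inv kr)); first by ring.
by rewrite kV; ring.
Qed.

(* The Faber polynomial of zeta^k, paired with Dk, gives the principal part of zeta^k. *)
Lemma faber k l : (0 < k)%N ->
  \sum_(j < k.+1) (zh ^+ k) (k - j)%N * dk j l = if l is 0%N then 0 else (zh ^+ k) (k + l)%N.
Proof.
move=> k0.
pose S := \sum_(i < k) (c * z) ^+ i * (Xo * e) ^+ (k.-1 - i).
have rr1 (B : comNzRingType) (p1 p2 p3 p4 : B) : p1 * (p2 * p3) * p4 = p3 * (p1 * p4) * p2 by ring.
have rr2 (B : comNzRingType) (p1 p2 p3 x y : B) : p1 * (p2 * p3) * (x * y) = y * p3 * p1 * (x * p2) by ring.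
have XX : (c * z) ^+ k - (Xo * e) ^+ k = (c * z - Xo * e) * S.
  rewrite subrXX; congr (_ * _); rewrite /S (reindex_inj rev_ord_inj) /=; apply: eq_bigr => i _.
  by congr (_ ^+ _ * _ ^+ _); have := ltn_ord i; lia.
pose h := S * (C (C a) * kr).
have hE : (c - Xo) * h = (c * z) ^+ k - (Xo * e) ^+ k.
  rewrite XX [c * z]mulrC (kerE a0 zh0) /h; ring.
have czE i m : ((c * z) ^+ i) m = fpsX K ^+ i * C ((zh ^+ i) m).
  by rewrite exprMn -rmorphXn /= fpsCM fps_mapXn.
(* The sum telescopes: (c z)^i theta(c z) is theta((c z)^(i+1)) / (i+1), whose coefficient of degree
   i + 1 is that of (c z)^(i+1). *)
have S1 : (S * fps_theta (c * z - Xo * e)) k = fpsX K ^+ k * C ((zh ^+ k) k) - zh ^+ k.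
  have F i : (i < k)%N -> ((c * z) ^+ i * (Xo * e) ^+ (k.-1 - i) * fps_theta (c * z - Xo * e)) k =
     zh ^+ (k.-1 - i) * ((c * z) ^+ i.+1) i.+1 - zh ^+ (k - i) * ((c * z) ^+ i) i.
    move=> ik; rewrite fps_thetaB [fps_theta (Xo * e)]fps_thetaM fps_thetaX fps_thetaC mulr0 addr0.
    rewrite mulrBr fpsBE; congr (_ - _).
      transitivity ((e ^+ (k.-1 - i) * ((c * z) ^+ i * fps_theta (c * z)) * Xo ^+ (k.-1 - i)) k).
        rewrite [(Xo * e) ^+ _]exprMn; congr (_ k).
        exact: (@rr1 (fps (fps K))).
      rewrite fpsMXn ltnNge (_ : (k.-1 - i <= k)%N) /=; last lia.
      have -> : (k - (k.-1 - i) = i.+1)%N by lia.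
      rewrite -rmorphXn /= fpsCM; congr (_ * _).
      have := congr1 (fun f => f i.+1) (fps_thetaXn (c * z) i); rewrite -mulrA fps_natM.
      by rewrite {1}/fps_theta => /fps_nat_inj ->.
    transitivity ((e ^+ (k - i) * ((c * z) ^+ i) * Xo ^+ (k - i)) k).
      have -> : (k - i = (k.-1 - i).+1)%N by lia.
      rewrite [(Xo * e) ^+ _]exprMn !exprS; congr (_ k).
      exact: (@rr2 (fps (fps K))).
    rewrite fpsMXn ltnNge leq_subr /= subKn ?(ltnW ik) // -rmorphXn /= fpsCM.
    by [].
  rewrite mulr_suml fps_sumE (eq_bigr (fun i : 'I_k => zh ^+ (k - i.+1) * ((c * z) ^+ i.+1) i.+1 -
     zh ^+ (k - i) * ((c * z) ^+ i) i)); last first.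
    by move=> i _; rewrite F //; congr (_ ^+ _ * _ - _); have := ltn_ord i; lia.
  rewrite -(big_mkord xpredT (fun i => zh ^+ (k - i.+1) * ((c * z) ^+ i.+1) i.+1 -
     zh ^+ (k - i) * ((c * z) ^+ i) i)) telescope_sumr // subnn subn0 !expr0 mul1r czE.
  by rewrite fps1E mulr1.
(* Division of (c z)^k - (X e)^k by c - X, from the lowest outer coefficient upwards; (X e)^k starts
   only at degree k and does not interfere. *)
have hk : h k.-1 = \sum_(m < k) fpsX K ^+ m * C ((zh ^+ k) m).
  have X1 m : (m < k)%N -> fpsX K ^+ m.+1 * h m = fpsX K ^+ k * \sum_(i < m.+1) fpsX K ^+ i * C ((zh ^+ k) i).
    elim: m => [|m IH] mk; have := congr1 (fun f => f _) hE.
      move=> /(_ 0%N); rewrite mulrBl fpsBE fpsCM fpsXM subr0 expr1 => ->.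
      rewrite fpsBE czE [(Xo * e) ^+ k]exprMn [Xo ^+ k * _]mulrC fpsMXn mk.
      by rewrite subr0 big_ord1 expr0 mul1r.
    move=> /(_ m.+1); rewrite mulrBl fpsBE fpsCM fpsXM fpsBE czE.
    rewrite [(Xo * e) ^+ k]exprMn [Xo ^+ k * _]mulrC fpsMXn mk subr0 => Em.
    rewrite big_ord_recr /= mulrDr -IH ?(ltnW mk) //.
    have {}Em : fpsX K * h m.+1 = h m + fpsX K ^+ k * C ((zh ^+ k) m.+1) by rewrite -Em addrC subrK.
    by rewrite exprS -mulrA mulrCA Em mulrDr; congr (_ + _); rewrite mulrCA.
  have := X1 k.-1; rewrite prednK // leqnn => /(_ isT).
  move: (h k.-1) (\sum_(i < k) _) => u v; elim: (k) => [|i IH]; rewrite ?expr0 ?mul1r // !exprS -!mulrA.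
  by move=> /fpsX_inj.
have main : fpsX K ^+ k * (z ^+ k * dk) k = zh ^+ k - \sum_(m < k.+1) fpsX K ^+ m * C ((zh ^+ k) m).
  transitivity (((c * z) ^+ k * dk) k).
    by rewrite exprMn -mulrA -[c ^+ k]rmorphXn fpsCM.
  have -> : (c * z) ^+ k = (Xo * e) ^+ k + S * (c * z - Xo * e) by rewrite [S * _]mulrC -XX addrC subrK.
  have dk0 : dk 0%N = 0 by rewrite /Dk fpsM0 fpsNE /fps_theta mul0r oppr0 mul0r.
  (* The outer order of (X e)^k is already k, and [Dk] has no constant term in the outer
     variable. *)
  have Z : ((Xo * e) ^+ k * dk) k = 0.
    by rewrite exprMn -mulrA fpsXnM leqnn subnn fpsM0 dk0 mulr0.
  rewrite mulrDl fpsDE Z add0r.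
  rewrite -mulrA ker_Dk mulrBr mulrN fpsBE fpsNE S1.
  have -> : (S * (Xo * (C (C a) * kr))) k = h k.-1.
    by rewrite mulrCA fpsXM -/h; case: (k) k0.
  rewrite hk big_ord_recr /=; ring.
have -> : \sum_(j < k.+1) (zh ^+ k) (k - j)%N * dk j l = (z ^+ k * dk) k l.
  rewrite fps_mapXn fpsME_rev fps_sumE; apply: eq_bigr => j _.
  by rewrite /fps_map fpsCM.
have := congr1 (fun f => f (k + l)%N) main; rewrite fpsXnM leq_addr addKn => ->.
rewrite fpsBE fps_sumE; case: l => [|l].
  rewrite addn0 (bigD1 ord_max) //= fpsXnM leqnn subnn big1 ?addr0 ?subrr // => i.
  rewrite -val_eqE /= fpsXnM => ik; have := ltn_ord i; case: ifP => // _ ik2.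
  by case E : (k - i)%N => [|m] //; lia.
rewrite big1 ?subr0 // => i _; rewrite fpsXnM; case: ifP => // _.
by case E : (k + l.+1 - i)%N => [|m] //; have := ltn_ord i; lia.
Qed.

End Faber.

End FaberCoefficients.

(** * Convergence in the tower implies the Stein equation *)

Module TowerConvergence.
Import Reals ZArith.
Import Defs.
Import structures.
Import all_boot all_order all_algebra all_fingroup.
Import boolp classical_sets functions reals topology normedtype sequences exp.
Import ring lra zify.
Import PowerSeries GrowthFamilies SingleVariableLimit SeriesTower SteinEquation.
Set Implicit Arguments.
Unset Strict Implicit.
Unset Printing Implicit Defensive.
Import Order.TTheory GRing.Theory Num.Theory numFieldNormedType.Exports.
Local Open Scope ring_scope.
Local Open Scope classical_set_scope.

Section Dets.
Variable A : comNzRingType.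

Lemma det_scale r (u v : nat -> A) (M : nat -> nat -> A) :
  \det (\matrix_(i < r, j < r) (u i * v j * M i j)) =
  (\prod_(i < r) u i) * (\prod_(j < r) v j) * \det (\matrix_(i < r, j < r) M i j).
Proof.
have -> : \matrix_(i < r, j < r) (u i * v j * M i j) =
    diag_mx (\row_i u i) *m (\matrix_(i < r, j < r) M i j) *m diag_mx (\row_j v j).
  by apply/matrixP => i j; rewrite mul_mx_diag mul_diag_mx !mxE mulrAC.
rewrite !det_mulmx !det_diag [in RHS]mulrAC.
by congr (_ * _ * _); apply: eq_bigr => i _; rewrite mxE.
Qed.

Lemma det_rev r (M : nat -> nat -> A) :
  \det (\matrix_(i < r, j < r) M i (r - j.+1)%N) =
  (-1) ^+ perm (@rev_ord_inj r) * \det (\matrix_(i < r, j < r) M i j).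
Proof.
set p := perm _; have -> : \matrix_(i < r, j < r) M i (r - j.+1)%N = col_perm p (\matrix_(i, j) M i j).
  by apply/matrixP => i j; rewrite !mxE permE.
by rewrite col_permE det_mulmx det_perm odd_permV mulrC.
Qed.

Lemma det_cast (m r : nat) (M : nat -> nat -> A) : m = r ->
  \det (\matrix_(i < m, j < m) M i j) = \det (\matrix_(i < r, j < r) M i j).
Proof. by move=> ->. Qed.

Lemma vandermonde r (x : nat -> A) :
  \det (\matrix_(i < r, j < r) x i ^+ j) = \prod_(i < r) \prod_(j < r | (i < j)%N) (x j - x i).
Proof.
have <- : (Vandermonde r (\row_i x i))^T = \matrix_(i < r, j < r) x i ^+ j.
  by apply/matrixP => i j; rewrite !mxE.
by rewrite det_tr det_Vandermonde; apply: eq_bigr => i _; apply: eq_bigr => j _; rewrite !mxE.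
Qed.
End Dets.

Section TowerConv.
Variable K : realType.
Local Notation C := (@fpsC _).

Lemma conv_near r (u v : nat -> tow K r) x :
  (exists N0, forall N, (N0 <= N)%N -> u N = v N) -> conv u x -> conv v x.
Proof.
elim: r u v x => [|r IH] u v x [N0 H] /=.
  by apply: cvg_trans; apply: near_eq_cvg; exists N0 => // N /H.
by move=> ux k; apply: IH (ux k); exists N0 => N /H ->.
Qed.

Lemma conv_io r (u : nat -> K) x : u @ \oo --> x -> conv (fun N => io K r (u N)) (io K r x).
Proof.
elim: r => [|r IH] //= ux; move: (IH ux) => H [|k] //=.
exact: conv_cst.
Qed.

Lemma conv_emb r a (u : nat -> fps K) x : (forall k, (fun N => u N k) @ \oo --> x k) ->
  conv (fun N => emb K r a (u N)) (emb K r a x).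
Proof.
move=> ux; elim: r a => [|r IH] [|a] /=; [exact: ux | exact: ux | |].
  by move=> k; apply: conv_io.
by move=> [|k] /=; [exact: IH | exact: conv_cst].
Qed.

Lemma conv_prod (A : limring) (I : Type) (s : seq I) (F : I -> nat -> A) (G : I -> A) :
  (forall i, conv (F i) (G i)) -> conv (fun N => \prod_(i <- s) F i N) (\prod_(i <- s) G i).
Proof.
move=> FG; elim: s => [|i s IH].
  by rewrite big_nil; under eq_fun do rewrite big_nil; exact: conv_cst.
by rewrite big_cons; under eq_fun do rewrite big_cons; exact: convM.
Qed.

Lemma conv_det (A : limring) r (F : nat -> nat -> nat -> A) (G : nat -> nat -> A) :
  (forall i j, (i < r)%N -> (j < r)%N -> conv (F i j) (G i j)) ->
  conv (fun N => \det (\matrix_(i < r, j < r) F i j N)) (\det (\matrix_(i < r, j < r) G i j)).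
Proof.
move=> FG; rewrite /determinant; apply: conv_sum => s; apply: convM; first exact: conv_cst.
apply: conv_prod => i; rewrite mxE; under eq_fun do rewrite mxE.
exact: FG.
Qed.

Section FromTower.
Variables (T : Type) (S : nat -> seq T) (w : nat -> T -> K) (Y : nat -> T -> fps K).
Variables (a : K) (zh : fps K).
Hypothesis a0 : a != 0.
Hypothesis zh0 : zh 0%N = a.

Definition EE N (f : T -> K) : K := \sum_(t <- S N) w N t * f t.
(** The joint moment of Y at r formal points, as one element of the tower. *)
Definition UU r N : tow K r := \sum_(t <- S N) io K r (w N t) * pe r (Y N t).
Hypothesis U_conv : forall r, conv (UU r) (GG a zh r).

Lemma Ys_U ts N : EE N (Ys Y ts N) = coef ts (UU (size ts) N).
Proof.
rewrite /UU coef_sum; apply: eq_bigr => t _; rewrite coef_io coef_pe //.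
Qed.

Lemma dYs_coef j ts N t : dYs Y (Dk a zh) j ts N t =
  coef ts ((\sum_(b < size ts) emb K (size ts) b (Dk a zh j)) * pe (size ts) (Y N t)).
Proof.
elim: ts => [|k ts IH]; first by rewrite big_ord0 mul0r.
have -> : (\sum_(b < (size ts).+1) emb K (size ts).+1 b (Dk a zh j)) * pe (size ts).+1 (Y N t) =
  (fps_map (io K (size ts)) (Dk a zh j * Y N t) * C (pe (size ts) (Y N t)) +
   fps_map (io K (size ts)) (Y N t) * C ((\sum_(b < size ts) emb K (size ts) b (Dk a zh j)) * pe (size ts) (Y N t))
   : fps (tow K (size ts))).
  rewrite big_ord_recl mulrDl; congr (_ + _); first by rewrite rmorphM mulrA.
  by rewrite mulrCA rmorphM; congr (_ * _); rewrite rmorph_sum.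
rewrite -[dYs _ _ j (k :: ts) N t]/((Dk a zh j * Y N t) k * Ys Y ts N t + Y N t k * dYs Y (Dk a zh) j ts N t).
rewrite coefD; congr (_ + _).
  by rewrite (coef_emb0 (r := size ts) (k :: ts)) /= coef_pe.
by rewrite (coef_emb0 (r := size ts) (k :: ts)) /= IH.
Qed.

Lemma EED N f g : EE N (fun t => f t + g t) = EE N f + EE N g.
Proof. by rewrite -big_split; apply: eq_bigr => t _; rewrite mulrDr. Qed.

Lemma EEZ N c f : EE N (fun t => c * f t) = c * EE N f.
Proof. by rewrite mulr_sumr; apply: eq_bigr => t _; rewrite mulrCA. Qed.

Lemma EE_ext N f g : (forall t, f t = g t) -> EE N f = EE N g.
Proof. by move=> fg; apply: eq_bigr => t _; rewrite fg. Qed.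

(** Both sides of the Stein equation for V = 1 are coefficients of expressions in [UU] with exponent
    k in the outermost variable and exponents [ts] in the others; in the limit they agree by
    [GG_rec]. *)
Lemma good1_tower : good EE Y (Dk a zh) (fun _ _ => 1) (fun _ _ _ => 0).
Proof.
split.
- move=> ts; exists (coef ts (GG a zh (size ts))).
  apply: cvg_eq (conv_coef (ts := ts) (U_conv (size ts))) => // N.
  by rewrite -Ys_U; apply: EE_ext => t; rewrite mul1r.
- by move=> j; apply: nice0; exact: EEZ.
move=> k ts; set r := size ts.
have U1 := @U_conv r.+1.
have L1 := @cvg_scale _ k%:R _ _ (conv_coef (ts := ts) (U1 k)).
have Lj (j : 'I_k.+1) : (fun N => coef ts ((\sum_(b < r) emb K r b (Dk a zh j)) * (UU r.+1 N : fps (tow K r)) (k - j)%N))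
   @ \oo --> coef ts ((\sum_(b < r) emb K r b (Dk a zh j)) * (GG a zh r.+1 : fps (tow K r)) (k - j)%N).
  apply: conv_coef; apply: convM; [exact: conv_cst | exact: (U1 (k - j)%N)].
have L2 := @cvg_big_sum K _ (index_enum 'I_k.+1) _ _ Lj.
have Gr := congr1 (coef ts) (GG_rec a zh r k).
apply: cvg_eq (K_cvgD L1 (@cvg_scale _ (-1) _ _ L2)) => [N|].
  rewrite mulN1r; congr (_ * _ - _).
    transitivity (EE N (Ys Y (k :: ts) N)); first by rewrite Ys_U.
    by apply: EE_ext => t; rewrite mulr1 /Ys big_cons.
  apply: eq_bigr => j _.
  have -> : (UU r.+1 N : fps (tow K r)) (k - j)%N = \sum_(t <- S N) io K r (w N t) * (io K r (Y N t (k - j)%N) * pe r (Y N t)).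
    rewrite /UU fps_sumE; apply: eq_bigr => t _.
    rewrite -[io K r.+1 _]/(C (io K r (w N t))) fpsCM; congr (_ * _).
    by rewrite /= mulrC fpsCM mulrC.
  rewrite mulr_sumr coef_sum; apply: eq_bigr => t _.
  rewrite mulrCA coef_io mulrCA coef_io mulr0 add0r mulr1 dYs_coef; congr (_ * (_ * _)).
have kio : (k%:R : tow K r) = io K r k%:R by rewrite rmorph_nat.
by rewrite mulN1r -[k%:R * coef _ _]coef_io -kio Gr coef_sum subrr.
Qed.
End FromTower.
End TowerConv.

End TowerConvergence.

(** * The exact formula at formal points N zeta *)

Module DeterminantalMoments.
Import Reals ZArith.
Import Defs.
Import structures.
Import all_boot all_order all_algebra all_fingroup.
Import boolp classical_sets functions reals topology normedtype sequences exp Rstruct Rstruct_topology.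
Import ring lra zify ssrZ.
Import PowerSeries FiniteDifferences InterlacingSums Branching SchurIdentification GrowthFamilies Transport TransportCoordinates HomogeneousEvaluation ExponentialSeries SingleVariableLimit SeriesTower SteinEquation TowerConvergence.
Set Implicit Arguments.
Unset Strict Implicit.
Unset Printing Implicit Defensive.
Import Order.TTheory GRing.Theory Num.Theory numFieldNormedType.Exports.
Local Open Scope ring_scope.
Local Open Scope classical_set_scope.

Section Entries.
Variable K : realType.
Local Notation C := (@fpsC K).
Local Notation X := (fpsX K).
Local Notation hv := (hev (@fpsC K)).
Variables (zh izh : fps K).
Hypothesis zhM : zh * izh = 1.
Let xt := X * izh.

Lemma xt0 : xt 0%N = 0.
Proof. by rewrite /xt fpsXM. Qed.

Lemma xt_zh : xt * zh = X.
Proof. by rewrite /xt -mulrA [izh * _]mulrC zhM mulr1. Qed.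

Lemma hev_xt (N : nat) m f : (0 < N)%N ->
  hv (C N%:R * zh) X m f = C (N%:R ^+ m) * zh ^+ m * fps_comp xt (hv 1 (C N%:R^-1 * X) m f).
Proof.
move=> N0; have N1 : C N%:R * C N%:R^-1 = 1.
  by rewrite -rmorphM divff ?rmorph1 // pnatr_eq0 -lt0n.
rewrite hev_comp ?xt0 // fps_comp1 fps_compM ?xt0 // fps_compC fps_compX ?xt0 //.
rewrite rmorphXn -exprMn -hevM_scale mulr1.
have -> // : C N%:R * zh * (C N%:R^-1 * xt) = X.
by transitivity ((C N%:R * C N%:R^-1) * (xt * zh)); [ring | rewrite N1 xt_zh mul1r].
Qed.

(** At u = N zeta and with x = 1/zeta the entry is a factor independent of j times N^j x^(r-1-j), so
    the determinant reduces to a Vandermonde with columns reversed. *)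
Lemma entry_left (N M r j : nat) (cs : seq K) : (0 < N)%N -> size cs = M -> (j < r)%N ->
  hv (C N%:R * zh) X (M + r.-1) ('X^j * rootpoly cs) =
  (C (N%:R ^+ M) * zh ^+ (M + r.-1) * fps_comp xt (hv 1 (C N%:R^-1 * X) M (rootpoly cs))) *
  C (N%:R ^+ j) * xt ^+ (r - j.+1).
Proof.
move=> N0 sz jr; rewrite addnC hevM ?size_polyXn ?size_prod_XsubC ?sz //; last by lia.
rewrite hevXn; last by lia.
rewrite hev_xt // exprMn -rmorphXn /= exprD -{1}xt_zh exprMn (_ : (r - j.+1 = r.-1 - j)%N); last lia.
have -> : zh ^+ r.-1 = zh ^+ j * zh ^+ (r.-1 - j) by rewrite -exprD; congr (_ ^+ _); lia.
have rr (A : comNzRingType) (c1 z1 x z2 c2 z3 f : A) :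
  c1 * z1 * (x * z2) * (c2 * z3 * f) = c2 * (z1 * z2 * z3) * f * c1 * x by ring.
exact: rr.
Qed.

(** The same factorization, with the ratio [Tser] measuring the deviation of Delta^n (u^j P) from
    u^j Delta^n P. *)
Lemma entry_right (N M n r j : nat) (l : seq K) : (0 < N)%N -> N = (M + n)%N -> size l = N -> (j < r)%N ->
  hv (C N%:R * zh) X (M + r.-1) (iter n (@fdiff K) ('X^j * rootpoly l)) =
  (C (N%:R ^+ M) * zh ^+ (M + r.-1) * fps_comp xt (pser N l n)) *
  C (N%:R ^+ j) * (xt ^+ (r - j.+1) * fps_comp xt (Tser N l j n)).
Proof.
move=> N0 NE sl jr.
have sf : (size (iter n (@fdiff K) ('X^j * rootpoly l)%R) <= (N + j - n).+1)%N.
  apply: size_iter_fdiff; last by lia.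
  by rewrite (leq_trans (size_polyMleq _ _)) // size_polyXn size_prod_XsubC sl; lia.
have -> : (M + r.-1 = (r - j.+1) + (N + j - n))%N by lia.
rewrite hev_wk // hev_xt // /Tser.
have pV : pser N l n * fps_vinv (pser N l n) = 1 by apply: pserV => //; lia.
have pV' : fps_comp xt (pser N l n) * fps_comp xt (fps_vinv (pser N l n)) = 1.
  by rewrite -fps_compM ?xt0 // pV fps_comp1.
rewrite [fps_comp xt (_ * fps_vinv _)]fps_compM ?xt0 //.
set g := fps_comp xt (hv _ _ _ _).
have -> : (N + j - n = M + j)%N by lia.
rewrite -{1}xt_zh exprMn [N%:R ^+ (M + j)]exprD rmorphM !exprD /=.
move: (xt ^+ _) (zh ^+ _) (zh ^+ _) (zh ^+ _) (C _) (C _) => p1 p2 p3 p4 p5 p6.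
transitivity (p1 * p2 * (p5 * p6 * (p3 * p4) * g) * (fps_comp xt (pser N l n) * fps_comp xt (fps_vinv (pser N l n)))).
  by rewrite pV' mulr1; ring.
ring.
Qed.
End Entries.

Section Restriction.
Local Notation K := Rdefinitions.R.
Local Notation C := (@fpsC K).
Local Notation X := (fpsX K).
Local Notation hv := (hev (@fpsC K)).
Variables (lam : nat -> seq Z) (S : nat -> seq (seq Z)) (rho : nat -> seq Z -> K) (M : nat -> nat).
Hypothesis lam_sig : forall N, is_sig N (lam N).
Hypothesis MN : forall N, (M N <= N)%N.
Hypothesis SGF : forall N, SGF_restriction N (M N) (lam N) (S N) (rho N).
Variables (a : K) (mom : nat -> K) (B : K).
Hypothesis a01 : 0 < a < 1.
Hypothesis M_to : (fun N => (M N)%:R / N%:R : K) @ \oo --> a.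
Hypothesis B_ge0 : 0 <= B.
Let l N : seq K := pts IZR (lam N).
Hypothesis l_bd : forall N c, c \in l N -> `|c / N%:R| <= B.
Hypothesis mom_to : forall k, (fun N => N%:R^-1 * \sum_(c <- l N) (c / N%:R) ^+ k) @ \oo --> mom k.

Let n N := (N - M N)%N.
Definition zhm : fps K := zhat (1 - a) (psim mom).
Definition izhm : fps K := izhat (1 - a) (psim mom).
Let xt := X * izhm.

Lemma size_l N : size (l N) = N.
Proof. by rewrite size_pts (is_sig_Zdecr (lam_sig N)).2. Qed.

Lemma zhm0 : zhm 0%N = a.
Proof. by rewrite /zhm zhat0 opprB addrC subrK. Qed.

Lemma zhmM : zhm * izhm = 1.
Proof.
apply: zhatM.
by rewrite opprB addrC subrK; have /andP[] := a01 => /gt_eqF ->.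
Qed.

(** Q at N zeta, divided by Delta^n P with its leading coefficient restored, which makes the
    constant term 1. For N = 0 the value 1 is a default. *)
Definition Yser N (mu : seq Z) : fps K := if (0 < N)%N then
  fps_comp xt (hv 1 (C N%:R^-1 * X) (M N) (rootpoly (pts IZR mu))) *
  (C (pser N (l N) (n N) 0%N) * fps_comp xt (fps_vinv (pser N (l N) (n N)))) else 1.

Definition cst r N : K := (\prod_(k < n N) \prod_(i < r) (M N + k + i.+1)%:R)^-1 * pser N (l N) (n N) 0%N ^+ r.

Lemma MnN N : N = (M N + n N)%N.
Proof. by rewrite subnKC. Qed.

Lemma size_mu N mu : mu \in S N -> size mu = M N.
Proof.
move=> /InP muS; have [_ [Ssig _]] := SGF N.
by have [] := is_sig_Zdecr (Ssig _ muS).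
Qed.

(** [exact_formula] after row factors, column factors and the sign of the column reversal, common to
    both sides, are cancelled by multiplying with their inverses. *)
Lemma U_vd r N : (0 < N)%N ->
  UU S rho Yser r N * vd r xt = io K r (cst r N) *
   \det (\matrix_(i < r, j < r) emb K r i (xt ^+ j * fps_comp xt (Tser N (l N) (r - j.+1) (n N)))).
Proof.
move=> N0.
(* Evaluation at N zeta in the i-th variable, homogenized in degree M + r - 1, the largest degree
   occurring on either side. *)
pose phi i f := emb K r i (hv (C N%:R * zhm) X (M N + r.-1) f).
have lphi f : List.In f (mkseq phi r) -> linf (io K r) f.
  move=> /List.in_map_iff[i [<- _]] c f1 f2.
  by rewrite /phi linf_hev rmorphD rmorphM emb_C.
have sp := size_mkseq phi r.
have := exact_formula (lam_sig N) (MnN N) (SGF N) lphi.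
pose F f (i j : nat) := nth (fun=> 0) (mkseq phi r) i (f j).
under eq_bigr => mu _ do rewrite (det_cast (F (fun j => 'X^j * rootpoly (pts IZR mu))) sp).
rewrite (det_cast (F (fun j => iter (n N) (@fdiff K) ('X^j * rootpoly (l N)))) sp) sp.
pose dd := C (N%:R ^+ M N) * zhm ^+ (M N + r.-1).
pose q mu := fps_comp xt (hv 1 (C N%:R^-1 * X) (M N) (rootpoly (pts IZR mu))).
pose sg : tow K r := (-1) ^+ perm (@rev_ord_inj r).
pose V : tow K r := \prod_(j < r) io K r (N%:R ^+ j).
set d2 := \det (\matrix_(i < r, j < r) emb K r i _).
have FL mu : mu \in S N -> \det (\matrix_(i < r, j < r) F (fun j => 'X^j * rootpoly (pts IZR mu)) i j) =
   pe r (dd * q mu) * V * (sg * vd r xt).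
  move=> muS; rewrite vdE -(vandermonde _ (fun i => emb K r i xt)) -(det_rev _ (fun i j => emb K r i xt ^+ j)).
  rewrite peE -(det_scale _ (fun i => emb K r i (dd * q mu)) (fun j => io K r (N%:R ^+ j)) (fun i j => emb K r i xt ^+ (r - j.+1))).
  congr (\det _); apply/matrixP => i j; rewrite !mxE /F nth_mkseq // /phi.
  rewrite (entry_left zhmM) ?size_pts ?(size_mu muS) // -/dd -/(q mu).
  transitivity (emb K r i (dd * q mu) * emb K r i (C (N%:R ^+ j)) * emb K r i (xt ^+ (r - j.+1))).
    by rewrite -[in RHS](rmorphM (emb K r i)) -[in RHS](rmorphM (emb K r i)).
  by rewrite emb_C -[emb K r i xt ^+ _]rmorphXn.
have FR : \det (\matrix_(i < r, j < r) F (fun j => iter (n N) (@fdiff K) ('X^j * rootpoly (l N))) i j) =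
   pe r (dd * fps_comp xt (pser N (l N) (n N))) * V * (sg * d2).
  rewrite /d2 -(det_rev _ (fun i j => emb K r i (xt ^+ j * fps_comp xt (Tser N (l N) (r - j.+1) (n N))))).
  rewrite peE -(det_scale _ (fun i => emb K r i (dd * fps_comp xt (pser N (l N) (n N)))) (fun j => io K r (N%:R ^+ j))
     (fun i j => emb K r i (xt ^+ (r - j.+1) * fps_comp xt (Tser N (l N) (r - (r - j.+1).+1) (n N))))).
  congr (\det _); apply/matrixP => i j; rewrite !mxE /F nth_mkseq // /phi.
  rewrite (entry_right zhmM N0 (MnN N)) ?size_l // -/dd [in LHS]rmorphM [in LHS]rmorphM /= emb_C.
  by congr (_ * _ * emb K r i (_ * fps_comp _ (Tser _ _ _ _))); have := ltn_ord j; lia.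
rewrite FR => EF.
have pV : fps_comp xt (pser N (l N) (n N)) * fps_comp xt (fps_vinv (pser N (l N) (n N))) = 1.
  have pp : pser N (l N) (n N) * fps_vinv (pser N (l N) (n N)) = 1.
    by apply: pserV => //; [exact: size_l | exact: leq_subr].
  by rewrite -(fps_compM _ _ (xt0 izhm)) pp fps_comp1.
have Nn0 : (N%:R : K) != 0 by rewrite pnatr_eq0 -lt0n.
pose ddi := C (N%:R ^- M N) * izhm ^+ (M N + r.-1).
have ddV : dd * ddi = 1.
  by rewrite mulrACA -rmorphM divff ?expf_neq0 // rmorph1 mul1r -exprMn zhmM expr1n.
pose Vi : tow K r := \prod_(j < r) io K r (N%:R ^- j).
have VV : V * Vi = 1.
  by rewrite -big_split big1 // => j _ /=; rewrite -rmorphM divff ?expf_neq0 // rmorph1.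
have sgV : sg * sg = 1 by rewrite -expr2 sqrr_sign.
pose p0 := pser N (l N) (n N) 0%N.
pose W := pe r (ddi * (C p0 * fps_comp xt (fps_vinv (pser N (l N) (n N))))).
have WL mu : pe r (dd * q mu) * W = pe r (Yser N mu).
  rewrite -peM /Yser N0; congr pe; rewrite -/(q mu) -/p0.
  by transitivity ((dd * ddi) * (q mu * (C p0 * fps_comp xt (fps_vinv (pser N (l N) (n N)))))); [ring | rewrite ddV mul1r].
have WR : pe r (dd * fps_comp xt (pser N (l N) (n N))) * W = io K r (p0 ^+ r).
  rewrite -peM.
  transitivity (pe r (C p0)); last first.
    by rewrite peE; under eq_bigr do rewrite emb_C; rewrite prodr_const card_ord rmorphXn.
  congr pe; transitivity ((dd * ddi) * (C p0 * (fps_comp xt (pser N (l N) (n N)) * fps_comp xt (fps_vinv (pser N (l N) (n N)))))).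
    by ring.
  by rewrite ddV pV mul1r mulr1.
have rr (A : comNzRingType) (c p v vi s d w : A) : v * vi = 1 -> s * s = 1 ->
    c * (p * v * (s * d)) * (w * vi * s) = c * (p * w) * d.
  move=> vV sV; transitivity ((c * (p * w)) * d * ((v * vi) * (s * s))); first by ring.
  by rewrite vV sV !mulr1.
have := congr1 (fun x => x * (W * Vi * sg)) EF.
have -> : io K r (\prod_(k < n N) \prod_(i < r) (M N + k + i.+1)%:R)^-1 *
   (pe r (dd * fps_comp xt (pser N (l N) (n N))) * V * (sg * d2)) * (W * Vi * sg) =
   io K r (cst r N) * d2.
  rewrite /cst -/p0 rmorphM -WR.
  exact: rr VV sgV.
move=> <-; rewrite /UU mulr_suml mulr_suml big_seq [RHS]big_seq; apply: eq_bigr => mu muS.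
rewrite FL // -WL.
by rewrite (rr _ _ _ _ _ _ _ _ VV sgV).
Qed.

End Restriction.

End DeterminantalMoments.

(** * Power sums as coefficients of log Y, and the limit of their moments *)

Module PowerSumMoments.
Import Reals ZArith.
Import Defs.
Import structures.
Import all_boot all_order all_algebra all_fingroup.
Import boolp classical_sets functions reals topology normedtype sequences exp Rstruct Rstruct_topology.
Import ring lra zify ssrZ.
Import PowerSeries FiniteDifferences InterlacingSums Branching SchurIdentification GrowthFamilies Transport TransportCoordinates HomogeneousEvaluation ExponentialSeries SingleVariableLimit SeriesTower SteinEquation FaberCoefficients TowerConvergence DeterminantalMoments.
Set Implicit Arguments.
Unset Strict Implicit.
Unset Printing Implicit Defensive.
Import Order.TTheory GRing.Theory Num.Theory numFieldNormedType.Exports.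
Local Open Scope ring_scope.
Local Open Scope classical_set_scope.

Section Constants.
Variable K : realType.

Lemma pser_const_prod N M n (l : seq K) : (0 < N)%N -> size l = N -> N = (M + n)%N ->
  pser N l n 0%N = \prod_(k < n) (M + k.+1)%:R.
Proof.
move=> N0 sl NE.
have H m : (m <= n)%N -> pser N l m 0%N = \prod_(k < m) (N - k)%:R.
  elim: m => [|m IH] mn.
    by rewrite big_ord0 (pser0E sl) -(big_map (fun c => c) xpredT (fun c => 1 - fpsC (c * N%:R^-1) * fpsX K)) prod_roots0.
  by rewrite (pser_const N0 sl) ?(IH (ltnW mn)); [rewrite big_ord_recr mulrC | lia].
rewrite H // (reindex_inj rev_ord_inj); apply: eq_bigr => i _ /=.
by congr (_%:R); have := ltn_ord i; lia.
Qed.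

Lemma prod_shift (x n : nat) :
  (\prod_(k < n) (x + k.+1)%:R) * x%:R = (\prod_(k < n) (x + k)%:R) * (x + n)%:R :> K.
Proof.
rewrite -(big_ord_recr n (fun k => (x + k)%:R)) /= big_ord_recl /= addn0 mulrC.
by congr (_ * _); apply: eq_bigr.
Qed.

Lemma prod_ratio M n i :
  (\prod_(k < n) (M + k.+1)%:R) * (\prod_(t < i) (M + n + t.+1)%:R) =
  (\prod_(k < n) (M + k + i.+1)%:R) * (\prod_(t < i) (M + t.+1)%:R) :> K.
Proof.
elim: i => [|i IH].
  by rewrite !big_ord0 !mulr1; apply: eq_bigr => k _; congr (_%:R); lia.
rewrite !big_ord_recr /= mulrA IH -!mulrA [_ * (M + n + i.+1)%:R]mulrC [RHS]mulrCA [RHS]mulrC.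
rewrite -[RHS]mulrA [RHS]mulrC mulrA.
have := prod_shift (M + i.+1) n.
have -> : \prod_(k < n) (M + i.+1 + k.+1)%:R = \prod_(k < n) (M + k + i.+2)%:R :> K.
  by apply: eq_bigr => k _; congr (_%:R); lia.
have -> : \prod_(k < n) (M + i.+1 + k)%:R = \prod_(k < n) (M + k + i.+1)%:R :> K.
  by apply: eq_bigr => k _; congr (_%:R); lia.
have -> : (M + i.+1 + n = M + n + i.+1)%N by lia.
by move=> <-; rewrite [RHS]mulrC mulrA.
Qed.
End Constants.

Section LogDerivative.
Variable K : realType.
Local Notation C := (@fpsC K).
Local Notation X := (fpsX K).

Definition ld (f : fps K) : fps K := fps_theta f * fps_inv f.

Lemma ldM (f g : fps K) : f 0%N = 1 -> g 0%N = 1 -> ld (f * g) = ld f + ld g.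
Proof.
move=> f0 g0; have fg0 : (f * g) 0%N = 1 by rewrite fpsM0 f0 g0 mulr1.
have fV := fps_mulV f0; have gV := fps_mulV g0; have fgV := fps_mulV fg0.
rewrite /ld fps_thetaM.
transitivity ((fps_theta f * g + f * fps_theta g) * fps_inv (f * g) * (f * fps_inv f) * (g * fps_inv g)).
  by rewrite fV gV !mulr1.
transitivity ((f * g * fps_inv (f * g)) * (fps_theta f * fps_inv f * (g * fps_inv g) + fps_theta g * fps_inv g * (f * fps_inv f))).
  by ring.
by rewrite fV gV fgV !mul1r !mulr1.
Qed.

Lemma ld_prod (cs : seq K) (F : K -> fps K) : (forall c, F c 0%N = 1) ->
  (\prod_(c <- cs) F c) 0%N = 1 /\ ld (\prod_(c <- cs) F c) = \sum_(c <- cs) ld (F c).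
Proof.
move=> F0; elim: cs => [|c cs [IH0 IH]].
  by rewrite !big_nil /ld fps_theta1 mul0r.
by rewrite !big_cons fpsM0 IH0 F0 mulr1 ldM // IH.
Qed.

Variables (zh izh : fps K).
Hypothesis zhM : zh * izh = 1.
Let xt := X * izh.

(* zh^(p+1) theta(xt) = X (zh^p - theta(zh^p)/p) has no term of degree p+1. *)
Lemma residue_zh p : (zh ^+ p.+1 * fps_theta xt) p.+1 = (p == 0)%:R.
Proof.
have Tz : fps_theta zh * izh + zh * fps_theta izh = 0 by rewrite -fps_thetaM zhM fps_theta1.
have E : zh * (zh * fps_theta izh) = - fps_theta zh.
  transitivity (zh * (fps_theta zh * izh + zh * fps_theta izh) - fps_theta zh * (zh * izh)); first by ring.
  by rewrite Tz zhM; ring.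
have T1 : zh ^+ p.+1 * fps_theta xt = X * (zh ^+ p + zh ^+ p.+1 * fps_theta izh).
  rewrite /xt fps_thetaM fps_thetaX.
  transitivity (X * (zh ^+ p * (zh * izh) + zh ^+ p.+1 * fps_theta izh)); first by rewrite exprS; ring.
  by rewrite zhM mulr1.
rewrite T1 fpsXM; case: p {T1} => [|p] /=.
  have iz0 : (zh * fps_theta izh) 0%N = 0 by rewrite fpsM0 /fps_theta mul0r mulr0.
  by rewrite fpsDE expr0 expr1 iz0 fps1E addr0.
have -> : zh ^+ p.+2 * fps_theta izh = - (zh ^+ p * fps_theta zh).
  by rewrite !exprS -mulrN -E; ring.
have := congr1 (fun f => f p.+1) (fps_thetaXn zh p); rewrite -mulrA fps_natM {1}/fps_theta => /(mulfI _) H.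
by rewrite fpsBE H ?subrr // pnatr_eq0.
Qed.

Lemma xt_zh_pow k m : (m <= k)%N -> zh ^+ k * xt ^+ m = X ^+ m * zh ^+ (k - m).
Proof.
move=> mk; rewrite -{1}(subnKC mk) exprD mulrAC -exprMn [zh * xt]mulrC (xt_zh zhM).
by rewrite mulrC.
Qed.

(** The residue of zeta^k d log(1 - y/zeta): in the geometric expansion only the term with m = k - 1
    contributes, and it isolates y^k. *)
Lemma ld_xt k y : (0 < k)%N -> (zh ^+ k * ld (1 - C y * xt)) k = - y ^+ k.
Proof.
move=> k0; set v := fps_inv (1 - C y * xt).
have f0 : (1 - C y * xt) 0%N = 1 by rewrite fpsBE fpsCM [xt 0%N](xt0 izh) mulr0 subr0 fps1E.
have vV : (1 - C y * xt) * v = 1 by apply: fps_mulV.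
have vE : v = \sum_(m < k) (C y * xt) ^+ m + (C y * xt) ^+ k * v.
  have G := subrX1 (C y * xt) k.
  have S1 : \sum_(m < k) (C y * xt) ^+ m = (1 - (C y * xt) ^+ k) * v.
    transitivity ((1 - C y * xt) * v * \sum_(m < k) (C y * xt) ^+ m); first by rewrite vV mul1r.
    transitivity (- ((C y * xt - 1) * \sum_(m < k) (C y * xt) ^+ m) * v); first by ring.
    by rewrite -G; ring.
  by rewrite S1; ring.
have T : fps_theta (1 - C y * xt) = - (C y * fps_theta xt).
  by rewrite fps_thetaB fps_theta1 fps_thetaM fps_thetaC; ring.
rewrite /ld -/v T vE mulrDr mulrDr fpsDE.
have -> : (zh ^+ k * (- (C y * fps_theta xt) * ((C y * xt) ^+ k * v))) k = 0.
  have -> : zh ^+ k * (- (C y * fps_theta xt) * ((C y * xt) ^+ k * v)) =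
      zh ^+ k * xt ^+ k * (- (C y ^+ k.+1) * (fps_theta xt * v)).
    by rewrite exprMn exprS; ring.
  rewrite xt_zh_pow // subnn expr0 mulr1 fpsXnM leqnn subnn !fpsM0 /fps_theta mul0r.
  by rewrite mul0r mulr0.
rewrite addr0 mulr_sumr mulr_sumr fps_sumE (eq_bigr (fun m : 'I_k => - y ^+ m.+1 * (k.-1 == m)%:R)); last first.
  move=> m _; have mk := ltn_ord m.
  have -> : zh ^+ k * (- (C y * fps_theta xt) * (C y * xt) ^+ m) =
      C (- y ^+ m.+1) * ((zh ^+ k * xt ^+ m) * fps_theta xt).
    by rewrite exprMn rmorphN rmorphXn exprS; ring.
  rewrite xt_zh_pow 1?ltnW // fpsCM -mulrA fpsXnM (ltnW mk).
  have -> : (k - m = (k.-1 - m).+1)%N by lia.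
  rewrite residue_zh; congr (_ * (_ : bool)%:R).
  by apply/eqP/eqP; lia.
have pk : (k.-1 < k)%N by lia.
rewrite (bigD1 (Ordinal pk)) //= eqxx mulr1 prednK // big1 ?addr0 // => m.
by rewrite -val_eqE /= eq_sym => /negbTE ->; rewrite mulr0.
Qed.

Lemma factor0 (d c : K) : (1 - C (c / d) * xt) 0%N = 1.
Proof. by rewrite fpsBE fpsCM [xt 0%N](xt0 izh) mulr0 subr0 fps1E. Qed.

Lemma comp_hev_roots (d : K) (cs : seq K) :
  fps_comp xt (hev (@fpsC K) 1 (C d^-1 * X) (size cs) (rootpoly cs)) = \prod_(c <- cs) (1 - C (c / d) * xt).
Proof.
have x0 : xt 0%N = 0 := xt0 izh.
rewrite hev_comp // fps_comp1 fps_compM // fps_compC fps_compX //.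
by rewrite hev_rootpoly; apply: eq_bigr => c _; rewrite rmorphM mulrA.
Qed.

(** The logarithmic derivative is additive, so a further factor h changes the coefficient only by an
    additive term that does not involve the roots. *)
Lemma ld_roots k (d : K) (cs : seq K) (h : fps K) : (0 < k)%N -> h 0%N = 1 ->
  let q := fps_comp xt (hev (@fpsC K) 1 (C d^-1 * X) (size cs) (rootpoly cs)) in
  q 0%N = 1 /\ (zh ^+ k * ld (q * h)) k = - \sum_(c <- cs) (c / d) ^+ k + (zh ^+ k * ld h) k.
Proof.
move=> k0 h0; rewrite /= comp_hev_roots; have [P0 P1] := @ld_prod cs (fun c => 1 - C (c / d) * xt) (factor0 d); split=> //.
rewrite ldM // P1 mulrDr fpsDE mulr_sumr fps_sumE; congr (_ + _).
by rewrite -sumrN; apply: eq_bigr => c _; rewrite ld_xt.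
Qed.
End LogDerivative.

Section Covariance.
Variable (K : realType) (a : K) (zh : fps K).
Hypothesis a0 : a != 0.
Hypothesis zh0 : zh 0%N = a.

(** [ker] equals 1 as soon as the inner variable is 0, so its logarithmic derivative vanishes
    there. *)
Lemma Dk_j0 j : Dk a zh j 0%N = 0.
Proof.
have kc : fps_map (@fps_c0 K) (ker a zh) = 1.
  by apply/fpsP => p; rewrite -[LHS]/(((p == 0)%N && true)%:R - a^-1 * (if (p == 0)%N || true then 0 else zh (p + 0)%N)) orbT andbT mulr0 subr0 fps1E.
have : fps_map (@fps_c0 K) (Dk a zh) = 0.
  by rewrite /Dk rmorphM rmorphN /= fps_map_theta kc fps_theta1 oppr0 mul0r.
by move=> /(congr1 (fun f => f j)).
Qed.

(** Since zeta = [zh] / tau, the coefficient of index k + i in [zh ^+ k] is that of tau^i in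
    zeta^k. *)
Definition covZ k k' : K := \sum_(i < k'.+1) i%:R * (zh ^+ k') (k' - i)%N * (zh ^+ k) (k + i)%N.

(** Summing over j first turns the row of Faber coefficients, paired with [Dk], into the principal
    part of zeta^k by [faber]; the two minus signs cancel. *)
Lemma covA_covZ k k' : (0 < k)%N -> covA (Dk a zh) (fun k j => - (zh ^+ k) (k - j)%N) k k' = covZ k k'.
Proof.
move=> k0; rewrite /covA /cA.
transitivity (\sum_(j < k.+1) \sum_(i < k'.+1) i%:R * (zh ^+ k') (k' - i)%N * ((zh ^+ k) (k - j)%N * Dk a zh j i)).
  by apply: eq_bigr => j _; rewrite mulr_sumr; apply: eq_bigr => i _; ring.
rewrite exchange_big; apply: eq_bigr => i _ /=; rewrite -mulr_sumr (faber a0 zh0) //.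
by case: (val i) => [|i'] //; rewrite !mul0r.
Qed.
End Covariance.

Section Points.
Local Notation K := Rdefinitions.R.

Lemma Rsum_natE n (f : nat -> K) : Rsum_nat n f = \sum_(i <- iota 0 n) f i.
Proof. by rewrite /Rsum_nat fold_right_Rplus; congr (\sum_(i <- _) _); elim: n 0%N => //= n IH m; rewrite IH. Qed.

Lemma pts_nth (l : seq Z) :
  pts IZR l = [seq IZR (List.nth i l Z0) + INR (size l) - INR i.+1 | i <- iota 0 (size l)].
Proof.
have SI k : INR k.+1 = INR k + 1 by rewrite S_INR.
elim: l => [|z l IH] //.
rewrite -[LHS]/(IZR (Z.add z (Z.of_nat (size l))) :: pts IZR l) IH.
rewrite -[iota 0 (size (z :: l))]/(0%N :: iota 1 (size l)) map_cons; congr (_ :: _).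
  rewrite -[RHS]/(IZR z + INR (size l).+1 - INR 1) plus_IZR -INR_IZR_INZ RplusE !SI.
  by rewrite (_ : INR 0 = 0) //; ring.
rewrite -[1%N]addn0 iotaDl -map_comp; apply: eq_map => i.
rewrite -[LHS]/(IZR (List.nth i l Z0) + INR (size l) - INR i.+1).
rewrite -[RHS]/(IZR (List.nth i l Z0) + INR (size l).+1 - INR (1 + i).+1).
by rewrite add1n !SI; ring.
Qed.

Lemma pk_pts k (mu : seq Z) : pk k mu = \sum_(c <- pts IZR mu) c ^+ k.
Proof.
rewrite /pk Rsum_natE pts_nth big_map; apply: eq_bigr => i _.
by rewrite RpowE.
Qed.

End Points.

Section CLT.
Local Notation K := Rdefinitions.R.
Local Notation C := (@fpsC K).
Local Notation X := (fpsX K).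
Local Notation hv := (hev (@fpsC K)).
Variables (lam : nat -> seq Z) (S : nat -> seq (seq Z)) (rho : nat -> seq Z -> K) (M : nat -> nat).
Hypothesis lam_sig : forall N, is_sig N (lam N).
Hypothesis MN : forall N, (M N <= N)%N.
Hypothesis SGF : forall N, SGF_restriction N (M N) (lam N) (S N) (rho N).
Variables (a : K) (mom : nat -> K) (B : K).
Hypothesis a01 : 0 < a < 1.
Hypothesis M_to : (fun N => (M N)%:R / N%:R : K) @ \oo --> a.
Hypothesis B_ge0 : 0 <= B.
Let l N : seq K := pts IZR (lam N).
Hypothesis l_bd : forall N c, c \in l N -> `|c / N%:R| <= B.
Hypothesis mom_to : forall k, (fun N => N%:R^-1 * \sum_(c <- l N) (c / N%:R) ^+ k) @ \oo --> mom k.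
Let n N := (N - M N)%N.
Let zh := zhm a mom.
Let izh := izhm a mom.
Let xt := X * izh.
Let zhM : zh * izh = 1. Proof. exact: zhmM. Qed.
Let zh0 : zh 0%N = a. Proof. exact: zhm0. Qed.
Let a0 : a != 0. Proof. by have /andP[/gt_eqF ->] := a01. Qed.

Let sl N : size (l N) = N. Proof. exact: size_l lam_sig N. Qed.

Lemma cst_eq r N : (0 < N)%N -> cst lam M r N = \prod_(i < r) \prod_(t < i) ((M N + t.+1)%:R / (N + t.+1)%:R).
Proof.
move=> N0; have NE : N = (M N + n N)%N by rewrite subnKC.
rewrite /cst (pser_const_prod N0 (sl N) NE) exchange_big /= -(card_ord r) -prodr_const card_ord.
rewrite -prodfV -big_split; apply: eq_bigr => i _ /=.
have nz (m k : nat) (F : nat -> nat) : \prod_(j < m) (F j + k.+1)%:R != 0 :> K.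
  by apply/prodf_neq0 => j _; rewrite addnS pnatr_eq0.
have PR := prod_ratio K (M N) (n N) i; rewrite -NE in PR.
have nP : \prod_(k < n N) (M N + k + i.+1)%:R != 0 :> K by exact: (nz _ i (fun k => M N + k)%N).
have nQ : \prod_(t < i) (N + t.+1)%:R != 0 :> K.
  by apply/prodf_neq0 => j _; rewrite addnS pnatr_eq0.
rewrite prodf_div; apply: (canLR (mulKf nP)); rewrite mulrA; exact: (canRL (mulfK nQ)).
Qed.

(** Each of the r (r - 1)/2 ratios in [cst_eq] tends to a. *)
Lemma cst_to r : (fun N => cst lam M r N) @ \oo --> a ^+ 'C(r, 2).
Proof.
have H : (fun N : nat => \prod_(i < r) \prod_(t < i) ((M N + t.+1)%:R / (N + t.+1)%:R : K)) @ \oo --> a ^+ 'C(r, 2).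
  have -> : a ^+ 'C(r, 2) = \prod_(i < r) \prod_(t < i) a.
    under eq_bigr do rewrite prodr_const card_ord; rewrite -expr_sum; congr (_ ^+ _).
    by rewrite -bin2_sum big_mkord.
  apply: (@conv_prod (base_lim K) _ _ (fun (i : 'I_r) N => _)) => i.
  apply: (@conv_prod (base_lim K) _ _ (fun (t : 'I_i) N => _)) => t /=.
  have e0 := @inv_to0 K.
  have L1 : (fun N => (M N)%:R / N%:R + t.+1%:R * N%:R^-1 : K) @ \oo --> a.
    rewrite -[X in _ --> X]addr0 -(mulr0 (t.+1%:R : K)).
    by apply: K_cvgD => //; apply: cvg_scale.
  have L2 : (fun N => (1 + t.+1%:R * N%:R^-1 : K)^-1) @ \oo --> (1^-1 : K).
    apply: cvgV; first exact: oner_neq0.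
    rewrite -[X in _ --> X]addr0 -(mulr0 (t.+1%:R : K)).
    by apply: K_cvgD; [exact: K_cvg_cst | apply: cvg_scale].
  have := K_cvgM L1 L2; rewrite invr1 mulr1; apply: cvg_trans; apply: near_eq_cvg.
  exists 1%N => // N /= N0; have Nn : N%:R != 0 :> K by rewrite pnatr_eq0 -lt0n.
  have Ntn : N%:R + t.+1%:R != 0 :> K by rewrite -natrD addnS pnatr_eq0.
  rewrite [(M N + _)%:R]natrD [(N + _)%:R]natrD.
  have gen (F : realType) (x y z : F) : y != 0 -> y + z != 0 -> (x / y + z * y^-1) / (1 + z * y^-1) = (x + z) / (y + z).
    by move=> y0 yz; rewrite -mulrDl -{1}[1](divff y0) -mulrDl invf_div mulrA divfK.
  exact: gen.
apply: cvg_trans H; apply: near_eq_cvg; exists 1%N => // N /= N0; by rewrite cst_eq.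
Qed.

(** In the limit [Tser] j becomes the j-th power of 1/[zh], so the entry is xt^j izh^(r-1-j) =
    izh^(r-1) X^j and the determinant is a Vandermonde in tau. *)
Lemma U_conv r : conv (UU S rho (Yser lam M a mom) r) (GG a zh r).
Proof.
have a2 : a ^+ 'C(r, 2) != 0 by rewrite expf_neq0.
apply: (conv_G a0 zh0 zhM a2) => //.
have -> : io K r (a ^+ 'C(r, 2)) * (pe r izh ^+ r.-1 * vd r X) = io K r (a ^+ 'C(r, 2)) *
    \det (\matrix_(i < r, j < r) emb K r i (xt ^+ j * izh ^+ (r - j.+1))).
  congr (_ * _); rewrite vdE -(vandermonde _ (fun i => emb K r i X)) peE -prodrXl.
  transitivity (\det (\matrix_(i < r, j < r) (emb K r i izh ^+ r.-1 * 1 * emb K r i X ^+ j))).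
    rewrite (det_scale _ (fun i => emb K r i izh ^+ r.-1) (fun=> 1) (fun i j => emb K r i X ^+ j)).
    by rewrite [X in _ * X * _]big1 // mulr1.
  congr (\det _); apply/matrixP => i j; rewrite !mxE mulr1 -!rmorphXn -rmorphM; congr (emb K r i _).
  rewrite [xt ^+ j]exprMn (_ : r.-1 = j + (r - j.+1))%N; first by rewrite exprD mulrC mulrA.
  by have := ltn_ord j; lia.
apply: (@conv_near _ r (fun N => io K r (cst lam M r N) * _)).
  by exists 1%N => N N0; apply/esym; apply: (U_vd lam_sig MN SGF).
apply: convM; first exact: conv_io (@cst_to r).
apply: (@conv_det (tow K r) r (fun i j N => emb K r i (xt ^+ j * fps_comp xt (Tser N (l N) (r - j.+1) (n N)))) (fun i j => emb K r i (xt ^+ j * izh ^+ (r - j.+1)))) => i j ir jr.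
apply: conv_emb => k; rewrite fpsME; under eq_fun do rewrite fpsME.
apply: cvg_big_sum => t; apply: cvg_scale.
apply: (vser_Tser_to sl B_ge0 l_bd mom_to (s := 1 - a) (nN := n)).
  by have /andP[? ?] := a01; apply/andP; split; lra.
have := K_cvgD (@K_cvg_cst _ (1 : K)) (@cvg_scale _ (-1) _ _ M_to); rewrite mulN1r; apply: cvg_trans.
apply: near_eq_cvg; exists 1%N => // N /= N0.
rewrite /n natrB // mulrBl divff ?mulN1r // pnatr_eq0 -lt0n //.
Qed.


Let Y := Yser lam M a mom.
Let p N := pser N (l N) (n N).
Definition Hser N : fps K := C (p N 0%N) * fps_comp xt (fps_vinv (p N)).

Lemma p_neq0 N : (0 < N)%N -> p N 0%N != 0.
Proof. by move=> N0; apply: pser_neq0 => //; exact: leq_subr. Qed.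

Lemma Hser0 N : (0 < N)%N -> Hser N 0%N = 1.
Proof. by move=> N0; rewrite /Hser fpsCM fps_comp_const fps_vinv0 divff // p_neq0. Qed.

Lemma Y0 N mu : mu \in S N -> Y N mu 0%N = 1.
Proof.
move=> muS; rewrite /Y /Yser; case: ifP => // N0; rewrite fpsM0 -/(Hser N) Hser0 // mulr1.
have sz : size (pts IZR mu) = M N by rewrite size_pts (size_mu SGF muS).
by rewrite -sz; have [] := ld_roots zhM N%:R (pts IZR mu) (ltn0Sn 0) (Hser0 N0).
Qed.

Lemma La_powersum k N mu : (0 < N)%N -> (0 < k)%N -> mu \in S N ->
  (zh ^+ k * ld (Y N mu)) k = - (pk k mu / N%:R ^+ k) + (zh ^+ k * ld (Hser N)) k.
Proof.
move=> N0 k0 muS; rewrite /Y /Yser N0 -/(Hser N).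
have sz : size (pts IZR mu) = M N by rewrite size_pts (size_mu SGF muS).
have [_] := ld_roots zhM N%:R (pts IZR mu) k0 (Hser0 N0); rewrite sz => ->; congr (- _ + _).
by rewrite pk_pts mulr_suml; apply: eq_bigr => c _; rewrite exprMn exprVn.
Qed.

Let E := EE S rho.
(** The coefficients of the Faber polynomial of zeta^k, with the sign of [ld_xt]: they lead from
    theta log Y to the k-th power sum. *)
Let Ac k j : K := - (zh ^+ k) (k - j)%N.

(* Off the support of rho(N) the variables are irrelevant; they are set so that all hypotheses hold everywhere. *)
Let Y' N mu : fps K := if mu \in S N then Y N mu else 1.
Let D := Dk a zh.
Let P := Pk Y' D Ac.

Let Dk_j0 j : D j 0%N = 0. Proof. exact: Dk_j0. Qed.

Lemma U_conv' r : conv (UU S rho Y' r) (GG a zh r).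
Proof.
apply: conv_near (U_conv r); exists 0%N => N _.
by rewrite /UU big_seq [RHS]big_seq; apply: eq_bigr => mu muS; rewrite /Y' muS.
Qed.

Lemma E1 N : E N (fun=> 1) = 1.
Proof.
have [_ [_ [_ [SE _]]]] := SGF N; rewrite -[RHS]SE /Ex fold_right_Rplus.
by apply: eq_bigr.
Qed.

Let shift k N : K := if (0 < k)%N then
  (zh ^+ k * ld (Hser N)) k + \sum_(j < k.+1) Ac k j * SteinEquation.mu D j - Ex (S N) (rho N) (pk k) / N%:R ^+ k else 0.
Let X1 k N mu : K := if (0 < k)%N && (mu \in S N) then Xnk (S N) (rho N) N k mu else P k N mu + shift k N.

Lemma ExE N f : Ex (S N) (rho N) f = E N f.
Proof. by rewrite /Ex fold_right_Rplus. Qed.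

Lemma X1_shift N k mu : (0 < N)%N -> X1 k N mu = P k N mu + shift k N.
Proof.
move=> N0; rewrite /X1; case: ifP => // /andP[k0 muS].
have PE : P k N mu = - (zh ^+ k * ld (Y N mu)) k - \sum_(j < k.+1) Ac k j * SteinEquation.mu D j.
  have LaE : La Y' N mu = ld (Y N mu) by rewrite /La /Y' muS.
  rewrite /P /Pk LaE fpsME_rev -sumrN -sumrB; apply: eq_bigr => j _.
  by rewrite /Ac mulrBr mulNr.
rewrite PE La_powersum // /shift k0 /Xnk -INRE RdivE RminusE -RpowE.
move: (Ex _ _ _) (pk k mu) (\sum_(j < _) _) ((zh ^+ k * ld _) k) => x y z w.
rewrite mulrBl; ring.
Qed.

Lemma EX1 k N : E N (X1 k N) = 0.
Proof.
rewrite /X1; case: (ltnP 0 k) => k0 /=.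
  have -> : E N (fun mu => if mu \in S N then Xnk (S N) (rho N) N k mu else P k N mu + shift k N) =
      E N (fun mu => (pk k mu + - Ex (S N) (rho N) (pk k) * 1) * (pow (INR N) k)^-1).
    rewrite /E /EE big_seq [RHS]big_seq; apply: eq_bigr => mu muS; rewrite muS /Xnk RdivE RminusE.
    by rewrite mulr1.
  have -> : E N (fun mu => (pk k mu + - Ex (S N) (rho N) (pk k) * 1) * (pow (INR N) k)^-1) =
      E N (fun mu => (pow (INR N) k)^-1 * (pk k mu + - Ex (S N) (rho N) (pk k) * 1)).
    by apply: eq_bigr => mu _; rewrite [X in _ * X]mulrC.
  by rewrite /E EEZ EED EEZ -/E E1 ExE mulr1 subrr mulr0.
have -> : k = 0%N by lia.
rewrite /E /EE big1 // => mu _; rewrite /P /Pk /shift /= big_ord1 addr0 /La fpsM0 /fps_theta mul0r mul0r.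
by rewrite /SteinEquation.mu big_ord1 subnn Dk_j0 oppr0 subrr !mulr0.
Qed.

Lemma Y'0 N mu : Y' N mu 0%N = 1.
Proof. by rewrite /Y'; case: ifP => // /Y0. Qed.

Lemma mixed_moment_to ks : all (fun k => 0 < k)%N ks ->
  (fun N => mixed_moment (S N) (rho N) N ks) @ \oo --> wick D Ac (size ks) ks.
Proof.
move=> ks0; have XP : \forall N \near \oo, forall k mu, X1 k N mu = P k N mu + shift k N.
  by exists 1%N => // N /= N0 k mu; apply: X1_shift.
have := moments_wick (EED S rho) (EEZ S rho) Y'0 Dk_j0 (good1_tower U_conv') E1 XP EX1 (ks := ks).
apply: cvg_eq => // N; rewrite /mixed_moment ExE /E /EE big_seq [RHS]big_seq; apply: eq_bigr => mu muS.
congr (_ * _); elim: ks ks0 => [|k ks IH] /=; first by rewrite big_nil.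
by move=> /andP[k0 /IH <-]; rewrite big_cons /X1 k0 muS.
Qed.
End CLT.

End PowerSumMoments.

(** * The contour integral *)

Module EvaluatedSeries.
Import Reals Lra Lia Psatz.
Import Coquelicot.
Import Defs.
Open Scope R_scope.

Lemma Cmod_le_sum (x : C) : Cmod x <= Rabs (fst x) + Rabs (snd x).
Proof.
  assert (H1 := Rabs_pos (fst x)). assert (H2 := Rabs_pos (snd x)).
  unfold Cmod. rewrite <- (sqrt_pow2 (Rabs (fst x) + Rabs (snd x))) by lra.
  apply sqrt_le_1_alt. rewrite <- (pow2_abs (fst x)), <- (pow2_abs (snd x)). nra.
Qed.

Lemma Cmod_triangle_minus (x y : C) : Cmod (x - y) <= Cmod x + Cmod y.
Proof. unfold Cminus. rewrite <- (Cmod_opp y). apply Cmod_triangle. Qed.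

Lemma Cmod_sub_sym (x y : C) : Cmod (x - y) = Cmod (y - x).
Proof. rewrite <- Cmod_opp. f_equal. ring. Qed.

Fixpoint rsum (u : nat -> R) (n : nat) : R :=
  match n with O => 0 | S k => rsum u k + u k end.

Lemma rsum_front u n : rsum u (S n) = u O + rsum (fun k => u (S k)) n.
Proof.
  induction n as [|n IH]; [simpl; ring|].
  change (rsum u (S (S n))) with (rsum u (S n) + u (S n)). rewrite IH. simpl. ring.
Qed.

Lemma geom_ex (u : nat -> R) (A q : R) : (forall n, Rabs (u n) <= A * q ^ n) -> 0 <= q <= / 2 -> ex_series u.
Proof.
  intros H q0. apply (ex_series_le (K := R_AbsRing) (V := R_CompleteNormedModule) u (fun n => A * q ^ n)); [exact H|].
  apply (ex_series_scal (K := R_AbsRing) (V := R_NormedModule) A (fun n => q ^ n)). apply ex_series_geom.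
  rewrite Rabs_right; lra.
Qed.

Lemma series_tail n : forall (u : nat -> R) (A q : R), (forall n, Rabs (u n) <= A * q ^ n) ->
  0 <= q <= / 2 -> Rabs (Series u - rsum u n) <= 2 * A * q ^ n.
Proof.
  induction n as [|n IH]; intros u A q H q0; assert (Hex := geom_ex u A q H q0).
  - simpl. rewrite Rminus_0_r.
    assert (A0 : 0 <= A). { specialize (H O). simpl in H. assert (P := Rabs_pos (u O)). lra. }
    assert (E2 : ex_series (fun n => Rabs (u n))).
    { apply (geom_ex _ A q); [intros k; rewrite Rabs_Rabsolu; apply H|exact q0]. }
    apply Rle_trans with (Series (fun n => Rabs (u n))); [apply Series_Rabs; exact E2|].
    apply Rle_trans with (Series (fun n => A * q ^ n)).
    { apply Series_le; [intros k; split; [apply Rabs_pos|apply H]|].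
      apply (geom_ex _ A q); [intros k; rewrite Rabs_right; [lra|]|exact q0].
      apply Rle_ge, Rmult_le_pos; [exact A0|apply pow_le; lra]. }
    rewrite Series_scal_l, Series_geom by (rewrite Rabs_right; lra).
    assert (/ (1 - q) <= 2). { replace 2 with (/ / 2) by field. apply Rinv_le_contravar; lra. }
    nra.
  - rewrite rsum_front, (Series_incr_1 u Hex).
    replace (u O + Series (fun k => u (S k)) - (u O + rsum (fun k => u (S k)) n))
      with (Series (fun k => u (S k)) - rsum (fun k => u (S k)) n) by ring.
    replace (2 * A * q ^ S n) with (2 * (A * q) * q ^ n) by (simpl; ring).
    apply IH; [|exact q0]. intros k. specialize (H (S k)). simpl in H.
    replace (A * q * q ^ k) with (A * (q * q ^ k)) by ring. exact H.
Qed.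

Fixpoint psum (c : nat -> R) (n : nat) (x : C) : C :=
  match n with O => 0%C | S k => (psum c k x + RtoC (c k) * x ^ k)%C end.

(* Only meaningful where the series converges: Series of a divergent series is a junk value. *)
Definition ev (c : nat -> R) (x : C) : C :=
  (Series (fun n => c n * fst (x ^ n)%C), Series (fun n => c n * snd (x ^ n)%C)).

(** Explicit geometric growth. The rate L fixes the disc of evaluation, and both constants are
    followed through the algebraic operations. *)
Definition gb (A L : R) (c : nat -> R) : Prop := forall n, Rabs (c n) <= A * L ^ n.

Lemma gb_A A L c : gb A L c -> 0 <= A.
Proof. intros H. specialize (H O). simpl in H. assert (P := Rabs_pos (c O)). lra. Qed.

Lemma gb_weaken A L A' L' c : gb A L c -> 0 <= L <= L' -> A <= A' -> gb A' L' c.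
Proof.
  intros H HL HA n. assert (A0 := gb_A _ _ _ H). apply Rle_trans with (1 := H n).
  apply Rmult_le_compat; [exact A0|apply pow_le; lra|exact HA|apply pow_incr; lra].
Qed.

Lemma gb_ext A L c d : (forall n, c n = d n) -> gb A L c -> gb A L d.
Proof. intros E H n. rewrite <- E. apply H. Qed.

Lemma psum_re c n x : fst (psum c n x) = rsum (fun k => c k * fst (x ^ k)%C) n /\
  snd (psum c n x) = rsum (fun k => c k * snd (x ^ k)%C) n.
Proof. induction n as [|n [IH1 IH2]]; [split; reflexivity|]. simpl. rewrite IH1, IH2. split; ring. Qed.

(** The factor 4 is 2 for the tail of a geometric series of ratio at most 1/2, times 2 for the real
    and imaginary parts. *)
Lemma ev_err A L c x n : gb A L c -> 0 <= L -> L * Cmod x <= / 2 ->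
  Cmod (ev c x - psum c n x) <= 4 * A * (L * Cmod x) ^ n.
Proof.
  intros H L0 q1. assert (x0 := Cmod_ge_0 x). assert (q0 : 0 <= L * Cmod x) by nra.
  assert (B : forall (p : C -> R), (forall z, Rabs (p z) <= Cmod z) ->
     forall k, Rabs (c k * p (x ^ k)%C) <= A * (L * Cmod x) ^ k).
  { intros p Hp k. rewrite Rabs_mult, Rpow_mult_distr.
    assert (P := Hp (x ^ k)%C). rewrite Cmod_pow in P. assert (P2 := H k).
    assert (P3 := Rabs_pos (c k)). assert (P4 := Rabs_pos (p (x ^ k)%C)). nra. }
  assert (B1 := B fst (fun z => Rle_trans _ _ _ (Rmax_l _ _) (Rmax_Cmod z))).
  assert (B2 := B snd (fun z => Rle_trans _ _ _ (Rmax_r _ _) (Rmax_Cmod z))).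
  apply Rle_trans with (1 := Cmod_le_sum _).
  destruct (psum_re c n x) as [E1 E2].
  assert (T1 := series_tail n _ _ _ B1 (conj q0 q1)). assert (T2 := series_tail n _ _ _ B2 (conj q0 q1)).
  unfold ev, Cminus, Cplus, Copp. simpl. rewrite E1, E2. unfold Rminus in T1, T2. lra.
Qed.

Lemma ev_bound A L c x : gb A L c -> 0 <= L -> L * Cmod x <= / 2 -> Cmod (ev c x) <= 4 * A.
Proof.
  intros H L0 q1. assert (E := ev_err _ _ _ x O H L0 q1). simpl in E.
  replace (ev c x - 0)%C with (ev c x) in E by ring. lra.
Qed.

Lemma half_pow_small (B y : R) : (forall n, y <= B * (/ 2) ^ n) -> y <= 0.
Proof.
  intros H. destruct (Rle_or_lt y 0) as [|yp]; [assumption|].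
  assert (B0 : 0 < B). { specialize (H O). simpl in H. lra. }
  destruct (pow_lt_1_zero (/ 2)) with (y := y / B) as [N HN].
  - rewrite Rabs_right; lra.
  - apply Rdiv_lt_0_compat; lra.
  - specialize (HN N (le_n N)). specialize (H N). rewrite Rabs_right in HN by (apply Rle_ge, pow_le; lra).
    assert (B * (/ 2) ^ N < B * (y / B)) by (apply Rmult_lt_compat_l; assumption).
    replace (B * (y / B)) with y in H0 by (field; lra). lra.
Qed.

Lemma pow_half_le q n : 0 <= q <= / 2 -> q ^ n <= (/ 2) ^ n.
Proof. intros. apply pow_incr. lra. Qed.

(** The means by which identities between partial sums pass to values of series. *)
Lemma ev_unique A L c x v B : gb A L c -> 0 <= L -> L * Cmod x <= / 2 ->
  (forall n, Cmod (v - psum c (S n) x) <= B * (/ 2) ^ n) -> v = ev c x.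
Proof.
  intros H L0 q1 Hv. assert (A0 := gb_A _ _ _ H). assert (x0 := Cmod_ge_0 x).
  assert (Z : Cmod (v - ev c x) <= 0).
  { apply half_pow_small with (B + 4 * A). intros n.
    replace (v - ev c x)%C with ((v - psum c (S n) x) - (ev c x - psum c (S n) x))%C by ring.
    apply Rle_trans with (1 := Cmod_triangle_minus _ _).
    assert (E := ev_err _ _ _ x (S n) H L0 q1). specialize (Hv n).
    assert (P := pow_half_le (L * Cmod x) (S n) (conj (Rmult_le_pos _ _ L0 x0) q1)).
    assert (P2 : (/ 2) ^ S n <= (/ 2) ^ n). { simpl. assert (0 <= (/2)^n) by (apply pow_le; lra). lra. }
    assert (4 * A * (L * Cmod x) ^ S n <= 4 * A * (/ 2) ^ n) by (apply Rmult_le_compat_l; lra). lra. }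
  assert (Z2 : (v - ev c x)%C = 0%C). { apply Cmod_eq_0. apply Rle_antisym; [exact Z|apply Cmod_ge_0]. }
  replace v with ((v - ev c x) + ev c x)%C by ring. rewrite Z2. ring.
Qed.

Lemma ev_ext c d x : (forall n, c n = d n) -> ev c x = ev d x.
Proof. intros E. unfold ev. f_equal; apply Series_ext; intros n; rewrite E; reflexivity. Qed.

Lemma psum_ext c d n x : (forall n, c n = d n) -> psum c n x = psum d n x.
Proof. intros E. induction n as [|n IH]; simpl; [reflexivity|]. rewrite IH, E. reflexivity. Qed.

Lemma psum_lin a b c d n x :
  psum (fun k => a * c k + b * d k) n x = (RtoC a * psum c n x + RtoC b * psum d n x)%C.
Proof.
  induction n as [|n IH]; simpl; [ring|]. rewrite IH, RtoC_plus, !RtoC_mult. ring.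
Qed.

Lemma gb_lin a b c d A A' L : gb A L c -> gb A' L d -> 0 <= L ->
  gb (Rabs a * A + Rabs b * A') L (fun k => a * c k + b * d k).
Proof.
  intros H H' L0 n. apply Rle_trans with (1 := Rabs_triang _ _). rewrite !Rabs_mult.
  specialize (H n). specialize (H' n). assert (P := Rabs_pos a). assert (P' := Rabs_pos b). nra.
Qed.

Lemma ev_lin a b c d A A' L x : gb A L c -> gb A' L d -> 0 <= L -> L * Cmod x <= / 2 ->
  ev (fun k => a * c k + b * d k) x = (RtoC a * ev c x + RtoC b * ev d x)%C.
Proof.
  intros H H' L0 q1. symmetry.
  apply ev_unique with (Rabs a * A + Rabs b * A') L (Rabs a * (4 * A) + Rabs b * (4 * A')); auto.
  { apply gb_lin; auto. }
  intros n. rewrite psum_lin.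
  replace (RtoC a * ev c x + RtoC b * ev d x - (RtoC a * psum c (S n) x + RtoC b * psum d (S n) x))%C
    with (RtoC a * (ev c x - psum c (S n) x) + RtoC b * (ev d x - psum d (S n) x))%C by ring.
  apply Rle_trans with (1 := Cmod_triangle _ _). rewrite !Cmod_mult, !Cmod_R.
  assert (E := ev_err _ _ _ x (S n) H L0 q1). assert (E' := ev_err _ _ _ x (S n) H' L0 q1).
  assert (P := pow_half_le (L * Cmod x) (S n) (conj (Rmult_le_pos _ _ L0 (Cmod_ge_0 x)) q1)).
  assert (P2 : (/ 2) ^ S n <= (/ 2) ^ n). { simpl. assert (0 <= (/2)^n) by (apply pow_le; lra). lra. }
  assert (A0 := gb_A _ _ _ H). assert (A0' := gb_A _ _ _ H').
  assert (Q : 4 * A * (L * Cmod x) ^ S n <= 4 * A * (/ 2) ^ n) by (apply Rmult_le_compat_l; lra).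
  assert (Q' : 4 * A' * (L * Cmod x) ^ S n <= 4 * A' * (/ 2) ^ n) by (apply Rmult_le_compat_l; lra).
  assert (Pa := Rabs_pos a). assert (Pb := Rabs_pos b).
  rewrite Rmult_plus_distr_r, !Rmult_assoc in *.
  apply Rplus_le_compat; apply Rmult_le_compat_l; lra.
Qed.

Definition delta0 (a : R) : nat -> R := fun n => match n with O => a | S _ => 0 end.

Lemma gb_delta0 a L : 0 <= L -> gb (Rabs a) L (delta0 a).
Proof.
  intros L0 [|n]; simpl; [lra|]. rewrite Rabs_R0.
  apply Rmult_le_pos; [apply Rabs_pos|]. apply (pow_le L (S n) L0).
Qed.

Lemma psum_delta0 a n x : psum (delta0 a) (S n) x = RtoC a.
Proof. induction n as [|n IH]; [simpl; ring|]. change (psum (delta0 a) (S n) x + RtoC 0 * x ^ S n = RtoC a)%C. rewrite IH. ring. Qed.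

Lemma ev_delta0 a x : ev (delta0 a) x = RtoC a.
Proof.
  symmetry. apply ev_unique with (Rabs a) 0 0; [apply gb_delta0; lra|lra|lra|].
  intros n. rewrite psum_delta0. replace (RtoC a - RtoC a)%C with (RtoC 0) by ring. rewrite Cmod_0. lra.
Qed.

Definition shift1 (c : nat -> R) : nat -> R := fun n => c (S n).

Lemma gb_shift1 A L c : gb A L c -> gb (A * L) L (shift1 c).
Proof. intros H n. unfold shift1. specialize (H (S n)). simpl in H. rewrite Rmult_assoc. exact H. Qed.

Lemma psum_front c n x : psum c (S n) x = (RtoC (c O) + x * psum (shift1 c) n x)%C.
Proof.
  induction n as [|n IH]; [simpl; ring|].
  change (psum c (S (S n)) x) with (psum c (S n) x + RtoC (c (S n)) * x ^ S n)%C.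
  rewrite IH, Cpow_S. simpl psum. unfold shift1 at 3. ring.
Qed.

Lemma ev_front A L c x : gb A L c -> 0 <= L -> L * Cmod x <= / 2 ->
  ev c x = (RtoC (c O) + x * ev (shift1 c) x)%C.
Proof.
  intros H L0 q1. symmetry. assert (H' := gb_shift1 _ _ _ H).
  apply ev_unique with A L (4 * (A * L) * Cmod x); auto. intros n. rewrite psum_front.
  replace (RtoC (c O) + x * ev (shift1 c) x - (RtoC (c O) + x * psum (shift1 c) n x))%C
    with (x * (ev (shift1 c) x - psum (shift1 c) n x))%C by ring.
  rewrite Cmod_mult. assert (E := ev_err _ _ _ x n H' L0 q1).
  assert (P := pow_half_le (L * Cmod x) n (conj (Rmult_le_pos _ _ L0 (Cmod_ge_0 x)) q1)).
  assert (A0 := gb_A _ _ _ H').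
  assert (Q : 4 * (A * L) * (L * Cmod x) ^ n <= 4 * (A * L) * (/ 2) ^ n) by (apply Rmult_le_compat_l; lra).
  assert (x0 := Cmod_ge_0 x).
  replace (4 * (A * L) * Cmod x * (/ 2) ^ n) with (Cmod x * (4 * (A * L) * (/ 2) ^ n)) by ring.
  apply Rmult_le_compat_l; lra.
Qed.

Definition shift (p : nat) (c : nat -> R) : nat -> R := fun n => c (p + n)%nat.

Lemma gb_shift A L p c : gb A L c -> gb (A * L ^ p) L (shift p c).
Proof. intros H n. unfold shift. specialize (H (p + n)%nat). rewrite pow_add, <- Rmult_assoc in H. exact H. Qed.

Fixpoint csum (F : nat -> C) (n : nat) : C :=
  match n with O => 0%C | S k => (csum F k + F k)%C end.

Lemma csum_ext F G n : (forall k, (k < n)%nat -> F k = G k) -> csum F n = csum G n.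
Proof. induction n as [|n IH]; intros H; simpl; [reflexivity|]. rewrite IH, H; auto. Qed.

Lemma csum_plus F G n : csum (fun k => F k + G k)%C n = (csum F n + csum G n)%C.
Proof. induction n as [|n IH]; simpl; [ring|]. rewrite IH. ring. Qed.

Lemma csum_scal a F n : csum (fun k => a * F k)%C n = (a * csum F n)%C.
Proof. induction n as [|n IH]; simpl; [ring|]. rewrite IH. ring. Qed.

Lemma csum_bound F n B : (forall k, (k < n)%nat -> Cmod (F k) <= B) -> Cmod (csum F n) <= INR n * B.
Proof.
  induction n as [|n IH]; intros H; [simpl; rewrite Cmod_0; lra|].
  rewrite S_INR. simpl csum. apply Rle_trans with (1 := Cmod_triangle _ _).
  assert (H1 := H n (Nat.lt_succ_diag_r n)).
  assert (H2 := IH (fun k Hk => H k (Nat.lt_lt_succ_r _ _ Hk))). lra.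
Qed.

Definition cmul (c d : nat -> R) : nat -> R := fun n => sum_f_R0 (fun i => c i * d (n - i)%nat) n.

Lemma RtoC_sum F n : RtoC (sum_f_R0 F n) = csum (fun k => RtoC (F k)) (S n).
Proof. induction n as [|n IH]; [simpl; ring|]. simpl sum_f_R0. rewrite RtoC_plus, IH. reflexivity. Qed.

Lemma psum_csum c n x : psum c n x = csum (fun k => RtoC (c k) * x ^ k)%C n.
Proof. induction n as [|n IH]; simpl; [reflexivity|]. rewrite IH. reflexivity. Qed.

Lemma psum_cmul c d n x :
  psum (cmul c d) n x = csum (fun j => RtoC (c j) * x ^ j * psum d (n - j) x)%C n.
Proof.
  induction n as [|n IH]; [reflexivity|].
  change (psum (cmul c d) n x + RtoC (cmul c d n) * x ^ n =
    csum (fun j => RtoC (c j) * x ^ j * psum d (S n - j) x) n + RtoC (c n) * x ^ n * psum d (S n - n) x)%C.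
  rewrite (csum_ext (fun j => RtoC (c j) * x ^ j * psum d (S n - j) x)%C
    (fun j => RtoC (c j) * x ^ j * psum d (n - j) x + x ^ n * RtoC (c j * d (n - j)%nat))%C).
  - rewrite csum_plus, <- IH, csum_scal. unfold cmul. rewrite RtoC_sum.
    replace (S n - n)%nat with 1%nat by lia. simpl csum. rewrite Nat.sub_diag, RtoC_mult. simpl psum. ring.
  - intros k Hk. replace (S n - k)%nat with (S (n - k)) by lia. simpl psum. rewrite RtoC_mult.
    replace (x ^ n)%C with (x ^ k * x ^ (n - k))%C; [ring|]. rewrite <- Cpow_add_r. f_equal. lia.
Qed.

Lemma INR_le_pow2 n : INR n + 1 <= 2 ^ n.
Proof. induction n as [|n IH]; [simpl; lra|]. rewrite S_INR. simpl. assert (P := pos_INR n). lra. Qed.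

Lemma sum_bound F n B : (forall k, (k <= n)%nat -> Rabs (F k) <= B) -> Rabs (sum_f_R0 F n) <= (INR n + 1) * B.
Proof.
  induction n as [|n IH]; intros H; [simpl; rewrite Rplus_0_l, Rmult_1_l; apply H; lia|].
  rewrite S_INR. simpl sum_f_R0. apply Rle_trans with (1 := Rabs_triang _ _).
  assert (H1 := H (S n) (le_n _)). assert (H2 := IH (fun k Hk => H k (le_S _ _ Hk))). lra.
Qed.

(** The n + 1 terms of the convolution are paid for by doubling the rate, because n + 1 <= 2^n. *)
Lemma gb_cmul A A' L c d : gb A L c -> gb A' L d -> 0 <= L -> gb (A * A') (2 * L) (cmul c d).
Proof.
  intros H H' L0 n. assert (A0 := gb_A _ _ _ H). assert (A0' := gb_A _ _ _ H').
  apply Rle_trans with ((INR n + 1) * (A * A' * L ^ n)).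
  - apply sum_bound. intros k Hk. rewrite Rabs_mult.
    replace (L ^ n) with (L ^ k * L ^ (n - k)) by (rewrite <- pow_add; f_equal; lia).
    replace (A * A' * (L ^ k * L ^ (n - k))) with ((A * L ^ k) * (A' * L ^ (n - k))) by ring.
    apply Rmult_le_compat; auto using Rabs_pos.
  - rewrite Rpow_mult_distr. assert (P := INR_le_pow2 n).
    assert (0 <= A * A' * L ^ n) by (apply Rmult_le_pos; [nra|apply pow_le; auto]). nra.
Qed.

(** The doubled rate of the product explains 1/4 in place of 1/2. The error splits into the tail of
    one factor and the tails of the other, weighted by the terms of the first. *)
Lemma ev_mul A A' L c d x : gb A L c -> gb A' L d -> 0 <= L -> L * Cmod x <= / 4 ->
  ev (cmul c d) x = (ev c x * ev d x)%C.
Proof.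
  intros H H' L0 q1. assert (A0 := gb_A _ _ _ H). assert (A0' := gb_A _ _ _ H').
  assert (x0 := Cmod_ge_0 x). set (q := L * Cmod x) in *. assert (q0 : 0 <= q) by (unfold q; nra).
  symmetry. apply ev_unique with (A * A') (2 * L) (16 * A * A' + 4 * A * A'); [apply gb_cmul; auto|lra|unfold q in q1; lra|].
  intros n0. set (n := S n0). rewrite psum_cmul.
  assert (E1 : (ev c x * ev d x - csum (fun j => RtoC (c j) * x ^ j * psum d (n - j) x) n =
    (ev c x - psum c n x) * ev d x + csum (fun j => RtoC (c j) * x ^ j * (ev d x - psum d (n - j) x)) n)%C).
  { rewrite (csum_ext (fun j => RtoC (c j) * x ^ j * (ev d x - psum d (n - j) x))%C
      (fun j => ev d x * (RtoC (c j) * x ^ j) + (-1) * (RtoC (c j) * x ^ j * psum d (n - j) x))%C)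
      by (intros; ring).
    rewrite csum_plus, !csum_scal, <- psum_csum. ring. }
  rewrite E1. apply Rle_trans with (1 := Cmod_triangle _ _).
  assert (q2 : q <= / 2) by lra.
  assert (B1 : Cmod ((ev c x - psum c n x) * ev d x) <= 16 * A * A' * q ^ n).
  { rewrite Cmod_mult. assert (E := ev_err _ _ _ x n H L0 q2). assert (E' := ev_bound _ _ _ x H' L0 q2). fold q in E.
    assert (P1 := Cmod_ge_0 (ev c x - psum c n x)). assert (P2 := Cmod_ge_0 (ev d x)).
    replace (16 * A * A' * q ^ n) with ((4 * A * q ^ n) * (4 * A')) by ring.
    apply Rmult_le_compat; auto. }
  assert (B2 : Cmod (csum (fun j => RtoC (c j) * x ^ j * (ev d x - psum d (n - j) x))%C n) <= INR n * (4 * A * A' * q ^ n)).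
  { apply csum_bound. intros k Hk. rewrite !Cmod_mult, Cmod_R, Cmod_pow.
    assert (E' := ev_err _ _ _ x (n - k) H' L0 q2). fold q in E'. specialize (H k).
    replace (q ^ n) with (q ^ k * q ^ (n - k)) by (rewrite <- pow_add; f_equal; lia).
    replace (4 * A * A' * (q ^ k * q ^ (n - k))) with ((A * q ^ k) * (4 * A' * q ^ (n - k))) by ring.
    apply Rmult_le_compat; [apply Rmult_le_pos; [apply Rabs_pos|apply pow_le; auto]|apply Cmod_ge_0| |exact E'].
    unfold q. rewrite Rpow_mult_distr, <- Rmult_assoc. apply Rmult_le_compat_r; [apply pow_le; auto|exact H]. }
  assert (q3 : q ^ n <= (/ 4) ^ n) by (apply pow_incr; lra).
  assert (q4 : (INR n + 1) * (/ 4) ^ n <= (/ 2) ^ n).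
  { replace (/ 4) with (/ 2 * / 2) by lra. rewrite Rpow_mult_distr, <- Rmult_assoc.
    rewrite <- (Rmult_1_l ((/ 2) ^ n)) at 3. apply Rmult_le_compat_r; [apply pow_le; lra|].
    rewrite pow_inv. assert (P := INR_le_pow2 n). assert (0 < 2 ^ n) by (apply pow_lt; lra).
    apply Rmult_le_reg_r with (2 ^ n); [assumption|]. rewrite Rmult_assoc, Rinv_l by lra. lra. }
  assert (q5 : (/ 2) ^ n <= (/ 2) ^ n0). { unfold n. simpl. assert (0 <= (/2)^n0) by (apply pow_le; lra). lra. }
  assert (q6 : 0 <= q ^ n) by (apply pow_le; auto). assert (Pn := pos_INR n).
  assert (q7 : INR n * q ^ n <= (/ 2) ^ n0) by nra. assert (q8 : q ^ n <= (/ 2) ^ n0) by nra.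
  assert (0 <= A * A') by nra. nra.
Qed.

Definition dser (c : nat -> R) : nat -> R := fun n => (INR n + 1) * c (S n).

Lemma gb_dser A L c : gb A L c -> 0 <= L -> gb (A * L) (2 * L) (dser c).
Proof.
  intros H L0 n. unfold dser. rewrite Rabs_mult, Rabs_right by (assert (P := pos_INR n); lra).
  specialize (H (S n)). simpl in H. rewrite Rpow_mult_distr. assert (P := INR_le_pow2 n).
  assert (P2 := Rabs_pos (c (S n))). assert (P3 := pos_INR n).
  apply Rle_trans with (2 ^ n * (A * (L * L ^ n))); [apply Rmult_le_compat; lra|]. apply Req_le. ring.
Qed.

(** Second-order Taylor remainder of a monomial, scaled by the growth rate. The factor 2^-(i+1)
    makes the remainders summable over i. *)
Lemma powdiff L x y i : 0 < L -> L * Cmod x <= / 4 -> L * Cmod y <= / 4 ->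
  L ^ S i * Cmod (x ^ S i - y ^ S i - (RtoC (INR i + 1)) * (x - y) * y ^ i)
    <= 16 * L ^ 2 * (/ 2) ^ S i * Cmod (x - y) ^ 2.
Proof.
  intros L0 Hx Hy. assert (m0 := Cmod_ge_0 (x - y)%C). assert (x0 := Cmod_ge_0 x). assert (y0 := Cmod_ge_0 y).
  induction i as [|i IH].
  - replace (x ^ 1 - y ^ 1 - RtoC (INR 0 + 1) * (x - y) * y ^ 0)%C with (RtoC 0).
    + rewrite Cmod_0, Rmult_0_r. simpl. repeat apply Rmult_le_pos; lra.
    + rewrite RtoC_plus. simpl. ring.
  - replace (x ^ S (S i) - y ^ S (S i) - RtoC (INR (S i) + 1) * (x - y) * y ^ S i)%C
      with (x * (x ^ S i - y ^ S i - RtoC (INR i + 1) * (x - y) * y ^ i) + RtoC (INR i + 1) * (x - y) ^ 2 * y ^ i)%C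
      by (rewrite S_INR, !RtoC_plus, !Cpow_S; ring).
    set (D := (x ^ S i - y ^ S i - _)%C) in *.
    apply Rle_trans with (L ^ S (S i) * (Cmod (x * D) + Cmod (RtoC (INR i + 1) * (x - y) ^ 2 * y ^ i))).
    { apply Rmult_le_compat_l; [apply pow_le; lra|apply Cmod_triangle]. }
    rewrite !Cmod_mult, Cmod_R, !Cmod_pow, Rabs_right by (assert (P := pos_INR i); lra).
    set (m := Cmod (x - y)%C) in *.
    assert (H1 : L ^ S (S i) * (Cmod x * Cmod D) <= / 4 * (16 * L ^ 2 * (/ 2) ^ S i * m ^ 2)).
    { replace (L ^ S (S i) * (Cmod x * Cmod D)) with ((L * Cmod x) * (L ^ S i * Cmod D)) by (simpl; ring).
      apply Rmult_le_compat; [nra|apply Rmult_le_pos; [apply pow_le; lra|apply Cmod_ge_0]|lra|exact IH]. }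
    assert (H2 : L ^ S (S i) * ((INR i + 1) * m ^ 2 * Cmod y ^ i) <= L ^ 2 * m ^ 2 * (2 * (/ 2) ^ i)).
    { replace (L ^ S (S i) * ((INR i + 1) * m ^ 2 * Cmod y ^ i))
        with (L ^ 2 * m ^ 2 * ((INR i + 1) * (L * Cmod y) ^ i)) by (rewrite Rpow_mult_distr; simpl; ring).
      apply Rmult_le_compat_l; [apply Rmult_le_pos; apply pow2_ge_0|].
      assert (P := INR_le_pow2 i). assert (P2 := pos_INR i).
      apply Rle_trans with (2 ^ i * (/ 4) ^ i).
      - apply Rmult_le_compat; [lra|apply pow_le; nra|lra|apply pow_incr; nra].
      - rewrite <- Rpow_mult_distr. replace (2 * / 4) with (/ 2) by lra.
        assert (0 <= (/ 2) ^ i) by (apply pow_le; lra). lra. }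
    rewrite Rmult_plus_distr_l.
    replace (16 * L ^ 2 * (/ 2) ^ S (S i) * m ^ 2)
      with (/ 4 * (16 * L ^ 2 * (/ 2) ^ S i * m ^ 2) + L ^ 2 * m ^ 2 * (2 * (/ 2) ^ i)) by (simpl; field).
    lra.
Qed.

(** The remainders of [powdiff] summed against the coefficients, first for partial sums; [dser] is
    the termwise derivative. *)
Lemma ev_quad A L c x y : gb A L c -> 0 < L -> L * Cmod x <= / 8 -> L * Cmod y <= / 8 ->
  Cmod (ev c x - ev c y - (x - y) * ev (dser c) y) <= 32 * A * L ^ 2 * Cmod (x - y) ^ 2.
Proof.
  intros H L0 Hx Hy. assert (A0 := gb_A _ _ _ H). assert (m0 := Cmod_ge_0 (x - y)%C).
  assert (x0 := Cmod_ge_0 x). assert (y0 := Cmod_ge_0 y).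
  set (K := A * (16 * L ^ 2 * Cmod (x - y) ^ 2)).
  assert (K0 : 0 <= K). { unfold K. repeat apply Rmult_le_pos; try lra; apply pow2_ge_0. }
  assert (S1 : forall n, Cmod (psum c (S n) x - psum c (S n) y - (x - y) * psum (dser c) n y) <= 2 * K * (1 - (/ 2) ^ S n)).
  { induction n as [|n IH].
    - replace (psum c 1 x - psum c 1 y - (x - y) * psum (dser c) 0 y)%C with (RtoC 0) by (simpl; ring).
      rewrite Cmod_0. simpl. lra.
    - change (psum c (S (S n)) x) with (psum c (S n) x + RtoC (c (S n)) * x ^ S n)%C.
      change (psum c (S (S n)) y) with (psum c (S n) y + RtoC (c (S n)) * y ^ S n)%C.
      change (psum (dser c) (S n) y) with (psum (dser c) n y + RtoC ((INR n + 1) * c (S n)) * y ^ n)%C.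
      replace (psum c (S n) x + RtoC (c (S n)) * x ^ S n - (psum c (S n) y + RtoC (c (S n)) * y ^ S n)
        - (x - y) * (psum (dser c) n y + RtoC ((INR n + 1) * c (S n)) * y ^ n))%C
        with ((psum c (S n) x - psum c (S n) y - (x - y) * psum (dser c) n y)
          + RtoC (c (S n)) * (x ^ S n - y ^ S n - RtoC (INR n + 1) * (x - y) * y ^ n))%C
        by (rewrite RtoC_mult; ring).
      apply Rle_trans with (1 := Cmod_triangle _ _). rewrite Cmod_mult, Cmod_R.
      assert (P := powdiff L x y n L0 ltac:(lra) ltac:(lra)).
      set (D := Cmod (x ^ S n - _ - _)%C) in *. assert (D0 : 0 <= D) by apply Cmod_ge_0.
      assert (Q : Rabs (c (S n)) * D <= K * (/ 2) ^ S n).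
      { apply Rle_trans with (A * L ^ S n * D); [apply Rmult_le_compat_r; auto; apply H|].
        rewrite Rmult_assoc. apply Rle_trans with (A * (16 * L ^ 2 * (/ 2) ^ S n * Cmod (x - y) ^ 2)).
        - apply Rmult_le_compat_l; auto.
        - apply Req_le. unfold K. ring. }
      replace (2 * K * (1 - (/ 2) ^ S (S n))) with (2 * K * (1 - (/ 2) ^ S n) + K * (/ 2) ^ S n) by (simpl; field).
      lra. }
  replace (32 * A * L ^ 2 * Cmod (x - y) ^ 2) with (2 * K) by (unfold K; ring).
  assert (H' := gb_dser _ _ _ H (Rlt_le _ _ L0)).
  apply Rminus_le. apply half_pow_small with (8 * A + Cmod (x - y) * (4 * (A * L))). intros n.
  assert (q2x : L * Cmod x <= / 2) by lra. assert (q2y : L * Cmod y <= / 2) by lra.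
  assert (q2d : 2 * L * Cmod y <= / 2) by lra.
  assert (E1 := ev_err _ _ _ x (S n) H (Rlt_le _ _ L0) q2x). assert (E2 := ev_err _ _ _ y (S n) H (Rlt_le _ _ L0) q2y).
  assert (E3 := ev_err _ _ _ y n H' ltac:(lra) q2d).
  assert (p1 := pow_half_le (L * Cmod x) (S n) ltac:(split; nra)).
  assert (p2 := pow_half_le (L * Cmod y) (S n) ltac:(split; nra)).
  assert (p3 := pow_half_le (2 * L * Cmod y) n ltac:(split; nra)).
  assert (h0 : 0 <= (/ 2) ^ n) by (apply pow_le; lra). simpl in p1, p2.
  specialize (S1 n). assert (h1 : 0 <= (/ 2) ^ S n) by (apply pow_le; lra).
  replace (ev c x - ev c y - (x - y) * ev (dser c) y)%C with
    (((ev c x - psum c (S n) x) - (ev c y - psum c (S n) y)) +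
     ((psum c (S n) x - psum c (S n) y - (x - y) * psum (dser c) n y) - (x - y) * (ev (dser c) y - psum (dser c) n y)))%C by ring.
  assert (T1 := Cmod_triangle_minus (ev c x - psum c (S n) x) (ev c y - psum c (S n) y)).
  assert (T2 := Cmod_triangle_minus (psum c (S n) x - psum c (S n) y - (x - y) * psum (dser c) n y)
     ((x - y) * (ev (dser c) y - psum (dser c) n y))).
  rewrite (Cmod_mult (x - y)) in T2.
  assert (T3 := Cmod_triangle ((ev c x - psum c (S n) x) - (ev c y - psum c (S n) y))
    ((psum c (S n) x - psum c (S n) y - (x - y) * psum (dser c) n y) - (x - y) * (ev (dser c) y - psum (dser c) n y))).
  assert (F1 : Cmod (ev c x - psum c (S n) x) <= 4 * A * (/ 2) ^ n).
  { apply Rle_trans with (1 := E1). apply Rmult_le_compat_l; [lra|]. simpl. lra. }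
  assert (F2 : Cmod (ev c y - psum c (S n) y) <= 4 * A * (/ 2) ^ n).
  { apply Rle_trans with (1 := E2). apply Rmult_le_compat_l; [lra|]. simpl. lra. }
  assert (F3 : Cmod (x - y) * Cmod (ev (dser c) y - psum (dser c) n y) <= Cmod (x - y) * (4 * (A * L) * (/ 2) ^ n)).
  { apply Rmult_le_compat_l; [lra|]. apply Rle_trans with (1 := E3). apply Rmult_le_compat_l; [nra|lra]. }
  assert (F4 : 2 * K * (1 - (/ 2) ^ S n) <= 2 * K) by nra.
  lra.
Qed.

End EvaluatedSeries.

(** * Complex derivatives, the exponential and the principal logarithm *)

Module ComplexDerivatives.
Import Reals Lra Lia Psatz.
Import Coquelicot.
Import Defs.
Import EvaluatedSeries.
Open Scope R_scope.

(** Differentiability in epsilon-delta form without division; it is converted to the library notion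
    only where [C_derive] has to be evaluated. *)
Definition cder (f : C -> C) (x l : C) : Prop := forall eps, 0 < eps -> exists d, 0 < d /\
  forall y, Cmod (y - x) < d -> Cmod (f y - f x - (y - x) * l) <= eps * Cmod (y - x).

Lemma cder_is_derive f x l : cder f x l -> @is_derive C_AbsRing C_NormedModule f x l.
Proof.
  intros H. split; [apply is_linear_scal_l|].
  intros z Hz. apply (@is_filter_lim_locally_unique C_AbsRing (AbsRing_NormedModule C_AbsRing) x z) in Hz. subst z.
  intros eps. destruct (H eps (cond_pos eps)) as [d [d0 Hd]]. exists (mkposreal d d0). intros y Hy.
  apply (Hd y Hy).
Qed.

Lemma cder_quad (f : C -> C) (x l : C) (B d : R) : 0 < d ->
  (forall y, Cmod (y - x) < d -> Cmod (f y - f x - (y - x) * l) <= B * Cmod (y - x) ^ 2) -> cder f x l.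
Proof.
  intros d0 H eps e0. exists (Rmin d (eps / (Rabs B + 1))). assert (P := Rabs_pos B). assert (P2 := Rle_abs B). split.
  { apply Rmin_pos; auto. apply Rdiv_lt_0_compat; lra. }
  intros y Hy. apply Rle_trans with (1 := H y (Rlt_le_trans _ _ _ Hy (Rmin_l _ _))).
  assert (Hy2 := Rlt_le_trans _ _ _ Hy (Rmin_r _ _)). assert (m0 := Cmod_ge_0 (y - x)%C).
  apply (Rmult_lt_compat_r (Rabs B + 1)) in Hy2; [|lra].
  unfold Rdiv in Hy2. rewrite Rmult_assoc, Rinv_l, Rmult_1_r in Hy2 by lra.
  replace (B * Cmod (y - x) ^ 2) with (B * Cmod (y - x) * Cmod (y - x)) by ring.
  apply Rmult_le_compat_r; [auto|]. nra.
Qed.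

Lemma cder_lip f x l : cder f x l -> exists d, 0 < d /\ forall y, Cmod (y - x) < d ->
  Cmod (f y - f x) <= (Cmod l + 1) * Cmod (y - x).
Proof.
  intros H. destruct (H 1 Rlt_0_1) as [d [d0 Hd]]. exists d. split; auto. intros y Hy. specialize (Hd y Hy).
  replace (f y - f x)%C with ((f y - f x - (y - x) * l) + (y - x) * l)%C by ring.
  apply Rle_trans with (1 := Cmod_triangle _ _). rewrite Cmod_mult. lra.
Qed.

Lemma cder_ext_loc f g x l d : 0 < d -> (forall y, Cmod (y - x) < d -> f y = g y) -> cder f x l -> cder g x l.
Proof.
  intros d0 E H eps e0. destruct (H eps e0) as [d' [d0' Hd]]. exists (Rmin d d'). split; [apply Rmin_pos; auto|].
  intros y Hy. rewrite <- (E y), <- (E x).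
  - apply Hd. apply Rlt_le_trans with (1 := Hy), Rmin_r.
  - replace (x - x)%C with (RtoC 0) by ring. rewrite Cmod_0. exact d0.
  - apply Rlt_le_trans with (1 := Hy), Rmin_l.
Qed.

Lemma cder_const a x : cder (fun _ => a) x 0%C.
Proof.
  apply cder_quad with 0 1; [lra|]. intros y _. replace (a - a - (y - x) * 0)%C with (RtoC 0) by ring.
  rewrite Cmod_0. lra.
Qed.

Lemma cder_id x : cder (fun z => z) x 1%C.
Proof.
  apply cder_quad with 0 1; [lra|]. intros y _. replace (y - x - (y - x) * 1)%C with (RtoC 0) by ring.
  rewrite Cmod_0. lra.
Qed.

Lemma cder_plus f g x l m : cder f x l -> cder g x m -> cder (fun z => f z + g z)%C x (l + m)%C.
Proof.
  intros Hf Hg eps e0. destruct (Hf (eps / 2) ltac:(lra)) as [d [d0 Hd]]. destruct (Hg (eps / 2) ltac:(lra)) as [d' [d0' Hd']].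
  exists (Rmin d d'). split; [apply Rmin_pos; auto|]. intros y Hy.
  specialize (Hd y (Rlt_le_trans _ _ _ Hy (Rmin_l _ _))). specialize (Hd' y (Rlt_le_trans _ _ _ Hy (Rmin_r _ _))).
  replace (f y + g y - (f x + g x) - (y - x) * (l + m))%C with ((f y - f x - (y - x) * l) + (g y - g x - (y - x) * m))%C by ring.
  apply Rle_trans with (1 := Cmod_triangle _ _). lra.
Qed.

Lemma cder_mult f g x l m : cder f x l -> cder g x m -> cder (fun z => f z * g z)%C x (l * g x + f x * m)%C.
Proof.
  intros Hf Hg eps e0. set (A := Cmod (f x) + Cmod (g x) + 1).
  assert (p1 := Cmod_ge_0 (f x)). assert (p2 := Cmod_ge_0 (g x)).
  assert (A0 : 0 < A) by (unfold A; lra).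
  assert (e1 : 0 < eps / (3 * A)) by (apply Rdiv_lt_0_compat; lra).
  destruct (Hf _ e1) as [d1 [d10 H1]]. destruct (Hg _ e1) as [d2 [d20 H2]].
  destruct (cder_lip _ _ _ Hf) as [d3 [d30 H3]]. destruct (cder_lip _ _ _ Hg) as [d4 [d40 H4]].
  set (B := (Cmod l + 1) * (Cmod m + 1)).
  assert (p3 := Cmod_ge_0 l). assert (p4 := Cmod_ge_0 m). assert (B0 : 0 < B) by (unfold B; nra).
  exists (Rmin (Rmin d1 d2) (Rmin (Rmin d3 d4) (eps / (3 * B)))). split.
  { repeat apply Rmin_pos; auto. apply Rdiv_lt_0_compat; lra. }
  intros y Hy.
  assert (y1 : Cmod (y - x) < d1) by (apply Rlt_le_trans with (1 := Hy); apply Rle_trans with (1 := Rmin_l _ _), Rmin_l).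
  assert (y2 : Cmod (y - x) < d2) by (apply Rlt_le_trans with (1 := Hy); apply Rle_trans with (1 := Rmin_l _ _), Rmin_r).
  assert (y3 : Cmod (y - x) < d3) by (apply Rlt_le_trans with (1 := Hy); apply Rle_trans with (1 := Rmin_r _ _); apply Rle_trans with (1 := Rmin_l _ _), Rmin_l).
  assert (y4 : Cmod (y - x) < d4) by (apply Rlt_le_trans with (1 := Hy); apply Rle_trans with (1 := Rmin_r _ _); apply Rle_trans with (1 := Rmin_l _ _), Rmin_r).
  assert (y5 : Cmod (y - x) < eps / (3 * B)) by (apply Rlt_le_trans with (1 := Hy); apply Rle_trans with (1 := Rmin_r _ _), Rmin_r).
  specialize (H1 y y1). specialize (H2 y y2). specialize (H3 y y3). specialize (H4 y y4).
  replace (f y * g y - f x * g x - (y - x) * (l * g x + f x * m))%C with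
    ((f y - f x - (y - x) * l) * g x + (f x * (g y - g x - (y - x) * m) + (f y - f x) * (g y - g x)))%C by ring.
  apply Rle_trans with (1 := Cmod_triangle _ _).
  assert (T := Cmod_triangle (f x * (g y - g x - (y - x) * m)) ((f y - f x) * (g y - g x))).
  rewrite !Cmod_mult in *. set (h := Cmod (y - x)%C) in *. assert (h0 : 0 <= h) by apply Cmod_ge_0.
  assert (b1 : Cmod (f y - f x - (y - x) * l) * Cmod (g x) <= eps / (3 * A) * h * A).
  { apply Rmult_le_compat; auto using Cmod_ge_0. unfold A; lra. }
  assert (b2 : Cmod (f x) * Cmod (g y - g x - (y - x) * m) <= A * (eps / (3 * A) * h)).
  { apply Rmult_le_compat; auto using Cmod_ge_0. unfold A; lra. }
  assert (b3 : Cmod (f y - f x) * Cmod (g y - g x) <= eps / 3 * h).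
  { apply Rle_trans with (((Cmod l + 1) * h) * ((Cmod m + 1) * h)); [apply Rmult_le_compat; auto using Cmod_ge_0|].
    replace ((Cmod l + 1) * h * ((Cmod m + 1) * h)) with (B * h * h) by (unfold B; ring).
    apply Rmult_le_compat_r; auto. apply Rle_trans with (B * (eps / (3 * B))); [apply Rmult_le_compat_l; lra|].
    apply Req_le. field. lra. }
  replace (eps / (3 * A) * h * A) with (eps / 3 * h) in b1 by (field; lra).
  replace (A * (eps / (3 * A) * h)) with (eps / 3 * h) in b2 by (field; lra). lra.
Qed.

Lemma cder_comp f g x l m : cder f x l -> cder g (f x) m -> cder (fun z => g (f z)) x (l * m)%C.
Proof.
  intros Hf Hg eps e0. destruct (cder_lip _ _ _ Hf) as [d1 [d10 H1]].
  assert (p3 := Cmod_ge_0 l). assert (p4 := Cmod_ge_0 m).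
  assert (e1 : 0 < eps / (2 * (Cmod l + 1))) by (apply Rdiv_lt_0_compat; lra).
  assert (e2 : 0 < eps / (2 * (Cmod m + 1))) by (apply Rdiv_lt_0_compat; lra).
  destruct (Hg _ e1) as [d2 [d20 H2]]. destruct (Hf _ e2) as [d3 [d30 H3]].
  exists (Rmin (Rmin d1 d3) (d2 / (Cmod l + 1))). split.
  { repeat apply Rmin_pos; auto. apply Rdiv_lt_0_compat; lra. }
  intros y Hy.
  assert (y1 : Cmod (y - x) < d1) by (apply Rlt_le_trans with (1 := Hy); apply Rle_trans with (1 := Rmin_l _ _), Rmin_l).
  assert (y3 : Cmod (y - x) < d3) by (apply Rlt_le_trans with (1 := Hy); apply Rle_trans with (1 := Rmin_l _ _), Rmin_r).
  assert (y2 : Cmod (y - x) < d2 / (Cmod l + 1)) by (apply Rlt_le_trans with (1 := Hy), Rmin_r).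
  specialize (H1 y y1). specialize (H3 y y3).
  assert (y2' : Cmod (f y - f x) < d2).
  { apply Rle_lt_trans with (1 := H1). apply (Rmult_lt_compat_l (Cmod l + 1)) in y2; [|lra].
    replace ((Cmod l + 1) * (d2 / (Cmod l + 1))) with d2 in y2 by (field; lra). exact y2. }
  specialize (H2 _ y2').
  replace (g (f y) - g (f x) - (y - x) * (l * m))%C with
    ((g (f y) - g (f x) - (f y - f x) * m) + (f y - f x - (y - x) * l) * m)%C by ring.
  apply Rle_trans with (1 := Cmod_triangle _ _). rewrite Cmod_mult.
  set (h := Cmod (y - x)%C) in *. assert (h0 : 0 <= h) by apply Cmod_ge_0.
  assert (b1 : eps / (2 * (Cmod l + 1)) * Cmod (f y - f x) <= eps / 2 * h).
  { apply Rle_trans with (eps / (2 * (Cmod l + 1)) * ((Cmod l + 1) * h)); [apply Rmult_le_compat_l; lra|].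
    apply Req_le. field. lra. }
  assert (b2 : Cmod (f y - f x - (y - x) * l) * Cmod m <= eps / 2 * h).
  { apply Rle_trans with (eps / (2 * (Cmod m + 1)) * h * (Cmod m + 1)).
    - apply Rmult_le_compat; auto using Cmod_ge_0. lra.
    - apply Req_le. field. lra. }
  lra.
Qed.

Lemma cder_inv (x : C) : x <> 0%C -> cder Cinv x (- / (x * x))%C.
Proof.
  intros x0. assert (m0 : 0 < Cmod x) by (apply (proj1 (Cmod_gt_0 x)); exact x0).
  apply cder_quad with (2 / Cmod x ^ 3) (Cmod x / 2); [lra|]. intros y Hy.
  assert (my : Cmod x / 2 <= Cmod y).
  { assert (T := Cmod_triangle_minus y (y - x)). replace (y - (y - x))%C with x in T by ring. lra. }
  assert (y0 : y <> 0%C) by (apply (proj2 (Cmod_gt_0 y)); lra).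
  replace (/ y - / x - (y - x) * - / (x * x))%C with ((y - x) ^ 2 / (x * x * y))%C by (simpl; field; auto).
  rewrite Cmod_div, Cmod_pow, !Cmod_mult by (repeat apply Cmult_neq_0; auto).
  assert (P := pow2_ge_0 (Cmod (y - x)%C)). unfold Rdiv. rewrite Rmult_comm. apply Rmult_le_compat_r; auto.
  replace (2 * / Cmod x ^ 3) with (/ (Cmod x * Cmod x * (Cmod x / 2))) by (simpl; field; lra).
  apply Rinv_le_contravar; [repeat apply Rmult_lt_0_compat; lra|]. apply Rmult_le_compat_l; [|lra].
  apply Rlt_le, Rmult_lt_0_compat; lra.
Qed.

Lemma cder_pow f x l n : cder f x l -> cder (fun z => f z ^ S n)%C x (RtoC (INR (S n)) * f x ^ n * l)%C.
Proof.
  intros H. induction n as [|n IH].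
  - apply cder_ext_loc with f 1; [lra|intros; simpl; ring|]. replace (RtoC (INR 1) * f x ^ 0 * l)%C with l by (simpl; ring). exact H.
  - assert (M := cder_mult _ _ _ _ _ H IH).
    replace (RtoC (INR (S (S n))) * f x ^ S n * l)%C with (l * f x ^ S n + f x * (RtoC (INR (S n)) * f x ^ n * l))%C.
    + exact M.
    + rewrite (S_INR (S n)), RtoC_plus, Cpow_S. ring.
Qed.

Lemma cder_scal a f x l : cder f x l -> cder (fun z => a * f z)%C x (a * l)%C.
Proof.
  intros H. assert (M := cder_mult _ _ _ _ _ (cder_const a x) H).
  replace (a * l)%C with (0 * f x + a * l)%C by ring. exact M.
Qed.

Definition ccont (f : C -> C) x := forall eps, 0 < eps -> exists d, 0 < d /\
  forall y, Cmod (y - x) < d -> Cmod (f y - f x) < eps.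

(** Derivative of a right inverse that is only assumed continuous: differentiability of f at G x,
    with f (G y) = y, forces G to be Lipschitz at x. *)
Lemma cder_inverse f G x l r : 0 < r -> (forall y, Cmod (y - x) < r -> f (G y) = y) -> ccont G x ->
  cder f (G x) l -> l <> 0%C -> cder G x (/ l)%C.
Proof.
  intros r0 HG Hc Hf l0 eps e0. assert (m0 : 0 < Cmod l) by (apply (proj1 (Cmod_gt_0 l)); exact l0).
  (* The first bound gives |G y - G x| <= 2 |y - x| / |l|; the second turns the remaining error into
     eps |y - x|. *)
  set (eta := Rmin (Cmod l / 2) (eps * Cmod l ^ 2 / 2)).
  assert (et : 0 < eta). { apply Rmin_pos; [lra|]. assert (0 < Cmod l ^ 2) by (apply pow_lt; auto). nra. }
  destruct (Hf eta et) as [d1 [d10 H1]]. destruct (Hc d1 d10) as [d2 [d20 H2]].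
  exists (Rmin r d2). split; [apply Rmin_pos; auto|]. intros y Hy.
  assert (y1 := Rlt_le_trans _ _ _ Hy (Rmin_l _ _)). assert (y2 := Rlt_le_trans _ _ _ Hy (Rmin_r _ _)).
  specialize (H1 _ (H2 y y2)). rewrite (HG y y1), (HG x) in H1.
  2:{ replace (x - x)%C with (RtoC 0) by ring. rewrite Cmod_0. auto. }
  set (k := Cmod (G y - G x)%C) in *. assert (k0 : 0 <= k) by apply Cmod_ge_0.
  set (h := Cmod (y - x)%C) in *. assert (h0 : 0 <= h) by apply Cmod_ge_0.
  assert (b1 : eta <= Cmod l / 2) by apply Rmin_l. assert (b2 : eta <= eps * Cmod l ^ 2 / 2) by apply Rmin_r.
  assert (kb : k * Cmod l <= h + eta * k).
  { unfold k at 1. rewrite <- Cmod_mult. replace ((G y - G x) * l)%C with ((y - x) - (y - x - (G y - G x) * l))%C by ring.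
    apply Rle_trans with (1 := Cmod_triangle_minus _ _). fold h. lra. }
  assert (kb2 : k * Cmod l <= 2 * h) by nra.
  replace (G y - G x - (y - x) * / l)%C with (- ((y - x - (G y - G x) * l) / l))%C by (field; auto).
  rewrite Cmod_opp, Cmod_div by auto. apply Rmult_le_reg_r with (Cmod l); auto.
  unfold Rdiv. rewrite Rmult_assoc, Rinv_l, Rmult_1_r by lra. apply Rle_trans with (1 := H1).
  apply Rmult_le_reg_r with (Cmod l); auto.
  apply Rle_trans with (eta * (2 * h)); [rewrite Rmult_assoc; apply Rmult_le_compat_l; lra|].
  apply Rle_trans with (eps * Cmod l ^ 2 / 2 * (2 * h)); [apply Rmult_le_compat_r; lra|]. apply Req_le. field.
Qed.

Definition cexp (z : C) : C := (exp (fst z) * cos (snd z), exp (fst z) * sin (snd z)).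

Lemma cexp_plus z w : cexp (z + w) = (cexp z * cexp w)%C.
Proof.
  unfold cexp, Cmult, Cplus. simpl. rewrite exp_plus, cos_plus, sin_plus. f_equal; ring.
Qed.

Lemma cexp_0 : cexp 0 = 1%C.
Proof. unfold cexp. simpl. rewrite exp_0, cos_0, sin_0. unfold RtoC. f_equal; ring. Qed.

Lemma sin_mvt y : exists c, Rabs c <= Rabs y /\ sin y = cos c * y.
Proof.
  destruct (MVT_gen sin 0 y cos) as [c [Hc E]].
  - intros x _. apply is_derive_sin.
  - intros x _. apply continuity_sin.
  - exists c. rewrite sin_0, !Rminus_0_r in E. split; [|exact E].
    unfold Rmin, Rmax in Hc. unfold Rabs. destruct (Rle_dec 0 y); destruct (Rcase_abs c); destruct (Rcase_abs y); lra.
Qed.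

Lemma sin_abs y : Rabs (sin y) <= Rabs y.
Proof.
  destruct (sin_mvt y) as [c [_ E]]. rewrite E, Rabs_mult. assert (P := Rabs_pos y).
  assert (Q := COS_bound c). assert (Rabs (cos c) <= 1) by (apply Rabs_le; lra). nra.
Qed.

Lemma cos_abs y : Rabs (cos y - 1) <= y ^ 2 / 2.
Proof.
  replace y with (2 * (y / 2)) at 1 by field. rewrite cos_2a_sin.
  assert (P := sin_abs (y / 2)). assert (Q := Rabs_pos (sin (y / 2))).
  replace (1 - 2 * sin (y / 2) * sin (y / 2) - 1) with (- (2 * (sin (y / 2) * sin (y / 2)))) by ring.
  rewrite Rabs_Ropp, Rabs_mult, (Rabs_right 2), Rabs_mult by lra.
  rewrite <- (pow2_abs y). replace (Rabs (y / 2)) with (Rabs y / 2) in P.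
  - nra.
  - unfold Rdiv. rewrite Rabs_mult, (Rabs_right (/ 2)); lra.
Qed.

Lemma sin_abs2 y : Rabs y <= 1 -> Rabs (sin y - y) <= y ^ 2.
Proof.
  intros H. destruct (sin_mvt y) as [c [Hc E]]. rewrite E. replace (cos c * y - y) with ((cos c - 1) * y) by ring.
  rewrite Rabs_mult. assert (P := cos_abs c). assert (P2 := Rabs_pos (cos c - 1)). rewrite <- (pow2_abs c) in P.
  rewrite <- (pow2_abs y). assert (P3 := Rabs_pos y). assert (P4 := Rabs_pos c).
  apply Rle_trans with (Rabs c ^ 2 / 2 * Rabs y); [apply Rmult_le_compat_r; auto|]. nra.
Qed.

Lemma exp_abs x : Rabs x <= / 2 -> Rabs (exp x - 1 - x) <= 2 * x ^ 2 /\ exp x <= 2.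
Proof.
  intros H. assert (H1 := exp_ineq1_le x). assert (H2 := exp_ineq1_le (- x)). rewrite exp_Ropp in H2.
  assert (x1 : - / 2 <= x <= / 2) by (apply Rabs_le_between; exact H).
  assert (P := exp_pos x).
  assert (H3 : exp x * (1 - x) <= 1).
  { apply (Rmult_le_compat_l (exp x)) in H2; [|lra]. rewrite Rinv_r in H2 by lra. lra. }
  assert (H4 : exp x <= 2) by nra. split; [|exact H4].
  rewrite Rabs_right by lra.
  assert (E : (exp x - 1 - x) * (1 - x) <= x ^ 2) by nra. assert (Q := pow2_ge_0 x). nra.
Qed.

Lemma cder_cexp w : cder cexp w (cexp w).
Proof.
  apply cder_quad with (Cmod (cexp w) * 10) (/ 2); [lra|]. intros y Hy. set (h := (y - w)%C) in *.
  replace y with (w + h)%C at 1 by (unfold h; ring). rewrite cexp_plus.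
  replace (cexp w * cexp h - cexp w - h * cexp w)%C with (cexp w * (cexp h - 1 - h))%C by ring.
  rewrite Cmod_mult, Rmult_assoc. apply Rmult_le_compat_l; [apply Cmod_ge_0|].
  apply Rle_trans with (1 := Cmod_le_sum _). destruct h as [a b]. 
  assert (Ha := Rle_trans _ _ _ (Rmax_l _ _) (Rmax_Cmod (a, b))). assert (Hb := Rle_trans _ _ _ (Rmax_r _ _) (Rmax_Cmod (a, b))).
  simpl in Ha, Hb. set (m := Cmod (a, b)) in *.
  unfold cexp, Cminus, Cplus, Copp. simpl fst. simpl snd.
  destruct (exp_abs a ltac:(lra)) as [e1 e2]. assert (c1 := cos_abs b). assert (s1 := sin_abs2 b ltac:(lra)).
  assert (pa := Rabs_pos a). assert (pb := Rabs_pos b). assert (ep := exp_pos a).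
  replace (exp a * cos b + - (1) + - a) with ((exp a - 1 - a) + exp a * (cos b - 1)) by ring.
  replace (exp a * sin b + - 0 + - b) with (exp a * (sin b - b) + ((exp a - 1 - a) + a) * b) by ring.
  assert (A2 : a ^ 2 <= m ^ 2) by (rewrite <- (pow2_abs a); nra).
  assert (B2 : b ^ 2 <= m ^ 2) by (rewrite <- (pow2_abs b); nra).
  assert (T1 : Rabs (exp a - 1 - a + exp a * (cos b - 1)) <= 3 * m ^ 2).
  { apply Rle_trans with (1 := Rabs_triang _ _). rewrite Rabs_mult, (Rabs_right (exp a)) by lra.
    assert (P := Rabs_pos (cos b - 1)). nra. }
  assert (T2 : Rabs (exp a * (sin b - b) + (exp a - 1 - a + a) * b) <= 4 * m ^ 2).
  { apply Rle_trans with (1 := Rabs_triang _ _). rewrite !Rabs_mult, (Rabs_right (exp a)) by lra.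
    assert (P := Rabs_pos (sin b - b)).
    assert (Q := Rabs_triang (exp a - 1 - a) a). assert (P2 := Rabs_pos (exp a - 1 - a + a)).
    assert (a2 : a ^ 2 <= / 2 * Rabs a) by (rewrite <- (pow2_abs a); nra).
    assert (R1 : exp a * Rabs (sin b - b) <= 2 * m ^ 2) by nra.
    assert (R2 : Rabs (exp a - 1 - a + a) * Rabs b <= 2 * m ^ 2) by nra. lra. }
  assert (0 <= m ^ 2) by apply pow2_ge_0. simpl in *. lra.
Qed.

Lemma cexp_Clog (x : C) : 0 < fst x -> cexp (Clog x) = x.
Proof.
  intros H. destruct x as [a b]. simpl in H. unfold cexp, Clog, Carg. simpl.
  destruct (Rlt_dec 0 a) as [h0|h0]; simpl; [clear h0|contradiction].
  assert (m0 : 0 < Cmod (a, b)). { apply (proj1 (Cmod_gt_0 _)). intros E. injection E. lra. }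
  rewrite exp_ln by exact m0. rewrite cos_atan, sin_atan.
  assert (E : Cmod (a, b) = a * sqrt (1 + (b / a)²)).
  { unfold Cmod. simpl fst. simpl snd. rewrite <- (sqrt_pow2 a) at 2 by lra. rewrite <- sqrt_mult.
    - f_equal. unfold Rsqr. field. lra.
    - apply pow2_ge_0.
    - assert (P := Rle_0_sqr (b / a)). lra. }
  assert (s0 : 0 < sqrt (1 + (b / a)²)) by (apply sqrt_lt_R0; assert (P := Rle_0_sqr (b / a)); lra).
  rewrite E. f_equal; field; lra.
Qed.

Lemma ccont_Clog (x : C) : 0 < fst x -> ccont Clog x.
Proof.
  intros H eps e0. assert (m0 : 0 < Cmod x). { apply (proj1 (Cmod_gt_0 _)). intros E. rewrite E in H. simpl in H. lra. }
  assert (C1 : continuous (T := C_UniformSpace) (U := R_UniformSpace) (fun z : C => ln (Cmod z)) x).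
  { apply (continuous_comp (U := C_UniformSpace) (V := R_UniformSpace) (W := R_UniformSpace) Cmod ln).
    - apply filterlim_locally. intros e. assert (he : 0 < e / 2) by (assert (P := cond_pos e); lra).
      exists (mkposreal _ he). intros y [h1 h2]. change C in y.
      change (Rabs (fst y - fst x) < e / 2) in h1. change (Rabs (snd y - snd x) < e / 2) in h2.
      change (Rabs (Cmod y - Cmod x) < e). apply Rle_lt_trans with (Cmod (y - x)).
      + apply Rabs_le. assert (T := Cmod_triangle (y - x) x). assert (T' := Cmod_triangle_minus y (y - x)).
        replace (y - x + x)%C with y in T by ring. replace (y - (y - x))%C with x in T' by ring. lra.
      + apply Rle_lt_trans with (1 := Cmod_le_sum _). simpl. unfold Rminus in h1, h2. lra.
    - apply continuity_pt_filterlim. apply derivable_continuous_pt. exists (/ Cmod x). apply derivable_pt_lim_ln. exact m0. }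
  assert (C2 : continuous (T := C_UniformSpace) (U := R_UniformSpace) (fun z : C => atan (snd z / fst z)) x).
  { apply (continuous_comp (U := C_UniformSpace) (V := R_UniformSpace) (W := R_UniformSpace) (fun z : C => snd z / fst z) atan).
    - apply (continuous_mult (U := C_UniformSpace) (K := R_AbsRing) (fun z : C => snd z) (fun z : C => / fst z)).
      + apply (continuous_snd (U := R_UniformSpace) (V := R_UniformSpace)).
      + apply (continuous_comp (U := C_UniformSpace) (V := R_UniformSpace) (W := R_UniformSpace) (fun z : C => fst z) Rinv).
        * apply (continuous_fst (U := R_UniformSpace) (V := R_UniformSpace)).
        * apply continuity_pt_filterlim. apply continuity_pt_inv; [apply derivable_continuous_pt, derivable_pt_id|lra].
    - apply continuity_pt_filterlim. apply derivable_continuous_pt. apply derivable_pt_atan. }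
  assert (e2 : 0 < eps / 2) by lra.
  destruct (proj1 (filterlim_locally _ _) C1 (mkposreal _ e2)) as [d1 H1].
  destruct (proj1 (filterlim_locally _ _) C2 (mkposreal _ e2)) as [d2 H2].
  exists (Rmin (fst x) (Rmin d1 d2)). split.
  { repeat apply Rmin_pos; auto; apply cond_pos. }
  intros y Hy. assert (ya := Rlt_le_trans _ _ _ Hy (Rmin_l _ _)).
  assert (yb := Rlt_le_trans _ _ _ Hy (Rmin_r _ _)).
  assert (y1 := Rlt_le_trans _ _ _ yb (Rmin_l _ _)). assert (y2 := Rlt_le_trans _ _ _ yb (Rmin_r _ _)).
  assert (Hf := Rle_trans _ _ _ (Rmax_l _ _) (Rmax_Cmod (y - x)%C)). assert (Hs := Rle_trans _ _ _ (Rmax_r _ _) (Rmax_Cmod (y - x)%C)).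
  simpl in Hf, Hs.
  assert (ball1 : forall d : posreal, Cmod (y - x) < d -> ball (M := C_UniformSpace) x d y).
  { intros d Hd. split; unfold ball; simpl; unfold AbsRing_ball, abs, minus, plus, opp; simpl; lra. }
  specialize (H1 y (ball1 _ y1)). specialize (H2 y (ball1 _ y2)).
  change (Rabs (ln (Cmod y) - ln (Cmod x)) < eps / 2) in H1.
  change (Rabs (atan (snd y / fst y) - atan (snd x / fst x)) < eps / 2) in H2.
  assert (fy : 0 < fst y). { assert (P := Rabs_def2 _ _ (Rle_lt_trans _ _ _ Hf ya)). lra. }
  apply Rle_lt_trans with (1 := Cmod_le_sum _).
  unfold Clog, Carg. destruct (Rlt_dec 0 (fst y)); [|contradiction]. destruct (Rlt_dec 0 (fst x)); [|contradiction].
  simpl. unfold Rminus in H1, H2. lra.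
Qed.

(** On the right half-plane [Clog] is a continuous right inverse of [cexp], so the rule for inverses
    applies. *)
Lemma cder_Clog (x : C) : 0 < fst x -> cder Clog x (/ x)%C.
Proof.
  intros H. assert (E := cexp_Clog x H).
  apply cder_inverse with cexp (fst x); auto.
  - intros y Hy. apply cexp_Clog.
    assert (Hf := Rle_trans _ _ _ (Rmax_l _ _) (Rmax_Cmod (y - x)%C)). simpl in Hf.
    assert (P := Rabs_def2 _ _ (Rle_lt_trans _ _ _ Hf Hy)). lra.
  - apply ccont_Clog, H.
  - rewrite <- E at 2. apply cder_cexp.
  - intros Z. rewrite Z in H. simpl in H. lra.
Qed.

Definition pder (g : R -> C) (t : R) (v : C) : Prop := forall eps, 0 < eps -> exists d, 0 < d /\
  forall s, Rabs (s - t) < d -> Cmod (g s - g t - RtoC (s - t) * v) <= eps * Rabs (s - t).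

Lemma cder_pder f g t v l : cder f (g t) l -> pder g t v -> pder (fun s => f (g s)) t (v * l)%C.
Proof.
  intros Hf Hg eps e0. assert (p3 := Cmod_ge_0 v). assert (p4 := Cmod_ge_0 l).
  destruct (Hg 1 Rlt_0_1) as [d1 [d10 H1]].
  assert (e1 : 0 < eps / (2 * (Cmod v + 1))) by (apply Rdiv_lt_0_compat; lra).
  assert (e2 : 0 < eps / (2 * (Cmod l + 1))) by (apply Rdiv_lt_0_compat; lra).
  destruct (Hf _ e1) as [d2 [d20 H2]]. destruct (Hg _ e2) as [d3 [d30 H3]].
  exists (Rmin (Rmin d1 d3) (d2 / (Cmod v + 1))). split.
  { repeat apply Rmin_pos; auto. apply Rdiv_lt_0_compat; lra. }
  intros y Hy.
  assert (y1 : Rabs (y - t) < d1) by (apply Rlt_le_trans with (1 := Hy); apply Rle_trans with (1 := Rmin_l _ _), Rmin_l).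
  assert (y3 : Rabs (y - t) < d3) by (apply Rlt_le_trans with (1 := Hy); apply Rle_trans with (1 := Rmin_l _ _), Rmin_r).
  assert (y2 : Rabs (y - t) < d2 / (Cmod v + 1)) by (apply Rlt_le_trans with (1 := Hy), Rmin_r).
  specialize (H1 y y1). specialize (H3 y y3).
  set (h := Rabs (y - t)) in *. assert (h0 : 0 <= h) by apply Rabs_pos.
  assert (H1' : Cmod (g y - g t) <= (Cmod v + 1) * h).
  { replace (g y - g t)%C with ((g y - g t - RtoC (y - t) * v) + RtoC (y - t) * v)%C by ring.
    apply Rle_trans with (1 := Cmod_triangle _ _). rewrite Cmod_mult, Cmod_R. fold h. lra. }
  assert (y2' : Cmod (g y - g t) < d2).
  { apply Rle_lt_trans with (1 := H1'). apply (Rmult_lt_compat_l (Cmod v + 1)) in y2; [|lra].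
    replace ((Cmod v + 1) * (d2 / (Cmod v + 1))) with d2 in y2 by (field; lra). exact y2. }
  specialize (H2 _ y2').
  replace (f (g y) - f (g t) - RtoC (y - t) * (v * l))%C with
    ((f (g y) - f (g t) - (g y - g t) * l) + (g y - g t - RtoC (y - t) * v) * l)%C by ring.
  apply Rle_trans with (1 := Cmod_triangle _ _). rewrite Cmod_mult.
  assert (b1 : eps / (2 * (Cmod v + 1)) * Cmod (g y - g t) <= eps / 2 * h).
  { apply Rle_trans with (eps / (2 * (Cmod v + 1)) * ((Cmod v + 1) * h)); [apply Rmult_le_compat_l; lra|].
    apply Req_le. field. lra. }
  assert (b2 : Cmod (g y - g t - RtoC (y - t) * v) * Cmod l <= eps / 2 * h).
  { apply Rle_trans with (eps / (2 * (Cmod l + 1)) * h * (Cmod l + 1)).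
    - apply Rmult_le_compat; auto using Cmod_ge_0. lra.
    - apply Req_le. field. lra. }
  lra.
Qed.

Lemma pder_is_derive g t v : pder g t v -> @is_derive R_AbsRing C_R_NormedModule g t v.
Proof.
  intros H. split; [apply is_linear_scal_l|].
  intros z Hz. apply (@is_filter_lim_locally_unique R_AbsRing (AbsRing_NormedModule R_AbsRing) t z) in Hz. subst z.
  intros eps. destruct (H eps (cond_pos eps)) as [d [d0 Hd]]. exists (mkposreal d d0). intros y Hy.
  specialize (Hd y Hy). rewrite <- scal_R_Cmult, Cmod_norm in Hd. exact Hd.
Qed.

Lemma pder_lin a t : pder (fun s => RtoC s * a)%C t a.
Proof.
  intros eps e0. exists 1. split; [lra|]. intros s _.
  replace (RtoC s * a - RtoC t * a - RtoC (s - t) * a)%C with (RtoC 0) by (rewrite RtoC_minus; ring).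
  rewrite Cmod_0. assert (P := Rabs_pos (s - t)). nra.
Qed.

Lemma pder_circle r t : pder (fun s => RtoC r * Cexpi s)%C t (Ci * RtoC r * Cexpi t)%C.
Proof.
  assert (E : forall s, Cexpi s = cexp (RtoC s * Ci)).
  { intros s. unfold Cexpi, cexp, Cmult, Ci, RtoC. simpl.
    replace (s * 0 - 0 * 1) with 0 by ring. replace (s * 1 + 0 * 0) with s by ring. rewrite exp_0. f_equal; ring. }
  assert (H := cder_pder _ _ _ _ _ (cder_scal (RtoC r) _ _ _ (cder_cexp (RtoC t * Ci)%C)) (pder_lin Ci t)).
  simpl in H. rewrite <- E in H. replace (Ci * RtoC r * Cexpi t)%C with (Ci * (RtoC r * Cexpi t))%C by ring.
  intros eps e0. destruct (H eps e0) as [d [d0 Hd]]. exists d. split; auto. intros s Hs. rewrite !E. rewrite E in Hd. apply Hd, Hs.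
Qed.

End ComplexDerivatives.

(** * Growth of coefficients under products, inverses and exponentials *)

Module SeriesBounds.
Import Reals Lra Lia Psatz.
Import Coquelicot.
Import Defs.
Import EvaluatedSeries ComplexDerivatives.
Open Scope R_scope.

(* Unlike gb with a fixed L, this class is stable under products, so that all powers of a series
   can be evaluated in one common disc. *)
Definition gbx (L : R) (c : nat -> R) : Prop := forall M, L < M -> exists A, gb A M c.

Lemma gb_gbx A L c : 0 <= L -> gb A L c -> gbx L c.
Proof.
  intros L0 H M HM. exists A. apply gb_weaken with (1 := H); lra.
Qed.

Lemma succ_le_pow theta n : 1 < theta -> INR n + 1 <= (1 + / (theta - 1)) * theta ^ n.
Proof.
  intros H. assert (P := poly n (theta - 1) ltac:(lra)). replace (1 + (theta - 1)) with theta in P by ring.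
  set (q := / (theta - 1)). assert (q0 : 0 < q) by (apply Rinv_0_lt_compat; lra).
  assert (E : q * (theta - 1) = 1) by (apply Rinv_l; lra). assert (N := pos_INR n).
  apply Rle_trans with ((1 + q) * (1 + INR n * (theta - 1))).
  - replace ((1 + q) * (1 + INR n * (theta - 1))) with (1 + q + INR n * (theta - 1) + INR n * (q * (theta - 1))) by ring.
    rewrite E. assert (0 <= INR n * (theta - 1)) by (apply Rmult_le_pos; lra). lra.
  - apply Rmult_le_compat_l; lra.
Qed.

(** A factor n + 1 is absorbed by any increase of the rate; the midpoint between L and M leaves room
    on both sides. *)
Lemma gbx_succ L c : 0 < L -> (forall M, L < M -> exists B, forall n, Rabs (c n) <= B * (INR n + 1) * M ^ n) -> 
  gbx L c.
Proof.
  intros L0 H M HM. set (M' := (L + M) / 2). assert (m1 : L < M' < M) by (unfold M'; lra).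
  destruct (H M' (proj1 m1)) as [B HB]. 
  assert (th : 1 < M / M'). { apply Rmult_lt_reg_r with M'; [lra|]. unfold Rdiv. rewrite Rmult_assoc, Rinv_l; lra. }
  exists (Rabs B * (1 + / (M / M' - 1))). intros n. apply Rle_trans with (1 := HB n).
  assert (S := succ_le_pow _ n th). assert (p := pos_INR n).
  assert (pm : 0 < M' ^ n) by (apply pow_lt; lra).
  replace (M ^ n) with ((M / M') ^ n * M' ^ n) by (rewrite <- Rpow_mult_distr; f_equal; field; lra).
  rewrite <- (Rmult_assoc (Rabs B * _)). apply Rmult_le_compat_r; [lra|]. rewrite (Rmult_assoc (Rabs B)).
  apply Rle_trans with (Rabs B * (INR n + 1)); [apply Rmult_le_compat_r; [lra|apply Rle_abs]|].
  apply Rmult_le_compat_l; [apply Rabs_pos|exact S].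
Qed.

Lemma gbx_cmul L c d : 0 < L -> gbx L c -> gbx L d -> gbx L (cmul c d).
Proof.
  intros L0 Hc Hd. apply gbx_succ; auto. intros M HM. destruct (Hc M HM) as [A HA]. destruct (Hd M HM) as [A' HA'].
  exists (A * A'). intros n. apply Rle_trans with ((INR n + 1) * (A * A' * M ^ n)); [|apply Req_le; ring].
  apply sum_bound. intros k Hk. rewrite Rabs_mult.
  replace (M ^ n) with (M ^ k * M ^ (n - k)) by (rewrite <- pow_add; f_equal; lia).
  replace (A * A' * (M ^ k * M ^ (n - k))) with ((A * M ^ k) * (A' * M ^ (n - k))) by ring.
  apply Rmult_le_compat; auto using Rabs_pos.
Qed.

Lemma gbx_dser L c : 0 < L -> gbx L c -> gbx L (dser c).
Proof.
  intros L0 Hc. apply gbx_succ; auto. intros M HM. destruct (Hc M HM) as [A HA]. exists (A * M).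
  intros n. unfold dser. assert (p := pos_INR n). rewrite Rabs_mult, (Rabs_right (INR n + 1)) by lra.
  replace (A * M * (INR n + 1) * M ^ n) with ((INR n + 1) * (A * M ^ S n)) by (simpl; ring).
  apply Rmult_le_compat_l; [lra|apply HA].
Qed.

Lemma gbx_shift L p c : gbx L c -> gbx L (shift p c).
Proof. intros H M HM. destruct (H M HM) as [A HA]. exists (A * M ^ p). apply gb_shift, HA. Qed.

Lemma gbx_ext L c d : (forall n, c n = d n) -> gbx L c -> gbx L d.
Proof. intros E H M HM. destruct (H M HM) as [A HA]. exists A. apply gb_ext with c; auto. Qed.

Lemma gbx_lin a b c d L : 0 < L -> gbx L c -> gbx L d -> gbx L (fun k => a * c k + b * d k).
Proof.
  intros L0 Hc Hd M HM. destruct (Hc M HM) as [A HA]. destruct (Hd M HM) as [A' HA'].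
  exists (Rabs a * A + Rabs b * A'). apply gb_lin; auto. lra.
Qed.

Lemma gbx_delta0 L a : 0 < L -> gbx L (delta0 a).
Proof. intros L0 M HM. exists (Rabs a). apply gb_delta0. lra. Qed.

Lemma sum_pow2 n : sum_f_R0 (fun i => 2 ^ (n - i)) n <= 2 ^ S n.
Proof.
  enough (sum_f_R0 (fun i => 2 ^ (n - i)) n = 2 ^ S n - 1) by lra.
  induction n as [|n IH]; [simpl; ring|].
  rewrite decomp_sum by lia. simpl Nat.pred.
  rewrite (sum_eq _ (fun i => 2 ^ (n - i))) by (intros; f_equal; lia). rewrite IH. simpl. ring.
Qed.

(** By strong induction: the powers 2^(n-i) from the induction hypothesis sum to at most 2^(n+1),
    which accounts for the factor 2. *)
Lemma conv_bound (u : nat -> R) K : 0 <= K -> Rabs (u O) <= 1 ->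
  (forall n, Rabs (u (S n)) <= sum_f_R0 (fun i => K ^ S i * Rabs (u (n - i)%nat)) n) ->
  forall n, Rabs (u n) <= (2 * K) ^ n.
Proof.
  intros K0 u0 H n. induction n as [n IH] using (well_founded_induction Wf_nat.lt_wf).
  destruct n as [|n]; [simpl; lra|]. apply Rle_trans with (1 := H n).
  apply Rle_trans with (sum_f_R0 (fun i => 2 ^ (n - i) * K ^ S n) n).
  - apply sum_Rle. intros i Hi. apply Rle_trans with (K ^ S i * (2 * K) ^ (n - i)).
    + apply Rmult_le_compat_l; [apply pow_le; auto|apply IH; lia].
    + rewrite Rpow_mult_distr. replace (K ^ S n) with (K ^ S i * K ^ (n - i)) by (rewrite <- pow_add; f_equal; lia).
      apply Req_le. ring.
  - rewrite <- scal_sum, Rpow_mult_distr, Rmult_comm. apply Rmult_le_compat_r; [apply pow_le; auto|apply sum_pow2].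
Qed.

(** In (n+1) e_(n+1) = sum of (i+1) c_(i+1) e_(n-i) the weight i + 1 is at most n + 1, so the
    recursion has the form of [conv_bound]. *)
Lemma ode_bound c e K : 0 <= K -> (forall n, Rabs (c n) <= K ^ n) -> e O = 1 ->
  (forall n, dser e n = cmul (dser c) e n) -> gb 1 (2 * K) e.
Proof.
  intros K0 Hc e0 H n. rewrite Rmult_1_l. apply conv_bound; auto.
  { rewrite e0, Rabs_R1. lra. }
  clear n. intros n. specialize (H n). unfold dser at 1 in H. assert (p := pos_INR n).
  apply Rmult_le_reg_l with (INR n + 1); [lra|]. rewrite <- (Rabs_right (INR n + 1)) at 1 by lra.
  rewrite <- Rabs_mult, H. unfold cmul. apply Rle_trans with (1 := Rsum_abs _ _). rewrite scal_sum.
  apply sum_Rle. intros i Hi. unfold dser. rewrite !Rabs_mult. assert (pi := pos_INR i). rewrite (Rabs_right (INR i + 1)) by lra.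
  rewrite (Rmult_comm (_ * Rabs (e _))), <- Rmult_assoc. apply Rmult_le_compat_r; [apply Rabs_pos|].
  apply Rmult_le_compat; auto using Rabs_pos; try lra. apply le_INR in Hi. lra.
Qed.

Lemma inv_bound psi ipsi K : 0 <= K -> (forall n, Rabs (psi (S n)) <= K ^ S n) -> psi O = 1 -> 
  (forall n, cmul psi ipsi n = delta0 1 n) -> gb 1 (2 * K) ipsi.
Proof.
  intros K0 Hp p0 H n. rewrite Rmult_1_l. apply conv_bound; auto.
  { specialize (H O). unfold cmul in H. simpl in H. rewrite p0, Rmult_1_l in H. rewrite H, Rabs_R1. lra. }
  clear n. intros n. specialize (H (S n)). unfold cmul in H. rewrite decomp_sum in H by lia. simpl in H.
  rewrite p0, Rmult_1_l in H. replace (ipsi (S n)) with (- sum_f_R0 (fun i => psi (S i) * ipsi (n - i)%nat) n) by lra.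
  rewrite Rabs_Ropp. apply Rle_trans with (1 := Rsum_abs _ _). apply sum_Rle. intros i Hi. rewrite Rabs_mult.
  apply Rmult_le_compat_r; [apply Rabs_pos|apply Hp].
Qed.

Lemma cder_ev A L c x : gb A L c -> 0 < L -> L * Cmod x < / 8 -> cder (ev c) x (ev (dser c) x).
Proof.
  intros H L0 Hx. apply cder_quad with (32 * A * L ^ 2) (/ 8 / L - Cmod x).
  { apply Rmult_lt_reg_l with L; auto. replace (L * (/ 8 / L - Cmod x)) with (/ 8 - L * Cmod x) by (field; lra). lra. }
  intros y Hy. apply ev_quad; auto; [|lra].
  assert (T := Cmod_triangle (y - x) x). replace (y - x + x)%C with y in T by ring.
  assert (M : L * Cmod y <= L * (/ 8 / L)) by (apply Rmult_le_compat_l; lra).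
  replace (L * (/ 8 / L)) with (/ 8) in M by (field; lra). exact M.
Qed.

Lemma pder_fst g t v : pder g t v -> is_derive (fun s => fst (g s)) t (fst v).
Proof.
  intros H. split; [apply is_linear_scal_l|].
  intros z Hz. apply (@is_filter_lim_locally_unique R_AbsRing (AbsRing_NormedModule R_AbsRing) t z) in Hz. subst z.
  intros eps. destruct (H eps (cond_pos eps)) as [d [d0 Hd]]. exists (mkposreal d d0). intros y Hy.
  apply Rle_trans with (2 := Hd y Hy). apply Rle_trans with (2 := Rle_trans _ _ _ (Rmax_l _ _) (Rmax_Cmod _)).
  apply Req_le. unfold norm, minus, plus, opp, scal. simpl. unfold abs, mult. simpl. f_equal. ring.
Qed.

Lemma pder_snd g t v : pder g t v -> is_derive (fun s => snd (g s)) t (snd v).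
Proof.
  intros H. split; [apply is_linear_scal_l|].
  intros z Hz. apply (@is_filter_lim_locally_unique R_AbsRing (AbsRing_NormedModule R_AbsRing) t z) in Hz. subst z.
  intros eps. destruct (H eps (cond_pos eps)) as [d [d0 Hd]]. exists (mkposreal d d0). intros y Hy.
  apply Rle_trans with (2 := Hd y Hy). apply Rle_trans with (2 := Rle_trans _ _ _ (Rmax_r _ _) (Rmax_Cmod _)).
  apply Req_le. unfold norm, minus, plus, opp, scal. simpl. unfold abs, mult. simpl. f_equal. ring.
Qed.

Lemma real_const (f : R -> R) : (forall t, 0 <= t <= 1 -> is_derive f t 0) -> f 1 = f 0.
Proof.
  intros H. destruct (MVT_gen f 0 1 (fun _ => 0)) as [t [_ E]].
  - intros x Hx. apply H. rewrite Rmin_left, Rmax_right in Hx; lra.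
  - intros x Hx. rewrite Rmin_left, Rmax_right in Hx by lra. apply continuity_pt_filterlim.
    apply (ex_derive_continuous f). exists 0. apply H, Hx.
  - lra.
Qed.

Lemma pder_const g : (forall t, 0 <= t <= 1 -> pder g t 0%C) -> g 1 = g 0.
Proof.
  intros H. rewrite (surjective_pairing (g 1)), (surjective_pairing (g 0)). f_equal.
  - apply (real_const (fun t => fst (g t))). intros t Ht. apply (pder_fst _ _ _ (H t Ht)).
  - apply (real_const (fun t => snd (g t))). intros t Ht. apply (pder_snd _ _ _ (H t Ht)).
Qed.

Lemma ev_0 A L c : gb A L c -> 0 <= L -> ev c 0 = RtoC (c O).
Proof.
  intros H L0. rewrite (ev_front A L c 0%C H L0); [ring|]. rewrite Cmod_0. lra.
Qed.

(* ev e * cexp (- ev c) is constant along rays. *)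
Lemma cexp_ev A L c e x : gb A L c -> gb A L e -> 0 < L -> c O = 0 -> e O = 1 ->
  (forall n, dser e n = cmul (dser c) e n) -> L * Cmod x < / 8 -> cexp (ev c x) = ev e x.
Proof.
  intros Hc He L0 c0 e0 H Hx. assert (x0 := Cmod_ge_0 x).
  assert (K : forall t, 0 <= t <= 1 -> pder (fun s => (fun z => ev e z * cexp (-1 * ev c z)) (RtoC s * x))%C t 0%C).
  { intros t Ht. 
    assert (Ht2 : L * Cmod (RtoC t * x) < / 8).
    { rewrite Cmod_mult, Cmod_R, Rabs_right by lra. apply Rle_lt_trans with (2 := Hx). apply Rmult_le_compat_l; [lra|]. nra. }
    set (z := (RtoC t * x)%C) in *.
    assert (D1 := cder_ev _ _ _ _ He L0 Ht2).
    assert (D2 := cder_comp _ _ _ _ _ (cder_scal (-1)%C _ _ _ (cder_ev _ _ _ _ Hc L0 Ht2)) (cder_cexp _)).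
    assert (D3 := cder_mult _ _ _ _ _ D1 D2). simpl in D3.
    assert (P := cder_pder _ _ _ _ _ D3 (pder_lin x t)).
    match type of P with pder _ _ ?v => replace v with (RtoC 0) in P; [exact P|] end.
    rewrite (ev_ext _ _ z H).
    rewrite (ev_mul (A * L) A (2 * L) (dser c) e z); [ring|apply gb_dser; [auto|lra]|apply gb_weaken with A L; auto; lra|lra|lra]. }
  apply pder_const in K. cbv beta in K.
  replace (RtoC 1 * x)%C with x in K by ring. replace (RtoC 0 * x)%C with (RtoC 0) in K by ring.
  rewrite (ev_0 _ _ _ Hc), (ev_0 _ _ _ He), c0, e0 in K by lra.
  replace (-1 * RtoC 0)%C with (RtoC 0) in K by ring. rewrite cexp_0 in K.
  assert (I : (cexp (-1 * ev c x) * cexp (ev c x))%C = 1%C).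
  { rewrite <- cexp_plus. replace (-1 * ev c x + ev c x)%C with (RtoC 0) by ring. apply cexp_0. }
  replace (cexp (ev c x)) with ((1 * 1) * cexp (ev c x))%C by ring. rewrite <- K, <- Cmult_assoc, I. ring.
Qed.

End SeriesBounds.

(** * The branch tau of the inverse Stieltjes transform *)

Module InverseBranch.
Import Reals Lra Lia Psatz.
Import Coquelicot.
Import Defs.
Import EvaluatedSeries ComplexDerivatives SeriesBounds.
Open Scope R_scope.

(** The radius rho makes the quadratic remainder and the deviation of the derivative from 1 together
    at most [del], while staying well inside the disc of evaluation. *)
Lemma ev_near_id A M e del : gb A M e -> 0 < M -> e 1%nat = 1 -> 0 < del -> exists rho, 0 < rho /\ M * rho <= / 32 /\
  forall x y, Cmod x < rho -> Cmod y < rho ->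
    Cmod (ev e x - ev e y - (x - y)) <= del * Cmod (x - y) /\ Cmod (ev (dser e) y - 1) <= del.
Proof.
  intros H M0 e1 d0. assert (A0 := gb_A _ _ _ H).
  set (B := 64 * A * M ^ 2). set (B' := 8 * A * M * M).
  assert (B0 : 0 <= B) by (unfold B; assert (P := pow2_ge_0 M); nra).
  assert (B0' : 0 <= B') by (unfold B'; repeat apply Rmult_le_pos; lra).
  set (rho := Rmin (/ 32 / M) (del / (2 * (B + B' + 1)))).
  assert (r0 : 0 < rho).
  { apply Rmin_pos; [apply Rdiv_lt_0_compat; lra|apply Rdiv_lt_0_compat; lra]. }
  assert (r1 : M * rho <= / 32).
  { apply Rle_trans with (M * (/ 32 / M)); [apply Rmult_le_compat_l; [lra|apply Rmin_l]|]. apply Req_le. field. lra. }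
  assert (r2 : (B + B' + 1) * rho <= del / 2).
  { apply Rle_trans with ((B + B' + 1) * (del / (2 * (B + B' + 1)))); [apply Rmult_le_compat_l; [lra|apply Rmin_r]|].
    apply Req_le. field. lra. }
  exists rho. repeat split; auto.
  - assert (mx := Cmod_ge_0 x). assert (my := Cmod_ge_0 y).
    assert (Q := ev_quad A M e x y H M0 ltac:(nra) ltac:(nra)).
    assert (E := ev_err _ _ _ y 1 (gb_dser _ _ _ H ltac:(lra)) ltac:(lra) ltac:(nra)).
    assert (P : psum (dser e) 1 y = 1%C).
    { rewrite psum_front. simpl. unfold dser. simpl INR. rewrite e1. replace ((0 + 1) * 1) with 1 by ring. ring. }
    rewrite P, pow_1 in E.
    replace (ev e x - ev e y - (x - y))%C with ((ev e x - ev e y - (x - y) * ev (dser e) y) + (x - y) * (ev (dser e) y - 1))%C by ring.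
    apply Rle_trans with (1 := Cmod_triangle _ _). rewrite Cmod_mult.
    assert (T := Cmod_triangle_minus x y). set (h := Cmod (x - y)%C) in *. assert (h0 : 0 <= h) by apply Cmod_ge_0.
    apply Rle_trans with (32 * A * M ^ 2 * h ^ 2 + h * (B' * Cmod y)).
    + apply Rplus_le_compat; [exact Q|]. apply Rmult_le_compat_l; [auto|]. apply Rle_trans with (1 := E). apply Req_le. unfold B'. ring.
    + replace (32 * A * M ^ 2 * h ^ 2) with (h * (B / 2 * h)) by (unfold B; field). rewrite <- Rmult_plus_distr_l, Rmult_comm.
      apply Rmult_le_compat_r; auto. nra.
  - assert (my := Cmod_ge_0 y).
    assert (E := ev_err _ _ _ y 1 (gb_dser _ _ _ H ltac:(lra)) ltac:(lra) ltac:(nra)).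
    assert (P : psum (dser e) 1 y = 1%C).
    { rewrite psum_front. simpl. unfold dser. simpl INR. rewrite e1. replace ((0 + 1) * 1) with 1 by ring. ring. }
    rewrite P, pow_1 in E. apply Rle_trans with (1 := E).
    replace (4 * (A * M) * (2 * M * Cmod y)) with (B' * Cmod y) by (unfold B'; ring). nra.
Qed.

Definition tau (Ginv : C -> C) (z : C) : C := (/ Ginv (Clog (1 + z)))%C.

Lemma Clog_1 : Clog 1 = 0%C.
Proof.
  unfold Clog, Carg. rewrite Cmod_1, ln_1. simpl. destruct (Rlt_dec 0 1); [|lra].
  simpl. replace (0 / 1) with 0 by field. rewrite atan_0. reflexivity.
Qed.

(** Since C_m(1/x) = [ev c x] and its exponential is [ev e x], inverting C_m at log(1 + z) yields
    [ev e] (tau) = 1 + z. Smallness of tau is the condition that [Ginv] tends to infinity. *)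
Lemma tau_sol A M c e (Cm Ginv : C -> C) r0 rho : gb A M c -> gb A M e -> 0 < M -> c O = 0 -> e O = 1 ->
  (forall n, dser e n = cmul (dser c) e n) -> 0 < r0 ->
  (forall x, 0 < Cmod x < r0 -> Cm (/ x)%C = ev c x) -> functional_inverse_at0 Cm Ginv ->
  0 < rho -> M * rho <= / 32 ->
  exists r, 0 < r /\ r <= / 2 /\ forall z, 0 < Cmod z < r ->
    tau Ginv z <> 0%C /\ Cmod (tau Ginv z) < rho /\ ev e (tau Ginv z) = (1 + z)%C.
Proof.
  intros Hc He M0 c0 e0 H r00 HC [[d [d0 Hd]] HB] rho0 rM.
  set (rho' := Rmin rho r0). assert (rho'0 : 0 < rho') by (apply Rmin_pos; auto).
  destruct (HB (/ rho')) as [eta [eta0 Heta]].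
  destruct (ccont_Clog 1%C ltac:(simpl; lra) (Rmin d eta) ltac:(apply Rmin_pos; auto)) as [d1 [d10 Hd1]].
  exists (Rmin d1 (/ 2)). split; [apply Rmin_pos; lra|]. split; [apply Rmin_r|]. intros z [z0 Hz].
  assert (z1 := Rlt_le_trans _ _ _ Hz (Rmin_l _ _)). assert (z2 := Rlt_le_trans _ _ _ Hz (Rmin_r _ _)).
  assert (pz : 0 < fst (1 + z)%C).
  { assert (Hf := Rle_trans _ _ _ (Rmax_l _ _) (Rmax_Cmod z)). simpl.
    assert (P := Rabs_def2 _ _ (Rle_lt_trans _ _ _ Hf z2)). lra. }
  specialize (Hd1 (1 + z)%C). rewrite Clog_1 in Hd1.
  replace (1 + z - 1)%C with z in Hd1 by ring. specialize (Hd1 z1).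
  assert (EL := cexp_Clog _ pz). unfold tau. set (u := Clog (1 + z)) in *.
  replace (u - 0)%C with u in Hd1 by ring.
  assert (u0 : 0 < Cmod u).
  { apply (proj1 (Cmod_gt_0 u)). intros E. rewrite E, cexp_0 in EL.
    assert (z = 0)%C. { replace z with (1 + z - 1)%C by ring. rewrite <- EL. ring. }
    rewrite H0, Cmod_0 in z0. lra. }
  assert (Gd := Hd u (conj u0 (Rlt_le_trans _ _ _ Hd1 (Rmin_l _ _)))).
  assert (Gb := Heta u (conj u0 (Rlt_le_trans _ _ _ Hd1 (Rmin_r _ _)))).
  set (t := Ginv u) in *.
  assert (t0 : 0 < Cmod t). { apply Rlt_trans with (2 := Gb). apply Rinv_0_lt_compat; auto. }
  assert (tn : t <> 0%C) by (apply (proj2 (Cmod_gt_0 t)); auto).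
  assert (xb : Cmod (/ t) < rho').
  { rewrite Cmod_inv by auto. rewrite <- (Rinv_inv rho'). apply Rinv_lt_contravar; auto.
    apply Rmult_lt_0_compat; auto. apply Rinv_0_lt_compat; auto. }
  assert (xn : (/ t)%C <> 0%C). { intros E. assert (Q : (t * / t)%C = 0%C) by (rewrite E; ring). rewrite Cinv_r in Q by auto.
    injection Q. lra. }
  assert (xp : 0 < Cmod (/ t)) by (apply (proj1 (Cmod_gt_0 _)); auto).
  assert (xb1 := Rlt_le_trans _ _ _ xb (Rmin_l _ _)). assert (xb2 := Rlt_le_trans _ _ _ xb (Rmin_r _ _)).
  repeat split; auto.
  specialize (HC (/ t)%C (conj xp xb2)).
  replace (/ / t)%C with t in HC by (field; auto). rewrite Gd in HC.
  rewrite <- EL, HC. symmetry. apply cexp_ev with A M; auto. nra.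
Qed.

(* T is the branch tau = 1 / C_m^(-1)(log(1 + z)) and D its derivative. The constant 1/20 is small
   enough for |T z| <= 2/3 |T w| when |z| = eps and |w| = 2 eps, and for Re (Ffac z w) > 0. *)
Record tau_like (T D : C -> C) (r : R) : Prop := TauLike {
  tl_r : 0 < r <= / 2;
  tl_n0 : forall z, 0 < Cmod z < r -> T z <> 0%C;
  tl_lip : forall z w, 0 < Cmod z < r -> 0 < Cmod w < r -> Cmod ((z - w) - (T z - T w)) <= / 20 * Cmod (z - w);
  tl_id : forall z, 0 < Cmod z < r -> Cmod (z - T z) <= / 20 * Cmod z;
  tl_D : forall z, 0 < Cmod z < r -> cder T z (D z);
  tl_DD : forall z, 0 < Cmod z < r -> exists l, cder D z l;
  tl_DB : forall z, 0 < Cmod z < r -> Cmod (D z) <= 2 }.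

(** tau solves [ev e] (tau) = 1 + z with [ev e] close to a translation, hence tau is Lipschitz, so
    continuous, so differentiable. The bound 1/40 for [ev e] becomes 1/20 for its inverse, because
    |T z - T w| <= 2 |z - w|. *)
Lemma tau_tau_like A M c e (Cm Ginv : C -> C) r0 : gb A M c -> gb A M e -> 0 < M -> c O = 0 -> e O = 1 -> e 1%nat = 1 ->
  (forall n, dser e n = cmul (dser c) e n) -> 0 < r0 ->
  (forall x, 0 < Cmod x < r0 -> Cm (/ x)%C = ev c x) -> functional_inverse_at0 Cm Ginv ->
  exists r, tau_like (tau Ginv) (fun z => / ev (dser e) (tau Ginv z))%C r /\
    forall z, 0 < Cmod z < r -> M * Cmod (tau Ginv z) < / 32 /\ ev e (tau Ginv z) = (1 + z)%C.
Proof.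
  intros Hc He M0 c0 e0 e1 H r00 HC HF.
  destruct (ev_near_id A M e (/ 40) He M0 e1 ltac:(lra)) as [rho [rho0 [rM Hq]]].
  destruct (tau_sol A M c e Cm Ginv r0 rho Hc He M0 c0 e0 H r00 HC HF rho0 rM) as [r [rr [r2 Hr]]].
  set (T := tau Ginv) in *.
  assert (L1 : forall z w, 0 < Cmod z < r -> 0 < Cmod w < r -> Cmod ((z - w) - (T z - T w)) <= / 20 * Cmod (z - w)).
  { intros z w Hz Hw. destruct (Hr z Hz) as [z1 [z2 z3]]. destruct (Hr w Hw) as [w1 [w2 w3]].
    destruct (Hq _ _ z2 w2) as [Q _]. rewrite z3, w3 in Q.
    replace (1 + z - (1 + w) - (T z - T w))%C with ((z - w) - (T z - T w))%C in Q by ring.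
    assert (S := Cmod_triangle_minus (z - w) ((z - w) - (T z - T w))).
    replace (z - w - (z - w - (T z - T w)))%C with (T z - T w)%C in S by ring. assert (P := Cmod_ge_0 (z - w)%C). lra. }
  assert (cT : forall z, 0 < Cmod z < r -> cder T z (/ ev (dser e) (T z))%C).
  { intros z Hz. destruct (Hr z Hz) as [z1 [z2 z3]]. destruct (Hq _ _ z2 z2) as [_ Q].
    set (d := Rmin (Cmod z) (r - Cmod z)). assert (d0 : 0 < d) by (apply Rmin_pos; lra).
    assert (nb : forall y, Cmod (y - z) < d -> 0 < Cmod y < r).
    { intros y Hy. assert (y1 := Rlt_le_trans _ _ _ Hy (Rmin_l _ _)). assert (y2 := Rlt_le_trans _ _ _ Hy (Rmin_r _ _)).
      assert (S1 := Cmod_triangle_minus y (y - z)). replace (y - (y - z))%C with z in S1 by ring.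
      assert (S2 := Cmod_triangle (y - z) z). replace (y - z + z)%C with y in S2 by ring. lra. }
    apply cder_inverse with (fun x => ev e x + -1)%C d; auto.
    - intros y Hy. destruct (Hr y (nb y Hy)) as [y1 [y2 y3]]. rewrite y3. ring.
    - intros eps ep. exists (Rmin d (eps / 2)). split; [apply Rmin_pos; lra|]. intros y Hy.
      assert (y1 := Rlt_le_trans _ _ _ Hy (Rmin_l _ _)). assert (y2 := Rlt_le_trans _ _ _ Hy (Rmin_r _ _)).
      assert (LL := L1 y z (nb y y1) Hz). assert (S := Cmod_triangle_minus (y - z) ((y - z) - (T y - T z))).
      replace (y - z - (y - z - (T y - T z)))%C with (T y - T z)%C in S by ring. lra.
    - replace (ev (dser e) (T z)) with (ev (dser e) (T z) + 0)%C by ring. apply cder_plus; [|apply cder_const].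
      apply cder_ev with A M; auto. assert (M * Cmod (T z) <= M * rho) by (apply Rmult_le_compat_l; lra). lra.
    - intros E. rewrite E in Q. replace (0 - 1)%C with (-(1))%C in Q by ring. rewrite Cmod_opp, Cmod_1 in Q. lra. }
  exists r. split.
  - constructor; auto.
    + intros z Hz. apply (Hr z Hz).
    + intros z Hz. destruct (Hr z Hz) as [z1 [z2 z3]].
      destruct (Hq (T z) 0%C z2 ltac:(rewrite Cmod_0; auto)) as [Q _].
      rewrite z3, (ev_0 _ _ _ He), e0 in Q by lra.
      replace (1 + z - 1 - (T z - 0))%C with (z - T z)%C in Q by ring. replace (T z - 0)%C with (T z) in Q by ring.
      assert (S := Cmod_triangle_minus z (z - T z)). replace (z - (z - T z))%C with (T z) in S by ring. lra.
    + intros z Hz. destruct (Hr z Hz) as [z1 [z2 z3]]. destruct (Hq _ _ z2 z2) as [_ Q].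
      eexists. apply (cder_comp (fun z => ev (dser e) (T z)) Cinv).
      * apply (cder_comp T (ev (dser e))); [apply cT, Hz|].
        apply cder_ev with (A * M) (2 * M); [apply gb_dser; [auto|lra]|lra|].
        assert (M * Cmod (T z) <= M * rho) by (apply Rmult_le_compat_l; lra). lra.
      * apply cder_inv. intros E. rewrite E in Q. replace (0 - 1)%C with (-(1))%C in Q by ring. rewrite Cmod_opp, Cmod_1 in Q. lra.
    + intros z Hz. destruct (Hr z Hz) as [z1 [z2 z3]]. destruct (Hq _ _ z2 z2) as [_ Q].
      assert (S := Cmod_triangle_minus (ev (dser e) (T z)) (ev (dser e) (T z) - 1)).
      cbv beta.       replace (ev (dser e) (T z) - (ev (dser e) (T z) - 1))%C with (RtoC 1) in S by ring. rewrite Cmod_1 in S.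
      rewrite Cmod_inv by (apply (proj2 (Cmod_gt_0 _)); lra).
      replace 2 with (/ / 2) by field. apply Rinv_le_contravar; lra.
  - intros z Hz. destruct (Hr z Hz) as [z1 [z2 z3]]. split; auto.
    assert (M * Cmod (T z) < M * rho) by (apply Rmult_lt_compat_l; lra). lra.
Qed.

End InverseBranch.

(** * The kernel of the contour integral in terms of tau *)

Module CovarianceKernel.
Import Reals Lra Lia Psatz.
Import Coquelicot.
Import Defs.
Import EvaluatedSeries ComplexDerivatives SeriesBounds InverseBranch.
Open Scope R_scope.

Lemma Cmod_pos_neq (z : C) : 0 < Cmod z -> z <> 0%C.
Proof. apply (proj2 (Cmod_gt_0 z)). Qed.

Lemma Cneq_mod_pos (z : C) : z <> 0%C -> 0 < Cmod z.
Proof. apply (proj1 (Cmod_gt_0 z)). Qed.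

Lemma Csub_neq0 (z w : C) : z <> w -> (z - w)%C <> 0%C.
Proof. intros H E. apply H. replace z with (z - w + w)%C by ring. rewrite E. ring. Qed.

Lemma tl_inj T D r z w : tau_like T D r -> 0 < Cmod z < r -> 0 < Cmod w < r -> z <> w -> T z <> T w.
Proof.
  intros H Hz Hw n E. assert (P := tl_lip _ _ _ H z w Hz Hw). rewrite E in P.
  replace (z - w - (T w - T w))%C with (z - w)%C in P by ring.
  assert (0 < Cmod (z - w)) by (apply Cneq_mod_pos, Csub_neq0; auto). lra.
Qed.

Lemma near_one (x y : C) : x <> 0%C -> Cmod (y - x) <= / 20 * Cmod y -> Cmod (y / x - 1) <= / 10.
Proof.
  intros x0 H. replace (y / x - 1)%C with ((y - x) / x)%C by (field; auto). rewrite Cmod_div by auto.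
  assert (P := Cneq_mod_pos _ x0). assert (S := Cmod_triangle (y - x) x). replace (y - x + x)%C with y in S by ring.
  apply Rmult_le_reg_r with (Cmod x); auto. unfold Rdiv. rewrite Rmult_assoc, Rinv_l; lra.
Qed.

Lemma near_one_mul u v a b : Cmod (u - 1) <= a -> Cmod (v - 1) <= b -> Cmod (u * v - 1) <= a * b + a + b.
Proof.
  intros Hu Hv. replace (u * v - 1)%C with ((u - 1) * (v - 1) + ((u - 1) + (v - 1)))%C by ring.
  assert (P1 := Cmod_triangle ((u - 1) * (v - 1)) ((u - 1) + (v - 1))). assert (P2 := Cmod_triangle (u - 1) (v - 1)).
  rewrite Cmod_mult in P1. assert (Q1 := Cmod_ge_0 (u - 1)). assert (Q2 := Cmod_ge_0 (v - 1)).
  assert (Cmod (u - 1) * Cmod (v - 1) <= a * b) by (apply Rmult_le_compat; auto). lra.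
Qed.

Lemma re_near_one u : Cmod (u - 1) < 1 -> 0 < fst u.
Proof.
  intros H. assert (Hf := Rle_trans _ _ _ (Rmax_l _ _) (Rmax_Cmod (u - 1)%C)). simpl in Hf.
  assert (P := Rabs_def2 _ _ (Rle_lt_trans _ _ _ Hf H)). lra.
Qed.

Lemma one_plus_neq0 (z : C) : Cmod z < 1 -> (1 + z)%C <> 0%C.
Proof.
  intros H E. replace z with (-(1))%C in H.
  - rewrite Cmod_opp, Cmod_1 in H. lra.
  - replace z with (1 + z - 1)%C by ring. rewrite E. ring.
Qed.

(** By definition (1 + z) H'(1 + z) = C_m^(-1)(log(1 + z)) - (1 + z)/z, and the first term is
    1/tau(z). *)
Lemma PhiH_tau Ginv D r z : tau_like (tau Ginv) D r -> 0 < Cmod z < r ->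
  PhiH Ginv z = (/ tau Ginv z - / z - 1)%C.
Proof.
  intros H Hz. assert (R := tl_r _ _ _ H). assert (n0 := tl_n0 _ _ _ H z Hz).
  assert (z0 := Cmod_pos_neq _ (proj1 Hz)). assert (z1 := one_plus_neq0 z ltac:(lra)).
  unfold PhiH, Hprime. replace (1 + z - 1)%C with z by ring.
  assert (E : (Ginv (Clog (1 + z)) = / tau Ginv z)%C).
  { unfold tau in *. set (t := Ginv (Clog (1 + z))) in *. destruct (Ceq_dec t 0%C) as [E|E]; [|field; auto].
    (* The inverse of 0 evaluates to 0, so a nonzero tau excludes a zero of [Ginv]. *)
    exfalso. apply n0. rewrite E. unfold Cinv. simpl. unfold RtoC. f_equal; unfold Rdiv; ring. }
  rewrite E. field. auto.
Qed.


(** The argument of the logarithm becomes a product of functions of one variable and the divided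
    difference of tau; only the latter survives the mixed derivative. *)
Lemma Ffac_tau Ginv D r z w : tau_like (tau Ginv) D r -> 0 < Cmod z < r -> 0 < Cmod w < r -> z <> w ->
  let T := tau Ginv in Ffac Ginv z w = (z / T z * (w / T w) * ((T z - T w) / (z - w)))%C.
Proof.
  intros H Hz Hw n T. unfold Ffac. rewrite (PhiH_tau _ _ _ _ H Hz), (PhiH_tau _ _ _ _ H Hw). fold T.
  assert (a := tl_n0 _ _ _ H z Hz). assert (b := tl_n0 _ _ _ H w Hw). fold T in a, b.
  assert (z0 := Cmod_pos_neq _ (proj1 Hz)). assert (w0 := Cmod_pos_neq _ (proj1 Hw)).
  assert (s := Csub_neq0 _ _ n). field. auto.
Qed.

(** The three factors lie within 1/10, 1/10 and 1/20 of 1, so the product is within distance 1 of 1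
    and the principal logarithm is differentiable there. *)
Lemma Ffac_re Ginv D r z w : tau_like (tau Ginv) D r -> 0 < Cmod z < r -> 0 < Cmod w < r -> z <> w ->
  0 < fst (Ffac Ginv z w).
Proof.
  intros H Hz Hw n. rewrite (Ffac_tau _ _ _ _ _ H Hz Hw n). set (T := tau Ginv).
  assert (s := Csub_neq0 _ _ n).
  assert (a := near_one _ _ (tl_n0 _ _ _ H z Hz) (tl_id _ _ _ H z Hz)).
  assert (b := near_one _ _ (tl_n0 _ _ _ H w Hw) (tl_id _ _ _ H w Hw)). fold T in a, b.
  assert (d : Cmod ((T z - T w) / (z - w) - 1) <= / 20).
  { replace ((T z - T w) / (z - w) - 1)%C with (- ((z - w - (T z - T w)) / (z - w)))%C by (field; auto).
    rewrite Cmod_opp, Cmod_div by auto. assert (P := Cneq_mod_pos _ s).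
    apply Rmult_le_reg_r with (Cmod (z - w)); auto. unfold Rdiv. rewrite Rmult_assoc, Rinv_l, Rmult_1_r by lra.
    apply (tl_lip _ _ _ H z w Hz Hw). }
  apply re_near_one. apply Rle_lt_trans with (1 := near_one_mul _ _ _ _ (near_one_mul _ _ _ _ a b) d). lra.
Qed.

Lemma punctured_nbhd r (z v : C) : 0 < Cmod z < r -> z <> v -> exists d, 0 < d /\
  forall y, Cmod (y - z) < d -> 0 < Cmod y < r /\ y <> v.
Proof.
  intros Hz n. assert (s := Cneq_mod_pos _ (Csub_neq0 _ _ n)).
  exists (Rmin (Cmod (z - v)) (Rmin (Cmod z) (r - Cmod z))). split; [repeat apply Rmin_pos; lra|].
  intros y Hy. assert (y0 := Rlt_le_trans _ _ _ Hy (Rmin_l _ _)). assert (yy := Rlt_le_trans _ _ _ Hy (Rmin_r _ _)).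
  assert (y1 := Rlt_le_trans _ _ _ yy (Rmin_l _ _)). assert (y2 := Rlt_le_trans _ _ _ yy (Rmin_r _ _)).
  assert (S1 := Cmod_triangle_minus y (y - z)). replace (y - (y - z))%C with z in S1 by ring.
  assert (S2 := Cmod_triangle (y - z) z). replace (y - z + z)%C with y in S2 by ring. 
  repeat split; try lra. intros E. subst y. rewrite Cmod_sub_sym in y0. lra.
Qed.

Lemma Clog_Ffac_der Ginv D r z w : tau_like (tau Ginv) D r -> 0 < Cmod z < r -> 0 < Cmod w < r -> z <> w ->
  let T := tau Ginv in
  cder (fun w' => Clog (Ffac Ginv z w')) w (/ w - D w / T w - D w / (T z - T w) + / (z - w))%C.
Proof.
  intros H Hz Hw n T. destruct (punctured_nbhd r w z Hw ltac:(auto)) as [d [d0 Hd]].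
  assert (a := tl_n0 _ _ _ H z Hz). assert (b := tl_n0 _ _ _ H w Hw). fold T in a, b.
  assert (z0 := Cmod_pos_neq _ (proj1 Hz)). assert (w0 := Cmod_pos_neq _ (proj1 Hw)).
  assert (s := Csub_neq0 _ _ n). assert (s' := Csub_neq0 _ _ (tl_inj _ _ _ _ _ H Hz Hw n)). fold T in s'.
  assert (E : forall y, Cmod (y - w) < d -> (z / T z * (y * / T y * ((T z + -1 * T y) * / (z + -1 * y))))%C = Ffac Ginv z y).
  { intros y Hy. destruct (Hd y Hy) as [Hy1 Hy2]. rewrite (Ffac_tau _ _ _ _ _ H Hz Hy1) by auto. fold T. unfold Cdiv, Cminus.
    replace (-1 * T y)%C with (- T y)%C by ring. replace (-1 * y)%C with (- y)%C by ring. ring. }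
  assert (DT := tl_D _ _ _ H w Hw). fold T in DT.
  assert (s2 : (z + -1 * w)%C <> 0%C) by (replace (z + -1 * w)%C with (z - w)%C by ring; auto).
  assert (C1 := cder_comp _ _ _ _ _ DT (cder_inv _ b)).
  assert (C2 := cder_mult _ _ _ _ _ (cder_id w) C1).
  assert (C3 := cder_plus _ _ _ _ _ (cder_const (T z) w) (cder_scal (-1)%C _ _ _ DT)).
  assert (C4 := cder_comp _ _ _ _ _ (cder_plus _ _ _ _ _ (cder_const z w) (cder_scal (-1)%C _ _ _ (cder_id w))) (cder_inv _ s2)).
  assert (C5 := cder_scal (z / T z)%C _ _ _ (cder_mult _ _ _ _ _ C2 (cder_mult _ _ _ _ _ C3 C4))). cbv beta in C5.
  assert (C6 := cder_ext_loc _ _ _ _ _ d0 E C5).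
  assert (C7 := cder_comp _ _ _ _ _ C6 (cder_Clog _ (Ffac_re _ _ _ _ _ H Hz Hw n))). cbv beta in C7.
  match type of C7 with cder _ _ ?v => replace (/ w - D w / T w - D w / (T z - T w) + / (z - w))%C with v; [exact C7|] end.
  rewrite (Ffac_tau _ _ _ _ _ H Hz Hw n). fold T. field. repeat split; auto.
Qed.

(** The mixed derivative of log(tau(z) - tau(w)) is the right side; that of -log(z - w) is -1/(z -
    w)^2 and is cancelled by the extra term of the kernel. *)
Lemma Kern_tau Ginv D r z w : tau_like (tau Ginv) D r -> 0 < Cmod z < r -> 0 < Cmod w < r -> z <> w ->
  let T := tau Ginv in Kern Ginv z w = (D z * D w / (T z - T w) ^ 2)%C.
Proof.
  intros H Hz Hw n T. destruct (punctured_nbhd r z w Hz n) as [d [d0 Hd]].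
  assert (s := Csub_neq0 _ _ n). assert (s' := Csub_neq0 _ _ (tl_inj _ _ _ _ _ H Hz Hw n)). fold T in s'.
  unfold Kern.
  assert (E : forall y, Cmod (y - z) < d -> 
     ((/ w - D w / T w) + (-1 * D w) * / (T y + - T w) + / (y + - w))%C = C_derive (fun w' => Clog (Ffac Ginv y w')) w).
  { intros y Hy. destruct (Hd y Hy) as [Hy1 Hy2]. symmetry. apply is_C_derive_unique, cder_is_derive.
    assert (P := Clog_Ffac_der _ _ _ _ _ H Hy1 Hw Hy2). cbv zeta in P. fold T in P.
    match type of P with cder _ _ ?v => match goal with |- cder _ _ ?u => replace u with v; [exact P|] end end.
    unfold Cdiv, Cminus. ring. }
  assert (DT := tl_D _ _ _ H z Hz). fold T in DT.
  assert (C3 := cder_plus _ _ _ _ _ DT (cder_const (- T w)%C z)).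
  assert (C3' := cder_comp _ _ _ _ _ C3 (cder_inv _ s')).
  assert (C4 := cder_comp _ _ _ _ _ (cder_plus _ _ _ _ _ (cder_id z) (cder_const (- w)%C z)) (cder_inv _ s)).
  assert (C5 := cder_plus _ _ _ _ _ (cder_plus _ _ _ _ _ (cder_const (/ w - D w / T w)%C z) (cder_scal (-1 * D w)%C _ _ _ C3')) C4). 
  cbv beta in C5. assert (C6 := cder_ext_loc _ _ _ _ _ d0 E C5).
  rewrite (is_C_derive_unique _ _ _ (cder_is_derive _ _ _ C6)). unfold Cminus in s, s' |- *. field. auto.
Qed.

End CovarianceKernel.

(** * Integrals over circles and residues in the coordinate tau *)

Module CircleIntegrals.
Import Reals Lra Lia Psatz.
Import Coquelicot.
Import Defs.
Import EvaluatedSeries ComplexDerivatives SeriesBounds InverseBranch CovarianceKernel.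
Open Scope R_scope.

(** A relation rather than the total [circle_integral], so that existence of the integral is carried
    along with its value. *)
Definition circ (f : C -> C) (r : R) (v : C) : Prop :=
  @is_RInt C_R_NormedModule (fun t : R => (f (RtoC r * Cexpi t) * (Ci * RtoC r * Cexpi t))%C) 0 (2 * PI) v.

Lemma circ_unique f r v : circ f r v -> circle_integral f r = v.
Proof. intros H. apply (@is_RInt_unique C_R_CompleteNormedModule), H. Qed.

Lemma Cmod_Cexpi t : Cmod (Cexpi t) = 1.
Proof.
  unfold Cmod, Cexpi. simpl fst. simpl snd. replace (cos t ^ 2 + sin t ^ 2) with 1; [apply sqrt_1|].
  assert (P := sin2_cos2 t). unfold Rsqr in P. simpl. lra.
Qed.

Lemma Cmod_circle r t : 0 < r -> Cmod (RtoC r * Cexpi t) = r.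
Proof. intros H. rewrite Cmod_mult, Cmod_R, Cmod_Cexpi, Rabs_right; lra. Qed.

Lemma circ_ext f g r v : 0 < r -> (forall z, Cmod z = r -> f z = g z) -> circ f r v -> circ g r v.
Proof.
  intros r0 E H. unfold circ. eapply is_RInt_ext; [|exact H]. intros t _. simpl. rewrite E; auto. apply Cmod_circle, r0.
Qed.

Lemma circ_plus f g r v w : circ f r v -> circ g r w -> circ (fun z => f z + g z)%C r (v + w)%C.
Proof.
  intros H1 H2. unfold circ. eapply is_RInt_ext; [|exact (is_RInt_plus _ _ _ _ _ _ H1 H2)].
  intros t _. unfold plus. simpl. change prod_plus with Cplus. ring.
Qed.

Lemma is_RInt_Cscal (a : C) (f : R -> C) x y l :
  @is_RInt C_R_NormedModule f x y l -> @is_RInt C_R_NormedModule (fun t => a * f t)%C x y (a * l)%C.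
Proof.
  intros H. assert (H1 := is_RInt_fct_extend_fst _ _ _ _ H). assert (H2 := is_RInt_fct_extend_snd _ _ _ _ H).
  apply (is_RInt_fct_extend_pair (fun t => a * f t)%C); simpl.
  - apply (is_RInt_minus (V := R_NormedModule)); apply (is_RInt_scal (V := R_NormedModule)); assumption.
  - apply (is_RInt_plus (V := R_NormedModule)); apply (is_RInt_scal (V := R_NormedModule)); assumption.
Qed.

Lemma circ_scal a f r v : circ f r v -> circ (fun z => a * f z)%C r (a * v)%C.
Proof.
  intros H. unfold circ. eapply is_RInt_ext; [|exact (is_RInt_Cscal a _ _ _ _ H)]. intros t _. simpl. ring.
Qed.

Definition cdif f (z : C) : Prop := exists l, cder f z l.

Lemma cdif_mult f g z : cdif f z -> cdif g z -> cdif (fun x => f x * g x)%C z.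
Proof. intros [l H] [m K]. eexists. apply (cder_mult _ _ _ _ _ H K). Qed.

Lemma cdif_inv f z : cdif f z -> f z <> 0%C -> cdif (fun x => / f x)%C z.
Proof. intros [l H] n. eexists. apply (cder_comp _ _ _ _ _ H (cder_inv _ n)). Qed.

Lemma cdif_pow f z n : cdif f z -> cdif (fun x => f x ^ n)%C z.
Proof.
  intros [l H]. destruct n as [|n]; [exists 0%C; apply (cder_const 1%C)|]. eexists. apply (cder_pow _ _ _ _ H).
Qed.

Lemma cdif_const a z : cdif (fun _ => a) z.
Proof. exists 0%C. apply cder_const. Qed.

Lemma cdif_id z : cdif (fun x => x) z.
Proof. exists 1%C. apply cder_id. Qed.

Lemma circ_cont f r : 0 < r -> (forall z, Cmod z = r -> cdif f z) -> forall t,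
  @continuous R_UniformSpace C_R_NormedModule (fun t : R => (f (RtoC r * Cexpi t) * (Ci * RtoC r * Cexpi t))%C) t.
Proof.
  intros r0 H t. apply (@ex_derive_continuous R_AbsRing C_R_NormedModule). 
  set (z := (RtoC r * Cexpi t)%C). destruct (cdif_mult f (fun x => Ci * x)%C z) as [l Hl].
  - apply H, Cmod_circle, r0.
  - apply cdif_mult; [apply cdif_const|apply cdif_id].
  - eexists. assert (P := pder_is_derive _ _ _ (cder_pder _ _ _ _ _ Hl (pder_circle r t))). cbv beta in P.
    eapply is_derive_ext; [|exact P]. intros s. simpl. ring.
Qed.

Lemma circ_ex f r : 0 < r -> (forall z, Cmod z = r -> cdif f z) -> exists v, circ f r v.
Proof.
  intros r0 H. apply (@ex_RInt_continuous C_R_CompleteNormedModule). intros t _. apply circ_cont; auto.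
Qed.

Lemma circ_prim F f r : 0 < r -> (forall z, Cmod z = r -> cder F z (f z)) -> (forall z, Cmod z = r -> cdif f z) ->
  circ f r 0%C.
Proof.
  intros r0 H1 H2. 
  assert (P := @is_RInt_derive C_R_CompleteNormedModule (fun t => F (RtoC r * Cexpi t)%C)
    (fun t : R => (f (RtoC r * Cexpi t) * (Ci * RtoC r * Cexpi t))%C) 0 (2 * PI)).
  replace (RtoC 0) with (@minus C_R_CompleteNormedModule (F (RtoC r * Cexpi (2 * PI))%C) (F (RtoC r * Cexpi 0)%C)).
  - apply P.
    + intros t _. assert (Q := pder_is_derive _ _ _ (cder_pder _ _ _ _ _ (H1 _ (Cmod_circle r t r0)) (pder_circle r t))).
      cbv beta in Q. rewrite Cmult_comm. exact Q.
    + intros t _. apply circ_cont; auto.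
  - unfold Cexpi. rewrite cos_2PI, sin_2PI, cos_0, sin_0. apply (minus_eq_zero (G := C_R_CompleteNormedModule)).
Qed.

Lemma circ_Cinv r : 0 < r -> circ Cinv r (2 * RtoC PI * Ci)%C.
Proof.
  intros r0. unfold circ. apply is_RInt_ext with (fun _ : R => Ci : C_R_NormedModule).
  - intros t _. simpl. field. split; apply Cmod_pos_neq; [rewrite Cmod_Cexpi|rewrite Cmod_R, Rabs_right]; lra.
  - assert (P := @is_RInt_const C_R_NormedModule 0 (2 * PI) Ci).
    replace (2 * RtoC PI * Ci)%C with (@scal R_AbsRing C_R_NormedModule (2 * PI - 0) Ci); [exact P|].
    rewrite scal_R_Cmult. replace (2 * PI - 0) with (2 * PI) by ring. rewrite RtoC_mult. reflexivity.
Qed.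

Lemma circ_bound f r v B : 0 < r -> circ f r v -> (forall z, Cmod z = r -> Cmod (f z) <= B) -> Cmod v <= 2 * PI * (B * r).
Proof.
  intros r0 H HB. rewrite Cmod_norm. replace (2 * PI) with (2 * PI - 0) by ring.
  apply (@norm_RInt_le_const C_R_NormedModule _ 0 (2 * PI) _ _ ltac:(assert (P := PI_RGT_0); lra)) with (2 := H).
  intros t _. rewrite <- Cmod_norm. rewrite !Cmod_mult, Cmod_Cexpi, Cmod_R, (Rabs_right r) by lra.
  replace (Cmod Ci) with 1.
  - assert (P := HB _ (Cmod_circle r t r0)). nra.
  - unfold Cmod, Ci. simpl fst; simpl snd. replace (0 ^ 2 + 1 ^ 2) with 1 by ring. symmetry. apply sqrt_1.
Qed.

Definition antid (c : nat -> R) (n : nat) : R := match n with O => 0 | S m => c m / (INR m + 1) end.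

Lemma dser_antid c n : dser (antid c) n = c n.
Proof. unfold dser, antid. field. assert (P := pos_INR n). lra. Qed.

Lemma gb_antid A M c : gb A M c -> 0 < M -> gb (A / M) M (antid c).
Proof.
  intros H M0 n. assert (A0 := gb_A _ _ _ H). destruct n as [|n]; simpl.
  - rewrite Rabs_R0, Rmult_1_r. apply Rmult_le_pos; auto. apply Rlt_le, Rinv_0_lt_compat; auto.
  - assert (P := pos_INR n). unfold Rdiv. rewrite Rabs_mult, (Rabs_right (/ _)).
    2:{ apply Rle_ge, Rlt_le, Rinv_0_lt_compat. lra. }
    replace (A * / M * (M * M ^ n)) with (A * M ^ n * 1) by (field; lra).
    apply Rmult_le_compat; auto using Rabs_pos.
    + apply Rlt_le, Rinv_0_lt_compat; lra.
    + rewrite <- Rinv_1. apply Rinv_le_contravar; lra.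
Qed.

Section Residues.
Variables (T D : C -> C) (r M rho : R).
Hypothesis H : tau_like T D r.
Hypothesis M0 : 0 < M.
Hypothesis R0 : 0 < rho < r.
Hypothesis HM : forall z, Cmod z = rho -> M * Cmod (T z) < / 32.

Let in_r z : Cmod z = rho -> 0 < Cmod z < r.
Proof. intros E. rewrite E. exact R0. Qed.

Let Tn0 z : Cmod z = rho -> T z <> 0%C.
Proof. intros E. apply (tl_n0 _ _ _ H), in_r, E. Qed.

Let Tdif z : Cmod z = rho -> cdif T z.
Proof. intros E. eexists. apply (tl_D _ _ _ H), in_r, E. Qed.

Let Ddif z : Cmod z = rho -> cdif D z.
Proof. intros E. apply (tl_DD _ _ _ H), in_r, E. Qed.

Lemma evT_dif A c z : gb A M c -> Cmod z = rho -> cdif (fun x => ev c (T x)) z.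
Proof.
  intros Hc E. exists (D z * ev (dser c) (T z))%C. apply (cder_comp T (ev c) z _ _ (tl_D _ _ _ H z (in_r z E))).
  apply cder_ev with A M; auto. assert (P := HM z E). lra.
Qed.

Lemma circ_pole k : circ (fun z => (/ T z) ^ S (S k) * D z)%C rho 0%C.
Proof.
  apply circ_prim with (fun z => RtoC (- / INR (S k)) * (/ T z) ^ S k)%C; [lra| |].
  - intros z E. assert (n0 := Tn0 z E).
    assert (P := cder_scal (RtoC (- / INR (S k))) _ _ _ (cder_pow _ _ _ k (cder_comp _ _ _ _ _ (tl_D _ _ _ H z (in_r z E)) (cder_inv _ n0)))).
    cbv beta in P. match type of P with cder _ _ ?v => replace ((/ T z) ^ S (S k) * D z)%C with v; [exact P|] end.
    assert (Q : (RtoC (- / INR (S k)) * RtoC (INR (S k)))%C = (-(1))%C).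
    { rewrite <- RtoC_mult. replace (- / INR (S k) * INR (S k)) with (-(1)); [apply RtoC_opp|]. field. apply not_0_INR. lia. }
    rewrite !Cmult_assoc, Q, !Cpow_S. field. auto.
  - intros z E. apply cdif_mult; [apply cdif_pow, cdif_inv; auto|auto].
Qed.

(** The difference between tau'/tau and 1/z is the derivative of log(tau(z)/z), which is
    single-valued since tau(z)/z has positive real part on the circle. *)
Lemma circ_simple_pole : circ (fun z => / T z * D z)%C rho (2 * RtoC PI * Ci)%C.
Proof.
  assert (P : circ (fun z => / T z * D z + -1 * / z)%C rho 0%C).
  { apply circ_prim with (fun z => Clog (T z * / z)); [lra| |].
    - intros z E. assert (n0 := Tn0 z E). assert (z0 : z <> 0%C) by (apply Cmod_pos_neq; rewrite E; lra).
      assert (re : 0 < fst (T z * / z)%C).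
      { apply re_near_one. replace (T z * / z - 1)%C with (- ((z - T z) / z))%C by (field; auto).
        rewrite Cmod_opp, Cmod_div by auto. assert (Q := tl_id _ _ _ H z (in_r z E)). assert (Q0 := proj1 (in_r z E)).
        apply Rmult_lt_reg_r with (Cmod z); auto. unfold Rdiv. rewrite Rmult_assoc, Rinv_l; lra. }
      assert (Q := cder_comp _ _ _ _ _ (cder_mult _ _ _ _ _ (tl_D _ _ _ H z (in_r z E)) (cder_inv _ z0)) (cder_Clog _ re)).
      cbv beta in Q. match type of Q with cder _ _ ?v => replace (/ T z * D z + -1 * / z)%C with v; [exact Q|] end.
      field. auto.
    - intros z E. assert (z0 : z <> 0%C) by (apply Cmod_pos_neq; rewrite E; lra).
      destruct (cdif_mult (fun z => / T z)%C D z (cdif_inv _ _ (Tdif z E) (Tn0 z E)) (Ddif z E)) as [l Hl].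
      eexists. apply (cder_plus _ _ _ _ _ Hl (cder_scal (-1)%C _ _ _ (cder_inv _ z0))). }
  assert (Q := circ_plus _ _ _ _ _ P (circ_Cinv rho (proj1 R0))).
  replace (0 + 2 * RtoC PI * Ci)%C with (2 * RtoC PI * Ci)%C in Q by ring. eapply circ_ext; [| |exact Q]; [lra|].
  intros z E. simpl. ring.
Qed.

Lemma circ_regular A c : gb A M c -> circ (fun z => ev c (T z) * D z)%C rho 0%C.
Proof.
  intros Hc. apply circ_prim with (fun z => ev (antid c) (T z)); [lra| |].
  - intros z E. rewrite <- (ev_ext _ _ (T z) (dser_antid c)). rewrite Cmult_comm.
    apply (cder_comp T (ev (antid c)) z _ _ (tl_D _ _ _ H z (in_r z E))).
    apply cder_ev with (A / M) M; auto; [apply gb_antid; auto|]. assert (P := HM z E). lra.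
  - intros z E. apply cdif_mult; auto. apply evT_dif with A; auto.
Qed.

(** Coefficients are peeled off from the lowest: each of the first p sits on a pole of order at
    least 2 and integrates to 0, the next one sits on the simple pole, and the rest is regular. *)
Lemma circ_res p : forall A c, gb A M c ->
  circ (fun z => (/ T z) ^ S p * ev c (T z) * D z)%C rho (2 * RtoC PI * Ci * RtoC (c p))%C.
Proof.
  induction p as [|p IH]; intros A c Hc.
  - assert (P := circ_plus _ _ _ _ _ (circ_scal (RtoC (c O)) _ _ _ circ_simple_pole) (circ_regular _ _ (gb_shift1 _ _ _ Hc))).
    replace (2 * RtoC PI * Ci * RtoC (c O))%C with (RtoC (c O) * (2 * RtoC PI * Ci) + 0)%C by ring.
    eapply circ_ext; [| |exact P]; [lra|]. intros z E. cbv beta.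
    rewrite (ev_front A M c (T z) Hc) by (try assert (P1 := HM z E); lra). assert (n0 := Tn0 z E). simpl. field. auto.
  - assert (P := circ_plus _ _ _ _ _ (circ_scal (RtoC (c O)) _ _ _ (circ_pole p)) (IH _ _ (gb_shift1 _ _ _ Hc))).
    replace (2 * RtoC PI * Ci * RtoC (c (S p)))%C with (RtoC (c O) * 0 + 2 * RtoC PI * Ci * RtoC (shift1 c p))%C by (unfold shift1; ring).
    eapply circ_ext; [| |exact P]; [lra|]. intros z E. cbv beta.
    rewrite (ev_front A M c (T z) Hc) by (try assert (P1 := HM z E); lra). assert (n0 := Tn0 z E). rewrite !Cpow_S. field. auto.
Qed.

(** The factor N + 1 in the remainder is traded for (9/8)^N, which turns the ratio 2/3 into 3/4; 162
    is 2 times 9 from this trade times 9 from |1 - u| >= 1/3. *)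
Lemma geom2_rem (u : C) N : Cmod u <= 2 / 3 ->
  Cmod (/ (1 - u) ^ 2 - csum (fun n => RtoC (INR n + 1) * u ^ n)%C N) <= 162 * (3 / 4) ^ N.
Proof.
  intros Hu. assert (u0 := Cmod_ge_0 u).
  assert (m1 : / 3 <= Cmod (1 - u)). 
  { assert (Q := Cmod_triangle (1 - u) u). replace (1 - u + u)%C with (RtoC 1) in Q by ring. rewrite Cmod_1 in Q. lra. }
  assert (n1 : (1 - u)%C <> 0%C) by (apply Cmod_pos_neq; lra).
  assert (E : (csum (fun n => RtoC (INR n + 1) * u ^ n)%C N * (1 - u) ^ 2 = 1 - u ^ N * (RtoC (INR N) + 1 - RtoC (INR N) * u))%C).
  { induction N as [|N IH]; [simpl; ring|]. cbn [csum]. rewrite Cmult_plus_distr_r, IH, S_INR, !RtoC_plus, (Cpow_S u N). ring. }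
  replace (/ (1 - u) ^ 2 - csum (fun n => RtoC (INR n + 1) * u ^ n)%C N)%C with
    ((1 - csum (fun n => RtoC (INR n + 1) * u ^ n)%C N * (1 - u) ^ 2) / (1 - u) ^ 2)%C by (field; auto).
  rewrite E. replace (1 - (1 - u ^ N * (RtoC (INR N) + 1 - RtoC (INR N) * u)))%C with 
    (u ^ N * (RtoC (INR N + 1) - RtoC (INR N) * u))%C by (rewrite RtoC_plus; ring).
  rewrite Cmod_div, Cmod_mult, !Cmod_pow by (apply Cpow_nz; auto).
  assert (p := pos_INR N).
  assert (B1 : Cmod (RtoC (INR N + 1) - RtoC (INR N) * u) <= 2 * (INR N + 1)).
  { apply Rle_trans with (1 := Cmod_triangle_minus _ _). rewrite Cmod_mult, !Cmod_R, !Rabs_right by lra. nra. }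
  assert (B2 : INR N + 1 <= 9 * (9 / 8) ^ N).
  { apply Rle_trans with (1 := succ_le_pow (9 / 8) N ltac:(lra)). apply Req_le. f_equal. field. }
  assert (B3 : Cmod u ^ N <= (2 / 3) ^ N) by (apply pow_incr; lra).
  assert (B4 : / Cmod (1 - u) ^ 2 <= 9).
  { replace 9 with (/ ((/ 3) ^ 2)) by field. apply Rinv_le_contravar; [lra|]. apply pow_incr. lra. }
  assert (B5 : 0 <= / Cmod (1 - u) ^ 2) by (apply Rlt_le, Rinv_0_lt_compat, pow_lt; lra).
  apply Rle_trans with ((2 / 3) ^ N * (2 * (9 * (9 / 8) ^ N)) * 9).
  - apply Rmult_le_compat; auto.
    + apply Rmult_le_pos; [apply pow_le; auto|apply Cmod_ge_0].
    + apply Rmult_le_compat; auto; [apply pow_le; auto|apply Cmod_ge_0|lra].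
  - replace ((2 / 3) ^ N * (2 * (9 * (9 / 8) ^ N)) * 9) with (162 * ((2 / 3) ^ N * (9 / 8) ^ N)) by ring.
    rewrite <- Rpow_mult_distr. replace (2 / 3 * (9 / 8)) with (3 / 4) by field. lra.
Qed.

Lemma small_eq (a b : C) B : (forall N, Cmod (a - b) <= B * (3 / 4) ^ N) -> a = b.
Proof.
  intros Hab. assert (m0 := Cmod_ge_0 (a - b)%C). destruct (Rle_lt_or_eq_dec _ _ m0) as [P|P].
  - exfalso. assert (B0 : 0 < B) by (assert (Q := Hab O); simpl in Q; lra).
    destruct (pow_lt_1_zero (3 / 4) ltac:(rewrite Rabs_right; lra) (Cmod (a - b) / B) ltac:(apply Rdiv_lt_0_compat; auto)) as [N HN].
    assert (Q := HN N (Nat.le_refl N)). rewrite Rabs_right in Q by (apply Rle_ge, pow_le; lra).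
    assert (Q2 := Hab N). apply (Rmult_lt_compat_l B) in Q; auto.
    replace (B * (Cmod (a - b) / B)) with (Cmod (a - b)) in Q by (field; lra). lra.
  - replace a with (a - b + b)%C by ring. replace (a - b)%C with (RtoC 0); [ring|]. symmetry.
    apply Cmod_eq_0. auto.
Qed.

(* Expand 1/(x - T w)^2 in powers of x / T w; the remainder of the partial sums decays geometrically. *)
Lemma circ_res2 k A A' c x : gb A M c -> gb A' M (dser (shift k c)) -> M * Cmod x <= / 2 ->
  (forall z, Cmod z = rho -> Cmod x <= 2 / 3 * Cmod (T z)) ->
  circ (fun z => (/ T z) ^ k * ev c (T z) * D z * / (x - T z) ^ 2)%C rho
    (2 * RtoC PI * Ci * ev (dser (shift k c)) x)%C.
Proof.
  intros Hc Hh Mx Hx. assert (A0 := gb_A _ _ _ Hc). assert (A0' := gb_A _ _ _ Hh).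
  assert (Tm : forall z, Cmod z = rho -> 0 < Cmod (T z)) by (intros z E; apply Cneq_mod_pos, Tn0, E).
  assert (xT : forall z, Cmod z = rho -> (x - T z)%C <> 0%C).
  { intros z E Q. assert (x = T z) by (replace x with (x - T z + T z)%C by ring; rewrite Q; ring).
    assert (Q1 := Hx z E). assert (Q2 := Tm z E). rewrite H0 in Q1. lra. }
  destruct (circ_ex (fun z => (/ T z) ^ k * ev c (T z) * D z * / (x - T z) ^ 2)%C rho (proj1 R0)) as [v Hv].
  { intros z E. repeat apply cdif_mult; auto.
    - apply cdif_pow, cdif_inv; auto.
    - apply evT_dif with A; auto.
    - apply cdif_inv; [|apply Cpow_nz; auto]. apply cdif_pow.
      eexists. refine (cder_ext_loc _ _ _ _ 1 Rlt_0_1 _ (cder_plus _ _ _ _ _ (cder_const x z) (cder_comp T _ z _ _ (tl_D _ _ _ H z (in_r z E)) (cder_scal (-1)%C _ _ _ (cder_id _))))). intros y _. simpl. ring. }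
  replace (2 * RtoC PI * Ci * ev (dser (shift k c)) x)%C with v; [exact Hv|].
  set (h := dser (shift k c)) in *.
  assert (Hs : forall N, circ (fun z => (/ T z) ^ k * ev c (T z) * D z * ((/ T z) ^ 2 * csum (fun n => RtoC (INR n + 1) * (x * / T z) ^ n) N))%C rho
     (2 * RtoC PI * Ci * psum h N x)%C).
  { intros N. rewrite psum_csum. induction N as [|N IH]; cbn [csum].
    - replace (2 * RtoC PI * Ci * 0)%C with (0 * (2 * RtoC PI * Ci))%C by ring.
      eapply circ_ext; [| |exact (circ_scal 0%C _ _ _ circ_simple_pole)]; [lra|]. intros z E. cbv beta. ring.
    - assert (P := circ_plus _ _ _ _ _ IH (circ_scal (RtoC (INR N + 1) * x ^ N)%C _ _ _ (circ_res (S (k + N)) A c Hc))).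
      match type of P with circ _ _ ?u => match goal with |- circ _ _ ?u' => replace u' with u end end.
      + eapply circ_ext; [| |exact P]; [lra|]. intros z E. cbv beta. rewrite Cpow_mult_l, !Cpow_S, Cpow_add_r. ring.
      + unfold h, dser, shift. rewrite RtoC_mult. replace (k + S N)%nat with (S (k + N)) by lia. ring. }
  (* By [tl_id] this is a lower bound for |tau| on the circle. *)
  set (b := 19 / 20 * rho). assert (b0 : 0 < b) by (unfold b; lra).
  assert (Tb : forall z, Cmod z = rho -> Cmod (/ T z) <= / b).
  { intros z E. rewrite Cmod_inv by auto. apply Rinv_le_contravar; auto. assert (Q := tl_id _ _ _ H z (in_r z E)).
    assert (S := Cmod_triangle (z - T z) (T z)). replace (z - T z + T z)%C with z in S by ring. rewrite E in *. unfold b. lra. }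
  set (G := (/ b) ^ k * (4 * A) * 2 * ((/ b) ^ 2 * 162)).
  assert (Hb : forall N, Cmod (v - 2 * RtoC PI * Ci * psum h N x) <= 2 * PI * (G * rho) * (3 / 4) ^ N).
  { intros N. replace (2 * PI * (G * rho) * (3 / 4) ^ N) with (2 * PI * (G * (3 / 4) ^ N * rho)) by ring.
    assert (P := circ_plus _ _ _ _ _ Hv (circ_scal (-1)%C _ _ _ (Hs N))). cbv beta in P.
    replace (v - 2 * RtoC PI * Ci * psum h N x)%C with (v + -1 * (2 * RtoC PI * Ci * psum h N x))%C by ring.
    refine (circ_bound _ _ _ _ (proj1 R0) P _). intros z E. assert (n0 := Tn0 z E). assert (n1 := xT z E).
    replace (/ (x - T z) ^ 2)%C with ((/ T z) ^ 2 * / (1 - x * / T z) ^ 2)%C.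
    2:{ field. repeat split; auto. intros Q. apply n1. replace (x - T z)%C with (- (T z - x))%C by ring. rewrite Q. ring. }
    set (s := csum _ _). set (q := (/ (1 - x * / T z) ^ 2)%C).
    replace ((/ T z) ^ k * ev c (T z) * D z * ((/ T z) ^ 2 * q) + -1 * ((/ T z) ^ k * ev c (T z) * D z * ((/ T z) ^ 2 * s)))%C
      with ((/ T z) ^ k * ev c (T z) * D z * ((/ T z) ^ 2 * (q - s)))%C by ring.
    rewrite !Cmod_mult, !Cmod_pow.
    assert (g1 : Cmod (q - s) <= 162 * (3 / 4) ^ N).
    { apply geom2_rem. rewrite Cmod_mult, Cmod_inv by auto. assert (Q := Tm z E). 
      apply Rmult_le_reg_r with (Cmod (T z)); auto. rewrite Rmult_assoc, Rinv_l, Rmult_1_r by lra. apply Hx, E. }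
    assert (g2 : forall j, Cmod (/ T z) ^ j <= (/ b) ^ j) by (intros j; apply pow_incr; split; [apply Cmod_ge_0|apply Tb, E]).
    assert (g3 : Cmod (ev c (T z)) <= 4 * A) by (apply ev_bound with M; auto; [lra|]; assert (Q := HM z E); lra).
    assert (g4 := tl_DB _ _ _ H z (in_r z E)).
    assert (ge : forall j, 0 <= Cmod (/ T z) ^ j) by (intros j; apply pow_le, Cmod_ge_0).
    unfold G. replace ((/ b) ^ k * (4 * A) * 2 * ((/ b) ^ 2 * 162) * (3 / 4) ^ N) with
      ((/ b) ^ k * (4 * A) * 2 * ((/ b) ^ 2 * (162 * (3 / 4) ^ N))) by ring.
    assert (p2 := Cmod_ge_0 (ev c (T z))). assert (p3 := Cmod_ge_0 (D z)). assert (p4 := Cmod_ge_0 (q - s)%C).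
    apply Rmult_le_compat; [apply Rmult_le_pos; auto; apply Rmult_le_pos; auto|apply Rmult_le_pos; auto| |apply Rmult_le_compat; auto].
    apply Rmult_le_compat; auto; [apply Rmult_le_pos; auto|]. apply Rmult_le_compat; auto. }
  symmetry. apply small_eq with (2 * PI * (G * rho) + Cmod (2 * RtoC PI * Ci) * (4 * A')). intros N.
  rewrite Cmod_sub_sym.
  replace (v - 2 * RtoC PI * Ci * ev h x)%C with ((v - 2 * RtoC PI * Ci * psum h N x) - 2 * RtoC PI * Ci * (ev h x - psum h N x))%C by ring.
  apply Rle_trans with (1 := Cmod_triangle_minus _ _). rewrite Rmult_plus_distr_r. apply Rplus_le_compat; [apply Hb|].
  rewrite Cmod_mult, Rmult_assoc. apply Rmult_le_compat_l; [apply Cmod_ge_0|].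
  apply Rle_trans with (1 := ev_err _ _ _ _ N Hh ltac:(lra) Mx). apply Rmult_le_compat_l; [lra|].
  apply pow_incr. split; [apply Rmult_le_pos; [lra|apply Cmod_ge_0]|lra].
Qed.
End Residues.

End CircleIntegrals.

(** * Evaluation of the covariance integral *)

Module CovarianceFormula.
Import Reals Lra Lia Psatz.
Import Coquelicot.
Import Defs.
Import EvaluatedSeries ComplexDerivatives SeriesBounds InverseBranch CovarianceKernel CircleIntegrals.
Open Scope R_scope.

(** The coefficients of 1 - s x - s ipsi(x), which is tau zeta when ipsi is the inverse of
    Psi(x)/x. *)
Definition zser (s : R) (ipsi : nat -> R) : nat -> R :=
  fun n => (match n with O => 1 | 1%nat => - s | _ => 0 end) - s * ipsi n.

Fixpoint cpow (c : nat -> R) (k : nat) : nat -> R :=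
  match k with O => delta0 1 | S k' => cmul c (cpow c k') end.

Lemma gbx_cpow L c k : 0 < L -> gbx L c -> gbx L (cpow c k).
Proof. intros L0 H. induction k; simpl; [apply gbx_delta0; auto|apply gbx_cmul; auto]. Qed.

Lemma ev_cpow L c k x : 0 < L -> gbx L c -> 2 * L * Cmod x <= / 4 -> ev (cpow c k) x = (ev c x ^ k)%C.
Proof.
  intros L0 H Hx. induction k as [|k IH]; [apply ev_delta0|]. simpl cpow.
  destruct (H (2 * L) ltac:(lra)) as [A HA]. destruct (gbx_cpow L c k L0 H (2 * L) ltac:(lra)) as [A' HA'].
  rewrite (ev_mul _ _ _ _ _ _ HA HA' ltac:(lra) Hx), IH, Cpow_S. reflexivity.
Qed.

Definition X1 : nat -> R := fun n => match n with 1%nat => 1 | _ => 0 end.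

Lemma gbx_X1 L : 0 < L -> gbx L X1.
Proof.
  intros L0 M HM. exists (/ M). intros n. destruct n as [|[|n]]; simpl X1.
  - rewrite Rabs_R0. simpl. rewrite Rmult_1_r. apply Rlt_le, Rinv_0_lt_compat. lra.
  - rewrite Rabs_R1. simpl. apply Req_le. field. lra.
  - rewrite Rabs_R0. apply Rmult_le_pos; [apply Rlt_le, Rinv_0_lt_compat; lra|apply pow_le; lra].
Qed.

Lemma zserE s ipsi n : zser s ipsi n = 1 * (1 * delta0 1 n + - s * X1 n) + - s * ipsi n.
Proof. unfold zser, delta0, X1. destruct n as [|[|n]]; ring. Qed.

Lemma gbx_zser L s ipsi : 0 < L -> gbx L ipsi -> gbx L (zser s ipsi).
Proof.
  intros L0 H. apply gbx_ext with (fun n => 1 * (1 * delta0 1 n + - s * X1 n) + - s * ipsi n).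
  - intros n. symmetry. apply zserE.
  - apply gbx_lin; auto. apply gbx_lin; auto; [apply gbx_delta0; auto|apply gbx_X1; auto].
Qed.

Lemma ev_X1 L x : 0 < L -> L * Cmod x <= / 2 -> ev X1 x = x.
Proof.
  intros L0 Hx. destruct (gbx_X1 (L / 2) ltac:(lra) L ltac:(lra)) as [A HA].
  rewrite (ev_front A L _ _ HA ltac:(lra) Hx). rewrite (ev_ext _ (delta0 1)), ev_delta0; [simpl; ring|].
  intros [|n]; reflexivity.
Qed.

Lemma ev_zser L s ipsi x : 0 < L -> gbx L ipsi -> 2 * L * Cmod x <= / 2 ->
  ev (zser s ipsi) x = (1 - RtoC s * x - RtoC s * ev ipsi x)%C.
Proof.
  intros L0 H Hx. rewrite (ev_ext _ _ _ (zserE s ipsi)).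
  destruct (H (2 * L) ltac:(lra)) as [A HA]. destruct (gbx_X1 L L0 (2 * L) ltac:(lra)) as [A' HA'].
  assert (HB := gb_lin 1 (- s) _ _ _ _ _ (gb_delta0 1 (2 * L) ltac:(lra)) HA' ltac:(lra)).
  rewrite (ev_lin _ _ _ _ _ _ _ _ HB HA ltac:(lra) Hx).
  rewrite (ev_lin _ _ _ _ _ _ _ _ (gb_delta0 1 (2 * L) ltac:(lra)) HA' ltac:(lra) Hx).
  rewrite ev_delta0, (ev_X1 (2 * L)) by lra. rewrite RtoC_opp. ring.
Qed.

(** The inner integral is [circ_res2] at x = tau(z), the outer one [circ_res]. The first exponent is
    a successor because the outer residue is taken at a pole of order k1 + 1. *)
Lemma cov_formula_eval (c e ipsi : nat -> R) (Cm Ginv : C -> C) (a K r0 : R) :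
  0 < a -> 1 <= K -> (forall n, Rabs (c n) <= K ^ n) -> c O = 0 -> c 1%nat = 1 -> e O = 1 ->
  (forall n, dser e n = cmul (dser c) e n) -> (forall n, cmul (shift1 e) ipsi n = delta0 1 n) ->
  0 < r0 -> (forall x, 0 < Cmod x < r0 -> Cm (/ x)%C = ev c x) -> functional_inverse_at0 Cm Ginv ->
  exists eps0, 0 < eps0 /\ forall eps, 0 < eps < eps0 -> forall k1 k2 : nat,
    cov_formula Ginv a eps (S k1) k2 =
    RtoC (cmul (cpow (zser (1 - a) ipsi) (S k1)) (dser (shift k2 (cpow (zser (1 - a) ipsi) k2))) k1).
Proof.
  intros a0 K1 Hc c0 c1 e0 He Hi r00 HC HF.
  assert (gc : gb 1 K c) by (intros n; rewrite Rmult_1_l; apply Hc).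
  assert (ge := ode_bound c e K ltac:(lra) Hc e0 He).
  assert (e1 : e 1%nat = 1).
  { assert (P := He O). unfold dser, cmul in P. simpl in P. rewrite c1, e0 in P. lra. }
  (* Dividing by x shifts the index; n + 2 <= 2 (n + 1) makes up for it at the price of squaring the
     rate. *)
  assert (gpsi : forall n, Rabs (shift1 e (S n)) <= (4 * K ^ 2) ^ S n).
  { intros n. unfold shift1. apply Rle_trans with (1 := ge (S (S n))). rewrite Rmult_1_l.
    replace (4 * K ^ 2) with ((2 * K) ^ 2) by ring. rewrite <- pow_mult. apply Rle_pow; [lra|lia]. }
  assert (gi := inv_bound (shift1 e) ipsi (4 * K ^ 2) ltac:(nra) gpsi e1 Hi).
  set (L := 2 * (4 * K ^ 2)) in *. assert (L0 : 2 * K <= L) by (unfold L; nra). assert (L1 : 0 < L) by lra.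
  set (M := 2 * L). set (zh := zser (1 - a) ipsi).
  assert (gc' : gb 1 M c) by (apply gb_weaken with (1 := gc); unfold M; lra).
  assert (ge' : gb 1 M e) by (apply gb_weaken with (1 := ge); unfold M; lra).
  assert (gi' : gbx L ipsi) by (apply gb_gbx with 1; [lra|exact gi]).
  assert (gz : gbx L zh) by (apply gbx_zser; auto).
  destruct (tau_tau_like 1 M c e Cm Ginv r0 gc' ge' ltac:(unfold M; lra) c0 e0 e1 He r00 HC HF) as [r [HT HM]].
  set (T := tau Ginv) in *. set (D := fun z => (/ ev (dser e) (T z))%C) in *.
  exists (r / 2). assert (rr := tl_r _ _ _ HT). split; [lra|]. intros eps Heps k1 k2.
  assert (R1 : 0 < eps < r) by lra. assert (R2 : 0 < 2 * eps < r) by lra.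
  assert (HM1 : forall z, Cmod z = eps -> M * Cmod (T z) < / 32) by (intros z E; apply HM; rewrite E; auto).
  assert (HM2 : forall z, Cmod z = 2 * eps -> M * Cmod (T z) < / 32) by (intros z E; apply HM; rewrite E; auto).
  assert (M0 : 0 < M) by (unfold M; lra).
  assert (an : RtoC a <> 0%C) by (intros E; injection E; lra).
  (* The relation [ev e] (tau) = 1 + z says Psi(tau(z)) = z, and then 1/z + 1 + (1/tau - 1/z - 1)/a
     is zeta(tau)/a. *)
  assert (HA : forall z, 0 < Cmod z < r -> Afac Ginv a z = (/ RtoC a * (/ T z * ev zh (T z)))%C).
  { intros z Hz. destruct (HM z Hz) as [Tz Ez]. assert (n0 := tl_n0 _ _ _ HT z Hz).
    assert (z0 := Cmod_pos_neq _ (proj1 Hz)).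
    unfold Afac. rewrite (PhiH_tau _ _ _ _ HT Hz). fold T. unfold zh.
    rewrite (ev_zser L) by (auto; unfold M in Tz; lra).
    rewrite (ev_front 1 M e (T z) ge' ltac:(lra) ltac:(lra)), e0 in Ez.
    assert (zE : z = (T z * ev (shift1 e) (T z))%C).
    { replace z with (1 + z - 1)%C at 1 by ring. rewrite <- Ez. ring. }
    assert (gs := gb_shift1 _ _ _ ge'). destruct (gi' M ltac:(unfold M; lra)) as [Ai HAi].
    assert (Ag := gb_A _ _ _ gs).
    assert (IE : (ev (shift1 e) (T z) * ev ipsi (T z))%C = 1%C).
    { rewrite <- (ev_mul _ _ M _ _ _ gs HAi) by lra. rewrite (ev_ext _ _ _ Hi). apply ev_delta0. }
    set (p := ev (shift1 e) (T z)) in *. set (q := ev ipsi (T z)) in *.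
    assert (p0 : p <> 0%C). { intros E. rewrite E in zE. apply z0. rewrite zE. ring. }
    replace q with (/ p)%C by (replace q with (/ p * (p * q))%C by (field; auto); rewrite IE; ring).
    replace (/ z)%C with (/ (T z * p))%C by (rewrite <- zE; reflexivity). rewrite RtoC_minus. field. auto. }
  assert (HK : forall z w, Cmod z = eps -> Cmod w = 2 * eps -> Kern Ginv z w = (D z * D w / (T z - T w) ^ 2)%C).
  { intros z w Ez Ew. apply Kern_tau with r; auto; try (rewrite Ez; lra); try (rewrite Ew; lra).
    intros E. rewrite E in Ez. lra. }
  set (h := dser (shift k2 (cpow zh k2))).
  assert (gh : gbx L h) by (apply gbx_dser; auto; apply gbx_shift, gbx_cpow; auto).
  destruct (gh M ltac:(unfold M; lra)) as [Ah HAh].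
  destruct (gbx_cpow L zh k2 L1 gz M ltac:(unfold M; lra)) as [A2 HA2].
  assert (zpE : forall k z, 0 < Cmod z < r -> (Afac Ginv a z ^ k)%C = ((/ RtoC a) ^ k * ((/ T z) ^ k * ev (cpow zh k) (T z)))%C).
  { intros k z Hz. destruct (HM z Hz) as [Tz Ez].
    rewrite HA, !Cpow_mult_l, (ev_cpow L) by (auto; unfold M in Tz; lra). reflexivity. }
  (* |tau(z)| <= 21/20 eps and |tau(w)| >= 38/20 eps, and 21/38 < 2/3. *)
  assert (TI : forall z w, Cmod z = eps -> Cmod w = 2 * eps -> Cmod (T z) <= 2 / 3 * Cmod (T w)).
  { intros z w Ez Ew. assert (P1 := tl_id _ _ _ HT z ltac:(rewrite Ez; lra)). assert (P2 := tl_id _ _ _ HT w ltac:(rewrite Ew; lra)).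
    assert (S1 := Cmod_triangle_minus z (z - T z)). replace (z - (z - T z))%C with (T z) in S1 by ring.
    assert (S2 := Cmod_triangle (w - T w) (T w)). replace (w - T w + T w)%C with w in S2 by ring. lra. }
  set (P := (2 * RtoC PI * Ci)%C).
  assert (inner : forall z, Cmod z = eps -> 
    circle_integral (fun w => Afac Ginv a z ^ S k1 * Afac Ginv a w ^ k2 * Kern Ginv z w)%C (2 * eps) =
    ((/ RtoC a) ^ (S k1 + k2) * P * ((/ T z) ^ S k1 * ev (cmul (cpow zh (S k1)) h) (T z) * D z))%C).
  { intros z Ez. assert (Hz : 0 < Cmod z < r) by (rewrite Ez; lra). destruct (HM z Hz) as [Tz _].
    assert (Q := circ_res2 T D r M (2 * eps) HT M0 R2 HM2 k2 A2 Ah _ (T z) HA2 HAh ltac:(lra) (fun w Ew => TI z w Ez Ew)).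
    apply circ_unique. fold h in Q. fold P in Q.
    apply (circ_scal (Afac Ginv a z ^ S k1 * D z * (/ RtoC a) ^ k2)%C) in Q.
    replace ((/ RtoC a) ^ (S k1 + k2) * P * ((/ T z) ^ S k1 * ev (cmul (cpow zh (S k1)) h) (T z) * D z))%C with
      (Afac Ginv a z ^ S k1 * D z * (/ RtoC a) ^ k2 * (P * ev h (T z)))%C.
    - eapply circ_ext; [| |exact Q]; [lra|]. intros w Ew. cbv beta. 
      rewrite (zpE k2 w), (HK z w Ez Ew) by (rewrite Ew; lra). unfold Cdiv. ring.
    - destruct (gbx_cpow L zh (S k1) L1 gz M ltac:(unfold M; lra)) as [A1 HA1].
      rewrite (ev_mul _ _ M _ _ _ HA1 HAh) by lra. rewrite (zpE (S k1) z Hz), Cpow_add_r. ring. }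
  destruct (gbx_cmul L _ _ L1 (gbx_cpow L zh (S k1) L1 gz) gh M ltac:(unfold M; lra)) as [A3 HA3].
  assert (Q := circ_res T D r M eps HT M0 R1 HM1 k1 _ _ HA3). fold P in Q.
  apply (circ_scal ((/ RtoC a) ^ (S k1 + k2) * P)%C) in Q.
  unfold cov_formula. fold P.
  assert (Pn : P <> 0%C).
  { unfold P. apply Cmult_neq_0; [apply Cmult_neq_0|].
    - intros E. injection E. lra.
    - intros E. injection E. apply PI_neq0.
    - intros E. injection E. lra. }
  erewrite circ_unique.
  2:{ eapply circ_ext; [| |exact Q]; [lra|]. intros z Ez. cbv beta. rewrite (inner z Ez). reflexivity. }
  rewrite RtoC_pow. assert (AE : ((RtoC a) ^ (S k1 + k2) * (/ RtoC a) ^ (S k1 + k2))%C = 1%C).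
  { rewrite <- Cpow_mult_l, Cinv_r by auto. apply Cpow_1_l. }
  fold zh. fold h. change (ssrnat.addn (S k1) k2) with (S k1 + k2)%nat.
  set (v := RtoC (cmul _ _ _)).
  replace (RtoC a ^ (S k1 + k2) / P ^ 2 * ((/ RtoC a) ^ (S k1 + k2) * P * (P * v)))%C with
    ((RtoC a ^ (S k1 + k2) * (/ RtoC a) ^ (S k1 + k2)) * v)%C by (field; auto).
  rewrite AE. ring.
Qed.

End CovarianceFormula.

(** * Moments of the limit measure *)

Module MeasureIntegrals.
Import Reals.
Import Defs.
Import structures.
Import all_boot all_order all_algebra.
Import all_classical all_reals all_analysis.
Import measurable_realfun Rstruct Rstruct_topology.
Set Implicit Arguments. Unset Strict Implicit. Unset Printing Implicit Defensive.
Import Order.TTheory GRing.Theory Num.Theory.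
Import numFieldNormedType.Exports.
Local Open Scope classical_set_scope.
Local Open Scope ring_scope.

Local Notation R := Rdefinitions.R.
Local Notation mT := (measurableTypeR R).

Definition mfun (f : R -> R) : Prop := measurable_fun [set: mT] (f : mT -> mT).

Lemma mfun_cst a : mfun (fun _ => a).
Proof. exact: measurable_cst. Qed.

Lemma mfun_id : mfun id.
Proof. exact: measurable_id. Qed.

Lemma mfun_plus f g : mfun f -> mfun g -> mfun (fun x => Rplus (f x) (g x)).
Proof. by move=> mf mg; apply: (@measurable_funD _ mT R _ f g). Qed.

Lemma mfun_mult f g : mfun f -> mfun g -> mfun (fun x => Rmult (f x) (g x)).
Proof. by move=> mf mg; apply: (@measurable_funM _ mT R _ f g). Qed.

Lemma mfun_opp f : mfun f -> mfun (fun x => Ropp (f x)).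
Proof. by move=> mf; apply: (@measurableT_comp _ _ _ mT mT mT (-%R) _ f) => //; exact: oppr_measurable. Qed.

Lemma mfun_inv f : mfun f -> mfun (fun x => Rinv (f x)).
Proof.
move=> mf; have -> : (fun x => Rinv (f x)) = GRing.inv \o f by apply/funext => x; rewrite /= RinvE.
apply: (@measurableT_comp _ _ _ mT mT mT GRing.inv _ f) => //.
have -> : [set: mT] = (~` [set 0]) `|` [set 0] by rewrite setvU.
apply/measurable_funU; [by apply: measurableC; exact: measurable_set1|exact: measurable_set1|].
split; last exact: measurable_fun_set1.
apply: (@open_continuous_measurable_fun R).
  by apply: closed_openC; exact: closed_eq.
by move=> x; rewrite inE /= => /eqP x0; exact: inv_continuous.
Qed.

Lemma mfun_continuity f : (forall x, continuity_pt f x) -> mfun f.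
Proof. by move=> cf; apply: continuous_measurable_fun => x; apply/continuity_pt_cvg. Qed.

Lemma large_measurable (K : R) : measurable ((fun x => Rlt K (Rabs x)) : set mT).
Proof.
have -> : (fun x => Rlt K (Rabs x)) = ~` [set` `[- K, K]] :> set mT.
  apply/seteqP; split=> x; rewrite /= in_itv /= -ler_norml.
    by move=> /RltP; rewrite ltNge => /negP.
  by move=> /negP; rewrite -ltNge => /RltP.
by apply: measurableC; exact: measurable_itv.
Qed.

Definition null_beyond (m : PMeasR) (K : R) : Prop := m (fun x => Rlt K (Rabs x)) = EFin 0.

Section Integral.
Variables (m : PMeasR) (K : R).
Hypothesis mK : null_beyond m K.

Definition bdd (f : R -> R) : Prop := exists B, forall x, Rle (Rabs x) K -> Rle (Rabs (f x)) B.

Let N : set mT := fun x => Rlt K (Rabs x).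
Let D : set mT := [set: mT] `\` N.

Let mN : measurable N. Proof. exact: large_measurable. Qed.

Let mD : measurable D. Proof. exact: measurableD. Qed.

Let D_le x : D x -> Rle (Rabs x) K.
Proof. by move=> [_ /=] /RltP; rewrite -leNgt => /RleP. Qed.

Lemma bdd_integrable f : mfun f -> bdd f -> m.-integrable [set: mT] (EFin \o f).
Proof.
move=> mf [B fB]; apply/(negligible_integrable mN) => //; first exact/measurable_EFinP.
apply: measurable_bounded_integrable => //.
- by rewrite (le_lt_trans (probability_le1 _ _)) ?ltry.
- exact: measurable_funS mf.
- exists B; split; first by rewrite num_real.
  move=> y By x /D_le /fB /RleP fxB; apply: le_trans (ltW By); exact: fxB.
Qed.

Lemma mint_lin a b f g : mfun f -> bdd f -> mfun g -> bdd g ->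
  mint m (fun x => Rplus (Rmult a (f x)) (Rmult b (g x))) = Rplus (Rmult a (mint m f)) (Rmult b (mint m g)).
Proof.
move=> mf bf mg bg; have If := bdd_integrable mf bf; have Ig := bdd_integrable mg bg.
rewrite /mint (@RintegralD _ mT R m setT (fun x => a * f x) (fun x => b * g x)) //.
- by rewrite !RintegralZl.
- by have := @integrableZl _ mT R m setT measurableT a _ If; apply: eq_integrable => // x _ /=; rewrite EFinM.
- by have := @integrableZl _ mT R m setT measurableT b _ Ig; apply: eq_integrable => // x _ /=; rewrite EFinM.
Qed.

Lemma mint_bound f B : Rle (IZR Z0) B -> mfun f -> (forall x, Rle (Rabs x) K -> Rle (Rabs (f x)) B) -> Rle (Rabs (mint m f)) B.
Proof.
move=> B0 mf fB; have If : m.-integrable [set: mT] (EFin \o f) by apply: bdd_integrable => //; exists B.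
have -> : mint m f = Rintegral m D f.
  by rewrite /mint /Rintegral (negligible_integral mN _ If) //; exact: mK.
have IfD : m.-integrable D (EFin \o f) by apply: integrableS If.
apply/RleP; apply: le_trans (le_normr_Rintegral mD IfD) _.
have -> : B = B * 1 :> R by rewrite mulr1.
apply: (@le_trans _ _ (B * fine (m D))); last first.
  rewrite ler_wpM2l //; first by move/RleP: B0.
  rewrite -lee_fin fineK; first exact: probability_le1.
  by rewrite ge0_fin_numE // (le_lt_trans (probability_le1 _ _)) ?ltry.
rewrite -Rintegral_cst //; apply: le_Rintegral => //.
- exact: integrable_norm.
- apply: measurable_bounded_integrable => //.
    by rewrite (le_lt_trans (probability_le1 _ _)) ?ltry.
  exists B; split; first by rewrite num_real.
  move=> y By x _ /=; rewrite ger0_norm; [exact: ltW|by move/RleP: B0].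
- by move=> x /D_le /fB /RleP.
Qed.
End Integral.

Lemma mint_1 (m : PMeasR) : mint m (fun _ => IZR (Zpos xH)) = IZR (Zpos xH).
Proof.
rewrite /mint (@Rintegral_cst _ mT R m setT measurableT).
have H : fine (m setT) = 1 :> R by rewrite [m setT]probability_setT.
by rewrite H; exact: mulr1.
Qed.

(** The bound is enlarged to at least 1, so that its powers increase. *)
Lemma compact_bound (m : PMeasR) : compactly_supported m ->
  exists K, Rle (IZR (Zpos xH)) K /\ null_beyond m K.
Proof.
move=> [K mK]; exists (Rmax K (IZR (Zpos xH))); split; first exact: Rmax_r.
apply: (@subset_measure0 _ mT R m _ (fun x => Rlt K (Rabs x))) => //; try exact: large_measurable.
by move=> x /= H; apply: Rle_lt_trans H; exact: Rmax_l.
Qed.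

End MeasureIntegrals.

(** * Moments and the expansion of the Stieltjes transform at infinity *)

Module StieltjesTransform.
Import Reals Lra Lia Psatz.
Import Coquelicot.
Import Defs.
Import EvaluatedSeries ComplexDerivatives SeriesBounds CovarianceKernel MeasureIntegrals.
Open Scope R_scope.

(** The coefficients of C_m(1/x), the sum of mom_k x^(k+1). *)
Definition momser (mom : nat -> R) (n : nat) : R := match n with O => 0 | S k => mom k end.

Lemma mfun_pow k : mfun (fun x => x ^ k).
Proof.
  induction k as [|k IH]; simpl; [apply mfun_cst|]. apply mfun_mult; [apply mfun_id|exact IH].
Qed.

Section Moments.
Variables (m : PMeasR) (K : R).
Hypothesis K1 : 1 <= K.
Hypothesis mK : null_beyond m K.

Let mom k := mint m (fun x => x ^ k).

Lemma bdd_pow k : bdd K (fun x => x ^ k).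
Proof.
  exists (K ^ k). intros x Hx. rewrite <- RPow_abs. apply pow_incr. split; [apply Rabs_pos|exact Hx].
Qed.

Lemma mom_bound k : Rabs (mom k) <= K ^ k.
Proof.
  apply (@mint_bound _ _ mK); [apply pow_le; lra|apply mfun_pow|].
  intros x Hx. rewrite <- RPow_abs. apply pow_incr. split; [apply Rabs_pos|exact Hx].
Qed.

Lemma momser_bound n : Rabs (momser mom n) <= K ^ n.
Proof.
  destruct n as [|n]; simpl momser; [rewrite Rabs_R0; simpl; lra|].
  apply Rle_trans with (1 := mom_bound n). apply Rle_pow; [lra|lia].
Qed.

Lemma mfun_rsum (b : nat -> R) n : mfun (fun t => rsum (fun k => b k * t ^ k) n).
Proof.
  induction n as [|n IH]; simpl; [apply mfun_cst|]. apply mfun_plus; [exact IH|]. apply mfun_mult; [apply mfun_cst|apply mfun_pow].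
Qed.

Lemma bdd_rsum (b : nat -> R) n : bdd K (fun t => rsum (fun k => b k * t ^ k) n).
Proof.
  induction n as [|n [B HB]]; simpl; [exists 0; intros; rewrite Rabs_R0; lra|].
  destruct (bdd_pow n) as [B' HB']. exists (B + Rabs (b n) * B'). intros x Hx.
  apply Rle_trans with (1 := Rabs_triang _ _). rewrite Rabs_mult. 
  apply Rplus_le_compat; [apply HB, Hx|]. apply Rmult_le_compat_l; [apply Rabs_pos|apply HB', Hx].
Qed.

Lemma mint_ext f g : (forall x, f x = g x) -> mint m f = mint m g.
Proof. intros E. f_equal. apply FunctionalExtensionality.functional_extensionality, E. Qed.

Lemma mint_rsum (b : nat -> R) n : mint m (fun t => rsum (fun k => b k * t ^ k) n) = rsum (fun k => b k * mom k) n.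
Proof.
  induction n as [|n IH].
  - simpl. assert (P := @mint_bound m K mK (fun _ => 0) 0 (Rle_refl 0) (mfun_cst 0)).
    assert (Q : Rabs (mint m (fun _ => 0)) <= 0) by (apply P; intros; rewrite Rabs_R0; lra).
    assert (Q2 := Rabs_pos (mint m (fun _ => 0))). destruct (Req_dec (mint m (fun _ => 0)) 0) as [E|E]; [exact E|].
    assert (Q3 := Rabs_pos_lt _ E). lra.
  - simpl. rewrite <- IH. rewrite <- (Rmult_1_l (mint m (fun t => rsum _ n))). unfold mom. rewrite <- (@mint_lin m K mK).
    + apply mint_ext. intros x. simpl. ring.
    + apply mfun_rsum.
    + apply bdd_rsum.
    + apply mfun_pow.
    + apply bdd_pow.
Qed.

Lemma mint_close f (b : nat -> R) n B : 0 <= B -> mfun f -> bdd K f ->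
  (forall t, Rabs t <= K -> Rabs (f t - rsum (fun k => b k * t ^ k) n) <= B) ->
  Rabs (mint m f - rsum (fun k => b k * mom k) n) <= B.
Proof.
  intros B0 mf bf H. rewrite <- mint_rsum.
  replace (mint m f - mint m (fun t => rsum (fun k => b k * t ^ k) n)) with
    (1 * mint m f + -1 * mint m (fun t => rsum (fun k => b k * t ^ k) n)) by ring.
  rewrite <- (@mint_lin m K mK _ _ _ _ mf bf (mfun_rsum b n) (bdd_rsum b n)).
  apply (@mint_bound m K mK); auto.
  - apply mfun_plus; apply mfun_mult; try apply mfun_cst; auto. apply mfun_rsum.
  - intros x Hx. replace (1 * f x + -1 * rsum (fun k => b k * x ^ k) n) with (f x - rsum (fun k => b k * x ^ k) n) by ring.
    apply H, Hx.
Qed.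

Lemma resolvent_close (x : C) (t : R) n : x <> 0%C -> K * Cmod x <= / 2 -> Rabs t <= K ->
  Cmod (/ (/ x - RtoC t) - x * psum (pow t) n x) <= 2 * Cmod x * (/ 2) ^ n.
Proof.
  intros x0 Hx Ht. assert (p := Cmod_ge_0 x).
  assert (tx : Cmod (RtoC t * x) <= / 2) by (rewrite Cmod_mult, Cmod_R; nra).
  assert (m1 : / 2 <= Cmod (1 - RtoC t * x)).
  { assert (Q := Cmod_triangle (1 - RtoC t * x) (RtoC t * x)). replace (1 - RtoC t * x + RtoC t * x)%C with (RtoC 1) in Q by ring.
    rewrite Cmod_1 in Q. lra. }
  assert (n1 : (1 - RtoC t * x)%C <> 0%C) by (apply Cmod_pos_neq; lra).
  assert (E : ((1 - RtoC t * x) * psum (pow t) n x = 1 - (RtoC t * x) ^ n)%C).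
  { rewrite psum_csum. induction n as [|n IH]; [simpl; ring|]. cbn [csum]. rewrite Cmult_plus_distr_l, IH, Cpow_S, !Cpow_mult_l, RtoC_pow. ring. }
  replace (/ (/ x - RtoC t) - x * psum (pow t) n x)%C with (x * (RtoC t * x) ^ n / (1 - RtoC t * x))%C.
  - rewrite Cmod_div, Cmod_mult, Cmod_pow by auto.
    assert (B1 : / Cmod (1 - RtoC t * x) <= 2) by (replace 2 with (/ / 2) by field; apply Rinv_le_contravar; lra).
    assert (B2 : Cmod (RtoC t * x) ^ n <= (/ 2) ^ n) by (apply pow_incr; split; [apply Cmod_ge_0|exact tx]).
    replace (2 * Cmod x * (/ 2) ^ n) with (Cmod x * (/ 2) ^ n * 2) by ring.
    apply Rmult_le_compat; auto.
    + apply Rmult_le_pos; auto. apply pow_le, Cmod_ge_0.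
    + apply Rlt_le, Rinv_0_lt_compat. lra.
    + apply Rmult_le_compat_l; auto.
  - replace (psum (pow t) n x) with ((1 - (RtoC t * x) ^ n) / (1 - RtoC t * x))%C.
    + field. split; [exact n1|exact x0].
    + rewrite <- E. field. auto.
Qed.

Lemma resolvent_parts (z : C) (t : R) : (z - RtoC t)%C <> 0%C -> (/ (z - RtoC t))%C =
  ((fst z - t) / ((fst z - t) ^ 2 + snd z ^ 2), - snd z / ((fst z - t) ^ 2 + snd z ^ 2)).
Proof.
  intros H. destruct z as [u v]. unfold Cinv, Cminus, Cplus, Copp, RtoC. simpl. f_equal; f_equal; ring.
Qed.

Lemma RtoC_mult_pair (r : R) (y : C) : (RtoC r * y)%C = (fst y * r, snd y * r).
Proof. destruct y as [y1 y2]. unfold Cmult, RtoC. simpl. f_equal; ring. Qed.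

Lemma fst_cpsum (x : C) (t : R) n : fst (x * psum (pow t) n x)%C = rsum (fun k => fst (x ^ S k)%C * t ^ k) n /\
  snd (x * psum (pow t) n x)%C = rsum (fun k => snd (x ^ S k)%C * t ^ k) n.
Proof.
  rewrite psum_csum. induction n as [|n [IH1 IH2]]; [simpl; split; ring|]. cbn [csum].
  rewrite Cmult_plus_distr_l. cbn [rsum]. rewrite <- IH1, <- IH2.
  replace (x * (RtoC (t ^ n) * x ^ n))%C with (RtoC (t ^ n) * x ^ S n)%C by (rewrite Cpow_S; ring).
  rewrite RtoC_mult_pair. split; reflexivity.
Qed.

(** The resolvent is approximated by partial geometric sums uniformly on the support; integrating
    the approximation for each n avoids any exchange of series and integral. *)
Lemma stieltjes_ev (x : C) : 0 < Cmod x < / (2 * K) -> stieltjes m (/ x) = ev (momser mom) x.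
Proof.
  intros [x0' Hx']. assert (x0 : x <> 0%C) by (apply Cmod_pos_neq, x0').
  assert (Hx : K * Cmod x <= / 2).
  { replace (/ 2) with (K * / (2 * K)) by (field; lra). apply Rmult_le_compat_l; lra. }
  assert (gm : gb 1 K (momser mom)) by (intros n; rewrite Rmult_1_l; apply momser_bound).
  apply (ev_unique 1 K _ _ _ (4 * Cmod x) gm ltac:(lra) Hx). intros n.
  set (z := (/ x)%C).
  assert (RC : forall t, Rabs t <= K -> Cmod ((fst z - t) / ((fst z - t) ^ 2 + snd z ^ 2) - rsum (fun k => fst (x ^ S k)%C * t ^ k) n,
     - snd z / ((fst z - t) ^ 2 + snd z ^ 2) - rsum (fun k => snd (x ^ S k)%C * t ^ k) n) <= 2 * Cmod x * (/ 2) ^ n).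
  { intros t Ht. assert (P := resolvent_close x t n x0 Hx Ht). fold z in P.
    rewrite resolvent_parts in P.
    - destruct (fst_cpsum x t n) as [E1 E2]. rewrite <- E1, <- E2. exact P.
    - intros Q. assert (E : (RtoC t * x)%C = 1%C).
      { replace (RtoC t) with (z - (z - RtoC t))%C by ring. rewrite Q. unfold z. field. auto. }
      assert (M : Cmod (RtoC t * x) = 1) by (rewrite E; apply Cmod_1). rewrite Cmod_mult, Cmod_R in M.
      assert (Rabs t * Cmod x <= K * Cmod x) by (apply Rmult_le_compat_r; lra). lra. }
  assert (B0 : 0 <= 2 * Cmod x * (/ 2) ^ n) by (apply Rmult_le_pos; [lra|apply pow_le; lra]).
  assert (bd : forall (f : R -> R) b, (forall t, Rabs t <= K -> Rabs (f t - rsum (fun k => b k * t ^ k) n) <= 2 * Cmod x * (/ 2) ^ n) -> bdd K f).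
  { intros f b Hf. destruct (bdd_rsum b n) as [B HB]. exists (2 * Cmod x * (/ 2) ^ n + B). intros t Ht.
    replace (f t) with ((f t - rsum (fun k => b k * t ^ k) n) + rsum (fun k => b k * t ^ k) n) by ring.
    apply Rle_trans with (1 := Rabs_triang _ _). apply Rplus_le_compat; [apply Hf, Ht|apply HB, Ht]. }
  assert (H1 : forall t, Rabs t <= K -> Rabs ((fst z - t) / ((fst z - t) ^ 2 + snd z ^ 2) - rsum (fun k => fst (x ^ S k)%C * t ^ k) n) <= 2 * Cmod x * (/ 2) ^ n).
  { intros t Ht. apply Rle_trans with (2 := RC t Ht). apply (Rle_trans _ _ _ (Rmax_l _ _) (Rmax_Cmod (_, _))). }
  assert (H2 : forall t, Rabs t <= K -> Rabs (- snd z / ((fst z - t) ^ 2 + snd z ^ 2) - rsum (fun k => snd (x ^ S k)%C * t ^ k) n) <= 2 * Cmod x * (/ 2) ^ n).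
  { intros t Ht. apply Rle_trans with (2 := RC t Ht). apply (Rle_trans _ _ _ (Rmax_r _ _) (Rmax_Cmod (_, _))). }
  assert (md : mfun (fun t => / ((fst z - t) ^ 2 + snd z ^ 2))).
  { assert (ml : mfun (fun t => fst z - t)) by (apply mfun_plus; [apply mfun_cst|apply mfun_opp, mfun_id]).
    apply mfun_inv, mfun_plus; [|apply mfun_cst]. simpl. apply mfun_mult; auto. apply mfun_mult; auto. apply mfun_cst. }
  assert (m1 : mfun (fun t => (fst z - t) / ((fst z - t) ^ 2 + snd z ^ 2))).
  { apply mfun_mult; auto. apply mfun_plus; [apply mfun_cst|apply mfun_opp, mfun_id]. }
  assert (m2 : mfun (fun t => - snd z / ((fst z - t) ^ 2 + snd z ^ 2))) by (apply mfun_mult; auto; apply mfun_cst).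
  assert (C1 := mint_close _ _ n _ B0 m1 (bd _ _ H1) H1).
  assert (C2 := mint_close _ _ n _ B0 m2 (bd _ _ H2) H2).
  assert (E : psum (momser mom) (S n) x = (rsum (fun k => fst (x ^ S k)%C * mom k) n, rsum (fun k => snd (x ^ S k)%C * mom k) n)).
  { rewrite psum_front. simpl momser. rewrite (psum_ext (shift1 (momser mom)) mom) by reflexivity.
    rewrite psum_csum. clear. induction n as [|n IH]; [simpl; unfold Cplus, Cmult, RtoC; simpl; f_equal; ring|].
    cbn [csum]. cbn [rsum]. rewrite Cmult_plus_distr_l, Cplus_assoc, IH.
    replace (x * (RtoC (mom n) * x ^ n))%C with (RtoC (mom n) * x ^ S n)%C by (rewrite Cpow_S; ring).
    rewrite RtoC_mult_pair. reflexivity. }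
  rewrite E. apply Rle_trans with (1 := Cmod_le_sum _).
  replace (4 * Cmod x * (/ 2) ^ n) with (2 * Cmod x * (/ 2) ^ n + 2 * Cmod x * (/ 2) ^ n) by ring.
  apply Rplus_le_compat; [exact C1|exact C2].
Qed.
End Moments.

End StieltjesTransform.

(** * Consequences of regularity and weak convergence *)

Module RegularSignatures.
Import Reals ZArith Lra Lia Psatz List.
Import Coquelicot.
Import Defs.
Import EvaluatedSeries MeasureIntegrals StieltjesTransform.
Open Scope R_scope.

Lemma piecewise_locally_bounded f : piecewise_continuous f -> forall x, 0 <= x <= 1 ->
  exists d B, 0 < d /\ forall y, 0 <= y <= 1 -> Rabs (y - x) < d -> Rabs (f y) <= B.
Proof.
  intros [ts [H1 H2]] x Hx. destruct (in_dec Req_dec_T x ts) as [I|I].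
  - destruct (H2 x I) as [[l Hl] [r Hr]].
    destruct (Hl 1 Rlt_0_1) as [d [d0 Hd]]. destruct (Hr 1 Rlt_0_1) as [d' [d0' Hd']].
    exists (Rmin d d'), (Rabs (f x) + Rabs l + Rabs r + 1). split; [apply Rmin_pos; auto|]. intros y Hy Hyx.
    assert (y1 := Rlt_le_trans _ _ _ Hyx (Rmin_l _ _)). assert (y2 := Rlt_le_trans _ _ _ Hyx (Rmin_r _ _)).
    apply Rabs_def2 in y1. apply Rabs_def2 in y2.
    assert (p1 := Rabs_pos (f x)). assert (p2 := Rabs_pos l). assert (p3 := Rabs_pos r).
    destruct (Rtotal_order y x) as [L|[L|L]].
    + assert (Q := Hd y Hy ltac:(lra)). assert (T := Rabs_triang (f y - l) l). replace (f y - l + l) with (f y) in T by ring. lra.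
    + subst y. lra.
    + assert (Q := Hd' y Hy ltac:(lra)). assert (T := Rabs_triang (f y - r) r). replace (f y - r + r) with (f y) in T by ring. lra.
  - destruct (H1 x Hx I 1 Rlt_0_1) as [d [d0 Hd]]. exists d, (Rabs (f x) + 1). split; auto. intros y Hy Hyx.
    assert (Q := Hd y Hy Hyx). assert (T := Rabs_triang (f y - f x) (f x)). replace (f y - f x + f x) with (f y) in T by ring. lra.
Qed.

(** Compactness of [0, 1] by the supremum argument: the largest s up to which a bound exists can
    always be passed, unless it is 1. *)
Lemma locally_bounded_bounded f : (forall x, 0 <= x <= 1 ->
  exists d B, 0 < d /\ forall y, 0 <= y <= 1 -> Rabs (y - x) < d -> Rabs (f y) <= B) ->
  exists B, forall y, 0 <= y <= 1 -> Rabs (f y) <= B.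
Proof.
  intros H. set (E := fun s => 0 <= s <= 1 /\ exists B, forall y, 0 <= y <= s -> Rabs (f y) <= B).
  assert (E0 : E 0).
  { split; [lra|]. exists (Rabs (f 0)). intros y Hy. replace y with 0 by lra. lra. }
  destruct (completeness E) as [s [U L]].
  { exists 1. intros x [Hx _]. lra. }
  { exists 0. exact E0. }
  assert (s0 : 0 <= s) by (apply U, E0). assert (s1 : s <= 1) by (apply L; intros x [Hx _]; lra).
  destruct (H s ltac:(lra)) as [d [B [d0 HB]]].
  assert (X : exists x, E x /\ s - d < x).
  { apply Classical_Prop.NNPP. intros N. assert (s <= s - d); [|lra]. apply L. intros x Ex.
    apply Rnot_lt_le. intros Q. apply N. exists x. split; auto. }
  destruct X as [x [[Hx [B' HB']] xs]].
  assert (P : forall y, 0 <= y <= Rmin 1 (s + d / 2) -> Rabs (f y) <= Rmax B B').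
  { intros y Hy. assert (y1 := Rmin_l 1 (s + d / 2)). assert (y2 := Rmin_r 1 (s + d / 2)).
    destruct (Rle_dec y x) as [l|l].
    - apply Rle_trans with B'; [apply HB'; lra|apply Rmax_r].
    - apply Rle_trans with B; [apply HB; [lra|apply Rabs_def1; lra]|apply Rmax_l]. }
  assert (M : E (Rmin 1 (s + d / 2))).
  { split; [split; [apply Rmin_glb; lra|apply Rmin_l]|]. exists (Rmax B B'). exact P. }
  apply U in M. unfold Rmin in M, P. destruct (Rle_dec 1 (s + d / 2)); [|lra].
  exists (Rmax B B'). exact P.
Qed.

Lemma regular_bound lam : regular lam -> exists B, 0 <= B /\ forall N i, (i < N)%nat ->
  Rabs ((IZR (nth i (lam N) 0%Z) + INR N - INR (S i)) / INR N) <= B.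
Proof.
  intros [f [C0 [pc [_ H]]]]. destruct (locally_bounded_bounded f (piecewise_locally_bounded f pc)) as [B HB].
  assert (B0 : 0 <= B) by (apply Rle_trans with (2 := HB 0 ltac:(lra)); apply Rabs_pos).
  exists (B + Rabs C0 + 1). assert (p := Rabs_pos C0). split; [lra|]. intros N i Hi.
  assert (N0 : 0 < INR N) by (apply lt_0_INR; lia).
  specialize (H N (S i) ltac:(lia) ltac:(lia)). unfold lamj in H. simpl Nat.pred in H.
  assert (i0 : 0 <= INR (S i)) by apply pos_INR. assert (i1 : INR (S i) <= INR N) by (apply le_INR; lia).
  assert (q : 0 <= INR (S i) / INR N <= 1).
  { split; [apply Rmult_le_pos; auto; apply Rlt_le, Rinv_0_lt_compat; auto|].
    apply Rmult_le_reg_r with (INR N); auto. unfold Rdiv. rewrite Rmult_assoc, Rinv_l; lra. }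
  specialize (HB _ q). assert (C1 := Rle_abs C0). set (y := IZR _ / INR N) in *.
  replace ((IZR (nth i (lam N) 0%Z) + INR N - INR (S i)) / INR N) with ((y - f (INR (S i) / INR N)) + (f (INR (S i) / INR N) + (1 - INR (S i) / INR N))).
  - apply Rle_trans with (1 := Rabs_triang _ _). assert (T := Rabs_triang (f (INR (S i) / INR N)) (1 - INR (S i) / INR N)).
    rewrite (Rabs_right (1 - _)) in T by lra. lra.
  - unfold y. field. lra.
Qed.

Lemma Rsum_nat_ext n f g : (forall i, (i < n)%nat -> f i = g i) -> Rsum_nat n f = Rsum_nat n g.
Proof.
  intros H. unfold Rsum_nat. f_equal. apply map_ext_in. intros i Hi. apply in_seq in Hi. apply H. lia.
Qed.

(** The truncation of x to [-L, L], written with absolute values so that continuity is immediate. *)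
Definition clamp (L x : R) : R := (Rabs (x + L) - Rabs (x - L)) / 2.

Lemma clamp_id L x : Rabs x <= L -> clamp L x = x.
Proof.
  intros H. apply Rabs_le_between in H. unfold clamp. rewrite (Rabs_right (x + L)), (Rabs_left1 (x - L)) by lra. field.
Qed.

Lemma clamp_bound L x : 0 <= L -> Rabs (clamp L x) <= L.
Proof.
  intros H. unfold clamp. unfold Rabs at 2 3. destruct (Rcase_abs (x + L)); destruct (Rcase_abs (x - L)); apply Rabs_le; lra.
Qed.

Lemma clamp_cont L x : continuity_pt (clamp L) x.
Proof.
  unfold clamp. apply continuity_pt_mult; [|apply continuity_pt_const; intros ? ?; reflexivity].
  apply continuity_pt_minus.
  - apply (continuity_pt_comp (fun x => x + L) Rabs); [|apply Rcontinuity_abs].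
    apply continuity_pt_plus; [apply derivable_continuous_pt, derivable_pt_id|apply continuity_pt_const; intros ? ?; reflexivity].
  - apply (continuity_pt_comp (fun x => x - L) Rabs); [|apply Rcontinuity_abs].
    apply continuity_pt_minus; [apply derivable_continuous_pt, derivable_pt_id|apply continuity_pt_const; intros ? ?; reflexivity].
Qed.

(* x^k is not a bounded test function; its truncation agrees with it on all the supports. *)
Lemma weak_moments lam m K B : (forall N, is_sig N (lam N)) -> weak_conv_emp lam m -> 1 <= K -> null_beyond m K ->
  0 <= B -> (forall N i, (i < N)%nat -> Rabs ((IZR (nth i (lam N) 0%Z) + INR N - INR (S i)) / INR N) <= B) ->
  forall k, is_lim_seq (fun N => emp_integral (lam N) (fun x => x ^ k)) (mint m (fun x => x ^ k)).
Proof.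
  intros Hs Hw K1 mK B0 HB k. set (L := Rmax B K). assert (LB := Rmax_l B K). assert (LK := Rmax_r B K). fold L in LB, LK.
  set (g := fun x => clamp L x ^ k).
  assert (gc : forall x, continuity_pt g x).
  { intros x. apply (continuity_pt_comp (clamp L) (fun y => y ^ k)); [apply clamp_cont|].
    apply derivable_continuous_pt, derivable_pt_pow. }
  assert (gb : forall x, Rabs (g x) <= L ^ k).
  { intros x. unfold g. rewrite <- RPow_abs. apply pow_incr. split; [apply Rabs_pos|apply clamp_bound; lra]. }
  assert (E : mint m g = mint m (fun x => x ^ k)).
  { assert (bg : bdd K g) by (exists (L ^ k); intros x _; apply gb).
    assert (P := @mint_lin m K mK 1 (-1) g (fun x => x ^ k) (@mfun_continuity g gc) bg (mfun_pow k) (@bdd_pow K k)).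
    assert (Q : Rabs (mint m (fun x => 1 * g x + -1 * x ^ k)) <= 0).
    { apply (@mint_bound m K mK); [lra| |].
      - apply mfun_plus; apply mfun_mult; try apply mfun_cst; [apply (@mfun_continuity g gc)|apply mfun_pow].
      - intros x Hx. unfold g. rewrite clamp_id by lra. replace (1 * x ^ k + -1 * x ^ k) with 0 by ring. rewrite Rabs_R0. lra. }
    rewrite P in Q. destruct (Req_dec (mint m g) (mint m (fun x => x ^ k))) as [e|e]; auto.
    assert (Z : 1 * mint m g + -1 * mint m (fun x => x ^ k) <> 0) by (intros Z; apply e; lra).
    apply Rabs_pos_lt in Z. lra. }
  rewrite <- E. apply is_lim_seq_ext with (fun N => emp_integral (lam N) g).
  - intros N. unfold emp_integral. rewrite (proj1 (Hs N)). f_equal. apply Rsum_nat_ext. intros i Hi. unfold g.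
    rewrite clamp_id; auto. apply Rle_trans with B; auto.
  - apply Hw; auto. exists (L ^ k). exact gb.
Qed.

Lemma Mof_bounds a N : 0 < a < 1 -> a * INR N - 1 <= INR (Mof a N) <= a * INR N /\ (Mof a N <= N)%nat.
Proof.
  intros Ha. assert (N0 := pos_INR N). destruct (base_Int_part (a * INR N)) as [P1 P2]. unfold Mof.
  assert (z0 : (0 <= Int_part (a * INR N))%Z).
  { apply Z.lt_succ_r. apply lt_IZR. rewrite succ_IZR. nra. }
  assert (E : INR (Z.to_nat (Int_part (a * INR N))) = IZR (Int_part (a * INR N))).
  { rewrite INR_IZR_INZ, Z2Nat.id; auto. }
  rewrite E. split; [lra|]. apply INR_le. rewrite E. nra.
Qed.

Lemma Mof_ratio a : 0 < a < 1 -> is_lim_seq (fun N => INR (Mof a N) / INR N) a.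
Proof.
  intros Ha. assert (L : is_lim_seq (fun N => a - / INR N) a).
  { replace (Finite a) with (Finite (a - 0)) by (f_equal; ring). apply is_lim_seq_minus'; [apply is_lim_seq_const|].
    apply is_lim_seq_spec. intros eps. destruct (archimed_cor1 eps (cond_pos eps)) as [n [Hn n0]]. exists n. intros N HN.
    assert (i0 : 0 < INR n) by (apply lt_0_INR; auto). assert (i1 : INR n <= INR N) by (apply le_INR; auto).
    rewrite Rminus_0_r, Rabs_right; [|apply Rle_ge, Rlt_le, Rinv_0_lt_compat; lra].
    apply Rle_lt_trans with (2 := Hn). apply Rinv_le_contravar; auto. }
  apply is_lim_seq_le_le_loc with (fun N => a - / INR N) (fun _ => a); auto; [|apply is_lim_seq_const].
  exists 1%nat. intros N HN. assert (N0 : 0 < INR N) by (apply lt_0_INR; lia).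
  destruct (Mof_bounds a N Ha) as [[b1 b2] _]. split; apply Rmult_le_reg_r with (INR N); auto; unfold Rdiv; rewrite ?Rmult_minus_distr_r, ?Rmult_assoc, ?Rinv_l; lra.
Qed.

End RegularSignatures.

(** * Transfer between the two series formalisms, and the limit theorem for moments *)

Module LimitMoments.
Import Reals ZArith.
Import Defs.
Import structures.
Import all_boot all_order all_algebra.
Import boolp classical_sets functions reals topology normedtype sequences Rstruct Rstruct_topology.
Import ring lra zify.
Import PowerSeries FiniteDifferences InterlacingSums SchurIdentification GrowthFamilies TransportCoordinates ExponentialSeries SingleVariableLimit SeriesTower SteinEquation DeterminantalMoments PowerSumMoments EvaluatedSeries SeriesBounds CovarianceFormula StieltjesTransform.
Set Implicit Arguments.
Unset Strict Implicit.
Unset Printing Implicit Defensive.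
Import Order.TTheory GRing.Theory Num.Theory numFieldNormedType.Exports.
Local Open Scope ring_scope.
Local Open Scope classical_set_scope.
Local Notation K := Rdefinitions.R.
Local Notation is_lim_seq := Coquelicot.Lim_seq.is_lim_seq.
Local Notation Finite := Coquelicot.Rbar.Finite.

Lemma is_lim_seq_cvg (u : nat -> K) (x : K) : is_lim_seq u (Finite x) <-> u @ \oo --> x.
Proof.
split=> [/Coquelicot.Lim_seq.is_lim_seq_spec H|/cvg_seqP H].
  apply/cvg_seqP => c c0; have [N0 HN] := H (mkposreal c (elimT RltP c0)).
  by exists N0 => N /ssrnat.leP NN; have /RltP/ltW := HN N NN.
apply/Coquelicot.Lim_seq.is_lim_seq_spec => eps; have e0 : 0 < pos eps / 2 by rewrite divr_gt0 //; apply/RltP; exact: cond_pos.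
have [N0 HN] := H _ e0; exists N0 => N /ssrnat.leP NN; apply/RltP; apply: le_lt_trans (HN N NN) _.
by rewrite ltr_pdivrMr // mulr_natr mulr2n ltrDl; apply/RltP; exact: cond_pos.
Qed.

Lemma sum_f_R0E (f : nat -> K) n : sum_f_R0 f n = \sum_(i < n.+1) f i.
Proof. by elim: n => [|n IH]; rewrite ?big_ord1 // big_ord_recr /= -IH. Qed.

Lemma cmulE (c d : fps K) : cmul c d = c * d.
Proof. by apply/funext => n; rewrite /cmul sum_f_R0E fpsME. Qed.

Lemma delta0E : delta0 (IZR (Zpos xH)) = 1 :> fps K.
Proof. by apply/funext => -[|n]. Qed.

Lemma cpowE (c : fps K) k : cpow c k = c ^+ k.
Proof. elim: k => [|k IH]; first exact: delta0E.
by rewrite -[cpow c k.+1]/(cmul c (cpow c k)) cmulE IH exprS. Qed.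

Lemma succR k : Rplus (INR k) (IZR (Zpos xH)) = k.+1%:R :> K.
Proof. by rewrite -S_INR INRE. Qed.

Section Series.
Variables (a : K) (mom : nat -> K).
Hypothesis mom0 : mom 0%N = 1.

Definition eser : nat -> K := fps_ode (gmom mom).
Definition iser : nat -> K := fps_inv (psim mom).

(** theta of the moment series is [gmom], so the recursion defining [fps_ode] is the exponential
    equation with the index lowered by one. *)
Lemma eser_ode n : dser eser n = cmul (dser (momser mom)) eser n.
Proof.
rewrite cmulE fpsME_rev /dser /eser.
rewrite fps_odeS succR RmultE mulrA divff ?mul1r ?pnatr_eq0 //.
apply: eq_bigr => -[i /= ilt] _; rewrite succR RmultE; congr (_ * _).
by rewrite subSn ?(leq_trans ilt).
Qed.

Lemma psim_0 : psim mom 0%N = 1.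
Proof. by rewrite /psim fps_odeS big_ord1 subn0 invr1 mul1r mulr1 /= mul1r mom0. Qed.

Lemma iser_inv n : cmul (shift1 eser) iser n = delta0 (IZR (Zpos xH)) n.
Proof. by rewrite (cmulE (psim mom) (fps_inv (psim mom))) fps_mulV ?psim_0 // delta0E. Qed.

Lemma zserE_zhm : zser (Rminus (IZR (Zpos xH)) a) iser = zhm a mom.
Proof.
apply/funext => n; rewrite /zser /zhm /zhat !fpsBE !fpsCM fps1E /fpsX.
by case: n => [|[|n]]; rewrite !RminusE RmultE ?RoppE ?mulr0 ?mulr1 ?subr0 ?sub0r.
Qed.

(** The contour integral puts its first exponent in the second place of [covZ]; the term i = 0 of
    [covZ] vanishes, which accounts for the shift of the summation index. *)
Lemma cov_coef k1 k2 :
  cmul (cpow (zser (Rminus (IZR (Zpos xH)) a) iser) k1.+1)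
    (dser (shift k2 (cpow (zser (Rminus (IZR (Zpos xH)) a) iser) k2))) k1 = covZ (zhm a mom) k2 k1.+1.
Proof.
rewrite zserE_zhm !cpowE cmulE fpsME_rev /covZ [in RHS]big_ord_recl /= mul0r mul0r add0r.
apply: eq_bigr => -[i /= ilt] _; rewrite /dser /shift succR.
rewrite (_ : bump 0 i = i.+1) // subSS mulrC; exact: mulrAC.
Qed.
End Series.

Lemma picks_mem (T : eqType) (s : seq T) p : List.In p (picks s) -> p.1 \in s /\ {subset p.2 <= s}.
Proof.
elim: s p => [|x s IH] p //= [<-|]; first by split=> [|y]; rewrite /= ?mem_head // inE orbC => ->.
move=> /List.in_map_iff [q [<- /IH [q1 q2]]]; split; [by rewrite /= in_cons q1 orbT|move=> y; rewrite /= !in_cons].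
by case/orP => [->|/q2 ->] //; rewrite orbT.
Qed.

Lemma wick_aux_ext Cv Cv' f ks : (forall k k', (0 < k)%N -> (0 < k')%N -> Cv k k' = Cv' k k') -> all (fun k => 0 < k)%N ks ->
  wick_aux Cv f ks = wick_aux Cv' f ks.
Proof.
move=> H; elim: f ks => [|f IH] [|k ks] //= /andP[k0 /allP ks0]; congr (List.fold_right _ _ _).
apply: List.map_ext_in => p /picks_mem [p1 p2]; congr (Rmult _ _); first by apply: H => //; exact: ks0.
by apply: IH; apply/allP => j /p2 /ks0.
Qed.

Lemma gaussian_moment_ext Cv Cv' ks : (forall k k', le 1 k -> le 1 k' -> Cv k k' = Cv' k k') ->
  (forall k, List.In k ks -> le 1 k) -> gaussian_moment Cv ks = gaussian_moment Cv' ks.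
Proof.
move=> H ks1; apply: wick_aux_ext => [k k' /ssrnat.leP k0 /ssrnat.leP k0'|]; first exact: H.
by elim: ks ks1 => //= k ks IH ks1; rewrite IH => [|j jk]; [rewrite andbT; apply/ssrnat.leP; apply: ks1; left|apply: ks1; right].
Qed.

Lemma wick_wick_aux (D : nat -> fps K) A f ks : wick D A f ks = wick_aux (covA D A) f ks.
Proof.
elim: f ks => [|f IH] [|k ks] //=; rewrite fold_right_Rplus; apply: eq_bigr => p _.
by rewrite IH.
Qed.

Definition limit_cov (a : K) (mom : nat -> K) : nat -> nat -> K := covZ (zhm a mom).

Section Limit.
Variables (lam : nat -> seq Z) (m : PMeasR) (a : K) (S : nat -> seq (seq Z)) (rho : nat -> seq Z -> K) (B : K).
Hypothesis lam_sig : forall N, is_sig N (lam N).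
Hypothesis a01 : Rlt (IZR Z0) a /\ Rlt a (IZR (Zpos xH)).
Hypothesis SGF : forall N, SGF_restriction N (Mof a N) (lam N) (S N) (rho N).
Hypothesis B0 : Rle (IZR Z0) B.
Hypothesis l_bd : forall N i, lt i N ->
  Rle (Rabs (Rdiv (Rminus (Rplus (IZR (List.nth i (lam N) Z0)) (INR N)) (INR i.+1)) (INR N))) B.
Hypothesis mom_to : forall k, is_lim_seq (fun N => emp_integral (lam N) (fun x => pow x k)) (Finite (mint m (fun x => pow x k))).
Hypothesis M_to : is_lim_seq (fun N => Rdiv (INR (Mof a N)) (INR N)) (Finite a).
Hypothesis M_le : forall N, le (Mof a N) N.

Let mom k := mint m (fun x => pow x k).

Let sz N : size (lam N) = N. Proof. exact: (lam_sig N).1. Qed.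

Lemma points_bound N c : c \in pts IZR (lam N) -> `|c / N%:R| <= B.
Proof.
rewrite pts_nth sz => /mapP[i]; rewrite mem_iota add0n => /andP[_ iN] ->.
by have /RleP := l_bd (elimT ssrnat.ltP iN); rewrite INRE.
Qed.

Lemma points_moment k : (fun N => N%:R^-1 * \sum_(c <- pts IZR (lam N)) (c / N%:R) ^+ k) @ \oo --> mom k.
Proof.
apply/is_lim_seq_cvg; rewrite (_ : (fun N => _) = fun N => emp_integral (lam N) (fun x => pow x k)); first exact: (@mom_to k).
apply/funext => N.
rewrite /emp_integral -[List.length _]/(size (lam N)) sz Rsum_natE pts_nth sz big_map INRE -RinvE.
by congr (_ * _); apply: eq_bigr => i _; rewrite RpowE INRE.
Qed.

Lemma wick_lim ks : (forall k, List.In k ks -> le 1 k) ->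
  is_lim_seq (fun N => mixed_moment (S N) (rho N) N ks) (Finite (gaussian_moment (limit_cov a mom) ks)).
Proof.
move=> ks1; have ks0 : all (fun k => 0 < k)%N ks.
  by elim: ks ks1 => //= k ks IH H; rewrite IH => [|j jk]; [rewrite andbT; apply/ssrnat.leP; apply: H; left|apply: H; right].
have a01' : 0 < a < 1 by case: a01 => /RltP -> /RltP ->.
have M_to' : (fun N => (Mof a N)%:R / N%:R : K) @ \oo --> a.
  apply/is_lim_seq_cvg; rewrite (_ : (fun N => _) = fun N => Rdiv (INR (Mof a N)) (INR N)) //.
  by apply/funext => N; rewrite !INRE.
have M_le' N : (Mof a N <= N)%N by apply/ssrnat.leP.
have := mixed_moment_to lam_sig M_le' SGF a01' M_to' (introT RleP B0) points_bound points_moment ks0.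
rewrite wick_wick_aux (@wick_aux_ext _ (covZ (zhm a mom))) // => [|k k' k0 _]; first by move/is_lim_seq_cvg.
by apply: covA_covZ => //; [case/andP: a01' => /gt_eqF ->|exact: zhm0].
Qed.
End Limit.

End LimitMoments.

(** * Assembly: covariances as second moments and identification of the limit *)

Import Reals ZArith List Lra Lia.
Import Coquelicot.
Import Defs.
Import EvaluatedSeries SeriesBounds CovarianceFormula MeasureIntegrals StieltjesTransform RegularSignatures LimitMoments DeterminantalMoments PowerSumMoments.
Open Scope R_scope.

Lemma Ex_lin S rho (u v : R) (f g : list Z -> R) :
  Ex S rho (fun mu => u * f mu + v * g mu) = u * Ex S rho f + v * Ex S rho g.
Proof. unfold Ex. induction S as [|mu S IH]; simpl; [ring|]. rewrite IH. ring. Qed.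

Lemma Ex_ext S rho (f g : list Z -> R) : (forall mu, f mu = g mu) -> Ex S rho f = Ex S rho g.
Proof. intros H. unfold Ex. induction S as [|mu S IH]; simpl; [ring|]. rewrite IH, H. ring. Qed.

(** Convergence of the covariances thereby becomes the two-index case of the moment theorem. *)
Lemma mixed_moment_cov S rho N k1 k2 : Ex S rho (fun _ => 1) = 1 -> (0 < N)%nat ->
  mixed_moment S rho N (k1 :: k2 :: nil) = cov_p S rho k1 k2 / INR N ^ (k1 + k2).
Proof.
  intros H1 N0. assert (n0 : INR N <> 0) by (apply not_0_INR; lia).
  assert (p1 : INR N ^ k1 <> 0) by (apply pow_nonzero; auto). assert (p2 : INR N ^ k2 <> 0) by (apply pow_nonzero; auto).
  unfold mixed_moment, cov_p. simpl. unfold Xnk. set (m1 := Ex S rho (pk k1)). set (m2 := Ex S rho (pk k2)).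
  set (q := / INR N ^ (k1 + k2)).
  rewrite (Ex_ext _ _ _ (fun mu => 1 * (q * (pk k1 mu * pk k2 mu) + - q * m2 * pk k1 mu) + 1 * (- q * m1 * pk k2 mu + q * m1 * m2 * 1))).
  - rewrite !Ex_lin, H1. fold m1 m2. unfold Rdiv. fold q. ring.
  - intros mu. unfold q. rewrite pow_add. field. auto.
Qed.

Theorem mainTheorem6
  (lam : nat -> list Z) (m : PMeasR) (a : R)
  (S : nat -> list (list Z)) (rho : nat -> list Z -> R) (Ginv : C -> C) :
  (forall N : nat, is_sig N (lam N)) ->
  regular lam ->
  compactly_supported m ->
  weak_conv_emp lam m ->
  0 < a < 1 ->
  (forall N : nat, SGF_restriction N (Mof a N) (lam N) (S N) (rho N)) ->
  functional_inverse_at0 (stieltjes m) Ginv ->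
  exists eps0 : R, 0 < eps0 /\
    forall eps : R, 0 < eps < eps0 ->
      (forall k1 k2 : nat, Nat.le 1 k1 -> Nat.le 1 k2 ->
         Im (cov_formula Ginv a eps k1 k2) = 0 /\
         is_lim_seq (fun N => cov_p (S N) (rho N) k1 k2 / INR N ^ (k1 + k2))
                    (Re (cov_formula Ginv a eps k1 k2))) /\
      (forall ks : list nat, (forall k : nat, In k ks -> Nat.le 1 k) ->
         is_lim_seq (fun N => mixed_moment (S N) (rho N) N ks)
                    (gaussian_moment (fun k1 k2 => Re (cov_formula Ginv a eps k1 k2)) ks)).
Proof.
  intros Hs Hr Hc Hw Ha HG HF.
  destruct (@compact_bound m Hc) as [K [K1 mK]]. destruct (regular_bound lam Hr) as [B [B0 HB]].
  assert (Hm := weak_moments lam m K B Hs Hw K1 mK B0 HB).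
  set (mom := fun k => mint m (fun x => x ^ k)).
  assert (mom0 : mom O = 1) by (unfold mom; simpl; apply mint_1).
  assert (Lim := @wick_lim lam m a S rho B Hs Ha HG B0 HB Hm (Mof_ratio a Ha) (fun N => proj2 (Mof_bounds a N Ha))).
  fold mom in Lim. set (cv := limit_cov a mom) in *.
  assert (Lim2 : forall k1 k2, (1 <= k1)%nat -> (1 <= k2)%nat ->
    is_lim_seq (fun N => cov_p (S N) (rho N) k1 k2 / INR N ^ (k1 + k2)) (cv k1 k2)).
  { intros k1 k2 h1 h2. apply is_lim_seq_ext_loc with (fun N => mixed_moment (S N) (rho N) N (k1 :: k2 :: nil)).
    - exists 1%nat. intros N HN. apply mixed_moment_cov; [|lia]. apply (HG N).
    (* The Wick sum over two indices has a single pairing. *)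
    - assert (P := Lim (k1 :: k2 :: nil)). unfold gaussian_moment in P. simpl in P.
      replace (cv k1 k2) with (cv k1 k2 * 1 + 0) by ring. apply P. intros k [E|[E|[]]]; subst k; auto. }
  (* The residue computation yields the two indices in the opposite order. The symmetry, hidden in
     the coefficient formula, is inherited from the prelimit covariances by uniqueness of limits. *)
  assert (sym : forall k1 k2, (1 <= k1)%nat -> (1 <= k2)%nat -> cv k1 k2 = cv k2 k1).
  { intros k1 k2 h1 h2. assert (P := is_lim_seq_unique _ _ (Lim2 k1 k2 h1 h2)).
    rewrite (Lim_seq_ext _ (fun N => cov_p (S N) (rho N) k2 k1 / INR N ^ (k2 + k1))) in P.
    - rewrite (is_lim_seq_unique _ _ (Lim2 k2 k1 h2 h1)) in P. injection P. auto.
    - intros N. rewrite (Nat.add_comm k2 k1). f_equal. unfold cov_p.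
      rewrite (Ex_ext _ _ (fun mu => pk k1 mu * pk k2 mu) (fun mu => pk k2 mu * pk k1 mu)) by (intros; ring). ring. }
  assert (r00 : 0 < / (2 * K)) by (apply Rinv_0_lt_compat; lra).
  destruct (cov_formula_eval (momser mom) (eser mom) (iser mom) (stieltjes m) Ginv a K (/ (2 * K)) (proj1 Ha) K1
    (momser_bound m K K1 mK) eq_refl mom0 eq_refl (eser_ode mom) (iser_inv mom0) r00 (stieltjes_ev m K K1 mK) HF) as [eps0 [e0 Heps]].
  exists eps0. split; auto. intros eps He.
  assert (F : forall k1 k2, (1 <= k1)%nat -> (1 <= k2)%nat -> cov_formula Ginv a eps k1 k2 = RtoC (cv k1 k2)).
  { intros k1 k2 h1 h2. destruct k1 as [|k1]; [lia|]. rewrite (Heps eps He k1 k2), (sym _ _ h1 h2). f_equal.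
    apply (cov_coef a mom k1 k2). }
  split.
  - intros k1 k2 h1 h2. rewrite F by auto. split; [reflexivity|]. apply Lim2; auto.
  - intros ks Hks. assert (P := Lim ks Hks).
    replace (gaussian_moment (fun k1 k2 => Re (cov_formula Ginv a eps k1 k2)) ks) with (gaussian_moment cv ks); [exact P|].
    apply gaussian_moment_ext; auto. intros k1 k2 h1 h2. rewrite F by auto. reflexivity.
Qed.
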